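(* Assume that (with all constants and functions as defined in the context) the following conditions hold. (i) $\alpha_{1,2}^m=\alpha_{2,1}^m$, $\beta_{1,22}^m=\beta_{2,12}^m$ and $\beta_{1,12}^m=\beta_{2,11}^m$ for all $m=1,\dots,M$. (ii) $\sigma_0>0$, $c_2\neq 0$, $d_1>0$ and $d_2\neq0$. (iii) $\Psi_i^m(0,0)=0$, and there exist constants $\gamma_i^m$ such that $$|\Psi_i^m(x_1,x_2)-\Psi_i^m(y_1,y_2)|\leq \gamma_i^m(x_1^2+x_2^2+y_1^2+y_2^2)(|x_1-y_1|+|x_2-y_2|)$$ for all $(x_1,x_2),(y_1,y_2)\in\mathbb{R}^2$, $i=1,2$, $m=1,\dots,M$. (iv) There is a constant $\delta_0>0$ such that $T(z)\geq\delta_0(\min\{|z|,2\})^2$ for all $z\in\mathbb{R}$. Let $W_0=(W_*,\lambda W_* )^T$, where $W_*$ is the unique non-trivial, even, homoclinic (decaying at $\pm\infty$) solution of $W_*''=d_1W_*-d_2W_*^2$. Then there exist constants $\epsilon_0>0$ and $C>0$ (independent of $\epsilon$) such that for every $0<\epsilon<\epsilon_0$ and wave speed $c_\epsilon=\sqrt{\sigma_0+\epsilon^2}$ the advance-delay-differential equation $$\epsilon^3c_\epsilon^2\,Q_\epsilon''=\sum_{m=1}^M k_m\epsilon\,\delta_{-k_m\epsilon}F^m\big(k_m\epsilon^2\,\delta_{+k_m\epsilon}Q_\epsilon\big)$$ has a solution $Q_\epsilon:\mathbb{R}\to\mathbb{R}^2$ whose velocity profile $W_\epsilon=Q_\epsilon'$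 belongs to $(\mathsf{L}^2_{\rm even}(\mathbb{R}))^2$ and satisfies $\|W_\epsilon-W_0\|_2\leq C\epsilon^2$.
   Context: $\mathsf{L}^2_{\rm even}(\mathbb{R})$ is the space of even functions in $\mathsf{L}^2(\mathbb{R})$; $\|\cdot\|_2$ is the $\mathsf{L}^2$-norm (also for vector-valued functions). Fix $M\in\mathbb{N}$, real numbers $k_1,\dots,k_M$, and functions $F^m=(F^m_1,F^m_2):\mathbb{R}^2\to\mathbb{R}^2$ ($m=1,\dots,M$) of the form $$F_i^m(x_1,x_2)=\alpha_{i,1}^mx_1+\alpha_{i,2}^mx_2+\tfrac12\big(\beta_{i,11}^mx_1^2+2\beta_{i,12}^mx_1x_2+\beta_{i,22}^mx_2^2\big)+\Psi_i^m(x_1,x_2),\quad i=1,2,$$ with real coefficients. Difference operators: for $\eta\ne0$, $\delta_{+\eta}Y=\frac{Y(\cdot+\eta)-Y(\cdot)}{\eta}$ and $\delta_{-\eta}Y=\frac{Y(\cdot)-Y(\cdot-\eta)}{\eta}$; a term with $k_m=0$ is understood to be zero. Thus the $m$-th summand on the right-hand side of the equation is $G^m-G^m(\cdot-k_m\epsilon)$ with $G^m=F^m(\epsilon(Q_\epsilon(\cdot+k_m\epsilon)-Q_\epsilon))$. Constants: $c_1=\sum_m k_m^2\alpha_{1,1}^m$, $c_2=\sum_m k_m^2\alpha_{1,2}^m=\sum_m k_m^2\alpha_{2,1}^m$, $c_3=\sum_m k_m^2\alpha_{2,2}^m$; $\sigma_0=\frac12\big((c_1+c_3)+\sqrt{(c_1-c_3)^2+4c_2^2}\big)$,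 i.e. the larger root of $(c_1-\sigma_0)(c_3-\sigma_0)=c_2^2$; for $c_2\ne0$, $\lambda=\frac{c_2}{\sigma_0-c_3}=\frac{\sigma_0-c_1}{c_2}$; $a_1=\sum_m\frac{k_m^4}{12}\alpha_{1,1}^m$, $a_2=\sum_m\frac{k_m^4}{12}\alpha_{1,2}^m$, $b_1=\sum_m\frac{k_m^4}{12}\alpha_{2,2}^m$, $b_2=\sum_m\frac{k_m^4}{12}\alpha_{2,1}^m$; $a_3=\sum_m\frac{k_m^3}{2}\beta_{1,11}^m$, $a_4=\sum_m\frac{k_m^3}{2}\beta_{1,22}^m$, $a_5=\sum_m k_m^3\beta_{1,12}^m$, $b_3=\sum_m\frac{k_m^3}{2}\beta_{2,22}^m$, $b_4=\sum_m\frac{k_m^3}{2}\beta_{2,11}^m$, $b_5=\sum_m k_m^3\beta_{2,12}^m$; $$d_1=\frac{1+\lambda^2}{(a_1+\lambda a_2)+\lambda(b_2+\lambda b_1)},\qquad d_2=\frac{(a_3+\lambda^2a_4+\lambda a_5)+\lambda(\lambda b_5+\lambda^2b_3+b_4)}{(a_1+\lambda a_2)+\lambda(b_2+\lambda b_1)}$$ (the denominator being nonzero is part of the condition $d_1>0$). Explicitly, $W_*(\xi)=\frac{3d_1}{2d_2}\operatorname{sech}^2(\frac12\sqrt{d_1}\,\xi)$. With $\operatorname{sinc}(x)=\sin(x)/x$ ($\operatorname{sinc}(0)=1$) and $S_k(z)=1-\operatorname{sinc}^2(kz/2)$, define $$T(z)=\big(2\sigma_0-(c_1+c_3)\big)\Big(\sum_{m}k_m^2\big((\sigma_0-c_3)\alpha_{1,1}^m+(\sigma_0-c_1)\alpha_{2,2}^m+2c_2\alpha_{1,2}^m\big)S_{k_m}(z)+\Big(\sum_m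 k_m^2\alpha_{1,1}^mS_{k_m}(z)\Big)\Big(\sum_m k_m^2\alpha_{2,2}^mS_{k_m}(z)\Big)-\Big(\sum_m k_m^2\alpha_{1,2}^mS_{k_m}(z)\Big)^2\Big).$$ *)

(* Defs.v *)
From HB Require Import structures.
From mathcomp Require Import all_boot all_order all_algebra.
From mathcomp Require Import all_classical all_reals all_analysis.
Set Implicit Arguments.
Unset Strict Implicit.
Unset Printing Implicit Defensive.
Import Order.TTheory GRing.Theory Num.Theory.
Import numFieldNormedType.Exports.
Local Open Scope classical_set_scope.
Local Open Scope ring_scope.

(* The components 1, 2 of a vector and the indices 1, 2 of the coefficients are
   the elements 0, 1 of 'I_2: alpha_{i,j}^m is [alpha m i j] and beta_{i,jl}^m
   is [beta m i j l], shifted down by one. The entries [beta m i 1 0] have no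
   counterpart and are never used. *)

Definition force (R : realType) (M : nat) (alpha : 'I_M -> 'M[R]_2)
    (beta : 'I_M -> 'I_2 -> 'M[R]_2) (Psi : 'I_M -> 'I_2 -> 'cV[R]_2 -> R)
    (m : 'I_M) (x : 'cV[R]_2) : 'cV[R]_2 :=
  \col_i (alpha m i 0 * x 0 0 + alpha m i 1 * x 1 0
          + 2^-1 * (beta m i 0 0 * x 0 0 ^+ 2
                    + 2 * beta m i 0 1 * x 0 0 * x 1 0
                    + beta m i 1 1 * x 1 0 ^+ 2)
          + Psi m i x).

(* For eta = 0 both difference quotients are 0, because 0^-1 = 0. *)
Definition diff_fwd (R : realType) (V : lmodType R) (eta : R) (Y : R -> V) :
  R -> V := fun x => eta^-1 *: (Y (x + eta) - Y x).

Definition diff_bwd (R : realType) (V : lmodType R) (eta : R) (Y : R -> V) :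
  R -> V := fun x => eta^-1 *: (Y x - Y (x - eta)).

Section Constants.
Context (R : realType) (M : nat) (k : 'I_M -> R).
Context (alpha : 'I_M -> 'M[R]_2) (beta : 'I_M -> 'I_2 -> 'M[R]_2).

Definition c1 : R := \sum_m k m ^+ 2 * alpha m 0 0.
Definition c2 : R := \sum_m k m ^+ 2 * alpha m 0 1.
Definition c3 : R := \sum_m k m ^+ 2 * alpha m 1 1.

Definition sigma0 : R :=
  2^-1 * ((c1 + c3) + Num.sqrt ((c1 - c3) ^+ 2 + 4 * c2 ^+ 2)).

Definition lambda : R := c2 / (sigma0 - c3).

Definition a1 : R := \sum_m k m ^+ 4 / 12 * alpha m 0 0.
Definition a2 : R := \sum_m k m ^+ 4 / 12 * alpha m 0 1.
Definition a3 : R := \sum_m k m ^+ 3 / 2 * beta m 0 0 0.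
Definition a4 : R := \sum_m k m ^+ 3 / 2 * beta m 0 1 1.
Definition a5 : R := \sum_m k m ^+ 3 * beta m 0 0 1.

Definition b1 : R := \sum_m k m ^+ 4 / 12 * alpha m 1 1.
Definition b2 : R := \sum_m k m ^+ 4 / 12 * alpha m 1 0.
Definition b3 : R := \sum_m k m ^+ 3 / 2 * beta m 1 1 1.
Definition b4 : R := \sum_m k m ^+ 3 / 2 * beta m 1 0 0.
Definition b5 : R := \sum_m k m ^+ 3 * beta m 1 0 1.

(* If the common denominator vanishes then d1 = 0, so that 0 < d1 does include
   the requirement that the denominator be nonzero. *)
Definition d1 : R :=
  (1 + lambda ^+ 2) / ((a1 + lambda * a2) + lambda * (b2 + lambda * b1)).

Definition d2 : R :=
  ((a3 + lambda ^+ 2 * a4 + lambda * a5)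
   + lambda * (lambda * b5 + lambda ^+ 2 * b3 + b4))
  / ((a1 + lambda * a2) + lambda * (b2 + lambda * b1)).

Definition sinc (x : R) : R := if x == 0 then 1 else sin x / x.

Definition symbS (kappa z : R) : R := 1 - sinc (kappa * z / 2) ^+ 2.

Definition symbT (z : R) : R :=
  (2 * sigma0 - (c1 + c3)) *
  (\sum_m k m ^+ 2 * ((sigma0 - c3) * alpha m 0 0
                      + (sigma0 - c1) * alpha m 1 1
                      + 2 * c2 * alpha m 0 1) * symbS (k m) z
   + (\sum_m k m ^+ 2 * alpha m 0 0 * symbS (k m) z)
     * (\sum_m k m ^+ 2 * alpha m 1 1 * symbS (k m) z)
   - (\sum_m k m ^+ 2 * alpha m 0 1 * symbS (k m) z) ^+ 2).

End Constants.

Section Functions.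
Context (R : realType).

Definition twice_derivable (V : normedModType R) (f : R -> V) :=
  (forall x, derivable f x 1) /\ (forall x, derivable (derive1 f) x 1).

(* Nontrivial even homoclinic solutions of W'' = d W - e W^2. *)
Definition even_homoclinic (d e : R) (W : R -> R) :=
  [/\ twice_derivable W,
      forall x, derive1n 2 W x = d * W x - e * W x ^+ 2,
      forall x, W (- x) = W x,
      W x @[x --> +oo] --> (0 : R) /\ W x @[x --> -oo] --> (0 : R)
    & exists x, W x != 0].

(* Functions rather than classes modulo null sets: for continuous f, being even
   everywhere and being even almost everywhere are the same. *)
Definition L2_even (f : R -> R) :=
  f \in Lfun (@lebesgue_measure R) 2%:E /\ forall x, f (- x) = f x.

(* The library norm on column vectors is the maximum norm. *)
Definition euclidean_norm (v : 'cV[R]_2) : R :=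
  Num.sqrt (v 0 0 ^+ 2 + v 1 0 ^+ 2).

Definition L2_norm (f : R -> 'cV[R]_2) : \bar R :=
  ('N[@lebesgue_measure R]_2%:E[EFin \o euclidean_norm \o f])%E.

Definition travelling_wave (M : nat) (k : 'I_M -> R)
    (F : 'I_M -> 'cV[R]_2 -> 'cV[R]_2) (eps c : R) (Q : R -> 'cV[R]_2) :=
  twice_derivable Q /\
  forall x, (eps ^+ 3 * c ^+ 2) *: derive1n 2 Q x =
    \sum_m (k m * eps) *: diff_bwd (k m * eps)
      (fun y => F m ((k m * eps ^+ 2) *: diff_fwd (k m * eps) Q y)) x.

End Functions.

(* Main.v *)
Require Import Defs.
From HB Require Import structures.
From mathcomp Require Import all_boot all_order all_algebra.
From mathcomp Require Import all_classical all_reals all_analysis.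
From mathcomp Require Import measurable_realfun.
From mathcomp Require Import ring lra.
Set Implicit Arguments.
Unset Strict Implicit.
Unset Printing Implicit Defensive.
Import Order.TTheory GRing.Theory Num.Theory.
Import numFieldNormedType.Exports.
Local Open Scope classical_set_scope.
Local Open Scope ring_scope.

(* With [W = Q'] and [A_m] the average over an interval of length [|k_m| eps], the wave equation
   integrates to [eps^-2 c^2 W = sum_m A_m G_m (A_m W)], where [G_m] is a rescaling of [F^m].
   In coordinates [(p, q)] that diagonalise [sum_m k_m^2 alpha^m] the formal limit is
   [p = W_*, q = O(eps^2)], and [(W_*, eps^2 w)] with a suitable [w] solves the system up to an
   error [O(eps^2) sech^2].

   The wave speed lies slightly above the largest sound speed, and hypothesis (iv) makes the
   linear part positive; it yields a lower bound by [|p|^2 + D |p'|^2 + K |q|^2], with a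
   difference quotient at scale [eps] for [p'], uniformly in [eps]. Since [W_*] is a [sech^2]
   profile, the second variation at [(W_*, 0)] then compares with a Poeschl-Teller operator. On
   even functions it is coercive on a subspace of codimension one (those whose double average
   vanishes at a point [y0]) and negative in the direction of [W_*]. Reflecting this direction
   makes the nonlinear equation strongly monotone in an [L^2] ball of radius [O(eps^2)] around the
   approximate solution, and Zarantonello's iteration contracts there. The averages turn [L^2]
   convergence into uniform convergence, so the limit is continuous and solves the equation.

   Lower bounds for quadratic forms in translation-invariant operators are read off from their
   symbols by Fejer means of the cosine transform, in place of Plancherel's theorem. *)

(** * Derivatives, integrals and averages *)

(** The approximate solution is a saddle point. In the variable scaled by [wb], the second variation
    at the profile is -u'' + (4 - 12 sech^2) u, with eigenvalues -5, 0 and 3 below the essential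
    spectrum [4, oo). The eigenvalue 0 belongs to the translation mode, which is odd, so evenness
    removes it; the eigenvalue -5 remains, and plain monotonicity fails. The constraint that
    [A h (A h p)] vanish at [y0] cuts the line at two points and leaves pieces on which Riccati
    comparisons apply, while [W] stands in for the ground state because the profile equation makes
    its second variation computable. The other obstacle is that quadratic terms do not map L^2 to
    itself. The forces are evaluated at averages, and an average over a length of order eps costs a
    factor eps^(-1/2) in passing from L^2 to the supremum. On a ball of radius O(eps^2) the averages
    therefore stay within O(eps) of [(W, 0)], and replacing the equation by its linearisation there
    makes an error with Lipschitz constant O(eps), too small to spoil coercivity. *)

Section derivatives.
Context {R : realType}.
Implicit Types (f g F G : R -> R) (a b c x y d : R).

Definition der F x d : Prop := is_derive x (1 : R) F d.

Lemma der_ext F G x d : (forall y, F y = G y) -> der F x d -> der G x d.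
Proof. by move=> /funext ->. Qed.

Lemma der_eq F x d b : der F x d -> d = b -> der F x b.
Proof. by move=> ? <-. Qed.

Lemma der_cst c x : der (fun=> c) x 0.
Proof. exact: is_derive_cst. Qed.

Lemma der_id x : der (fun y => y) x 1.
Proof. exact: is_derive_id. Qed.

Lemma derD F G x a b : der F x a -> der G x b -> der (fun y => F y + G y) x (a + b).
Proof. by move=> h1 h2; exact: (is_deriveD h1 h2). Qed.

Lemma derN F x a : der F x a -> der (fun y => - F y) x (- a).
Proof. by move=> h1; exact: (is_deriveN h1). Qed.

Lemma derB F G x a b : der F x a -> der G x b -> der (fun y => F y - G y) x (a - b).
Proof. by move=> h1 h2; exact: (is_deriveB h1 h2). Qed.

Lemma derM F G x a b : der F x a -> der G x b ->
  der (fun y => F y * G y) x (a * G x + F x * b).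
Proof.
move=> h1 h2; apply: der_eq (is_deriveM h1 h2) _.
by rewrite /GRing.scale/= addrC [G x * a]mulrC.
Qed.

Lemma derZ c F x a : der F x a -> der (fun y => c * F y) x (c * a).
Proof. by move=> h; exact: (is_deriveZ c h). Qed.

Lemma der_comp F G x a b : der G x b -> der F (G x) a -> der (fun y => F (G y)) x (a * b).
Proof. by move=> h1 h2; exact: (is_derive1_comp h2 h1). Qed.

Lemma der_shift F x c a : der F (x + c) a -> der (fun y => F (y + c)) x a.
Proof.
move=> h; have hd := derD (der_id x) (der_cst c x).
by have := der_comp hd h; rewrite addr0 mulr1.
Qed.

Lemma der_scale F x c a : der F (c * x) a -> der (fun y => F (c * y)) x (c * a).
Proof.
move=> h; have hd := derZ c (der_id x).
by apply: der_eq (der_comp hd h) _; rewrite mulr1 mulrC.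
Qed.

Lemma derX F n x a : der F x a -> der (fun y => F y ^+ n.+1) x (n.+1%:R * F x ^+ n * a).
Proof.
move=> h; elim: n => [|n IH].
  by rewrite expr0 !mul1r; apply: der_ext h => y; rewrite expr1.
apply: der_ext (fun y => F y * F y ^+ n.+1) _ _ _ _ _ => [y|]; first by rewrite [RHS]exprS.
apply: der_eq (derM h IH) _; rewrite -[in RHS]natr1 exprS.
ring.
Qed.

Lemma der_inv F x a : F x != 0 -> der F x a -> der (fun y => (F y)^-1) x (- a / F x ^+ 2).
Proof.
move=> F0 h; have h' : der (fun y => y^-1) (F x) (- (F x ^+ 2)^-1).
  by have := is_deriveV F0 (is_derive_id (F x) (1 : R)); rewrite /GRing.scale/= mulr1 -exprVn exprVn.
by apply: der_eq (der_comp h h') _; rewrite mulrC mulrN mulNr.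
Qed.

Lemma der_cont F : (forall x, exists d, der F x d) -> continuous F.
Proof.
by move=> dF x; apply: differentiable_continuous; apply/derivable1_diffP; case: (dF x) => d [].
Qed.

Lemma der_cont' F f : (forall x, der F x (f x)) -> continuous F.
Proof. by move=> dF; apply: der_cont => x; exists (f x). Qed.

Lemma der_uniq F x a b : der F x a -> der F x b -> a = b.
Proof. by case=> _ <- [_ <-]. Qed.

Lemma der_derivable F x a : der F x a -> derivable F x 1.
Proof. by case. Qed.

Lemma der_derive1 F x a : der F x a -> derive1 F x = a.
Proof. by case=> _ <-; rewrite derive1E. Qed.

Lemma derivable_der F x : derivable F x 1 -> der F x (derive1 F x).
Proof. by move=> h; apply: DeriveDef => //; rewrite derive1E. Qed.

Lemma der_mvt F f a b : a <= b -> (forall x, der F x (f x)) ->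
  exists2 c, a <= c <= b & F b - F a = f c * (b - a).
Proof.
rewrite le_eqVlt => /predU1P[<- _|ab dF].
  by exists a; rewrite ?lexx// !subrr mulr0.
have [c /[!in_itv]/= /andP[ac cb] ->] := @MVT R F f a b ab (fun x _ => dF x)
  (continuous_subspaceT (der_cont' dF)).
by exists c => //; rewrite !ltW.
Qed.

End derivatives.

Section interval_integral.
Context {R : realType}.
Implicit Types (f g F : R -> R) (a b x : R).
Notation mu := (@lebesgue_measure R).

Definition int a b f : R := \int[mu]_(x in `[a, b]) f x.

Lemma cont_within f (A : set R) : continuous f -> {within A, continuous f}.
Proof. by move=> cf; apply: continuous_subspaceT => x; exact: cf. Qed.

Lemma int_integrable f a b : continuous f ->
  mu.-integrable `[a, b] (EFin \o f).
Proof.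
by move=> cf; apply: continuous_compact_integrable;
  [exact: segment_compact|exact: cont_within].
Qed.

Lemma eq_int f g a b : (forall x, a <= x <= b -> f x = g x) ->
  int a b f = int a b g.
Proof.
move=> fg; apply: eq_Rintegral => x; rewrite inE /= in_itv /=; exact: fg.
Qed.

Lemma intD f g a b : continuous f -> continuous g ->
  int a b (fun x => f x + g x) = int a b f + int a b g.
Proof. by move=> cf cg; rewrite /int RintegralD//; exact: int_integrable. Qed.

Lemma intB f g a b : continuous f -> continuous g ->
  int a b (fun x => f x - g x) = int a b f - int a b g.
Proof. by move=> cf cg; rewrite /int RintegralB//; exact: int_integrable. Qed.

Lemma intZ c f a b : continuous f -> int a b (fun x => c * f x) = c * int a b f.
Proof. by move=> cf; rewrite /int RintegralZl//; exact: int_integrable. Qed.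

Lemma int_cst c a b : a <= b -> int a b (fun=> c) = c * (b - a).
Proof.
move=> ab; rewrite /int Rintegral_cst//= lebesgue_measure_itv/= lte_fin.
by case: (ltgtP a b) ab => //= -> _; rewrite subrr.
Qed.

Lemma le_int f g a b : continuous f -> continuous g ->
  (forall x, a <= x <= b -> f x <= g x) -> int a b f <= int a b g.
Proof.
move=> cf cg fg; apply: le_Rintegral => //; exact: int_integrable.
Qed.

Lemma int_ge0 f a b : (forall x, a <= x <= b -> 0 <= f x) -> 0 <= int a b f.
Proof. by move=> f0; apply: Rintegral_ge0 => x/=; rewrite in_itv/=; exact: f0. Qed.

Lemma abs_int f a b : continuous f ->
  `|int a b f| <= int a b (fun x => `|f x|).
Proof. by move=> cf; apply: le_normr_Rintegral => //; exact: int_integrable. Qed.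

Lemma cont_norm f : continuous f -> continuous (fun x => `|f x|).
Proof. by move=> cf x; apply: continuous_comp; [exact: cf|exact: norm_continuous]. Qed.

Lemma abs_int_le f a b c : a <= b -> continuous f ->
  (forall x, a <= x <= b -> `|f x| <= c) -> `|int a b f| <= c * (b - a).
Proof.
move=> ab cf fc; apply: (le_trans (abs_int _ _ cf)); rewrite -int_cst//.
by apply: le_int => //; [exact: cont_norm|move=> x; exact: cst_continuous].
Qed.

Lemma FTC2 F f a b : a <= b -> continuous f ->
  (forall x, der F x (f x)) -> int a b f = F b - F a.
Proof.
rewrite le_eqVlt => /predU1P[<- _ _|ab cf dF].
  by rewrite subrr /int set_itv1 Rintegral_set1.
have cF := der_cont' dF.
rewrite /int /Rintegral (@continuous_FTC2 R f F a b)//.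
- exact: cont_within.
- split.
  + by move=> x _; case: (dF x).
  + by apply: cvg_at_right_filter; exact: cF.
  + by apply: cvg_at_left_filter; exact: cF.
- by move=> x _; rewrite derive1E; case: (dF x).
Qed.

Lemma int_cat f a b c : a <= b -> b <= c -> continuous f ->
  int a c f = int a b f + int b c f.
Proof.
move=> ab bc cf.
have -> : int a b f = \int[mu]_(x in `[a, b[) f x.
  rewrite Rintegral_itv_bndo_bndc//.
  by apply: integrableS (int_integrable a b cf) => //; apply: subset_itvl; rewrite bnd_simp.
rewrite /int -Rintegral_setU//=.
- by rewrite -itv_bndbnd_setU ?bnd_simp.
- rewrite -itv_bndbnd_setU ?bnd_simp//; exact: int_integrable.
- rewrite disj_set2E; apply/eqP; rewrite -subset0 => x [] /=.
  by rewrite !in_itv /= => /andP[_ xb] /andP[/(lt_le_trans xb)]; rewrite ltxx.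
Qed.

(** [int a b] is 0 when b < a, so integrating from 0 would fail on the left half-line. The lower end
    point, minus (|x| + 1), lies to the left of both 0 and x, and [FE] shows that moving it further
    left changes nothing. *)
Lemma primitive_exists f : continuous f ->
  exists F : R -> R, forall x, der F x (f x).
Proof.
move=> cf; pose F x := int (- (`|x| + 1)) x f - int (- (`|x| + 1)) 0 f.
have FE N x : `|x| + 1 <= N -> F x = int (- N) x f - int (- N) 0 f.
  move=> xN; have [h1 h2] : - N <= - (`|x| + 1) /\ - (`|x| + 1) <= 0.
    by split; have := normr_ge0 x; lra.
  have h3 : - (`|x| + 1) <= x by have := ler_norm (- x); rewrite normrN; lra.
  by rewrite (int_cat h1 h2 cf) (int_cat h1 h3 cf) /F; ring.
exists F => x; have [N NE] : exists N : R, N = `|x| + 2 by exists (`|x| + 2).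
have ltNx : - N < x by have := ler_norm (- x); rewrite normrN NE; lra.
have [dG dGE] := continuous_FTC1_closed (ltr_pwDr ltr01 (lexx x))
  (int_integrable (- N) (x + 1) cf) ltNx (cf x).
pose G y := int (- N) y f - int (- N) 0 f.
have dG' : der G x (f x).
  apply: der_eq (derB _ (der_cst _ x)) (subr0 _).
  by apply: DeriveDef; [exact: dG|rewrite -derive1E; exact: dGE].
apply: (near_eq_is_derive _ dG').
near=> y; rewrite /G (FE N)//; rewrite NE.
have : `|y - x| < 1 by rewrite distrC; near: y; apply: (@cvgr_dist_lt _ R^o); [exact: cvg_id|].
by have := ler_normD (y - x) x; rewrite subrK; lra.
Unshelve. all: by end_near. Qed.

End interval_integral.

Section averaging.
Context {R : realType}.
Implicit Types (f g F : R -> R) (a b x eta : R).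

(* The mean of [f] over the interval of length [|eta|] centred at [x]; negative [eta] is allowed
   and [A 0] is the identity. *)
Definition A eta f x : R := int 0 1 (fun s => f (x + eta * (s - 2^-1))).

Definition even f := forall x, f (- x) = f x.

Lemma der_aff (x eta c s : R) : der (fun s => x + eta * (s - c)) s eta.
Proof.
have := derD (der_cst x s) (derZ eta (derB (der_id s) (der_cst c s))).
by rewrite add0r subr0 mulr1.
Qed.

Lemma cont_aff f x eta (c : R) : continuous f ->
  continuous (fun s => f (x + eta * (s - c))).
Proof.
move=> cf s; apply: continuous_comp; last exact: cf.
by apply: (@der_cont' R _ (fun=> eta)) => y; exact: der_aff.
Qed.

Lemma cont_cst (c : R) : continuous (fun _ : R => c).
Proof. by move=> x; exact: cst_continuous. Qed.

Lemma cont_id : continuous (fun x : R => x).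
Proof. by move=> x; exact: cvg_id. Qed.

Lemma contD f g : continuous f -> continuous g -> continuous (fun x => f x + g x).
Proof. by move=> cf cg x; apply: continuousD; [exact: cf|exact: cg]. Qed.

Lemma contB f g : continuous f -> continuous g -> continuous (fun x => f x - g x).
Proof. by move=> cf cg x; apply: continuousB; [exact: cf|exact: cg]. Qed.

Lemma contM f g : continuous f -> continuous g -> continuous (fun x => f x * g x).
Proof. by move=> cf cg x; apply: continuousM; [exact: cf|exact: cg]. Qed.

Lemma contZ (c : R) f : continuous f -> continuous (fun x => c * f x).
Proof. by move=> cf; apply: contM => //; exact: cont_cst. Qed.

Lemma contX f n : continuous f -> continuous (fun x => f x ^+ n).
Proof.
move=> cf; elim: n => [|n IH]; first by under eq_fun do rewrite expr0; exact: cont_cst.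
by under eq_fun do rewrite exprS; exact: contM.
Qed.

(** This quotient form holds for both signs of [eta], because the average is parametrised over
    [0, 1]; most facts about [A] are read off from it. *)
Lemma A_prim F f eta x : eta != 0 -> continuous f ->
  (forall x, der F x (f x)) ->
  A eta f x = (F (x + eta / 2) - F (x - eta / 2)) / eta.
Proof.
move=> e0 cf dF; rewrite /A.
rewrite (@FTC2 R (fun s => eta^-1 * F (x + eta * (s - 2^-1)))) //; last 2 first.
- exact: cont_aff.
- move=> s; apply: der_eq (derZ _ (der_comp (der_aff x eta 2^-1 s) (dF _))) _.
  by rewrite mulrCA mulVf// mulr1.
- by rewrite -mulrBr mulrC; congr ((F _ - F _) / _); field.
Qed.

Lemma A_deriv f eta x : eta != 0 -> continuous f ->
  der (A eta f) x ((f (x + eta / 2) - f (x - eta / 2)) / eta).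
Proof.
move=> e0 cf; have [F dF] := primitive_exists cf.
apply: (@der_ext _ (fun y => eta^-1 * (F (y + eta / 2) - F (y - eta / 2)))) => [y|].
  by rewrite (A_prim _ e0 cf dF) mulrC.
by apply: der_eq (derZ _ (derB (der_shift (dF _)) (der_shift (dF _)))) _; rewrite mulrC.
Qed.

Lemma A0 f : A 0 f = f.
Proof.
apply/funext => x; rewrite /A; under eq_int do rewrite mul0r addr0.
by rewrite int_cst// subr0 mulr1.
Qed.

Lemma A_cont eta f : continuous f -> continuous (A eta f).
Proof.
move=> cf; have [->|e0] := eqVneq eta 0; first by rewrite A0.
by apply: der_cont => x; eexists; exact: A_deriv.
Qed.

Lemma A_cst eta (c : R) : A eta (fun=> c) = fun=> c.
Proof. by apply/funext => x; rewrite /A int_cst// subr0 mulr1. Qed.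

Lemma AD eta f g : continuous f -> continuous g ->
  A eta (fun x => f x + g x) = fun x => A eta f x + A eta g x.
Proof. by move=> cf cg; apply/funext => x; rewrite /A intD//; exact: cont_aff. Qed.

Lemma AB eta f g : continuous f -> continuous g ->
  A eta (fun x => f x - g x) = fun x => A eta f x - A eta g x.
Proof. by move=> cf cg; apply/funext => x; rewrite /A intB//; exact: cont_aff. Qed.

Lemma AZ eta (c : R) f : continuous f -> A eta (fun x => c * f x) = fun x => c * A eta f x.
Proof. by move=> cf; apply/funext => x; rewrite /A intZ//; exact: cont_aff. Qed.

Lemma A_even eta f : continuous f -> even f -> even (A eta f).
Proof.
move=> cf ef x; have [->|e0] := eqVneq eta 0; first by rewrite A0.
have [F dF] := primitive_exists cf.
(* For even f this function is a primitive as well as F; using one of them at x and the other at - x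
   gives the same quotient. *)
have dG (y : R) : der (fun y => - F (- y)) y (f y).
  by apply: der_eq (derN (der_comp (derN (der_id y)) (dF _))) _; rewrite mulrN1 opprK ef.
rewrite (A_prim _ e0 cf dF) (A_prim _ e0 cf dG).
by rewrite !opprD !opprK addrC.
Qed.

Lemma A_bound eta f x (c : R) : continuous f ->
  (forall s, `|s| <= `|eta| -> `|f (x + s)| <= c) -> `|A eta f x| <= c.
Proof.
move=> cf fc; rewrite -[c]mulr1 -[X in _ * X](subr0 1).
apply: abs_int_le => //; first exact: cont_aff.
move=> s /andP[s0 s1]; apply: fc; rewrite normrM ler_piMr//.
by rewrite ler_norml; apply/andP; split; lra.
Qed.

Lemma le_A eta f g x : continuous f -> continuous g ->
  (forall y, f y <= g y) -> A eta f x <= A eta g x.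
Proof. by move=> cf cg fg; apply: le_int => *; [exact: cont_aff..|]. Qed.

(** Jensen's inequality, from the nonnegative mean of (f - m)^2 with m the mean of f. *)
Lemma A_sqr_le eta f x : continuous f -> A eta f x ^+ 2 <= A eta (fun y => f y ^+ 2) x.
Proof.
move=> cf; set m := A eta f x.
have cf2 := contX (n := 2) cf.
have : 0 <= A eta (fun y => f y ^+ 2 - (2 * m * f y - m ^+ 2)) x.
  apply: int_ge0 => s _.
  have := sqr_ge0 (f (x + eta * (s - 2^-1)) - m); lra.
have c1 := contZ (c := 2 * m) cf.
rewrite AB//; last by apply: contB => //; exact: cont_cst.
rewrite AB//; last exact: cont_cst.
by rewrite AZ// A_cst -/m; lra.
Qed.

Lemma der_sinZ (z x : R) : der (fun x => sin (z * x)) x (z * cos (z * x)).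
Proof. exact: der_scale (is_derive_sin _). Qed.

Lemma cont_cosZ (z : R) : continuous (fun x => cos (z * x)).
Proof.
move=> x; apply: continuous_comp; last exact: continuous_cos.
by apply: contZ; exact: cont_id.
Qed.

(** Cosines are eigenfunctions of averaging, which is where the [sinc] in [symbS] comes from. *)
Lemma A_cos eta (z : R) x : A eta (fun x => cos (z * x)) x = sinc (eta * z / 2) * cos (z * x).
Proof.
have [->|e0] := eqVneq eta 0; first by rewrite A0 !mul0r /sinc eqxx mul1r.
have [->|z0] := eqVneq z 0.
  under eq_fun do rewrite mul0r cos0.
  by rewrite A_cst mulr0 mul0r /sinc eqxx mul0r cos0 mul1r.
have dF (y : R) : der (fun x => z^-1 * sin (z * x)) y (cos (z * y)).
  by apply: der_eq (derZ _ (der_sinZ z y)) _; rewrite mulKf.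
rewrite (A_prim _ e0 (cont_cosZ (z := z)) dF) /sinc.
rewrite ifF; last by apply/eqP => h; move/eqP: h; rewrite !mulf_eq0 (negbTE e0) (negbTE z0)/= invr_eq0 pnatr_eq0.
rewrite !mulrDr sinD sinD mulrN sinN cosN.
rewrite (_ : z * (eta / 2) = eta * z / 2); last by ring.
by field; rewrite z0 e0.
Qed.

End averaging.

(** * Integrals over the whole line *)

Section line_integral.
Context {R : realType}.
Implicit Types (f g : R -> R) (a b : R).
Notation mu := (@lebesgue_measure R).

Definition RI f : R := \int[mu]_x f x.

Definition integr f : Prop := mu.-integrable setT (EFin \o f).

Lemma cont_meas f : continuous f -> measurable_fun setT f.
Proof. exact: continuous_measurable_fun. Qed.

Lemma integr_dom f g : continuous f -> integr g -> (forall x, `|f x| <= g x) -> integr f.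
Proof.
move=> cf ig fg; apply: le_integrable ig => //.
  by apply/measurable_EFinP; exact: cont_meas.
by move=> x _ /=; rewrite lee_fin (le_trans (fg x))// ler_norm.
Qed.

Lemma integrD f g : integr f -> integr g -> integr (fun x => f x + g x).
Proof. by rewrite /integr => fi gi; exact: (integrableD measurableT fi gi). Qed.

Lemma integrZ (c : R) f : integr f -> integr (fun x => c * f x).
Proof. by rewrite /integr => fi; exact: (integrableZl measurableT c fi). Qed.

Lemma integrB f g : integr f -> integr g -> integr (fun x => f x - g x).
Proof. by rewrite /integr => fi gi; exact: (integrableB measurableT fi gi). Qed.

Lemma integr_norm f : integr f -> integr (fun x => `|f x|).
Proof. by move=> fi; exact: (integrable_norm fi). Qed.

Lemma RID f g : integr f -> integr g -> RI (fun x => f x + g x) = RI f + RI g.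
Proof. by move=> fi gi; rewrite /RI RintegralD. Qed.

Lemma RIB f g : integr f -> integr g -> RI (fun x => f x - g x) = RI f - RI g.
Proof. by move=> fi gi; rewrite /RI RintegralB. Qed.

Lemma RIZ (c : R) f : integr f -> RI (fun x => c * f x) = c * RI f.
Proof. by move=> fi; rewrite /RI RintegralZl. Qed.

Lemma le_RI f g : integr f -> integr g -> (forall x, f x <= g x) -> RI f <= RI g.
Proof. by move=> fi gi fg; apply: le_Rintegral. Qed.

Lemma RI_ge0 f : (forall x, 0 <= f x) -> 0 <= RI f.
Proof. by move=> f0; apply: Rintegral_ge0. Qed.

Lemma abs_RI f : integr f -> `|RI f| <= RI (fun x => `|f x|).
Proof. by move=> fi; apply: le_normr_Rintegral. Qed.

Lemma EFin_RI f : integr f -> (RI f)%:E = (\int[mu]_x (f x)%:E)%E.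
Proof. by move=> fi; rewrite /RI /Rintegral fineK//; exact: integrable_fin_num. Qed.

Lemma EFin_int f a b : continuous f -> (int a b f)%:E = (\int[mu]_(x in `[a, b]) (f x)%:E)%E.
Proof.
by move=> cf; rewrite /int /Rintegral fineK//; apply: integrable_fin_num => //; exact: int_integrable.
Qed.

Lemma int_le_RI f a b : continuous f -> (forall x, 0 <= f x) -> integr f ->
  int a b f <= RI f.
Proof.
move=> cf f0 fi; rewrite -lee_fin EFin_RI// EFin_int//.
apply: ge0_subset_integral => //; first by apply/measurable_EFinP; exact: cont_meas.
by move=> x _; rewrite lee_fin.
Qed.

Lemma cvg_int_ge0 f : continuous f -> (forall x, 0 <= f x) ->
  (int (- n%:R) n%:R f)%:E @[n --> \oo] --> (\int[mu]_x (f x)%:E)%E.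
Proof.
move=> cf f0.
have -> : [set: R] = \bigcup_(i : nat) `[(- i%:R : R), i%:R]%classic.
  apply/esym; rewrite -subTset => x _; exists (Num.bound `|x|) => //=.
  by rewrite in_itv/= -ler_norml ltW//; exact: archi_boundP.
under eq_fun do rewrite EFin_int//.
apply: ge0_nondecreasing_set_cvg_integral => //.
- move=> m n mn; apply/subsetPset => x /=; rewrite !in_itv/= -!ler_norml => xm.
  by rewrite (le_trans xm)// ler_nat.
- by move=> n; apply/measurable_EFinP; apply: measurable_funTS; exact: cont_meas.
- by move=> n x _; rewrite lee_fin.
Qed.

(** Monotone convergence along the windows [-n, n]. Integrability on the line thus follows from
    bounds on bounded intervals, where primitives are available. *)
Lemma integr_bounded f (c : R) : continuous f -> (forall x, 0 <= f x) ->
  (forall T, 0 <= T -> int (- T) T f <= c) -> integr f /\ RI f <= c.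
Proof.
move=> cf f0 fc.
have mf : measurable_fun setT f by exact: cont_meas.
have h : (\int[mu]_x (f x)%:E <= c%:E)%E.
  apply: (cvge_to_le (cvg_int_ge0 cf f0)); apply: nearW => n.
  by rewrite lee_fin; exact: fc.
have fi : integr f.
  apply/integrableP; split; first exact/measurable_EFinP.
  under eq_integral do rewrite /= ger0_norm//.
  by apply: le_lt_trans h _; rewrite ltry.
by split => //; rewrite -lee_fin EFin_RI.
Qed.

Lemma RI_tail_ge0 f : continuous f -> (forall x, 0 <= f x) -> integr f ->
  forall e, 0 < e -> exists T0, 0 <= T0 /\
  forall T, T0 <= T -> RI f - e <= int (- T) T f.
Proof.
move=> cf f0 fi e e0.
have := cvg_int_ge0 cf f0; rewrite -EFin_RI// => /fine_cvgP[_ /cvgrPdist_le /(_ _ e0)[N _ hN]].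
exists N%:R; split; first exact: ler0n.
move=> T NT; have := hN N (leqnn N) => /=; rewrite ler_norml => /andP[_ h].
have N0 : 0 <= N%:R :> R by exact: ler0n.
have h1 : int (- N%:R) N%:R f <= int (- T) T f.
  rewrite (@int_cat _ _ (- T) (- N%:R) T)//; try lra.
  rewrite (@int_cat _ _ (- N%:R) N%:R T)//; try lra.
  have : 0 <= int (- T) (- N%:R) f by apply: int_ge0.
  have : 0 <= int N%:R T f by apply: int_ge0.
  lra.
lra.
Qed.

Lemma RI_tail f : continuous f -> integr f ->
  forall e, 0 < e -> exists T0, 0 <= T0 /\
  forall T, T0 <= T -> `|RI f - int (- T) T f| <= e.
Proof.
move=> cf fi e e0.
have cn : continuous (fun x => `|f x|) by exact: cont_norm.
have ni := integr_norm fi.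
(* The functions |f| + f and |f| are nonnegative, so their tails are controlled, and f is their
   difference. *)
pose p x := `|f x| + f x; pose q x := `|f x|.
have cp : continuous p by exact: contD.
have pi : integr p by exact: integrD.
have p0 x : 0 <= p x by rewrite /p; have := ler_norm (- f x); rewrite normrN; lra.
have q0 x : 0 <= q x by rewrite /q.
have [T1 [T10 h1]] := RI_tail_ge0 cp p0 pi e0.
have [T2 [T20 h2]] := RI_tail_ge0 cn q0 ni e0.
exists (Num.max T1 T2); split; first by rewrite le_max T10.
move=> T; rewrite ge_max => /andP[/h1 k1 /h2 k2].
have e1 : RI p = RI q + RI f by rewrite /p RID.
have e2 : int (- T) T p = int (- T) T q + int (- T) T f by rewrite /p intD.
have := int_le_RI (- T) T cp p0 pi.
have := int_le_RI (- T) T cn q0 ni.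
rewrite ler_norml -/q in k2 * => k3 k4; apply/andP; split; lra.
Qed.

End line_integral.

(** * Continuous square-integrable functions *)

Section L2_space.
Context {R : realType}.
Implicit Types (f g h : R -> R) (a b c e eta : R).

(* Every iterate of the fixed-point scheme is continuous, so that neither classes modulo null
   sets nor the completeness of [L^2] are needed. *)
Definition L2c f := continuous f /\ integr (fun x => f x ^+ 2).

Definition ip f g : R := RI (fun x => f x * g x).

Definition nrm f : R := Num.sqrt (ip f f).

Lemma L2c_mul f g : L2c f -> L2c g -> integr (fun x => f x * g x).
Proof.
move=> [cf fi] [cg gi].
apply: (integr_dom (contM cf cg) (integrD fi gi)) => x.
rewrite normrM -[f x ^+ 2]real_normK ?num_real// -[g x ^+ 2]real_normK ?num_real//.
have := sqr_ge0 (`|f x| - `|g x|); have := sqr_ge0 (`|f x|); have := sqr_ge0 (`|g x|).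
by rewrite sqrrB; nra.
Qed.

Lemma L2c_bounded f c : continuous f ->
  (forall T, 0 <= T -> int (- T) T (fun x => f x ^+ 2) <= c) -> L2c f /\ ip f f <= c.
Proof.
move=> cf fc.
have [] := integr_bounded (contX (n := 2) cf) (fun x => sqr_ge0 _) fc.
move=> h1 h2; split; first by split.
by rewrite /ip; under [X in RI X]eq_fun do rewrite -expr2.
Qed.

Lemma L2cD f g : L2c f -> L2c g -> L2c (fun x => f x + g x).
Proof.
move=> [cf fi] [cg gi]; split; first exact: contD.
apply: (integr_dom _ (integrZ 2 (integrD fi gi))) => [|x].
  by apply: contX; exact: contD.
rewrite ger0_norm ?sqr_ge0//; have := sqr_ge0 (f x - g x); nra.
Qed.

Lemma L2cZ c f : L2c f -> L2c (fun x => c * f x).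
Proof.
move=> [cf fi]; split; first exact: contZ.
by under eq_fun do rewrite exprMn; exact: integrZ.
Qed.

Lemma L2cN f : L2c f -> L2c (fun x => - f x).
Proof.
move=> hf; rewrite (_ : (fun x => - f x) = (fun x => -1 * f x)); first exact: L2cZ.
by apply/funext => x; rewrite mulN1r.
Qed.

Lemma L2cB f g : L2c f -> L2c g -> L2c (fun x => f x - g x).
Proof. by move=> hf hg; apply: L2cD => //; exact: L2cN. Qed.

Lemma L2c0 : L2c (fun=> 0).
Proof.
split; first exact: cont_cst.
by under eq_fun do rewrite expr0n/=; exact: integrable0.
Qed.

Lemma L2c_sum (I : Type) (r : seq I) (F : I -> R -> R) :
  (forall i, L2c (F i)) -> L2c (fun x => \sum_(i <- r) F i x).
Proof.
move=> hF; elim: r => [|i r IH]; first by under eq_fun do rewrite big_nil; exact: L2c0.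
by under eq_fun do rewrite big_cons; exact: L2cD.
Qed.

Lemma L2c_dom f g c : continuous g -> L2c f -> (forall x, `|g x| <= c * `|f x|) ->
  L2c g /\ ip g g <= c ^+ 2 * ip f f.
Proof.
move=> cg [cf fi] gf.
have le2 x : g x ^+ 2 <= c ^+ 2 * f x ^+ 2.
  rewrite -exprMn -[g x ^+ 2]real_normK ?num_real// -[(c * f x) ^+ 2]real_normK ?num_real//.
  rewrite lerXn2r ?nnegrE//.
  by rewrite normrM (le_trans (gf x))// ler_wpM2r// ler_norm.
have ig : integr (fun x => g x ^+ 2).
  apply: (integr_dom _ (integrZ (c ^+ 2) fi)) => [|x]; first exact: contX.
  by rewrite ger0_norm ?sqr_ge0.
split; first by split.
rewrite /ip; under [X in RI X]eq_fun do rewrite -expr2.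
under [X in _ <= _ * RI X]eq_fun do rewrite -expr2.
by rewrite -RIZ//; apply: le_RI => //; exact: integrZ.
Qed.

Lemma ipC f g : ip f g = ip g f.
Proof. by rewrite /ip; congr RI; apply/funext => x; rewrite mulrC. Qed.

Lemma ipDl f g h : L2c f -> L2c g -> L2c h ->
  ip (fun x => f x + g x) h = ip f h + ip g h.
Proof.
move=> hf hg hh; rewrite /ip -RID; [|exact: L2c_mul..].
by congr RI; apply/funext => x; rewrite mulrDl.
Qed.

Lemma ipZl c f h : L2c f -> L2c h -> ip (fun x => c * f x) h = c * ip f h.
Proof.
move=> hf hh; rewrite /ip -RIZ; last exact: L2c_mul.
by congr RI; apply/funext => x; rewrite mulrA.
Qed.

Lemma ipBl f g h : L2c f -> L2c g -> L2c h ->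
  ip (fun x => f x - g x) h = ip f h - ip g h.
Proof.
move=> hf hg hh; rewrite /ip -RIB; [|exact: L2c_mul..].
by congr RI; apply/funext => x; rewrite mulrBl.
Qed.

Lemma ipDr f g h : L2c f -> L2c g -> L2c h ->
  ip h (fun x => f x + g x) = ip h f + ip h g.
Proof. by move=> hf hg hh; rewrite ipC ipDl// !(ipC h). Qed.

Lemma ipZr c f h : L2c f -> L2c h -> ip h (fun x => c * f x) = c * ip h f.
Proof. by move=> hf hh; rewrite ipC ipZl// (ipC h). Qed.

Lemma ipBr f g h : L2c f -> L2c g -> L2c h ->
  ip h (fun x => f x - g x) = ip h f - ip h g.
Proof. by move=> hf hg hh; rewrite ipC ipBl// !(ipC h). Qed.

Lemma ip_suml (I : Type) (r : seq I) (F : I -> R -> R) h :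
  (forall i, L2c (F i)) -> L2c h ->
  ip (fun x => \sum_(i <- r) F i x) h = \sum_(i <- r) ip (F i) h.
Proof.
move=> hF hh; elim: r => [|i r IH].
  rewrite big_nil /ip; under [X in RI X]eq_fun do rewrite big_nil mul0r.
  by rewrite /RI Rintegral_cst// mul0r.
rewrite big_cons -IH -ipDl//; last exact: L2c_sum.
by congr ip; apply/funext => x; rewrite big_cons.
Qed.

Lemma ip_ge0 f : 0 <= ip f f.
Proof. by apply: RI_ge0 => x; rewrite -expr2 sqr_ge0. Qed.

Lemma nrm_ge0 f : 0 <= nrm f. Proof. exact: sqrtr_ge0. Qed.

Lemma nrm_sqr f : nrm f ^+ 2 = ip f f. Proof. by rewrite sqr_sqrtr// ip_ge0. Qed.

Lemma ip_sqrD f g : L2c f -> L2c g ->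
  ip (fun x => f x + g x) (fun x => f x + g x) = ip f f + 2 * ip f g + ip g g.
Proof.
move=> hf hg; have hfg := L2cD hf hg.
by rewrite ipDl// !ipDr// (ipC g f); ring.
Qed.

Lemma ip_sqrB f g : L2c f -> L2c g ->
  ip (fun x => f x - g x) (fun x => f x - g x) = ip f f - 2 * ip f g + ip g g.
Proof.
move=> hf hg; have hfg := L2cB hf hg.
by rewrite ipBl// !ipBr// (ipC g f); ring.
Qed.

Lemma cauchy_schwarz f g : L2c f -> L2c g -> ip f g ^+ 2 <= ip f f * ip g g.
Proof.
move=> hf hg.
have h (t : R) : 0 <= ip f f - 2 * t * ip f g + t ^+ 2 * ip g g.
  have := ip_ge0 (fun x => f x - t * g x).
  by rewrite ip_sqrB ?ipZr ?ipZl//; [nra|exact: L2cZ..].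
have f0 := ip_ge0 f; have g0 := ip_ge0 g.
have [g1|g1] := eqVneq (ip g g) 0.
  rewrite g1 mulr0; have [->|n0] := eqVneq (ip f g) 0; first by rewrite expr0n.
  (* When g has norm 0 the quadratic in t is affine, and this t would give it the value -1. *)
  have := h ((ip f f + 1) / ip f g / 2); rewrite g1.
  rewrite (_ : 2 * ((ip f f + 1) / ip f g / 2) * ip f g = ip f f + 1); first lra.
  by field.
have gp : 0 < ip g g by rewrite lt_neqAle eq_sym g1.
have := h (ip f g / ip g g).
rewrite (_ : ip f f - _ + _ = (ip f f * ip g g - ip f g ^+ 2) / ip g g); last by field.
by rewrite pmulr_lge0 ?invr_gt0// subr_ge0.
Qed.

Lemma ip_le_nrm f g : L2c f -> L2c g -> `|ip f g| <= nrm f * nrm g.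
Proof.
move=> hf hg; rewrite /nrm -sqrtrM ?ip_ge0// -[`|_|]sqrtr_sqr.
exact/ler_wsqrtr/cauchy_schwarz.
Qed.

Lemma nrmD f g : L2c f -> L2c g -> nrm (fun x => f x + g x) <= nrm f + nrm g.
Proof.
move=> hf hg; rewrite -(@ler_pXn2r _ 2)// ?nnegrE ?addr_ge0 ?nrm_ge0//.
rewrite nrm_sqr ip_sqrD// sqrrD !nrm_sqr.
have := ip_le_nrm hf hg; have := ler_norm (ip f g); lra.
Qed.

Lemma nrmZ c f : L2c f -> nrm (fun x => c * f x) = `|c| * nrm f.
Proof.
move=> hf; rewrite /nrm ipZl ?ipZr//; last exact: L2cZ.
by rewrite mulrA -expr2 sqrtrM ?sqr_ge0// sqrtr_sqr.
Qed.

Lemma nrmN f : nrm (fun x => - f x) = nrm f.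
Proof. by rewrite /nrm /ip; under eq_fun do rewrite mulrNN. Qed.

Lemma nrmB f g : L2c f -> L2c g -> nrm (fun x => f x - g x) <= nrm f + nrm g.
Proof. by move=> hf hg; rewrite -(nrmN g); apply: nrmD => //; exact: L2cN. Qed.

Lemma nrm_le f c : 0 <= c -> ip f f <= c ^+ 2 -> nrm f <= c.
Proof. by move=> c0 h; rewrite -(ger0_norm c0) -sqrtr_sqr; exact: ler_wsqrtr. Qed.

Lemma nrm0 : nrm (fun=> 0) = 0.
Proof.
rewrite /nrm /ip; under [X in RI X]eq_fun do rewrite mulr0.
by rewrite /RI Rintegral_cst// mul0r sqrtr0.
Qed.

Lemma nrm_sum (I : Type) (r : seq I) (F : I -> R -> R) :
  (forall i, L2c (F i)) ->
  nrm (fun x => \sum_(i <- r) F i x) <= \sum_(i <- r) nrm (F i).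
Proof.
move=> hF; elim: r => [|i r IH].
  by under eq_fun do rewrite big_nil; rewrite big_nil nrm0.
under eq_fun do rewrite big_cons; rewrite big_cons.
by apply: (le_trans (nrmD _ _)) => //; [exact: L2c_sum|rewrite lerD2l].
Qed.

Lemma nrm_dom f g c : 0 <= c -> continuous g -> L2c f ->
  (forall x, `|g x| <= c * `|f x|) -> L2c g /\ nrm g <= c * nrm f.
Proof.
move=> c0 cg hf /(L2c_dom cg hf)[hg le]; split => //.
by apply: nrm_le; [rewrite mulr_ge0// nrm_ge0|rewrite exprMn nrm_sqr].
Qed.

Lemma int_sqr_le_ip f a b : L2c f -> int a b (fun x => f x ^+ 2) <= ip f f.
Proof.
move=> [cf fi]; rewrite /ip; under [X in RI X]eq_fun do rewrite -expr2.
by apply: int_le_RI => //; [exact: contX|move=> x; exact: sqr_ge0].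
Qed.

Lemma int_shift f a b c : a <= b -> continuous f ->
  int a b (fun x => f (x + c)) = int (a + c) (b + c) f.
Proof.
move=> ab cf; have [F dF] := primitive_exists cf.
rewrite (@FTC2 _ (fun x => F (x + c)) _ a b)//; last 2 first.
- by move=> x; apply: continuous_comp; [apply: contD; [exact: cont_id|exact: cont_cst]|exact: cf].
- by move=> x; exact: der_shift (dF _).
by rewrite (@FTC2 _ F _ (a + c) (b + c))// lerD2r.
Qed.

Lemma cont_shift f c : continuous f -> continuous (fun x => f (x + c)).
Proof.
by move=> cf x; apply: continuous_comp; [apply: contD; [exact: cont_id|exact: cont_cst]|exact: cf].
Qed.

Lemma L2c_shift_le f c : L2c f ->
  L2c (fun x => f (x + c)) /\ ip (fun x => f (x + c)) (fun x => f (x + c)) <= ip f f.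
Proof.
move=> hf; apply: L2c_bounded => [|T T0]; first by apply: cont_shift; case: hf.
have h := @int_shift (fun y => f y ^+ 2) (- T) T c.
rewrite h; [exact: int_sqr_le_ip|lra|by apply: contX; case: hf].
Qed.

Lemma L2c_shift f c : L2c f -> L2c (fun x => f (x + c)).
Proof. by move=> /(L2c_shift_le c)[]. Qed.

(** [L2c_shift_le] only gives an inequality; shifting back by - c gives the reverse one. *)
Lemma ip_shift_sqr f c : L2c f ->
  ip (fun x => f (x + c)) (fun x => f (x + c)) = ip f f.
Proof.
move=> hf; have [h1 h2] := L2c_shift_le c hf; have [h3 h4] := L2c_shift_le (- c) h1.
apply/eqP; rewrite eq_le h2 /=; move: h4.
by under [X in ip X _]eq_fun do rewrite subrK; under [X in ip _ X]eq_fun do rewrite subrK.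
Qed.

Lemma ip_shift f g c : L2c f -> L2c g ->
  ip (fun x => f (x + c)) (fun x => g (x + c)) = ip f g.
Proof.
move=> hf hg; have := ip_shift_sqr c (L2cD hf hg).
rewrite !ip_sqrD//; try exact: L2c_shift.
rewrite !ip_shift_sqr//; lra.
Qed.

Lemma ip_shift_adj f g c : L2c f -> L2c g ->
  ip f (fun x => g (x + c)) = ip (fun x => f (x - c)) g.
Proof.
move=> hf hg; rewrite -(ip_shift c (L2c_shift (- c) hf) hg).
by congr ip; apply/funext => x; rewrite addrK.
Qed.

End L2_space.

Section fubini.
Context {R : realType}.
Notation mu := (@lebesgue_measure R).

(** The interval enters as an indicator function on the plane, so that the product measure is that
    of the line with itself. The uniform bound [C] on the slices, times the length d - c, gives
    integrability on the product. *)
Lemma fubini_line (h : R -> R -> R) (c d C : R) : c <= d ->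
  measurable_fun setT (fun z : R * R => h z.1 z.2) ->
  (forall x, continuous (h x)) ->
  (forall s, c <= s <= d -> integr (h^~ s)) ->
  (forall s, c <= s <= d -> RI (fun x => `|h x s|) <= C) ->
  integr (fun x => int c d (h x)) ->
  RI (fun x => int c d (h x)) = int c d (fun s => RI (h^~ s)).
Proof.
move=> cd mh ch ih hC iA.
pose H (z : R * R) : \bar R := (h z.1 z.2 * \1_(`[c, d]%classic : set R) z.2)%:E.
have mH : measurable_fun setT H.
  apply/measurable_EFinP; apply: measurable_funM => //.
  by apply: measurableT_comp => //; exact: measurable_indic.
have HE s : (\int[mu]_x `|H (x, s)| =
    (\1_(`[c, d]%classic : set R) s)%:E * (\int[mu]_x `|h x s|%:E))%E.
  rewrite /H /= indicE; have [sI|sI] := boolP (s \in (`[c, d]%classic : set R)).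
    by rewrite mul1e; apply: eq_integral => x _; rewrite mulr1.
  rewrite mul0e; under eq_integral do rewrite mulr0 normr0; exact: integral0.
have mus : mu (`[c, d]%classic : set R) = (d - c)%:E.
  rewrite lebesgue_measure_itv/= lte_fin.
  by case: (ltgtP c d) cd => //= -> _; rewrite subrr.
have iH : (mu \x mu)%E.-integrable setT H.
  apply/integrable21ltyP => //.
  apply: (@le_lt_trans _ _ (\int[mu]_s ((\1_(`[c, d]%classic : set R) s)%:E * C%:E))%E).
    apply: ge0_le_integral => //.
    - by move=> s _; exact: integral_ge0.
    - have /= := @measurable_fun_fubini_tonelli_G _ _ _ _ R mu (abse \o H).
      by apply => //; exact: measurableT_comp.
    - apply: emeasurable_funM; last exact: measurable_cst.
      by apply/measurable_EFinP; exact: measurable_indic.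
    - move=> s _; rewrite HE.
      have [sI|sI] := boolP (s \in (`[c, d]%classic : set R)); last first.
        by rewrite indicE (negbTE sI) !mul0e.
      have sI' : c <= s <= d by move: sI; rewrite inE/= in_itv.
      rewrite indicE sI !mul1e -EFin_RI ?lee_fin; first exact: hC.
      exact: integr_norm (ih s sI').
  rewrite ge0_integralZr//; last 2 first.
  - by apply/measurable_EFinP; exact: measurable_indic.
  - rewrite lee_fin; apply: le_trans (hC c _); first by apply: RI_ge0.
    by rewrite lexx.
  rewrite [X in (X * _)%E](_ : _ = (d - c)%:E); first by rewrite -EFinM ltry.
  by rewrite integral_indic// setIT; exact: mus.
have FI := Fubini iH.
have L x : (\int[mu]_y H (x, y) = (int c d (h x))%:E)%E.
  rewrite (EFin_int c d (ch x)) [RHS]integral_mkcond; apply: eq_integral => y _.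
  by rewrite /H /= /patch indicE; case: ifP; rewrite ?mulr1 ?mulr0.
have Rr y : (\int[mu]_x H (x, y) = ((fun s => (RI (h^~ s))%:E) \_ `[c, d]) y)%E.
  rewrite /H /= /patch indicE; case: ifPn => [yI|yI].
    under eq_integral do rewrite mulr1.
    have yI' : c <= y <= d by move: yI; rewrite inE/= in_itv.
    exact: esym (EFin_RI (ih y yI')).
  by under eq_integral do rewrite mulr0; exact: integral0.
have e1 : (\int[mu]_x (int c d (h x))%:E = \int[mu]_x \int[mu]_y H (x, y))%E.
  by apply: eq_integral => x _; rewrite L.
have e2 : (\int[mu]_(s in `[c, d]) (RI (h^~ s))%:E = \int[mu]_y \int[mu]_x H (x, y))%E.
  by rewrite integral_mkcond; apply: eq_integral => y _; rewrite -Rr.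
have e3 := etrans (EFin_RI iA) (etrans e1 (etrans FI (esym e2))).
by rewrite [RHS]/int /Rintegral -e3.
Qed.

End fubini.

Section averaging_L2.
Context {R : realType}.
Implicit Types (f g F : R -> R) (x eta : R).
Notation mu := (@lebesgue_measure R).

Lemma A_der eta F f : continuous f -> (forall x, der F x (f x)) ->
  forall x, der (A eta F) x (A eta f x).
Proof.
move=> cf dF x; have [->|e0] := eqVneq eta 0; first by rewrite !A0.
by rewrite (A_prim _ e0 cf dF); apply: A_deriv => //; exact: der_cont' dF.
Qed.

(** [A eta G] is a primitive of the averaged square, so the integral is the mean over s of the
    integrals of f^2 over translates of [-T, T]. *)
Lemma int_A_sqr_le eta f T : 0 <= T -> L2c f ->
  int (- T) T (A eta (fun x => f x ^+ 2)) <= ip f f.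
Proof.
move=> T0 hf; have [cf _] := hf; have cf2 := contX (n := 2) cf.
have [G dG] := primitive_exists cf2; have cG := der_cont' dG.
have TT : - T <= T by lra.
rewrite (@FTC2 R (A eta G) _ _ _ TT (@A_cont R eta _ cf2) (A_der eta cf2 dG)).
rewrite /A -intB; [|exact: cont_aff..].
rewrite -[leRHS]mulr1 -[X in _ * X](subr0 1) -(int_cst _ ler01).
apply: le_int; first by apply: contB; exact: cont_aff.
- exact: cont_cst.
- move=> s _; rewrite -(@FTC2 _ G (fun x => f x ^+ 2))//; last by rewrite lerD2r.
  exact: int_sqr_le_ip.
Qed.

Lemma L2c_A_le eta f : L2c f -> L2c (A eta f) /\ ip (A eta f) (A eta f) <= ip f f.
Proof.
move=> hf; have [cf _] := hf; have cf2 := contX (n := 2) cf.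
apply: L2c_bounded => [|T T0]; first exact: A_cont.
apply: le_trans (int_A_sqr_le eta T0 hf).
apply: le_int; [by apply: contX; exact: A_cont|exact: A_cont|].
by move=> x _; exact: A_sqr_le.
Qed.

Lemma L2c_A eta f : L2c f -> L2c (A eta f). Proof. by move=> /(L2c_A_le eta)[]. Qed.

Lemma nrm_A eta f : L2c f -> nrm (A eta f) <= nrm f.
Proof. by move=> /(L2c_A_le eta)[_ h]; exact: ler_wsqrtr. Qed.

Lemma A_opp eta f : continuous f -> A (- eta) f = A eta f.
Proof.
move=> cf; have [->|e0] := eqVneq eta 0; first by rewrite oppr0.
apply/funext => x; have [F dF] := primitive_exists cf.
rewrite (A_prim _ e0 cf dF) (A_prim _ _ cf dF) ?oppr_eq0//.
by rewrite mulNr opprK invrN mulrN -mulNr opprB.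
Qed.

(** By Jensen the square is at most the mean of f^2 over an interval of length |eta|, hence at most
    [ip f f] divided by |eta|. *)
Lemma A_sup eta f x : eta != 0 -> L2c f ->
  `|A eta f x| <= (Num.sqrt `|eta|)^-1 * nrm f.
Proof.
move=> e0 hf; have [cf _] := hf; have cf2 := contX (n := 2) cf.
have np : 0 < `|eta| by rewrite normr_gt0.
have A2 : A eta f x ^+ 2 <= `|eta|^-1 * ip f f.
  wlog ep : eta e0 np / 0 < eta => [H|].
    have [h|h|h] := ltgtP eta 0; last by rewrite h eqxx in e0.
      have := H (- eta); rewrite normrN oppr_eq0 oppr_gt0 A_opp//; exact.
    exact: H.
  apply: (le_trans (A_sqr_le _ _ cf)).
  have [G dG] := primitive_exists cf2.
  rewrite (A_prim _ e0 cf2 dG) gtr0_norm// mulrC ler_pM2l ?invr_gt0//.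
  rewrite -(@FTC2 _ G (fun x => f x ^+ 2))//; first exact: int_sqr_le_ip.
  by rewrite lerD2l; lra.
rewrite -sqrtr_sqr.
rewrite -sqrtrV ?normr_ge0// -sqrtrM ?invr_ge0 ?normr_ge0//.
exact: ler_wsqrtr.
Qed.

Lemma nrm_shift f (c : R) : L2c f -> nrm (fun x => f (x + c)) = nrm f.
Proof. by move=> hf; rewrite /nrm ip_shift_sqr. Qed.

Lemma ip_A eta f g : L2c f -> L2c g ->
  ip f (A eta g) = int 0 1 (fun s => ip f (fun x => g (x + eta * (s - 2^-1)))).
Proof.
move=> hf hg; have [cf _] := hf; have [cg _] := hg.
pose h x s := f x * g (x + eta * (s - 2^-1)).
have hE x : int 0 1 (h x) = f x * A eta g x by rewrite /h intZ//; exact: cont_aff.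
rewrite {1}/ip; under [in LHS]eq_fun do rewrite -hE.
apply: (@fubini_line _ h 0 1 (nrm f * nrm g)) => //.
- apply: measurable_funM.
    by apply: measurableT_comp => //; exact: cont_meas.
  apply: (measurableT_comp (cont_meas cg)).
  apply: measurable_funD => //.
  apply: measurable_funM; first exact: measurable_cst.
  by apply: measurable_funB => //; exact: measurable_cst.
- by move=> x; apply: contZ; exact: cont_aff.
- by move=> s _; apply: L2c_mul => //; exact: L2c_shift.
- move=> s _; have hs := L2c_shift (eta * (s - 2^-1)) hg.
  have n1 : L2c (fun x => `|f x|).
    by apply: (@L2c_dom _ f _ 1 _ hf _).1 => [|x]; [exact: cont_norm|rewrite normr_id mul1r].
  have n2 : L2c (fun x => `|g (x + eta * (s - 2^-1))|).
    by apply: (@L2c_dom _ _ _ 1 _ hs _).1 => [|x]; [apply: cont_norm; case: hs|rewrite normr_id mul1r].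
  have := ip_le_nrm n1 n2.
  have e1 k : nrm (fun x : R => `|k x|) = nrm k.
    rewrite /nrm /ip; congr (Num.sqrt (RI _)); apply/funext => x.
    by rewrite -normrM ger0_norm// -expr2 sqr_ge0.
  rewrite !e1 nrm_shift// => /(le_trans (ler_norm _)); rewrite /ip /h.
  by under eq_fun do rewrite -normrM.
- by under eq_fun do rewrite hE; apply: L2c_mul => //; exact: L2c_A.
Qed.

(** The adjoint of a shift by t is the shift by - t, and the averaging interval is symmetric. *)
Lemma A_adj eta f g : L2c f -> L2c g -> ip (A eta f) g = ip f (A eta g).
Proof.
move=> hf hg; have [cf _] := hf.
rewrite ipC -(A_opp eta cf) (ip_A (- eta) hg hf) (ip_A eta hf hg).
congr int; apply/funext => s; rewrite ip_shift_adj// ipC; congr ip.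
by apply/funext => x; rewrite mulNr opprK.
Qed.

End averaging_L2.

(** * Compactly supported functions and cutoffs *)

Section compact_support.
Context {R : realType}.
Implicit Types (f g h F : R -> R) (a b c x L T : R).
Notation mu := (@lebesgue_measure R).

Lemma lip_cont F K : (forall x y, `|F x - F y| <= K * `|x - y|) -> continuous F.
Proof.
move=> lF x; apply/cvgrPdist_le => e e0.
have K0 : 0 <= `|K| + 1 by rewrite addr_ge0.
have Kp : 0 < `|K| + 1 by rewrite ltr_wpDl.
near=> y; apply: le_trans (lF x y) _.
have : `|x - y| <= e / (`|K| + 1).
  by near: y; apply: (@cvgr_dist_le _ R^o _ _ _ id); [exact: cvg_id|exact: divr_gt0].
rewrite ler_pdivlMr// mulrC; apply: le_trans.
by apply: ler_wpM2r => //; have := ler_norm K; lra.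
Unshelve. all: by end_near. Qed.

(** Uniform continuity in which x + u may leave [a, b]; hence a covering argument with
    neighbourhoods in the line rather than in the interval. *)
Lemma heine f a b : continuous f -> forall e, 0 < e -> exists2 d : R, 0 < d &
  forall x u, a <= x <= b -> `|u| <= d -> `|f (x + u) - f x| <= e.
Proof.
move=> cf e e0.
have e20 : 0 < e / 2 by rewrite divr_gt0.
have := (@compact_near_coveringP R^o `[a, b]%classic).1 (@segment_compact R a b) R (0^'+)
  (fun d x => forall u, `|u| <= d -> `|f (x + u) - f x| <= e).
case=> [x _|d /= d0 hd].
  have := cf x; move/cvgrPdist_le => /(_ _ e20)[r /= r0 hr].
  have r20 : 0 < r / 2 by rewrite divr_gt0.
  exists ([set y | `|x - y| < r / 2], [set d : R | d < r / 2]) => /=.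
    split; first by exists (r / 2).
    by apply: nbhs_right_lt.
  move=> [y d] /= [hy hd] u ud.
  have h1 := hr y _; have h2 := hr (y + u) _.
  have := ler_normD (f (y + u) - f x) (f x - f y).
  rewrite addrA subrK => /le_trans; apply.
  rewrite distrC [leRHS]splitr lerD//.
    apply: h2; rewrite /ball_ /= opprD addrA (le_lt_trans (ler_normB _ _))//.
    by rewrite [ltRHS]splitr ltrD// (le_lt_trans ud).
  have h3 : `|x - y| < r by lra.
  exact: h1 h3.
have d20 : 0 < d / 2 by rewrite divr_gt0.
exists (d / 2) => // x u xab ud.
apply: (hd (d / 2) _ d20 x) => //=.
- by rewrite sub0r normrN gtr0_norm// ltr_pdivrMr// ltr_pMr// ltr1n.
Qed.

Definition supp L f := forall x, L < `|x| -> f x = 0.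

Lemma suppMl L f g : supp L f -> supp L (fun x => f x * g x).
Proof. by move=> sf x /sf ->; rewrite mul0r. Qed.

Lemma int_supp0 L f a b : supp L f -> (forall x, a <= x <= b -> L <= `|x|) ->
  continuous f -> int a b f = 0.
Proof.
move=> sf h cf.
have [ab|ab] := ltP b a.
  by rewrite /int set_itv_ge ?Rintegral_set0// bnd_simp -ltNge.
rewrite (@eq_int _ f (fun=> 0))//; last first.
  (* At |x| = L the support condition is silent; there the value is 0 by continuity from outside. *)
  move=> x xab; have := h x xab; rewrite le_eqVlt => /predU1P[Lx|]; last exact: sf.
  have [a' [b' h1]] : exists a' b', a' = 0 :> R /\ b' = 0 :> R by exists 0, 0.
  have h2 : forall e, 0 < e -> `|f x| <= e.
    move=> e e0.
    have := cf x; move/cvgrPdist_le => /(_ _ e0)[r /= r0 hr].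
    have r20 : 0 < r / 2 by rewrite divr_gt0.
    have r2r : r / 2 < r by rewrite ltr_pdivrMr// ltr_pMr// ltr1n.
    have [x0|x0] := leP 0 x.
      have := hr (x + r / 2); rewrite /ball_ /= opprD addNKr normrN gtr0_norm// => /(_ r2r).
      by rewrite (sf (x + r / 2)) ?subr0// Lx !ger0_norm// ?addr_ge0 ?(ltW r20)// ltrDl.
    have := hr (x - r / 2); rewrite /ball_ /= opprB addrC subrK gtr0_norm// => /(_ r2r).
    rewrite (sf (x - r / 2)) ?subr0// Lx !ltr0_norm//; lra.
  by apply/eqP; rewrite -normr_eq0 eq_le normr_ge0 andbT; apply/ler_addgt0Pl => e e0; rewrite addr0 h2.
by rewrite int_cst// mul0r.
Qed.

Lemma int_supp L f a b T : continuous f -> supp L f -> 0 <= L -> a <= - L -> L <= b -> L <= T ->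
  int a b f = int (- T) T f.
Proof.
move=> cf sf L0 aL Lb LT.
have h c d : c <= - L -> L <= d -> int c d f = int (- L) L f.
  move=> h1 h2; rewrite (@int_cat _ _ c (- L) d)//; last lra.
  rewrite (@int_cat _ _ (- L) L d)//; last lra.
  rewrite (int_supp0 (a := c) (b := - L) sf)//; last first.
    by move=> x /andP[_ xL]; rewrite lerNr in xL; rewrite (le_trans xL)// -normrN ler_norm.
  rewrite (int_supp0 (a := L) (b := d) sf)//; first by rewrite add0r addr0.
  by move=> x /andP[Lx _]; rewrite (le_trans Lx)// ler_norm.
by rewrite !h//; lra.
Qed.

Lemma supp_int f L T : continuous f -> supp L f -> 0 <= L -> L <= T ->
  integr f /\ RI f = int (- T) T f.
Proof.
move=> cf sf L0 LT.
have fi : integr f.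
  have cn := cont_norm cf.
  have sn : supp L (fun x => `|f x|) by move=> x /sf ->; rewrite normr0.
  have [] := integr_bounded (c := int (- L) L (fun x => `|f x|)) cn (fun x => normr_ge0 _).
    move=> S S0; pose S' := Num.max S L.
    have LS : L <= S' by rewrite le_max lexx orbT.
    have SS : S <= S' by rewrite le_max lexx.
    rewrite -(@int_supp L _ (- S') S' L)//; try lra.
    rewrite (@int_cat _ _ (- S') (- S) S')//; try lra.
    rewrite (@int_cat _ _ (- S) S S')//; try lra.
    have : 0 <= int (- S') (- S) (fun x => `|f x|) by apply: int_ge0.
    have : 0 <= int S S' (fun x => `|f x|) by apply: int_ge0.
    lra.
  by move=> h _; apply: (integr_dom cf h).
split => //; apply/eqP; rewrite -subr_eq0 -normr_eq0 eq_le normr_ge0 andbT.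
apply/ler_addgt0Pl => e e0; rewrite addr0.
have [T0 [T00 h]] := RI_tail cf fi e0.
have := h (Num.max T0 T); rewrite le_max lexx => /(_ isT).
by rewrite (@int_supp L f _ _ T)//; rewrite ?lerN2 le_max ?LT ?orbT.
Qed.

Lemma supp_integr f L : continuous f -> supp L f -> 0 <= L -> integr f.
Proof. by move=> cf sf L0; exact: (supp_int cf sf L0 (lexx L)).1. Qed.

Lemma supp_L2c f L : continuous f -> supp L f -> 0 <= L -> L2c f.
Proof.
move=> cf sf L0; split => //; apply: (supp_integr (L := L)) => //; first exact: contX.
by move=> x /sf ->; rewrite expr0n.
Qed.

Lemma supp_bounded f L : continuous f -> supp L f -> exists M, forall x, `|f x| <= M.
Proof.
move=> cf sf.
have := @heine f (- L) L cf 1 ltr01.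
have [M [_ hM]] := compact_bounded (continuous_compact (cont_within (A := `[- L, L]%classic) cf) (@segment_compact R (- L) L)).
move=> _; exists (`|M| + 1) => x; have [xL|xL] := leP `|x| L.
  apply: hM; first by have := ler_norm M; lra.
  by exists x => //=; rewrite in_itv/= -ler_norml.
by rewrite sf// normr0 addr_ge0.
Qed.

Lemma int_opp f T : 0 <= T -> continuous f -> int (- T) T (fun x => f (- x)) = int (- T) T f.
Proof.
move=> T0 cf; have TT : - T <= T by lra.
have [F dF] := primitive_exists cf.
rewrite (FTC2 TT cf dF) (@FTC2 _ (fun x => - F (- x)) _ _ _ TT).
- by rewrite !opprK addrC.
- by move=> x; apply: continuous_comp; [exact: opp_continuous|exact: cf].
- move=> x; apply: der_eq (derN (der_comp (derN (der_id x)) (dF _))) _.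
  by rewrite mulrN1 opprK.
Qed.

Lemma RI_reflect_shift f L x : continuous f -> supp L f -> 0 <= L ->
  RI (fun y => f (x - y)) = RI f.
Proof.
move=> cf sf L0; have x0 := normr_ge0 x.
have cg : continuous (fun y => f (x - y)).
  by move=> y; apply: (@continuous_comp _ _ _ (fun y => x - y) f);
     [apply: contB; [exact: cont_cst|exact: cont_id]|exact: cf].
have sg : supp (L + `|x|) (fun y => f (x - y)).
  move=> y hy; apply: sf; have := ler_normB x (x - y).
  by rewrite opprB addrC subrK; lra.
have LL : 0 <= L + `|x| by lra.
rewrite (supp_int (T := L + `|x|) cg sg LL (lexx _)).2.
rewrite -int_opp//; under eq_fun do rewrite opprK addrC.
rewrite int_shift//; last lra.
rewrite (@int_supp L _ _ _ L)//.
- by rewrite -(supp_int cf sf L0 (lexx L)).2.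
- by have := ler_norm x; lra.
- by have := ler_norm (- x); rewrite normrN; lra.
Qed.

Definition chi (n x : R) : R := Num.max 0 (Num.min 1 (n + 1 - `|x|)).

Lemma chi_cont n : continuous (chi n).
Proof.
apply: (@lip_cont _ 1) => x y; rewrite mul1r /chi.
have := ler_normB x y; have := ler_norm (`|x| - `|y|); have := ler_dist_dist x y.
have := ler_norm (`|y| - `|x|); rewrite (distrC `|y|).
have := normr_ge0 (x - y).
move=> h1 h2 h3 h4 h5.
have E (s : R) : Num.max 0 (Num.min 1 s) = if 1 <= s then 1 else if 0 <= s then s else 0.
  case: (leP 1 s) => hs; first by case: leP => //; lra.
  by case: (leP 0 s).
rewrite !E ler_norml.
by case: ifP => k1; case: ifP => k2; try (case: ifP => k3); try (case: ifP => k4);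
  apply/andP; split; lra.
Qed.

Lemma chi_ge0 n x : 0 <= chi n x. Proof. by rewrite /chi le_max lexx. Qed.

Lemma chi_le1 n x : chi n x <= 1.
Proof. by rewrite /chi ge_max ler01/= ge_min lexx. Qed.

Lemma chi_even n : even (chi n). Proof. by move=> x; rewrite /chi normrN. Qed.

Lemma chi1 n x : `|x| <= n -> chi n x = 1.
Proof.
by move=> xn; rewrite /chi; case: (leP 1 (n + 1 - `|x|)) => hx; case: leP => h; lra.
Qed.

Lemma chi_supp n : supp (n + 1) (chi n).
Proof.
by move=> x nx; rewrite /chi; case: (leP 1 (n + 1 - `|x|)) => hx; case: leP => h; lra.
Qed.

(** Since (1 - chi)^2 <= 1 - chi^2 for 0 <= chi <= 1, the squared error is at most the integral of
    f^2 minus that of (chi f)^2, hence at most a tail of f^2. *)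
Lemma cvg_chi f : L2c f -> nrm (fun x => f x - chi n%:R x * f x) @[n --> \oo] --> 0.
Proof.
move=> hf; have [cf fi] := hf.
apply/cvgrPdist_le => e e0.
have e20 : 0 < e ^+ 2 by rewrite exprn_gt0.
have f20 x : 0 <= f x ^+ 2 by exact: sqr_ge0.
have [T0 [T00 hT]] := RI_tail_ge0 (contX (n := 2) cf) f20 fi e20.
near=> n; rewrite sub0r normrN ger0_norm ?nrm_ge0//.
apply: nrm_le; first exact: ltW.
have nT : T0 <= n%:R by near: n; exact: nbhs_infty_ger.
pose g x := f x - chi n%:R x * f x; pose k x := (chi n%:R x * f x) ^+ 2.
have ck : continuous (fun x => chi n%:R x * f x) by apply: contM => //; exact: chi_cont.
have sk : supp (n%:R + 1) (fun x => chi n%:R x * f x) by apply: suppMl; exact: chi_supp.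
have n0 : 0 <= n%:R :> R by exact: ler0n.
have lk : L2c (fun x => chi n%:R x * f x) by apply: supp_L2c ck sk _; lra.
have [_ ki] := lk.
have := hT _ nT.
have h1 : ip g g <= RI (fun x => f x ^+ 2 - k x).
  apply: le_RI; [exact: L2c_mul (L2cB hf lk) (L2cB hf lk)|exact: integrB|].
  move=> x; rewrite /g /k; have := chi_ge0 n%:R x; have := chi_le1 n%:R x.
  set c := chi _ _ => c1 c0.
  rewrite (_ : (f x - c * f x) * _ = f x ^+ 2 * (1 - c) ^+ 2); last by ring.
  rewrite (_ : f x ^+ 2 - _ = f x ^+ 2 * (1 - c ^+ 2)); last by ring.
  by apply: ler_wpM2l => //; nra.
have h2 : int (- n%:R) n%:R (fun x => f x ^+ 2) <= RI k.
  rewrite (@eq_int _ _ k) => [|x xn].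
    by apply: int_le_RI => //; [exact: contX|move=> x; exact: sqr_ge0].
  by rewrite /k chi1 ?mul1r// ler_norml.
rewrite RIB// in h1; lra.
Unshelve. all: by end_near. Qed.

End compact_support.

(** * Positivity of quadratic forms from Fourier symbols *)

Section multipliers.
Context {R : realType}.
Implicit Types (f g : R -> R) (T : (R -> R) -> R -> R) (s : R -> R) (r x z eta h : R).

(* Self-adjoint translation-invariant operators of finite range [r]; [s] is the
   Fourier symbol. *)
Record mult T s r : Prop := Mult {
  mult_r : 0 <= r;
  mult_cont : forall f, continuous f -> continuous (T f);
  mult_sub : forall f g, continuous f -> continuous g ->
    T (fun x => f x - g x) = fun x => T f x - T g x;
  mult_L2 : forall f, L2c f -> L2c (T f) /\ nrm (T f) <= 2 * nrm f;
  mult_even : forall f, continuous f -> even f -> even (T f);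
  mult_adj : forall f g, L2c f -> L2c g -> ip (T f) g = ip f (T g);
  mult_loc : forall f g x, continuous f -> continuous g ->
    (forall y, `|y - x| <= r -> f y = g y) -> T f x = T g x;
  mult_cos : forall z x, T (fun x => cos (z * x)) x = s z * cos (z * x) }.

Lemma mult_id : mult id (fun=> 1) 0.
Proof.
split=> //.
- by move=> f hf; split => //; have := nrm_ge0 f; lra.
- by move=> f g x _ _; apply; rewrite subrr normr0.
- by move=> z x; rewrite mul1r.
Qed.

Lemma A_loc eta f g x : (forall y, `|y - x| <= `|eta| -> f y = g y) -> A eta f x = A eta g x.
Proof.
move=> fg; apply: eq_int => s /andP[s0 s1]; apply: fg.
rewrite addrAC subrr add0r normrM ler_piMr//.
by rewrite ler_norml; apply/andP; split; lra.
Qed.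

Lemma mult_A eta : mult (A eta) (fun z => sinc (eta * z / 2)) `|eta|.
Proof.
split=> //.
- by move=> f; exact: A_cont.
- by move=> f g; exact: AB.
- by move=> f hf; split; [exact: L2c_A|have := nrm_A eta hf; have := nrm_ge0 f; lra].
- by move=> f; exact: A_even.
- by move=> f g; exact: A_adj.
- by move=> f g x _ _; exact: A_loc.
- by move=> z x; exact: A_cos.
Qed.

Lemma mult_IA eta : mult (fun f x => f x - A eta f x) (fun z => 1 - sinc (eta * z / 2)) `|eta|.
Proof.
split=> //.
- by move=> f cf; apply: contB => //; exact: A_cont.
- by move=> f g cf cg; apply/funext => x; rewrite AB//; ring.
- move=> f hf; split; first by apply: L2cB => //; exact: L2c_A.
  by have := nrmB hf (L2c_A eta hf); have := nrm_A eta hf; lra.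
- by move=> f cf ef x; rewrite A_even// ef.
- by move=> f g hf hg; rewrite ipBl ?ipBr ?A_adj//; exact: L2c_A.
- move=> f g x _ _ fg; rewrite (A_loc fg) fg// subrr normr0; exact: normr_ge0.
- by move=> z x; rewrite A_cos; ring.
Qed.

Definition avg2 h f x : R := 2^-1 * (f (x + h) + f (x - h)).

Lemma mult_avg2 h : mult (avg2 h) (fun z => cos (h * z)) `|h|.
Proof.
rewrite /avg2; split=> //.
- by move=> f cf; apply: contZ; apply: contD; exact: cont_shift.
- by move=> f g cf cg; apply/funext => x; ring.
- move=> f hf; have h1 := L2c_shift h hf; have h2 := L2c_shift (- h) hf.
  split; first by apply: L2cZ; exact: L2cD.
  rewrite nrmZ; last exact: L2cD.
  have := nrmD h1 h2; rewrite !nrm_shift// ger0_norm ?invr_ge0//.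
  by have := nrm_ge0 f; lra.
- move=> f cf ef x; rewrite -(ef (- x + h)) -(ef (- x - h)) !opprD !opprK addrC.
  by congr (_ * _); rewrite addrC.
- move=> f g hf hg; have h1 := L2c_shift h hf; have h2 := L2c_shift (- h) hf.
  have h3 := L2c_shift h hg; have h4 := L2c_shift (- h) hg.
  rewrite ipZl ?ipZr//; try exact: L2cD.
  rewrite ipDl// ipDr// ip_shift_adj// (ip_shift_adj (- h))//.
  by under [X in _ = _ * (_ + ip X _)]eq_fun do rewrite opprK; rewrite addrC.
- move=> f g x _ _ fg; congr (_ * (_ + _)); apply: fg.
    by rewrite addrAC subrr add0r.
  by rewrite addrAC subrr add0r normrN.
- move=> z x; rewrite !mulrDr mulrN cosD cosD cosN sinN mulrC [z * h]mulrC.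
  by lra.
Qed.

(** T 0 = 0 is [mult_sub] with equal arguments; the finite range then allows f to be replaced by 0
    near x. *)
Lemma mult_supp T s r L f : mult T s r -> continuous f -> supp L f -> supp (L + r) (T f).
Proof.
move=> mT cf sf x hx.
rewrite (@mult_loc _ _ _ mT f (fun x => f x - f x)) //.
- by rewrite (mult_sub mT)// subrr.
- exact: contB.
- move=> y hy; rewrite subrr; apply: sf.
  by have := ler_normD (x - y) y; rewrite subrK distrC; lra.
Qed.

Definition ft f z : R := RI (fun x => f x * cos (z * x)).

Lemma cos_lip (x y : R) : `|cos x - cos y| <= `|x - y|.
Proof.
wlog xy : x y / y <= x => [H|].
  have [h|h] := leP y x; first exact: H.
  by rewrite distrC [leRHS]distrC; apply: H; exact: ltW.
have [c _ ->] := der_mvt xy (fun x => is_derive_cos x).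
by rewrite normrM ler_piMl// normrN sin_max.
Qed.

Lemma ft_lip f L z z' : continuous f -> supp L f -> 0 <= L ->
  `|ft f z - ft f z'| <= (L * RI (fun x => `|f x|)) * `|z - z'|.
Proof.
move=> cf sf L0.
have cfz y : continuous (fun x => f x * cos (y * x)) by apply: contM => //; exact: cont_cosZ.
have ifz y : integr (fun x => f x * cos (y * x)).
  by apply: supp_integr (cfz y) _ L0; exact: suppMl.
have cn := cont_norm cf.
have ni : integr (fun x => `|f x|).
  by apply: supp_integr cn _ L0 => x /sf ->; rewrite normr0.
rewrite /ft -RIB//; apply: le_trans (abs_RI (integrB (ifz z) (ifz z'))) _.
have -> : (L * RI (fun x => `|f x|)) * `|z - z'| = RI (fun x => (L * `|z - z'|) * `|f x|).
  by rewrite RIZ//; ring.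
apply: le_RI; [exact: integr_norm (integrB (ifz z) (ifz z'))|exact: integrZ|].
move=> x; rewrite -mulrBr normrM.
have [xL|xL] := leP `|x| L; last by rewrite sf// normr0 mul0r mulr0.
rewrite mulrC; apply: ler_wpM2r => //.
apply: le_trans (cos_lip _ _) _; rewrite -mulrBl normrM mulrC.
by apply: ler_wpM2r.
Qed.

Lemma ft_cont f L : continuous f -> supp L f -> 0 <= L -> continuous (ft f).
Proof. by move=> cf sf L0; apply: lip_cont => z z'; exact: ft_lip cf sf L0. Qed.

Lemma ft_mult T s r L f z : mult T s r -> continuous f -> supp L f -> 0 <= L ->
  ft (T f) z = s z * ft f z.
Proof.
move=> mT cf sf L0; have r0 := mult_r mT.
(* The cosine is not square-integrable, so self-adjointness is applied to its cutoff at radius L +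
   r; because of the finite range the cutoff is invisible on the support of f. *)
pose N := L + r; pose k x := chi N x * cos (z * x).
have ck : continuous k by apply: contM; [exact: chi_cont|exact: cont_cosZ].
have N0 : 0 <= N + 1 by rewrite /N; lra.
have sk : supp (N + 1) k by apply: suppMl; exact: chi_supp.
have hk := supp_L2c ck sk N0.
have hf := supp_L2c cf sf L0.
have e1 : ft (T f) z = ip (T f) k.
  congr RI; apply/funext => x; rewrite /k; have [xN|xN] := leP `|x| N.
    by rewrite chi1// mul1r.
  by rewrite (mult_supp mT cf sf)// !mul0r.
rewrite e1 (mult_adj mT)// /ft -RIZ; last first.
  apply: supp_integr (suppMl _ sf) L0.
  by apply: contM => //; exact: cont_cosZ.
congr RI; apply/funext => x; have [xL|xL] := leP `|x| L; last by rewrite sf// !mul0r mulr0.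
rewrite mulrCA; congr (_ * _); rewrite -(mult_cos mT).
apply: (mult_loc mT) => //; first exact: cont_cosZ.
move=> y hy; rewrite /k chi1 ?mul1r// /N.
by have := ler_normD (y - x) x; rewrite subrK; lra.
Qed.

End multipliers.

(** * Fejer means of the cosine transform *)

Section fejer.
Context {R : realType}.
Implicit Types (f g m : R -> R) (N L C x u z e : R).

Lemma osc_cont N m C : 0 <= N -> continuous m -> (forall z, 0 <= z <= N -> `|m z| <= C) ->
  continuous (fun x => int 0 N (fun z => m z * cos (z * x))).
Proof.
move=> N0 cm mC; apply: (@lip_cont _ _ (C * N * N)) => x y.
have c w : continuous (fun z => m z * cos (z * w)).
  by apply: contM => //; under eq_fun do rewrite mulrC; exact: cont_cosZ.
rewrite -intB//; apply: le_trans (abs_int_le (c := C * N * `|x - y|) N0 _ _) _.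
- exact: contB.
- move=> z z0N; rewrite -mulrBr normrM -mulrA; apply: ler_pM => //; first exact: mC.
  apply: le_trans (cos_lip _ _) _; rewrite -mulrBr normrM ler_wpM2r//.
  by case/andP: z0N => z0 zN; rewrite ger0_norm.
- by rewrite subr0; lra.
Qed.

Lemma osc_fubini N g m L C : 0 <= N -> continuous m ->
  (forall z, 0 <= z <= N -> `|m z| <= C) ->
  continuous g -> supp L g -> 0 <= L ->
  int 0 N (fun z => m z * ft g z) =
  RI (fun x => g x * int 0 N (fun z => m z * cos (z * x))).
Proof.
move=> N0 cm mC cg sg L0.
pose h x z := g x * (m z * cos (z * x)).
have cmz x : continuous (fun z => m z * cos (z * x)).
  by apply: contM => //; under eq_fun do rewrite mulrC; exact: cont_cosZ.
have cgz z : continuous (fun x => g x * cos (z * x)) by apply: contM => //; exact: cont_cosZ.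
have igz z : integr (fun x => g x * cos (z * x)).
  by apply: supp_integr (cgz z) _ L0; exact: suppMl.
have hE z : (fun x => h x z) = (fun x => m z * (g x * cos (z * x))).
  by apply/funext => x; rewrite /h mulrCA.
have hI x : int 0 N (h x) = g x * int 0 N (fun z => m z * cos (z * x)).
  by rewrite /h intZ.
have E1 : (fun x => g x * int 0 N (fun z => m z * cos (z * x))) = (fun x => int 0 N (h x)).
  by apply/funext => x; rewrite hI.
rewrite E1 (@fubini_line _ h 0 N (C * RI (fun x => `|g x|)) N0).
- by apply: eq_int => z _; rewrite hE RIZ.
- apply: measurable_funM; first by apply: measurableT_comp => //; exact: cont_meas.
  apply: measurable_funM; first by apply: measurableT_comp => //; exact: cont_meas.
  apply: (measurableT_comp (cont_meas (@continuous_cos R))).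
  by apply: measurable_funM; [exact: measurable_snd|exact: measurable_fst].
- by move=> x; apply: contZ.
- by move=> z _; rewrite hE; exact: integrZ.
- move=> z z0N; have cn := cont_norm cg.
  have ni : integr (fun x => `|g x|).
    by apply: supp_integr cn _ L0 => x /sg ->; rewrite normr0.
  rewrite -RIZ//; apply: le_RI; [|exact: integrZ|].
    by apply: integr_norm; rewrite hE; exact: integrZ.
  move=> x; rewrite /h normrM mulrC; apply: ler_wpM2r => //.
  rewrite normrM -[C]mulr1; apply: ler_pM => //; [exact: mC|exact: cos_max].
- rewrite -E1; apply: supp_integr (suppMl _ sg) L0.
  by apply: contM => //; apply: osc_cont mC.
Qed.

(** The Fejer kernel, unnormalised: for u != 0 it equals (1 - cos (N u)) / (N u^2), which is
    nonnegative and at most 2 / (N u^2). *)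
Definition kap N u : R := int 0 N (fun z => (1 - z / N) * cos (z * u)).

Lemma cont_wt N : continuous (fun z => 1 - z / N).
Proof.
apply: contB; first exact: cont_cst.
by under eq_fun do rewrite mulrC; apply: contZ; exact: cont_id.
Qed.

Lemma wt_bound N z : 0 < N -> 0 <= z <= N -> 0 <= 1 - z / N <= 1.
Proof.
move=> N0 /andP[z0 zN]; have h1 : z / N <= 1 by rewrite ler_pdivrMr// mul1r.
have h2 : 0 <= z / N by rewrite divr_ge0// ltW.
by apply/andP; split; lra.
Qed.

Lemma kap_closed N u : 0 < N -> u != 0 -> kap N u = (1 - cos (N * u)) / (N * u ^+ 2).
Proof.
move=> N0 u0; have N1 : N != 0 by rewrite gt_eqF.
pose F z := u^-1 * ((1 - N^-1 * z) * sin (u * z)) - (N * u ^+ 2)^-1 * cos (u * z).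
have dF z : der F z ((1 - z / N) * cos (z * u)).
  have d1 : der (fun z => 1 - N^-1 * z) z (0 - N^-1 * 1).
    by apply: derB; [exact: der_cst|apply: derZ; exact: der_id].
  have d2 := der_scale (c := u) (is_derive_sin (u * z)).
  have d3 := der_scale (c := u) (is_derive_cos (u * z)).
  apply: der_eq (derB (derZ u^-1 (derM d1 d2)) (derZ (N * u ^+ 2)^-1 d3)) _.
  by rewrite (mulrC z u); field; rewrite u0 N1.
have cw : continuous (fun z => (1 - z / N) * cos (z * u)).
  by apply: contM; [exact: cont_wt|under eq_fun do rewrite mulrC; exact: cont_cosZ].
rewrite /kap (FTC2 (ltW N0) cw dF) /F /= !mulr0 sin0 cos0 mulVf// subrr (mulrC u N).
by field; rewrite u0 N1.
Qed.

Lemma kap_ge0 N u : 0 < N -> 0 <= kap N u.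
Proof.
move=> N0; have [->|u0] := eqVneq u 0.
  apply: int_ge0 => z zN; rewrite mulr0 cos0 mulr1.
  by have /andP[] := wt_bound N0 zN.
rewrite kap_closed//; apply: divr_ge0; first by have := cos_le1 (N * u); lra.
by rewrite mulr_ge0 ?sqr_ge0// ltW.
Qed.

Lemma kap_le N u d : 0 < N -> 0 < d -> d <= `|u| -> kap N u <= 2 / (N * d ^+ 2).
Proof.
move=> N0 d0 du; have u0 : u != 0 by rewrite -normr_gt0 (lt_le_trans d0).
rewrite kap_closed// -[u ^+ 2]real_normK ?num_real//.
have h : N * d ^+ 2 <= N * `|u| ^+ 2.
  by rewrite ler_pM2l// lerXn2r// ?nnegrE ?(ltW d0).
have p : 0 < N * d ^+ 2 by rewrite mulr_gt0// exprn_gt0.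
apply: ler_pM.
- by have := cos_le1 (N * u); lra.
- by rewrite invr_ge0 (le_trans _ h)// ltW.
- by have := cos_geN1 (N * u); lra.
- by rewrite lef_pV2// posrE// (lt_le_trans p).
Qed.

Lemma kap_cont N : 0 < N -> continuous (kap N).
Proof.
move=> N0; apply: (@osc_cont N (fun z => 1 - z / N) 1); first exact: ltW.
- exact: cont_wt.
- by move=> z /(wt_bound N0) /andP[h1 h2]; rewrite ger0_norm.
Qed.

(** On this range |z u| <= 1/2 for z <= N, so the cosine is at least 1/2, and the weight 1 - z / N
    integrates to N / 2. *)
Lemma kap_lower N u : 0 < N -> `|u| <= (2 * N)^-1 -> N / 4 <= kap N u.
Proof.
move=> N0 uN.
pose F z := 2^-1 * (z - (2 * N)^-1 * z ^+ 2).
have dF z : der F z (2^-1 * (1 - z / N)).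
  apply: der_eq (derZ _ (derB (der_id z) (derZ _ (derX 1 (der_id z))))) _.
  by field; rewrite gt_eqF.
have cw : continuous (fun z => 2^-1 * (1 - z / N)) by apply: contZ; exact: cont_wt.
have -> : N / 4 = int 0 N (fun z => 2^-1 * (1 - z / N)).
  by rewrite (FTC2 (ltW N0) cw dF) /F; field; rewrite gt_eqF.
apply: le_int => //.
  by apply: contM; [exact: cont_wt|under eq_fun do rewrite mulrC; exact: cont_cosZ].
move=> z zN; have /andP[w0 w1] := wt_bound N0 zN; case/andP: zN => z0 zN.
rewrite mulrC; apply: ler_wpM2l => //.
have := cos_lip (z * u) 0; rewrite cos0 subr0 normrM (ger0_norm z0).
have : z * `|u| <= 2^-1.
  apply: (@le_trans _ _ (N * (2 * N)^-1)); first by apply: ler_pM.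
  by rewrite invfM mulrCA mulfV ?mulr1// gt_eqF.
by have := ler_norm (1 - cos (z * u)); rewrite distrC; lra.
Qed.

(** The normalising constant is the mass on [-1, 1], since the remaining mass is O(1/N) by
    [kap_le]. *)
Definition kmass N : R := int (-1) 1 (kap N).

Lemma kmass_lower N : 1 <= N -> 1 / 4 <= kmass N.
Proof.
move=> N1; have N0 : 0 < N by lra.
pose d := (2 * N)^-1; have d0 : 0 < d by rewrite invr_gt0 mulr_gt0.
have d1 : d <= 1 by rewrite invf_le1 ?mulr_gt0//; lra.
have ck := kap_cont N0.
have h0 a b : 0 <= int a b (kap N) by apply: int_ge0 => x _; exact: kap_ge0.
rewrite /kmass (@int_cat _ _ (-1) (- d) 1)//; try lra.
rewrite (@int_cat _ _ (- d) d 1)//; try lra.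
have := h0 (-1) (- d); have := h0 d 1.
have : N / 4 * (d - (- d)) <= int (- d) d (kap N).
  rewrite -int_cst; last lra.
  apply: le_int => // [|x xd]; first exact: cont_cst.
  by apply: kap_lower => //; rewrite ler_norml.
rewrite (_ : N / 4 * (d - - d) = 1 / 4); first lra.
by rewrite /d; field; rewrite gt_eqF.
Qed.

(** After the substitution u = x - y the integral is split at |u| = d' and |u| = 1. Below d' uniform
    continuity gives e; between d' and 1 the kernel is at most 2 / (N d'^2); beyond 1 it is at most
    2 / N on a bounded interval. *)
Lemma kap_approx f L : continuous f -> supp L f -> 0 <= L ->
  forall e, 0 < e -> exists K, forall N x, 1 <= N -> `|x| <= L ->
  `|RI (fun y => f y * kap N (x - y)) - kmass N * f x| <= e * kmass N + K / N.
Proof.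
move=> cf sf L0 e e0.
have [M hM] := supp_bounded cf sf.
have M0 : 0 <= M by apply: le_trans (hM 0).
have [d d0 hd] := @heine _ f (- L) L cf e e0.
pose d' := Num.min d 1; have d'0 : 0 < d' by rewrite lt_min d0 ltr01.
have d'd : d' <= d by rewrite ge_min lexx.
have d'1 : d' <= 1 by rewrite ge_min lexx orbT.
pose B := 2 * L + 1.
exists (8 * M / d' ^+ 2 + 4 * M * (B - 1)) => N x N1 xL.
have N0 : 0 < N by lra.
have ck := kap_cont N0.
have cs : continuous (fun u => f (x - u)).
  by move=> u; apply: (@continuous_comp _ _ _ (fun u => x - u) f);
     [apply: contB; [exact: cont_cst|exact: cont_id]|exact: cf].
have c1 : continuous (fun u => f (x - u) * kap N u) by exact: contM.
have c2 : continuous (fun y => f y * kap N (x - y)).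
  apply: contM => //.
  by move=> u; apply: (@continuous_comp _ _ _ (fun u => x - u) (kap N));
     [apply: contB; [exact: cont_cst|exact: cont_id]|exact: ck].
have -> : RI (fun y => f y * kap N (x - y)) = RI (fun u => f (x - u) * kap N u).
  rewrite -(RI_reflect_shift x c2 (suppMl _ sf) L0); congr RI; apply/funext => y.
  by rewrite subKr.
have s1 : supp (2 * L) (fun u => f (x - u) * kap N u).
  apply: suppMl => u hu; apply: sf; have := ler_normB x (x - u).
  by rewrite opprB addrC subrK; lra.
rewrite (supp_int (T := B) c1 s1 _ _).2 ?/B; try lra.
rewrite -/B; have B1 : 1 <= B by rewrite /B; lra.
rewrite (@int_cat _ _ (- B) (-1) B)//; try lra.
rewrite (@int_cat _ _ (-1) 1 B)//; try lra.
have out a b : a <= b -> (forall u, a <= u <= b -> 1 <= `|u|) ->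
    `|int a b (fun u => f (x - u) * kap N u)| <= (M * (2 / N)) * (b - a).
  move=> ab hu; apply: abs_int_le => // u uab; rewrite normrM ler_pM//.
  rewrite ger0_norm ?kap_ge0//; have := kap_le N0 ltr01 (hu u uab).
  by rewrite expr1n mulr1.
have o1 := out (- B) (-1); have o2 := out 1 B.
have {}o1 : `|int (- B) (-1) (fun u => f (x - u) * kap N u)| <= (M * (2 / N)) * (-1 - - B).
  by apply: o1 => [|u /andP[_ h]]; [lra|have := ler_norm (- u); rewrite normrN; lra].
have {}o2 : `|int 1 B (fun u => f (x - u) * kap N u)| <= (M * (2 / N)) * (B - 1).
  by apply: o2 => [|u /andP[h _]]; [lra|have := ler_norm u; lra].
have mid : `|int (-1) 1 (fun u => f (x - u) * kap N u) - kmass N * f x| <=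
    e * kmass N + 8 * M / (N * d' ^+ 2).
  have -> : kmass N * f x = int (-1) 1 (fun u => f x * kap N u) by rewrite intZ// mulrC.
  rewrite -intB//; last exact: contZ.
  have c3 : continuous (fun u => f (x - u) * kap N u - f x * kap N u).
    by apply: contB => //; exact: contZ.
  apply: le_trans (abs_int _ _ c3) _.
  have c4 := contZ (c := e) ck.
  have -> : e * kmass N + 8 * M / (N * d' ^+ 2) =
      int (-1) 1 (fun u => e * kap N u + 4 * M / (N * d' ^+ 2)).
    rewrite intD//; last exact: cont_cst.
    rewrite intZ// int_cst; last lra.
    by rewrite /kmass; congr (_ + _); ring.
  apply: le_int; first exact: cont_norm.
    by apply: contD => //; exact: cont_cst.
  move=> u _; rewrite -mulrBl normrM (ger0_norm (kap_ge0 u N0)).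
  have k0 := kap_ge0 u N0.
  have q0 : 0 <= 4 * M / (N * d' ^+ 2).
    by rewrite divr_ge0 ?mulr_ge0 ?sqr_ge0// ltW.
  have [ud|ud] := leP `|u| d'.
    have h : `|f (x - u) - f x| <= e.
      by apply: hd; [rewrite -ler_norml|rewrite normrN (le_trans ud)].
    by apply: (le_trans (ler_wpM2r k0 h)); lra.
  have h : `|f (x - u) - f x| <= 2 * M.
    by have := ler_normB (f (x - u)) (f x); have := hM (x - u); have := hM x; lra.
  have h2 := kap_le N0 d'0 (ltW ud).
  have : `|f (x - u) - f x| * kap N u <= 2 * M * (2 / (N * d' ^+ 2)).
    by apply: ler_pM.
  have : 0 <= e * kap N u by rewrite mulr_ge0// ltW.
  rewrite (_ : 2 * M * (2 / (N * d' ^+ 2)) = 4 * M / (N * d' ^+ 2)); first lra.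
  by ring.
set i1 := int (- B) _ _; set i2 := int (-1) 1 _; set i3 := int 1 B _.
rewrite -/i1 in o1; rewrite -/i2 in mid; rewrite -/i3 in o2.
have -> : i1 + (i2 + i3) - kmass N * f x = i1 + i3 + (i2 - kmass N * f x) by ring.
have -> : (8 * M / d' ^+ 2 + 4 * M * (B - 1)) / N =
  8 * M / (N * d' ^+ 2) + M * (2 / N) * (-1 - - B) + M * (2 / N) * (B - 1).
  by field; rewrite !gt_eqF.
have := ler_normD (i1 + i3) (i2 - kmass N * f x).
have := ler_normD i1 i3; lra.
Qed.

Definition Phi N f g : R := int 0 N (fun z => (1 - z / N) * (ft f z * ft g z)).

Lemma ft_bound f L z : continuous f -> supp L f -> 0 <= L -> `|ft f z| <= RI (fun x => `|f x|).
Proof.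
move=> cf sf L0.
have cz : continuous (fun x => f x * cos (z * x)) by apply: contM => //; exact: cont_cosZ.
have iz : integr (fun x => f x * cos (z * x)).
  by apply: supp_integr cz _ L0; exact: suppMl.
apply: (le_trans (abs_RI iz)); apply: le_RI; first exact: integr_norm.
  by apply: supp_integr (cont_norm cf) _ L0 => x /sf ->; rewrite normr0.
by move=> x; rewrite normrM ler_piMr// cos_max.
Qed.

(** The product of the transforms is a double integral of cos (z x) cos (z y). Evenness of f merges
    the resulting terms in x - y and x + y, which leaves a convolution with [kap]. *)
Lemma PhiE f g L N : continuous f -> supp L f -> even f -> continuous g -> supp L g ->
  0 <= L -> 0 < N ->
  continuous (fun x => RI (fun y => f y * kap N (x - y))) /\
  Phi N f g = RI (fun x => g x * RI (fun y => f y * kap N (x - y))).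
Proof.
move=> cf sf ef cg sg L0 N0.
pose m z := (1 - z / N) * ft f z.
have cm : continuous m by apply: contM; [exact: cont_wt|exact: ft_cont cf sf L0].
have mC z : 0 <= z <= N -> `|m z| <= RI (fun x => `|f x|).
  move=> /(wt_bound N0) /andP[w0 w1]; rewrite normrM -[leRHS]mul1r ler_pM//.
    by rewrite ger0_norm.
  exact: ft_bound cf sf L0.
have E x : int 0 N (fun z => m z * cos (z * x)) = RI (fun y => f y * kap N (x - y)).
  pose m' z := (1 - z / N) * cos (z * x).
  have cc y : continuous (fun z => cos (z * y)).
    by under eq_fun do rewrite mulrC; exact: cont_cosZ.
  have cm' : continuous m' by apply: contM; [exact: cont_wt|].
  have m'C z : 0 <= z <= N -> `|m' z| <= 1.
    move=> /(wt_bound N0) /andP[w0 w1]; rewrite normrM -[leRHS]mul1r ler_pM//.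
      by rewrite ger0_norm.
    exact: cos_max.
  rewrite (@eq_int _ _ (fun z => m' z * ft f z)); last by move=> z _; rewrite /m /m'; ring.
  rewrite (osc_fubini (ltW N0) cm' m'C cf sf L0).
  have kE y : int 0 N (fun z => m' z * cos (z * y)) = 2^-1 * (kap N (x - y) + kap N (x + y)).
    have ck v : continuous (fun z => (1 - z / N) * cos (z * v)).
      by apply: contM => //; exact: cont_wt.
    rewrite /kap -intD// -intZ; last exact: contD.
    apply: eq_int => z _; rewrite /m' (mulrBr z) (mulrDr z) !cosD sinN cosN.
    by field; rewrite gt_eqF.
  under eq_fun do rewrite kE.
  have ck := kap_cont N0.
  have cA : continuous (fun y => f y * kap N (x - y)).
    apply: contM => //.
    by move=> u; apply: (@continuous_comp _ _ _ (fun u => x - u) (kap N));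
       [apply: contB; [exact: cont_cst|exact: cont_id]|exact: ck].
  have cB : continuous (fun y => f y * kap N (x + y)).
    apply: contM => //; under eq_fun do rewrite addrC; exact: cont_shift.
  have iA := supp_integr cA (suppMl _ sf) L0.
  have iB := supp_integr cB (suppMl _ sf) L0.
  have eB : RI (fun y => f y * kap N (x + y)) = RI (fun y => f y * kap N (x - y)).
    rewrite -(RI_reflect_shift 0 cA (suppMl _ sf) L0); congr RI; apply/funext => y.
    by rewrite sub0r opprK ef.
  transitivity (2^-1 * (RI (fun y => f y * kap N (x - y)) + RI (fun y => f y * kap N (x + y)))).
    rewrite -RID// -RIZ; last exact: integrD.
    by congr RI; apply/funext => y; ring.
  by rewrite eB mulrDr ![2^-1 * _]mulrC -splitr.
split; first by under eq_fun do rewrite -E; exact: osc_cont (ltW N0) cm mC.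
rewrite /Phi (@eq_int _ _ (fun z => m z * ft g z)); last by move=> z _; rewrite /m; ring.
rewrite (osc_fubini (ltW N0) cm mC cg sg L0).
by congr RI; apply/funext => x; rewrite E.
Qed.

(** Parseval's identity in Fejer-summed form. On the support of g the approximation error is at most
    2 e1 [kmass], and e1 is chosen against the L^1 norm [G] of g. *)
Lemma Phi_cvg f g L : continuous f -> supp L f -> even f -> continuous g -> supp L g -> 0 <= L ->
  Phi n.+1%:R f g / kmass n.+1%:R @[n --> \oo] --> ip f g.
Proof.
move=> cf sf ef cg sg L0.
have cn := cont_norm cg.
have ni : integr (fun x => `|g x|).
  by apply: supp_integr cn _ L0 => x /sg ->; rewrite normr0.
set G := RI (fun x => `|g x|).
have G0 : 0 <= G by apply: RI_ge0.
apply/cvgrPdist_le => e e0.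
have [e1 e1E] : exists e1 : R, e1 = e / (2 * (G + 1)) by eexists.
have e10 : 0 < e1 by rewrite e1E divr_gt0// mulr_gt0//; lra.
have [K hK] := kap_approx cf sf L0 e10.
have K10 : 0 < 1 + `|K| by rewrite ltr_pwDl.
near=> n; have [N NE] : exists N : R, N = n.+1%:R by eexists.
rewrite -NE; have N1 : 1 <= N by rewrite NE ler1n.
have N0 : 0 < N by lra.
have NK : 4 * (1 + `|K|) / e1 <= N.
  have h : 4 * (1 + `|K|) / e1 <= n%:R by near: n; exact: nbhs_infty_ger.
  by rewrite NE -natr1; lra.
have c0 := kmass_lower N1; have cp : 0 < kmass N by lra.
have [cc ->] := PhiE cf sf ef cg sg L0 N0.
set k := fun x => RI _ in cc *.
have i1 : integr (fun x => g x * k x) by apply: supp_integr (suppMl _ sg) L0; exact: contM.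
have i2 : integr (fun x => kmass N * (f x * g x)).
  by apply: integrZ; apply: supp_integr (suppMl _ sf) L0; exact: contM.
have h : `|RI (fun x => g x * k x) - kmass N * ip f g| <= (2 * e1 * kmass N) * G.
  rewrite /ip -RIZ; last by apply: supp_integr (suppMl _ sf) L0; exact: contM.
  rewrite -RIB//; apply: le_trans (abs_RI (integrB i1 i2)) _.
  rewrite /G -RIZ//; apply: le_RI; [exact: integr_norm (integrB i1 i2)|exact: integrZ|].
  move=> x; have -> : g x * k x - kmass N * (f x * g x) = (k x - kmass N * f x) * g x by ring.
  rewrite normrM; have [xL|xL] := leP `|x| L; last by rewrite (sg x xL) normr0 !mulr0.
  apply: ler_wpM2r => //; apply: le_trans (hK N x N1 xL) _.
  have : K / N <= e1 / 4.
    rewrite ler_pdivrMr//; move: NK; rewrite ler_pdivrMr//.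
    have := ler_norm K; lra.
  have := ler_wpM2l (ltW e10) c0; lra.
have -> : ip f g - RI (fun x => g x * k x) / kmass N =
  - ((RI (fun x => g x * k x) - kmass N * ip f g) / kmass N).
  by field; rewrite gt_eqF.
rewrite normrN normrM normfV (gtr0_norm cp) ler_pdivrMr//; apply: (le_trans h).
rewrite mulrAC; apply: ler_wpM2r; first exact: ltW.
rewrite e1E (_ : 2 * (e / (2 * (G + 1))) * G = e * (G / (G + 1))); last by field; rewrite gt_eqF//; lra.
rewrite ler_piMr ?(ltW e0)// ler_pdivrMr; lra.
Unshelve. all: by end_near. Qed.

End fejer.

(** * From nonnegative symbols to nonnegative quadratic forms *)

Section positivity.
Context {R : realType}.
Implicit Types (f g p q : R -> R) (N L z : R).

(** A finite list of terms encodes a quadratic form in (p, q): each term carries a multiplier and a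
    symmetric 2 x 2 matrix with entries [t0], [t1], [t2]. The multiplier acts on both arguments, so
    its symbol enters [tsymb] squared. *)
Record term := Term { tT : (R -> R) -> R -> R; ts : R -> R; tr : R;
  tmult : mult tT ts tr; t0 : R; t1 : R; t2 : R }.

Implicit Types (t : term) (l : seq term).

Definition tform t p q : R :=
  t0 t * ip (tT t p) (tT t p) + 2 * t1 t * ip (tT t p) (tT t q) + t2 t * ip (tT t q) (tT t q).

Definition tsymb t z (x y : R) : R :=
  ts t z ^+ 2 * (t0 t * x ^+ 2 + 2 * t1 t * x * y + t2 t * y ^+ 2).

Definition tends (u : nat -> R) (a : R) : Prop := u n @[n --> \oo] --> a.

Lemma tendsD u v a b : tends u a -> tends v b -> tends (fun n => u n + v n) (a + b).
Proof. by move=> h1 h2; exact: (cvgD h1 h2). Qed.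

Lemma tendsM u v a b : tends u a -> tends v b -> tends (fun n => u n * v n) (a * b).
Proof. by move=> h1 h2; exact: (cvgM h1 h2). Qed.

Lemma tends_cst a : tends (fun=> a) a.
Proof. exact: cvg_cst. Qed.

Lemma tendsZ c u a : tends u a -> tends (fun n => c * u n) (c * a).
Proof. by move=> h; apply: tendsM => //; exact: tends_cst. Qed.

Lemma tendsB u v a b : tends u a -> tends v b -> tends (fun n => u n - v n) (a - b).
Proof. by move=> h1 h2; exact: (cvgB h1 h2). Qed.

Lemma tends_ge0 u a : (forall n, 0 <= u n) -> tends u a -> 0 <= a.
Proof. by move=> u0 h; apply: (cvgr_to_ge h); exact: nearW. Qed.

Lemma tends_sum (F : term -> nat -> R) (G : term -> R) l :
  (forall t, tends (F t) (G t)) ->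
  tends (fun n => \sum_(t <- l) F t n) (\sum_(t <- l) G t).
Proof.
move=> h; elim: l => [|t l IH].
  by rewrite big_nil; under eq_fun do rewrite big_nil; exact: tends_cst.
by rewrite big_cons; under eq_fun do rewrite big_cons; exact: tendsD.
Qed.

Lemma tends0_le u v : (forall n, `|v n| <= u n) -> tends u 0 -> tends v 0.
Proof.
move=> uv /cvgrPdist_le h; apply/cvgrPdist_le => e e0.
apply: filterS (h e e0) => n; rewrite !sub0r !normrN => /(le_trans _); apply.
exact: le_trans (uv n) (ler_norm _).
Qed.

Lemma int_sum (F : term -> R -> R) N l : (forall t, continuous (F t)) ->
  continuous (fun z => \sum_(t <- l) F t z) /\
  int 0 N (fun z => \sum_(t <- l) F t z) = \sum_(t <- l) int 0 N (F t).
Proof.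
move=> cF; elim: l => [|t l [c IH]].
  rewrite big_nil; split; first by under eq_fun do rewrite big_nil; exact: cont_cst.
  rewrite (@eq_int _ _ (fun z => 0 * 1)) => [|z _]; last by rewrite big_nil mul0r.
  by rewrite intZ ?mul0r//; exact: cont_cst.
have E : (fun z => \sum_(t <- t :: l) F t z) = (fun z => F t z + \sum_(t <- l) F t z).
  by apply/funext => z; rewrite big_cons.
by rewrite E big_cons -IH intD//; split=> //; exact: contD.
Qed.

(** For each N the Fejer mean of the form is the integral over z of a nonnegative weight times the
    total symbol at the pair of transforms of p and q. *)
Lemma positivity_supp l p q L : continuous p -> continuous q -> even p -> even q ->
  supp L p -> supp L q -> 0 <= L ->
  (forall z x y, 0 <= \sum_(t <- l) tsymb t z x y) ->
  0 <= \sum_(t <- l) tform t p q.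
Proof.
move=> cp cq ep eq sp sq L0 pos.
pose Y t n f g := Phi n.+1%:R (tT t f) (tT t g) / kmass n.+1%:R.
pose X t n := t0 t * Y t n p p + 2 * t1 t * Y t n p q + t2 t * Y t n q q.
have Lr t : 0 <= L + tr t by have := mult_r (tmult t); lra.
have cT t f : continuous f -> continuous (tT t f) by exact: mult_cont (tmult t) f.
have sT t f : continuous f -> supp L f -> supp (L + tr t) (tT t f).
  by move=> cf sf; exact: mult_supp (tmult t) cf sf.
have eT t f : continuous f -> even f -> even (tT t f) by exact: mult_even (tmult t) f.
have cX t : tends (X t) (tform t p q).
  have h f g : continuous f -> supp L f -> even f -> continuous g -> supp L g ->
      tends (fun n => Y t n f g) (ip (tT t f) (tT t g)).
    by move=> cf sf ef cg sg; apply: (@Phi_cvg _ _ _ (L + tr t)) => //;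
      [exact: cT|exact: sT|exact: eT|exact: cT|exact: sT].
  by apply: tendsD; [apply: tendsD|]; apply: tendsZ; exact: h.
apply: (tends_ge0 _ (tends_sum (l := l) cX)) => n.
have [N NE] : exists N : R, N = n.+1%:R by eexists.
have N1 : 1 <= N by rewrite NE ler1n.
have N0 : 0 < N by lra.
have c0 := kmass_lower N1.
pose F t z := t0 t * (ft (tT t p) z * ft (tT t p) z) + 2 * t1 t * (ft (tT t p) z * ft (tT t q) z)
  + t2 t * (ft (tT t q) z * ft (tT t q) z).
have cf t : continuous (ft (tT t p)) by apply: ft_cont (cT t _ cp) (sT t _ cp sp) (Lr t).
have cg t : continuous (ft (tT t q)) by apply: ft_cont (cT t _ cq) (sT t _ cq sq) (Lr t).
have cw := @cont_wt R N.
have k (f g : R -> R) : continuous f -> continuous g ->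
    continuous (fun z => (1 - z / N) * (f z * g z)).
  by move=> h1 h2; apply: contM => //; exact: contM.
have cF t : continuous (fun z => (1 - z / N) * F t z).
  by apply: contM => //; rewrite /F; apply: contD; [apply: contD|]; apply: contZ; exact: contM.
have IF t : X t n = (kmass N)^-1 * int 0 N (fun z => (1 - z / N) * F t z).
  rewrite (@eq_int _ _ (fun z => t0 t * ((1 - z / N) * (ft (tT t p) z * ft (tT t p) z)) +
    2 * t1 t * ((1 - z / N) * (ft (tT t p) z * ft (tT t q) z)) +
    t2 t * ((1 - z / N) * (ft (tT t q) z * ft (tT t q) z)))); last by move=> z _; rewrite /F; ring.
  have k1 := contZ (c := t0 t) (k _ _ (cf t) (cf t)).
  have k2 := contZ (c := 2 * t1 t) (k _ _ (cf t) (cg t)).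
  have k3 := contZ (c := t2 t) (k _ _ (cg t) (cg t)).
  rewrite intD//; last exact: contD.
  rewrite intD// !intZ; [|exact: k..].
  rewrite /X /Y -NE -/(Phi N (tT t p) (tT t p)) -/(Phi N (tT t p) (tT t q)) -/(Phi N (tT t q) (tT t q)).
  move: (Phi N (tT t p) (tT t p)) (Phi N (tT t p) (tT t q)) (Phi N (tT t q) (tT t q)) => a b c.
  by rewrite ![_ / kmass N]mulrC; ring.
rewrite (eq_bigr (fun t => (kmass N)^-1 * int 0 N (fun z => (1 - z / N) * F t z))); last by [].
rewrite -mulr_sumr -(int_sum N l cF).2; apply: mulr_ge0; first by rewrite invr_ge0; lra.
apply: int_ge0 => z /(wt_bound N0) /andP[w0 _].
rewrite -mulr_sumr; apply: mulr_ge0 => //.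
rewrite (eq_bigr (fun t => tsymb t z (ft p z) (ft q z))); first exact: pos.
move=> t _; rewrite /F /tsymb (ft_mult z (tmult t) cp sp L0) (ft_mult z (tmult t) cq sq L0); ring.
Qed.

Lemma tends_ip (u v : nat -> R -> R) f g : L2c f -> L2c g ->
  (forall n, L2c (u n)) -> (forall n, L2c (v n)) ->
  tends (fun n => nrm (fun x => f x - u n x)) 0 ->
  tends (fun n => nrm (fun x => g x - v n x)) 0 ->
  tends (fun n => ip (u n) (v n)) (ip f g).
Proof.
move=> hf hg hu hv fu gv.
pose a n := nrm (fun x => f x - u n x); pose b n := nrm (fun x => g x - v n x).
have h : tends (fun n => ip f g - ip (u n) (v n)) 0.
  apply: (@tends0_le (fun n => nrm f * b n + nrm g * a n + a n * b n)) => [n|].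
    have h1 := L2cB hf (hu n); have h2 := L2cB hg (hv n).
    have -> : ip f g - ip (u n) (v n) = ip f (fun x => g x - v n x) +
        ip g (fun x => f x - u n x) - ip (fun x => f x - u n x) (fun x => g x - v n x).
      by rewrite !ipBr// !ipBl// (ipC g f) (ipC g (u n)); ring.
    have := ip_le_nrm hf h2; have := ip_le_nrm hg h1; have := ip_le_nrm h1 h2.
    rewrite -/(a n) -/(b n).
    set A := ip f _; set B := ip g _; set D := ip _ _ => k1 k2 k3.
    have := ler_normB (A + B) D; have := ler_normD A B; lra.
  have := tendsD (tendsD (tendsZ (c := nrm f) gv) (tendsZ (c := nrm g) fu)) (tendsM fu gv).
  by rewrite !mulr0 !addr0.
have := tendsB (tends_cst (a := ip f g)) h; rewrite subr0.
by under eq_fun do rewrite subKr.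
Qed.

(** A density argument: truncation by [chi] preserves evenness, and multipliers are bounded on L^2,
    so the compactly supported case passes to the limit. *)
Theorem positivity l p q : L2c p -> L2c q -> even p -> even q ->
  (forall z x y, 0 <= \sum_(t <- l) tsymb t z x y) ->
  0 <= \sum_(t <- l) tform t p q.
Proof.
move=> hp hq ep eq pos.
pose cut f (n : nat) x := chi n%:R x * f x.
have cutS f n : supp (n%:R + 1) (cut f n) by apply: suppMl; exact: chi_supp.
have cutE f n : even f -> even (cut f n) by move=> ef x; rewrite /cut chi_even ef.
have cutC f n : L2c f -> continuous (cut f n).
  by move=> [cf _]; apply: contM => //; exact: chi_cont.
have n1 (n : nat) : 0 <= n%:R + 1 :> R by have := ler0n R n; lra.
have cutL f n : L2c f -> L2c (cut f n).
  by move=> hf; exact: supp_L2c (cutC f n hf) (cutS f n) (n1 n).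
have T2 t f : L2c f -> L2c (tT t f) by move=> hf; exact: (mult_L2 (tmult t) hf).1.
have cvT t f : L2c f -> tends (fun n => nrm (fun x => tT t f x - tT t (cut f n) x)) 0.
  move=> hf; apply: (@tends0_le (fun n => 2 * nrm (fun x => f x - cut f n x))) => [n|].
    rewrite ger0_norm ?nrm_ge0//.
    have [cf _] := hf; rewrite -(mult_sub (tmult t) cf (cutC f n hf)).
    exact: (mult_L2 (tmult t) (L2cB hf (cutL f n hf))).2.
  by have := tendsZ (c := 2) (cvg_chi hf); rewrite mulr0.
have cX t : tends (fun n => tform t (cut p n) (cut q n)) (tform t p q).
  by apply: tendsD; [apply: tendsD|]; apply: tendsZ; apply: tends_ip; auto.
apply: (tends_ge0 _ (tends_sum (l := l) cX)) => n.
by apply: (@positivity_supp l _ _ (n%:R + 1)); auto.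
Qed.

End positivity.

(** * The homoclinic profile and its Poeschl-Teller operator *)

Section solitary_wave.
Context {R : realType}.
Variables (d1 d2 : R).
Hypotheses (d1_gt0 : 0 < d1) (d2_neq0 : d2 != 0).
Implicit Types (x y T : R).

Definition wb : R := Num.sqrt d1 / 2.

Lemma wb_gt0 : 0 < wb. Proof. by rewrite divr_gt0// sqrtr_gt0. Qed.

Lemma wb_sqr : wb ^+ 2 = d1 / 4.
Proof. by rewrite exprMn sqr_sqrtr ?(ltW d1_gt0)//; field. Qed.

Definition wE x : R := expR (2 * wb * x).

(** [th] is tanh (wb x) and [S] is sech^2 (wb x). Both are rational in [wE], so that identities
    between them reduce to field arithmetic. *)
Definition th x : R := 1 - 2 * (wE x + 1)^-1.

Definition S x : R := 1 - th x ^+ 2.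

Definition Ws x : R := 3 * d1 / (2 * d2) * S x.

Definition Ws1 x : R := - (2 * wb * th x * Ws x).

Lemma wE_gt0 x : 0 < wE x. Proof. exact: expR_gt0. Qed.

Lemma S_E x : S x = 4 * wE x / (wE x + 1) ^+ 2.
Proof. by rewrite /S /th; field; have := wE_gt0 x; lra. Qed.

Lemma S_gt0 x : 0 < S x.
Proof.
have h := wE_gt0 x; rewrite S_E; apply: divr_gt0; first exact: mulr_gt0.
by apply: exprn_gt0; lra.
Qed.

Lemma th_sqr_le1 x : th x ^+ 2 <= 1. Proof. by have := S_gt0 x; rewrite /S; lra. Qed.

Lemma th_le1 x : `|th x| <= 1.
Proof. by rewrite -(@expr_le1 _ 2)// real_normK ?num_real// th_sqr_le1. Qed.

Lemma S_le1 x : S x <= 1. Proof. by rewrite /S; have := sqr_ge0 (th x); lra. Qed.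

Lemma der_th x : der th x (wb * S x).
Proof.
have h := wE_gt0 x.
have dE : der wE x (2 * wb * wE x) by apply: der_scale; exact: is_derive_expR.
have dE1 : der (fun x => wE x + 1) x (2 * wb * wE x + 0).
  by apply: derD dE _; exact: der_cst.
have n0 : wE x + 1 != 0 by rewrite gt_eqF//; lra.
apply: der_eq (derB (der_cst 1 x) (derZ 2 (@der_inv _ (fun x => wE x + 1) _ _ n0 dE1))) _.
by rewrite S_E; field.
Qed.

Lemma der_S x : der S x (- (2 * wb * th x * S x)).
Proof.
apply: der_eq (derB (der_cst 1 x) (derX 1 (der_th x))) _.
by rewrite expr1; ring.
Qed.

Lemma der_Ws x : der Ws x (Ws1 x).
Proof. by apply: der_eq (derZ _ (der_S x)) _; rewrite /Ws1 /Ws; ring. Qed.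

Lemma der_Ws1 x : der Ws1 x (d1 * Ws x - d2 * Ws x ^+ 2).
Proof.
have h := derN (derM (derZ (2 * wb) (der_th x)) (der_Ws x)).
apply: der_eq h _; rewrite /Ws1 /Ws.
transitivity (- (2 * wb ^+ 2 * (3 * d1 / (2 * d2)) * S x * (S x - 2 * th x ^+ 2))); first by ring.
rewrite wb_sqr /S; field; exact: d2_neq0.
Qed.

Lemma wE_opp x : wE (- x) = (wE x)^-1. Proof. by rewrite /wE mulrN expRN. Qed.

Lemma S_even : even S.
Proof.
move=> x; rewrite !S_E wE_opp; have h := wE_gt0 x.
by field; repeat (apply/andP; split); rewrite gt_eqF//; lra.
Qed.

Lemma Ws_even : even Ws. Proof. by move=> x; rewrite /Ws S_even. Qed.

Lemma cont_S : continuous S. Proof. exact: der_cont' der_S. Qed.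
Lemma cont_Ws : continuous Ws. Proof. exact: der_cont' der_Ws. Qed.

Lemma L2c_S : L2c S.
Proof.
apply: (@L2c_bounded _ _ (2 / wb) cont_S _).1 => T T0.
have wp := wb_gt0.
apply: (@le_trans _ _ (int (- T) T S)).
  apply: le_int; [apply: contX; exact: cont_S|exact: cont_S|].
  move=> x _; rewrite expr2 ler_piMr ?S_le1//; exact: ltW (S_gt0 x).
have TT : - T <= T by lra.
have dT x : der (fun x => wb^-1 * th x) x (S x).
  by apply: der_eq (derZ _ (der_th x)) _; rewrite mulKf// gt_eqF.
rewrite (FTC2 TT cont_S dT) -mulrBr mulrC ler_pM2r ?invr_gt0//.
have := ler_norm (th T); have := ler_norm (- th (- T)); rewrite normrN.
by have := th_le1 T; have := th_le1 (- T); lra.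
Qed.

(** A shift by at most 1 multiplies [wE] by a factor between 1 / k and k, where k = e^(2 wb). This
    Harnack-type bound makes sech^2 a majorant that survives translation and averaging. *)
Lemma S_shift x y : `|y| <= 1 -> S (x + y) <= expR (2 * wb) ^+ 3 * S x.
Proof.
rewrite ler_norml => /andP[y1 y2]; have wp := wb_gt0.
rewrite !S_E {2 3}/wE mulrDr expRD -/(wE x).
have [k kE] : exists k, k = expR (2 * wb) by eexists.
have [c cE] : exists c, c = expR (2 * wb * y) by eexists.
rewrite -kE -cE.
have c0 : 0 < c by rewrite cE expR_gt0.
have k0 : 0 < k by rewrite kE expR_gt0.
have k1 : 1 <= k by rewrite kE -[X in X <= _]expR0 ler_expR; nra.
have ck : c <= k by rewrite cE kE ler_expR; nra.
have kc : 1 <= k * c by rewrite cE kE -expRD -[X in X <= _]expR0 ler_expR; nra.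
have E0 := wE_gt0 x; set E := wE x in E0 *.
rewrite /wE mulrDr expRD -/(wE x) -/E -cE.
have p1 : 0 < E * c + 1 by have := mulr_gt0 E0 c0; lra.
have p2 : 0 < E + 1 by lra.
rewrite ler_pdivrMr ?exprn_gt0//.
have h : E + 1 <= k * (E * c + 1) by nra.
have h2 : (E + 1) ^+ 2 <= k ^+ 2 * (E * c + 1) ^+ 2.
  by rewrite -exprMn lerXn2r// ?nnegrE; nra.
have -> : k ^+ 3 * (4 * E / (E + 1) ^+ 2) * (E * c + 1) ^+ 2 =
  4 * E * k * (k ^+ 2 * (E * c + 1) ^+ 2 / (E + 1) ^+ 2) by field; rewrite gt_eqF.
rewrite mulrA; have q : 1 <= k ^+ 2 * (E * c + 1) ^+ 2 / (E + 1) ^+ 2.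
  by rewrite ler_pdivlMr ?exprn_gt0// mul1r.
have Ek : 4 * E * c <= 4 * E * k by rewrite ler_pM2l// mulr_gt0.
have : 0 <= 4 * E * k by rewrite !mulr_ge0// ltW.
nra.
Qed.

Lemma S_decay x : 0 <= x -> S x <= 4 / (1 + 2 * wb * x).
Proof.
move=> x0; have wp := wb_gt0; have wx : 0 <= wb * x by rewrite mulr_ge0// ltW.
have h : 1 + 2 * wb * x <= wE x by apply: expR_ge1Dx.
have E0 := wE_gt0 x; rewrite S_E.
have p : 0 < 1 + 2 * wb * x by lra.
apply: (@le_trans _ _ (4 / wE x)); last by rewrite ler_pM2l// lef_pV2.
rewrite ler_pdivrMr; last by rewrite exprn_gt0//; lra.
have -> : 4 / wE x * (wE x + 1) ^+ 2 = 4 * wE x + 8 + 4 / wE x by field; rewrite gt_eqF.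
have : 0 < 4 / wE x by rewrite divr_gt0.
lra.
Qed.

Lemma S_cvg0 e : 0 < e -> exists2 T, 0 < T & forall x, T <= `|x| -> S x <= e.
Proof.
move=> e0; have wp := wb_gt0; exists (2 / (e * wb)).
  by apply: divr_gt0 => //; exact: mulr_gt0.
move=> x Tx; have -> : S x = S `|x| by case: (ger0P x) => // _; rewrite S_even.
have x0 := normr_ge0 x; apply: le_trans (S_decay x0) _.
have ewp : 0 < e * wb by exact: mulr_gt0.
move: Tx; rewrite ler_pdivrMr// => Tx.
have wx : 0 <= wb * `|x| by rewrite mulr_ge0// ltW.
rewrite ler_pdivrMr; nra.
Qed.

End solitary_wave.

(** * Uniqueness of the even homoclinic solution *)

Section homoclinic_uniqueness.
Context {R : realType}.
Variables (d e : R).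
Hypotheses (d_gt0 : 0 < d) (e_neq0 : e != 0).
Implicit Types (u v : R -> R).

(** Gronwall: the difference D solves D'' = g D with g bounded on [0, X], so (D^2 + D'^2) e^(-k x)
    does not increase once k is large; it starts at 0. *)
Lemma ode_unique u u1 v v1 :
  (forall x, der u x (u1 x)) -> (forall x, der u1 x (d * u x - e * u x ^+ 2)) ->
  (forall x, der v x (v1 x)) -> (forall x, der v1 x (d * v x - e * v x ^+ 2)) ->
  u 0 = v 0 -> u1 0 = v1 0 -> forall x, 0 <= x -> u x = v x.
Proof.
move=> du du1 dv dv1 e0 e1 X X0.
pose D x := u x - v x; pose D1 x := u1 x - v1 x; pose g x := d - e * (u x + v x).
have dD x : der D x (D1 x) by exact: derB.
have dD1 x : der D1 x (g x * D x) by apply: der_eq (derB (du1 x) (dv1 x)) _; rewrite /g /D; ring.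
have cg : continuous g.
  by apply: contB; [exact: cont_cst|apply: contZ; apply: contD; [exact: der_cont' du|exact: der_cont' dv]].
have [K [_ hK]] := compact_bounded (continuous_compact (cont_within (A := `[0, X]%classic) cg) (@segment_compact R 0 X)).
have gK x : 0 <= x <= X -> `|g x| <= `|K| + 1.
  move=> x0X; apply: hK; first by have := ler_norm K; lra.
  by exists x => //=; rewrite in_itv.
have [k kE] : exists k, k = `|K| + 2 by eexists.
pose N x := D x ^+ 2 + D1 x ^+ 2.
pose M x := N x * expR (- k * x).
have dM x : der M x ((2 * D x * D1 x + 2 * D1 x * (g x * D x) - k * N x) * expR (- k * x)).
  have h1 := derD (derX 1 (dD x)) (derX 1 (dD1 x)).
  have h2 := der_scale (c := - k) (is_derive_expR (- k * x)).
  by apply: der_eq (derM h1 h2) _; rewrite /N !expr1; ring.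
have [c c0X hc] := der_mvt X0 dM.
have le0 : (2 * D c * D1 c + 2 * D1 c * (g c * D c) - k * N c) * expR (- k * c) <= 0.
  apply: mulr_le0_ge0; last exact: expR_ge0.
  have := gK c c0X; rewrite ler_norml kE /N => /andP[g1 g2].
  have h1 := sqr_ge0 (D c - D1 c); have h2 := sqr_ge0 (D c + D1 c).
  have K0 := normr_ge0 K.
  have -> : 2 * D c * D1 c + 2 * D1 c * (g c * D c) - (`|K| + 2) * (D c ^+ 2 + D1 c ^+ 2) =
    - (D c - D1 c) ^+ 2 - 2^-1 * ((`|K| + 1 - g c) * (D c + D1 c) ^+ 2 + (`|K| + 1 + g c) * (D c - D1 c) ^+ 2) by field.
  have := mulr_ge0 (_ : 0 <= `|K| + 1 - g c) h2; have := mulr_ge0 (_ : 0 <= `|K| + 1 + g c) h1.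
  move=> /(_ ltac:(lra)) k1 /(_ ltac:(lra)) k2; lra.
have M0 : M 0 = 0 by rewrite /M /N /D /D1 e0 e1 !subrr expr0n/= addr0 mul0r.
have MX : M X <= 0 by move: hc; rewrite M0 !subr0 => ->; apply: mulr_le0_ge0.
have NX : N X <= 0.
  by move: MX; rewrite /M pmulr_lle0// expR_gt0.
have h : D X ^+ 2 <= 0 by have := sqr_ge0 (D1 X); rewrite /N in NX; lra.
have : D X ^+ 2 == 0 by rewrite eq_le h sqr_ge0.
by rewrite sqrf_eq0 subr_eq0 => /eqP.
Qed.

Lemma even_homoclinic_Ws : even_homoclinic d e (Ws d e).
Proof.
have dW x : der (Ws d e) x (Ws1 d e x) by exact: der_Ws.
have dW1 x : der (Ws1 d e) x (d * Ws d e x - e * Ws d e x ^+ 2) by exact: der_Ws1.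
have W'E : derive1 (Ws d e) = Ws1 d e by apply/funext => x; exact: der_derive1 (dW x).
have lim0 (e1 : R) : 0 < e1 -> exists2 T, 0 < T & forall x, T <= `|x| -> `|Ws d e x| <= e1.
  move=> e10; pose c := `|3 * d / (2 * e)| + 1.
  have c0 : 0 < c by rewrite ltr_wpDl.
  have [T T0 hT] := S_cvg0 d_gt0 (divr_gt0 e10 c0); exists T => // x /hT h.
  rewrite /Ws normrM (gtr0_norm (S_gt0 d x)).
  move: h; rewrite ler_pdivlMr// => h; apply: le_trans h; rewrite mulrC ler_pM2l ?S_gt0//.
  by rewrite /c lerDl.
split.
- split; first by move=> x; exact: der_derivable (dW x).
  by move=> x; rewrite W'E; exact: der_derivable (dW1 x).
- by move=> x; rewrite derive1nS derive1n1 W'E; exact: der_derive1 (dW1 x).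
- exact: Ws_even.
- split; apply/cvgrPdist_le => e1 e10; have [T T0 hT] := lim0 e1 e10; near=> x;
    rewrite sub0r normrN; apply: hT.
    by apply: le_trans (ler_norm x); near: x; apply: nbhs_pinfty_ge; exact: num_real.
  rewrite -normrN; apply: le_trans (ler_norm (- x)); rewrite lerNr.
  by near: x; apply: nbhs_ninfty_le; exact: num_real.
- exists 0; rewrite /Ws mulf_neq0//; last by rewrite gt_eqF// S_gt0.
  by rewrite !mulf_neq0// ?invr_neq0// ?mulf_neq0// gt_eqF.
Unshelve. all: by end_near. Qed.

(** The energy [En] is conserved and vanishes at infinity, and W'(0) = 0 by evenness, so W(0) is
    either 0 or 3 d / (2 e), the value of [Ws] at 0. The first case forces W = 0; the second is
    settled by uniqueness of the initial value problem. *)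
Lemma even_homoclinic_unique W : even_homoclinic d e W -> Ws d e = W.
Proof.
have dp := d_gt0; move=> [[dW dW'] ode evW [Wp _] [x0 Wx0]].
have DW x : der W x (derive1 W x) by exact: derivable_der.
have DW1 x : der (derive1 W) x (d * W x - e * W x ^+ 2).
  apply: der_eq (derivable_der (dW' x)) _.
  by rewrite -ode derive1nS derive1n1.
pose W1 := derive1 W.
pose En x := W1 x ^+ 2 - d * W x ^+ 2 + 2 / 3 * e * W x ^+ 3.
have dEn x : der En x 0.
  have h1 := derX 1 (DW1 x); have h2 := derZ d (derX 1 (DW x)).
  have h3 := derZ (2 / 3 * e) (derX 2 (DW x)).
  by apply: der_eq (derD (derB h1 h2) h3) _; rewrite /W1; field.
have EnC x y : x <= y -> En y = En x.
  move=> xy; have [c _ h] := der_mvt xy dEn.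
  by apply/eqP; rewrite -subr_eq0 h mul0r.
have W10 : W1 0 = 0.
  have h1 : der W 0 (- W1 0).
    have h := der_comp (derN (der_id 0)) (derivable_der (dW (- 0))).
    by apply: der_ext evW _; apply: der_eq h _; rewrite oppr0 mulrN1.
  have := der_uniq h1 (DW 0); rewrite -/W1; lra.
have En0 : En 0 = 0.
  apply/eqP; rewrite -normr_eq0 eq_le normr_ge0 andbT; apply/ler_addgt0Pl => r r0; rewrite addr0.
  have [C CE] : exists C : R, C = 4 + d + `|e| + 1 by eexists.
  have C1 : 1 <= C by rewrite CE; have := normr_ge0 e; lra.
  have [s sE] : exists s : R, s = Num.min 1 (r / C) by eexists.
  have s0 : 0 < s by rewrite sE lt_min ltr01 divr_gt0//; lra.
  have s1 : s <= 1 by rewrite sE ge_min lexx.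
  have sr : s <= r / C by rewrite sE ge_min lexx orbT.
  move/cvgrPdist_le : Wp => /(_ s s0) [T [Tr hT]].
  pose X := `|T| + 1; have TX : T < X by rewrite /X; have := ler_norm T; lra.
  have X0 : 0 <= X by rewrite /X; have := normr_ge0 T; lra.
  have hW y : X <= y -> `|W y| <= s by move=> Xy; rewrite -normrN -sub0r; apply: hT; lra.
  (* Only W is known to decay; the mean value theorem on [X, X + 1] provides one point c where W' is
     small too. *)
  have XX : X <= X + 1 by rewrite lerDl.
  have [c /andP[c1 c2] hc] := der_mvt XX DW.
  have Wc1 : `|W1 c| <= 2 * s.
    move: hc; rewrite (_ : X + 1 - X = 1) ?mulr1 -/W1; last by ring.
    move=> <-.
    have := ler_normB (W (X + 1)) (W X); have := hW X (lexx X); have := hW (X + 1) (ltac:(lra)); lra.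
  have Wc := hW c c1.
  rewrite -(EnC 0 c); last lra.
  have a1 : W1 c ^+ 2 <= 4 * s.
    rewrite -real_normK ?num_real//; have := normr_ge0 (W1 c); nra.
  have a2 : W c ^+ 2 <= s.
    rewrite -real_normK ?num_real//; have := normr_ge0 (W c); nra.
  have a3 : `|2 / 3 * e * W c ^+ 3| <= `|e| * s.
    rewrite normrM normrX normrM mulrC; have n0 := normr_ge0 (W c); have n1 := normr_ge0 e.
    have w3 : `|W c| ^+ 3 <= s.
      have w2 : `|W c| ^+ 2 <= 1 by nra.
      by rewrite exprS; nra.
    rewrite (@ger0_norm _ (2 / 3))//.
    have : `|W c| ^+ 3 * (2 / 3 * `|e|) <= s * (2 / 3 * `|e|).
      by apply: ler_wpM2r => //; rewrite mulr_ge0.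
    have := mulr_ge0 n1 (ltW s0); lra.
  apply: (@le_trans _ _ (C * s)); last by move: sr; rewrite ler_pdivlMr; lra.
  have b1 := sqr_ge0 (W1 c); have b2 := sqr_ge0 (W c).
  have := ler_norm (2 / 3 * e * W c ^+ 3); have := ler_norm (- (2 / 3 * e * W c ^+ 3)).
  rewrite normrN /En CE; set z := 2 / 3 * e * W c ^+ 3 in a3 * => z1 z2.
  have p1 : d * W c ^+ 2 <= d * s by rewrite ler_pM2l.
  have p2 : 0 <= d * W c ^+ 2 by rewrite mulr_ge0// ltW.
  rewrite ler_norml; apply/andP; split; lra.
have W0 : W 0 ^+ 2 * (2 / 3 * e * W 0 - d) = 0.
  by rewrite -[RHS]En0 /En W10; ring.
have S0 : S d 0 = 1.
  by rewrite S_E /wE mulr0 expR0; field.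
have th0 : th d 0 = 0.
  by rewrite /th /wE mulr0 expR0; field.
have [w0|w0] := eqVneq (W 0) 0.
  have z x : der (fun=> 0 : R) x 0 by exact: der_cst.
  have h := @ode_unique W W1 (fun=> 0) (fun=> 0) DW DW1 z _ w0 W10.
  have {}h x : 0 <= x -> W x = 0.
    by apply: h => y; apply: der_eq (z y) _; rewrite expr0n/= !mulr0 subr0.
  have : W x0 = 0.
    have [hx|hx] := leP 0 x0; first exact: h.
    by rewrite -evW h// oppr_ge0 ltW.
  by move=> h'; rewrite h' eqxx in Wx0.
have WW : Ws d e 0 = W 0.
  move/eqP: W0; rewrite mulf_eq0 sqrf_eq0 (negbTE w0)/= subr_eq0 => /eqP h.
  rewrite /Ws S0 mulr1 -h; field; exact: e_neq0.
have h : forall x, 0 <= x -> Ws d e x = W x.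
  have k1 x : der (Ws d e) x (Ws1 d e x) by exact: der_Ws.
  have k2 x : der (Ws1 d e) x (d * Ws d e x - e * Ws d e x ^+ 2) by exact: der_Ws1.
  have k3 : Ws1 d e 0 = W1 0 by rewrite W10 /Ws1 th0 mulr0 mul0r oppr0.
  exact: (ode_unique k1 k2 DW DW1 WW k3).
apply/funext => x; have [hx|hx] := leP 0 x; first exact: h.
by rewrite -evW -Ws_even h// oppr_ge0 ltW.
Qed.

End homoclinic_uniqueness.

(** * Coercivity of the Poeschl-Teller form on functions vanishing at two points *)

Section poschl_teller.
Context {R : realType}.
Variable d1 : R.
Hypothesis d1_gt0 : 0 < d1.
Implicit Types (x y T a b : R) (F f g phi : R -> R).

(** Differentiability of F is required on [a, b] alone, because the weights [Pin] and [Pout] have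
    poles elsewhere. *)
Lemma le_int_der F f g a b : a <= b -> (forall x, a <= x <= b -> der F x (f x)) ->
  continuous g -> (forall x, a <= x <= b -> f x <= g x) -> F b - F a <= int a b g.
Proof.
rewrite le_eqVlt => /predU1P[<-|ab] dF cg fg.
  by rewrite subrr /int set_itv1 Rintegral_set1.
have [G dG] := primitive_exists cg.
rewrite (FTC2 (ltW ab) cg dG).
have dH x : a <= x <= b -> der (fun x => G x - F x) x (g x - f x).
  by move=> xab; apply: derB => //; exact: dF.
have cH : {within `[a, b], continuous (fun x => G x - F x)}.
  apply: derivable_within_continuous => x; rewrite in_itv/= => h.
  exact: der_derivable (dH x h).
have dH' x : x \in `]a, b[%R -> is_derive x (1 : R) (fun x => G x - F x) (g x - f x).
  by rewrite in_itv/= => /andP[h1 h2]; apply: dH; rewrite !ltW.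
have [c cab] := @MVT R (fun x => G x - F x) (fun x => g x - f x) a b ab dH' cH.
move: cab; rewrite in_itv/= => /andP[/ltW ac /ltW cb] h.
have := fg c; rewrite ac cb => /(_ isT) fc.
have : 0 <= (g c - f c) * (b - a) by rewrite mulr_ge0//; lra.
lra.
Qed.

Lemma small_point f e T0 : L2c f -> 0 < e -> exists2 T, T0 <= T & f T ^+ 2 <= e.
Proof.
move=> hf e0; have [cf _] := hf.
apply: contrapT => H.
have h x : T0 <= x -> e <= f x ^+ 2.
  by move=> Tx; rewrite leNgt; apply/negP => fx; apply: H; exists x => //; exact: ltW.
pose n := ip f f / e + 1.
have n0 : 0 <= n by rewrite /n; have := divr_ge0 (ip_ge0 f) (ltW e0); lra.
have : e * (T0 + n - T0) <= int T0 (T0 + n) (fun x => f x ^+ 2).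
  rewrite -int_cst; last lra.
  by apply: le_int; [exact: cont_cst|exact: contX|move=> x /andP[h1 _]; exact: h].
move=> /le_trans /(_ (int_sqr_le_ip _ _ hf)).
have -> : e * (T0 + n - T0) = ip f f + e by rewrite /n; field; rewrite gt_eqF.
lra.
Qed.

Notation t := (th d1).
Notation b := (wb d1).

Lemma th_opp x : t (- x) = - t x.
Proof.
rewrite /th wE_opp; have h := wE_gt0 d1 x.
by field; repeat (apply/andP; split); rewrite gt_eqF//; lra.
Qed.

Lemma th_mono x y : x <= y -> t x <= t y.
Proof.
move=> xy; have [c _ h] := der_mvt xy (der_th d1).
have : 0 <= b * S d1 c * (y - x).
  have b0 := wb_gt0 d1_gt0; have S0 := S_gt0 d1 c.
  by apply: mulr_ge0; [apply: mulr_ge0; exact: ltW|lra].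
lra.
Qed.

(* The point where [tanh^2 = 1/6]: the weight [Pin] below is regular while [tanh^2 < 1/5], and
   [Pout] is a subsolution as soon as [tanh^2 > 1/7]. *)
Definition y0 : R := ln ((1 + (Num.sqrt 6)^-1) / (1 - (Num.sqrt 6)^-1)) / (2 * b).

Lemma th_y0 : 0 < t y0 /\ t y0 ^+ 2 = 1 / 6.
Proof.
have b0 := wb_gt0 d1_gt0; have [s sE] : exists s : R, s = Num.sqrt 6 by eexists.
have s2 : s ^+ 2 = 6 by rewrite sE sqr_sqrtr.
have s1 : 2 < s.
  have s0 : 0 <= s by rewrite sE sqrtr_ge0.
  nra.
have v0 : 0 < s^-1 by rewrite invr_gt0; lra.
have v1 : s^-1 < 1 / 2 by rewrite div1r ltf_pV2 ?posrE//; lra.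
have q0 : 0 < (1 + s^-1) / (1 - s^-1) by rewrite divr_gt0//; lra.
have E : wE d1 y0 = (1 + s^-1) / (1 - s^-1).
  rewrite /wE /y0 -sE mulrC divfK ?lnK ?posrE//.
  by rewrite mulf_neq0// gt_eqF.
have tE : t y0 = s^-1.
  rewrite /th E; have s00 : s != 0 by rewrite gt_eqF//; lra.
  have s10 : s - 1 != 0 by rewrite gt_eqF//; lra.
  have -> : (1 + s^-1) / (1 - s^-1) + 1 = 2 / (1 - s^-1) by field; rewrite s00 s10.
  rewrite invf_div mulrCA mulfV// ?mulr1; last lra.
by rewrite tE; split=> //; rewrite exprVn s2; lra.
Qed.

Lemma y0_gt0 : 0 < y0.
Proof.
have [h _] := th_y0; rewrite ltNge; apply/negP => /th_mono.
have -> : t 0 = 0 by rewrite /th /wE mulr0 expR0; field.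
lra.
Qed.

(* [Pin] is the logarithmic derivative of the second even
   eigenfunction [sech (1 - 5 tanh^2)], with eigenvalue [-1]; [Pout] is a
   subsolution of the Riccati equation at an energy slightly above [-4]. *)
Definition Pin x : R := - t x - 10 * (t x * (1 - t x ^+ 2) * (1 - 5 * t x ^+ 2)^-1).
Definition Pout x : R := - (309 / 100 * t x) + 11 / 10 * (t x)^-1.

(** The Riccati equation at the eigenvalue -1; the bound on tanh^2 keeps 1 - 5 tanh^2 positive. *)
Lemma der_Pin x : t x ^+ 2 <= 1 / 6 -> der Pin x (b * (1 - 12 * S d1 x - Pin x ^+ 2)).
Proof.
move=> tx; have dt := der_th d1 x.
have n0 : 1 - 5 * t x ^+ 2 != 0 by rewrite gt_eqF//; lra.
have d2 := derX 1 dt.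
have dA := derB (der_cst 1 x) d2.
have dB := derB (der_cst 1 x) (derZ 5 d2).
have dI := @der_inv _ (fun x => 1 - 5 * t x ^+ 2) _ _ n0 dB.
have dP := derB (derN dt) (derZ 10 (derM (derM dt dA) dI)).
apply: der_eq dP _; rewrite expr1 /Pin /S.
move: (t x) n0 => v n0; field; exact: n0.
Qed.

Lemma der_Pout x : t x != 0 -> der Pout x (b * (S d1 x * (- (309 / 100) - 11 / 10 / t x ^+ 2))).
Proof.
move=> tx; have dt := der_th d1 x.
have dP := derD (derN (derZ (309 / 100) dt)) (derZ (11 / 10) (der_inv tx dt)).
by apply: der_eq dP _; move: (t x) tx (S d1 x) => v v0 u; field.
Qed.

(** With coefficients -3 and 1 the weight would be the logarithmic derivative of sech^2 tanh, the
    translation mode at energy -4, and equality would hold without the 1/50. The perturbed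
    coefficients 309/100 and 11/10 buy this margin where tanh^2 >= 1/6; cleared of its denominator,
    the claim is a quadratic inequality in z = tanh^2. *)
Lemma Pout_riccati x : 1 / 6 <= t x ^+ 2 ->
  S d1 x * (- (309 / 100) - 11 / 10 / t x ^+ 2) + Pout x ^+ 2 <= 4 - 12 * S d1 x - 1 / 50.
Proof.
move=> tx; have t1 := th_sqr_le1 d1 x.
have t0 : t x != 0 by apply/eqP => h; move: tx; rewrite h expr0n/=; lra.
rewrite /S /Pout; set v := t x in tx t1 t0 *.
have [z zE] : exists z : R, z = v ^+ 2 by eexists.
have z0 : 0 < z by rewrite zE; lra.
have -> : (1 - v ^+ 2) * (- (309 / 100) - 11 / 10 / v ^+ 2) + (- (309 / 100 * v) + 11 / 10 * v^-1) ^+ 2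
  = (- (309 / 100 * (1 - z) * z) - 11 / 10 * (1 - z) + (309 / 100) ^+ 2 * z ^+ 2
     - 2 * (309 / 100) * (11 / 10) * z + (11 / 10) ^+ 2) / z by rewrite zE; field.
rewrite -zE in tx t1 *; rewrite ler_pdivrMr//.
nra.
Qed.

Lemma Pout_bound x : 1 / 6 <= t x ^+ 2 -> `|Pout x| <= 10.
Proof.
move=> tx; have t1 := th_le1 d1 x.
have t0 : t x != 0 by apply/eqP => h; move: tx; rewrite h expr0n/=; lra.
have n0 : 0 < `|t x| by rewrite normr_gt0.
have h : 1 / 4 <= `|t x|.
  rewrite leNgt; apply/negP => h; move: tx; rewrite -real_normK ?num_real//; nra.
rewrite /Pout; apply: (le_trans (ler_normD _ _)); rewrite normrN (normrM (309 / 100)) (normrM (11 / 10)) normfV.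
rewrite (@ger0_norm _ (309 / 100))// (@ger0_norm _ (11 / 10))//.
have : `|t x|^-1 <= 4 by rewrite -[4]invrK lef_pV2 ?posrE//; lra.
lra.
Qed.

(** Completing the square: phi'^2 + b^2 P^2 phi^2 dominates 2 b P phi phi', so the integrand is at
    least the derivative of b P phi^2 as soon as P is a Riccati subsolution. *)
Lemma riccati_step (P p1 : R -> R) phi phi1 x y z : y <= z ->
  (forall x, der phi x (phi1 x)) -> continuous phi1 ->
  (forall x, y <= x <= z -> der P x (b * p1 x)) ->
  (forall x, y <= x <= z -> p1 x + P x ^+ 2 <= 4 - 12 * S d1 x - 1 / 50) ->
  b * P z * phi z ^+ 2 - b * P y * phi y ^+ 2 <=
  int y z (fun x => phi1 x ^+ 2 + b ^+ 2 * (4 - 12 * S d1 x - 1 / 50) * phi x ^+ 2).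
Proof.
move=> yz dphi cphi1 dP hP; have cphi := der_cont' dphi.
have dF w : y <= w <= z -> der (fun x => b * P x * phi x ^+ 2) w
    (b * (b * p1 w) * phi w ^+ 2 + b * P w * (2 * phi w * phi1 w)).
  move=> yw; have h := derM (derZ b (dP w yw)) (derX 1 (dphi w)).
  by apply: der_eq h _; rewrite expr1.
apply: (le_int_der yz dF).
  apply: contD; first exact: contX.
  apply: contM; last exact: contX.
  apply: contZ; apply: contB; last exact: cont_cst.
  by apply: contB; [exact: cont_cst|apply: contZ; exact: cont_S].
move=> w yw; have := hP w yw; have := sqr_ge0 (phi1 w - b * P w * phi w).
set A := p1 w; set B := P w; set C := 4 - _ - _ => h1 h2.
have h3 : 0 <= (b * phi w) ^+ 2 * (C - (A + B ^+ 2)) by rewrite mulr_ge0 ?sqr_ge0//; lra.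
have -> : b * (b * A) * phi w ^+ 2 + b * B * (2 * phi w * phi1 w) =
  phi1 w ^+ 2 + b ^+ 2 * C * phi w ^+ 2 - (phi1 w - b * B * phi w) ^+ 2 -
  (b * phi w) ^+ 2 * (C - (A + B ^+ 2)) by ring.
lra.
Qed.

Lemma t_sqr_in x : `|x| <= y0 -> t x ^+ 2 <= 1 / 6.
Proof.
have [h1 h2] := th_y0; rewrite ler_norml -h2 => /andP[/th_mono k1 /th_mono k2].
by move: k1; rewrite th_opp => k1; nra.
Qed.

Lemma t_sqr_out x : y0 <= `|x| -> 1 / 6 <= t x ^+ 2.
Proof.
have [h1 h2] := th_y0; rewrite -h2 => hx.
have -> : t x ^+ 2 = t `|x| ^+ 2.
  by case: (ger0P x) => // _; rewrite th_opp sqrrN.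
by have k := th_mono hx; nra.
Qed.

(** Since phi vanishes at y0 and - y0, the line splits into three pieces. On each a Riccati weight
    bounds the integral from below by boundary terms, which vanish at the two cuts and are
    negligible at T and - T where phi is small. *)
Theorem poschl_teller phi phi1 : (forall x, der phi x (phi1 x)) -> continuous phi1 ->
  L2c phi -> L2c phi1 -> even phi -> phi y0 = 0 ->
  b ^+ 2 / 50 * ip phi phi <=
  ip phi1 phi1 + RI (fun x => b ^+ 2 * (4 - 12 * S d1 x) * phi x ^+ 2).
Proof.
move=> dphi cphi1 hphi hphi1 ephi phi0; have [cphi iphi] := hphi; have [_ iphi1] := hphi1.
have b0 := wb_gt0 d1_gt0; have yp := y0_gt0.
pose V x := b ^+ 2 * (4 - 12 * S d1 x).
have cV : continuous V.
  by apply: contZ; apply: contB; [exact: cont_cst|apply: contZ; exact: cont_S].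
pose g x := phi1 x ^+ 2 + b ^+ 2 * (4 - 12 * S d1 x - 1 / 50) * phi x ^+ 2.
have iV : integr (fun x => V x * phi x ^+ 2).
  apply: (integr_dom _ (integrZ (b ^+ 2 * 12) iphi)) => [|x].
    by apply: contM => //; exact: contX.
  rewrite normrM (ger0_norm (sqr_ge0 (phi x))) /V; apply: ler_wpM2r; first exact: sqr_ge0.
  rewrite normrM ger0_norm ?sqr_ge0//; apply: ler_wpM2l; first exact: sqr_ge0.
  have := S_gt0 d1 x; have := S_le1 d1 x => s1 s0; rewrite ler_norml; apply/andP; split; lra.
have gE : g = fun x => phi1 x ^+ 2 + V x * phi x ^+ 2 - (b ^+ 2 / 50) * phi x ^+ 2.
  by apply/funext => x; rewrite /g /V; field.
have ig : integr g by rewrite gE; apply: integrB; [exact: integrD|exact: integrZ].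
have cg : continuous g.
  rewrite gE; apply: contB; last by apply: contZ; exact: contX.
  by apply: contD; [exact: contX|apply: contM => //; exact: contX].
suff : 0 <= RI g.
  rewrite gE RIB ?RID//; [|exact: integrD|exact: integrZ].
  rewrite RIZ// /ip.
  under [X in _ -> _ * RI X <= _]eq_fun do rewrite -expr2.
  under [X in _ -> _ <= RI X + _]eq_fun do rewrite -expr2.
  rewrite -/V; lra.
apply/ler_addgt0Pr => e e0.
have e20 : 0 < e / 2 by lra.
have [T0 [T00 hT]] := RI_tail cg ig e20.
(* [Pout] is at most 10 in modulus, so the two outer boundary terms cost at most 20 b phi(T)^2,
   which is then at most e / 2. *)
have e30 : 0 < e / (40 * b) by apply: divr_gt0 => //; exact: mulr_gt0.
have [T TT fT] := small_point (Num.max T0 y0) hphi e30.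
move: TT; rewrite ge_max => /andP[T0T yT].
have := hT T T0T; rewrite ler_norml => /andP[h1 _].
suff : - (20 * b * phi T ^+ 2) <= int (- T) T g.
  have bp : 0 < 40 * b by exact: mulr_gt0.
  move: fT; rewrite ler_pdivlMr// => fT; lra.
rewrite (@int_cat _ _ (- T) (- y0) T)//; try lra.
rewrite (@int_cat _ _ (- y0) y0 T)//; try lra.
have out x : y0 <= `|x| -> der Pout x (b * (S d1 x * (- (309 / 100) - 11 / 10 / t x ^+ 2))).
  move=> /t_sqr_out h; apply: der_Pout; apply/eqP => tx.
  by move: h; rewrite tx expr0n/=; lra.
have phi0' : phi (- y0) = 0 by rewrite ephi.
have k1 := @riccati_step Pin (fun x => 1 - 12 * S d1 x - Pin x ^+ 2) phi phi1 0 (- y0) y0.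
have {}k1 : 0 <= int (- y0) y0 g.
  have := k1 (ltac:(lra)) dphi cphi1; rewrite phi0 phi0' expr0n/= !mulr0 subrr; apply.
    by move=> x hx; apply: der_Pin; apply: t_sqr_in; rewrite ler_norml.
  by move=> x _; lra.
have k2 := @riccati_step Pout (fun x => S d1 x * (- (309 / 100) - 11 / 10 / t x ^+ 2)) phi phi1 0 y0 T.
have {}k2 : b * Pout T * phi T ^+ 2 <= int y0 T g.
  have := k2 yT dphi cphi1; rewrite phi0 expr0n/= mulr0 subr0; apply.
    by move=> x /andP[hx _]; apply: out; apply: le_trans hx (ler_norm _).
  by move=> x /andP[hx _]; apply: Pout_riccati; apply: t_sqr_out; apply: le_trans hx (ler_norm _).
have k3 := @riccati_step Pout (fun x => S d1 x * (- (309 / 100) - 11 / 10 / t x ^+ 2)) phi phi1 0 (- T) (- y0).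
have {}k3 : - (b * Pout (- T) * phi T ^+ 2) <= int (- T) (- y0) g.
  have := k3 (ltac:(lra)) dphi cphi1; rewrite phi0' expr0n/= mulr0 sub0r ephi; apply.
    move=> x /andP[_ hx]; apply: out; rewrite -normrN; apply: le_trans (ler_norm _); lra.
  move=> x /andP[_ hx]; apply: Pout_riccati; apply: t_sqr_out.
  rewrite -normrN; apply: le_trans (ler_norm _); lra.
have TT : y0 <= `|T| by apply: le_trans yT (ler_norm _).
have TT' : y0 <= `|- T| by rewrite normrN.
have := Pout_bound (t_sqr_out TT); have := Pout_bound (t_sqr_out TT').
rewrite !ler_norml => /andP[q1 q2] /andP[q3 q4].
have f0 : 0 <= b * phi T ^+ 2 by rewrite mulr_ge0 ?sqr_ge0// ltW.
have r1 := mulr_ge0 f0 (_ : 0 <= 10 + Pout T).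
have r2 := mulr_ge0 f0 (_ : 0 <= 10 - Pout (- T)).
have {}r1 := r1 (ltac:(lra)); have {}r2 := r2 (ltac:(lra)).
lra.
Qed.

End poschl_teller.

(** * Bounds from the symbol condition *)

Section taylor.
Context {R : realType}.
Implicit Types (f g : R -> R) (x y z c r eta : R) (n : nat).

(** One step of Taylor's formula by the mean value theorem. The constant is carried along unchanged
    instead of being divided by factorials. *)
Lemma mvt_pow f g c n x r : (forall y, der f y (g y)) -> f x = 0 -> 0 <= c ->
  (forall y, `|y - x| <= r -> `|g y| <= c * `|y - x| ^+ n) ->
  forall y, `|y - x| <= r -> `|f y| <= c * `|y - x| ^+ n.+1.
Proof.
move=> df f0 c0 hg y yr.
have [w [hw e]] : exists w, `|w - x| <= `|y - x| /\ f y = g w * (y - x).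
  have [xy|yx] := leP x y.
    have [w /andP[w1 w2] h] := der_mvt xy df; exists w; split.
      by rewrite !ger0_norm ?subr_ge0// lerD2r.
    by rewrite -h f0 subr0.
  have [w /andP[w1 w2] h] := der_mvt (ltW yx) df; exists w; split.
    by rewrite !ler0_norm ?subr_le0//; [rewrite lerN2 lerD2r|exact: ltW].
  by move: h; rewrite f0 sub0r => h; rewrite -[f y]opprK h -mulrN opprB.
rewrite e normrM exprSr mulrA; apply: ler_wpM2r => //.
apply: le_trans (hg w (le_trans hw yr)) _; apply: ler_wpM2l => //.
by apply: lerXn2r => //; rewrite nnegrE.
Qed.

Lemma taylor2 f f1 f2 c x r : (forall y, der f y (f1 y)) -> (forall y, der f1 y (f2 y)) ->
  0 <= c -> (forall y, `|y - x| <= r -> `|f2 y| <= c) ->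
  forall y, `|y - x| <= r -> `|f y - (f x + f1 x * (y - x))| <= c * `|y - x| ^+ 2.
Proof.
move=> d0 d1 c0 h2.
have dl y : der (fun y => y - x) y 1.
  by apply: der_eq (derB (der_id y) (der_cst x y)) _; rewrite subr0.
apply: (@mvt_pow _ (fun y => f1 y - f1 x)) => //.
- move=> y; apply: der_eq (derB (d0 y) (derD (der_cst (f x) y) (derZ (f1 x) (dl y)))) _.
  by rewrite add0r mulr1.
- by rewrite subrr mulr0 addr0 subrr.
apply: (@mvt_pow _ f2) => //.
- by move=> y; apply: der_eq (derB (d1 y) (der_cst (f1 x) y)) _; rewrite subr0.
- by rewrite subrr.
- by move=> y /h2; rewrite expr0 mulr1.
Qed.

Lemma taylor4 f f1 f2 f3 f4 c x r : (forall y, der f y (f1 y)) -> (forall y, der f1 y (f2 y)) ->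
  (forall y, der f2 y (f3 y)) -> (forall y, der f3 y (f4 y)) ->
  0 <= c -> (forall y, `|y - x| <= r -> `|f4 y| <= c) ->
  forall y, `|y - x| <= r ->
  `|f y - (f x + f1 x * (y - x) + f2 x / 2 * (y - x) ^+ 2 + f3 x / 6 * (y - x) ^+ 3)| <=
  c * `|y - x| ^+ 4.
Proof.
move=> d0 d1 d2 d3 c0 h4.
have dl y : der (fun y => y - x) y 1.
  by apply: der_eq (derB (der_id y) (der_cst x y)) _; rewrite subr0.
apply: (@mvt_pow _ (fun y => f1 y - (f1 x + f2 x * (y - x) + f3 x / 2 * (y - x) ^+ 2))) => //.
- move=> y; apply: der_eq (derB (d0 y) (derD (derD (derD (der_cst (f x) y) (derZ (f1 x) (dl y)))
    (derZ (f2 x / 2) (derX 1 (dl y)))) (derZ (f3 x / 6) (derX 2 (dl y))))) _.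
  by rewrite expr1; field.
- by rewrite subrr !expr0n/= !mulr0 !addr0 subrr.
apply: (@mvt_pow _ (fun y => f2 y - (f2 x + f3 x * (y - x)))) => //.
- move=> y; apply: der_eq (derB (d1 y) (derD (derD (der_cst (f1 x) y) (derZ (f2 x) (dl y)))
    (derZ (f3 x / 2) (derX 1 (dl y))))) _.
  by rewrite expr1; field.
- by rewrite subrr !expr0n/= !mulr0 !addr0 subrr.
exact: (taylor2 d2 d3).
Qed.

(** The interval is centred, so odd powers drop out, and the mean of (s - 1/2)^2 is 1/12. *)
Lemma int_center (a b c d eta : R) :
  int 0 1 (fun s => a + b * (eta * (s - 2^-1)) + c / 2 * (eta * (s - 2^-1)) ^+ 2
    + d / 6 * (eta * (s - 2^-1)) ^+ 3) = a + eta ^+ 2 / 24 * c.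
Proof.
pose F s := a * s + b * eta / 2 * (s - 2^-1) ^+ 2 + c * eta ^+ 2 / 6 * (s - 2^-1) ^+ 3
  + d * eta ^+ 3 / 24 * (s - 2^-1) ^+ 4.
have dl (s : R) : der (fun s => s - 2^-1) s 1.
  by apply: der_eq (derB (der_id s) (der_cst 2^-1 s)) _; rewrite subr0.
rewrite (@FTC2 _ F)//.
- by rewrite /F; field.
- have cl : continuous (fun s : R => eta * (s - 2^-1)).
    by apply: contZ; apply: contB; [exact: cont_id|exact: cont_cst].
  apply: contD; last by apply: contZ; exact: contX.
  apply: contD; last by apply: contZ; exact: contX.
  by apply: contD; [exact: cont_cst|exact: contZ].
- move=> s; apply: der_eq (derD (derD (derD (derZ a (der_id s)) (derZ _ (derX 1 (dl s))))
    (derZ _ (derX 2 (dl s)))) (derZ _ (derX 3 (dl s)))) _.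
  by rewrite expr1; field.
Qed.

Lemma A_dist_le f eta x a b c d (C : R) : continuous f ->
  (forall y, `|y - x| <= `|eta| ->
    `|f y - (a + b * (y - x) + c / 2 * (y - x) ^+ 2 + d / 6 * (y - x) ^+ 3)| <= C) ->
  `|A eta f x - (a + eta ^+ 2 / 24 * c)| <= C.
Proof.
move=> cf h; rewrite /A -(int_center a b c d eta).
have cl : continuous (fun s : R => eta * (s - 2^-1)).
  by apply: contZ; apply: contB; [exact: cont_id|exact: cont_cst].
have cp : continuous (fun s : R => a + b * (eta * (s - 2^-1)) + c / 2 * (eta * (s - 2^-1)) ^+ 2
    + d / 6 * (eta * (s - 2^-1)) ^+ 3).
  apply: contD; last by apply: contZ; exact: contX.
  apply: contD; last by apply: contZ; exact: contX.
  by apply: contD; [exact: cont_cst|exact: contZ].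
have ca : continuous (fun s : R => f (x + eta * (s - 2^-1))) by exact: cont_aff.
rewrite -intB//; apply: (@le_trans _ _ (C * (1 - 0))); last by rewrite subr0 mulr1.
apply: abs_int_le => //; first exact: contB.
move=> s /andP[s0 s1]; have := h (x + eta * (s - 2^-1)).
rewrite [x + _ - x]addrAC subrr add0r; apply.
rewrite normrM ler_piMr//.
by rewrite ler_norml; apply/andP; split; lra.
Qed.

Lemma A_taylor2 f f1 f2 c x eta : (forall y, der f y (f1 y)) -> (forall y, der f1 y (f2 y)) ->
  0 <= c -> (forall y, `|y - x| <= `|eta| -> `|f2 y| <= c) ->
  `|A eta f x - f x| <= c * eta ^+ 2.
Proof.
move=> d0 d1 c0 h2; have cf := der_cont' d0.
have := @A_dist_le f eta x (f x) (f1 x) 0 0 (c * eta ^+ 2) cf.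
rewrite mulr0 addr0; apply => y hy; rewrite !mul0r !addr0.
apply: le_trans (taylor2 d0 d1 c0 h2 hy) _; apply: ler_wpM2l => //.
by rewrite -[eta ^+ 2]real_normK ?num_real// lerXn2r ?nnegrE.
Qed.

Lemma A_taylor4 f f1 f2 f3 f4 c x eta :
  (forall y, der f y (f1 y)) -> (forall y, der f1 y (f2 y)) ->
  (forall y, der f2 y (f3 y)) -> (forall y, der f3 y (f4 y)) ->
  0 <= c -> (forall y, `|y - x| <= `|eta| -> `|f4 y| <= c) ->
  `|A eta f x - (f x + eta ^+ 2 / 24 * f2 x)| <= c * eta ^+ 4.
Proof.
move=> d0 d1 d2 d3 c0 h4; have cf := der_cont' d0.
apply: (@A_dist_le f eta x (f x) (f1 x) (f2 x) (f3 x) _ cf) => y hy.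
apply: le_trans (taylor4 d0 d1 d2 d3 c0 h4 hy) _; apply: ler_wpM2l => //.
rewrite -[eta ^+ 4]ger0_norm; last by rewrite (exprM eta 2 2) sqr_ge0.
by rewrite normrX lerXn2r ?nnegrE.
Qed.

(** Each of the two averages contributes eta^2 / 24 f''. The factor 3 collects the averaged inner
    remainder, the outer remainder and the second-order error of [A eta f2]. *)
Lemma AA_taylor4 f f1 f2 f3 f4 c x eta :
  (forall y, der f y (f1 y)) -> (forall y, der f1 y (f2 y)) ->
  (forall y, der f2 y (f3 y)) -> (forall y, der f3 y (f4 y)) ->
  0 <= c -> (forall y, `|y - x| <= 2 * `|eta| -> `|f4 y| <= c) ->
  `|A eta (A eta f) x - (f x + eta ^+ 2 / 12 * f2 x)| <= 3 * c * eta ^+ 4.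
Proof.
move=> d0 d1 d2 d3 c0 h4; have cf := der_cont' d0; have cf2 := der_cont' d2.
have e0 := normr_ge0 eta.
have near0 y w : `|y - x| <= `|eta| -> `|w - y| <= `|eta| -> `|w - x| <= 2 * `|eta|.
  by have := ler_normD (w - y) (y - x); rewrite addrA subrK; lra.
pose g y := A eta f y - (f y + eta ^+ 2 / 24 * f2 y).
have cg : continuous g.
  by apply: contB; [exact: A_cont|apply: contD => //; exact: contZ].
have h1 : `|A eta g x| <= c * eta ^+ 4.
  apply: A_bound => // s hs; apply: (A_taylor4 d0 d1 d2 d3 c0) => w hw.
  by apply: h4; apply: near0 hw; rewrite addrAC subrr add0r.
have h2 : `|A eta f x - (f x + eta ^+ 2 / 24 * f2 x)| <= c * eta ^+ 4.
  by apply: (A_taylor4 d0 d1 d2 d3 c0) => w hw; apply: h4; lra.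
have h3 : `|A eta f2 x - f2 x| <= c * eta ^+ 2.
  by apply: (A_taylor2 d2 d3 c0) => w hw; apply: h4; lra.
have gE : A eta g x = A eta (A eta f) x - (A eta f x + eta ^+ 2 / 24 * A eta f2 x).
  rewrite /g AB; [|exact: A_cont|by apply: contD => //; exact: contZ].
  by rewrite AD//; [rewrite AZ|exact: contZ].
have -> : A eta (A eta f) x - (f x + eta ^+ 2 / 12 * f2 x) =
  A eta g x + (A eta f x - (f x + eta ^+ 2 / 24 * f2 x)) + eta ^+ 2 / 24 * (A eta f2 x - f2 x).
  by rewrite gE; field.
have h4' : `|eta ^+ 2 / 24 * (A eta f2 x - f2 x)| <= c * eta ^+ 4.
  rewrite normrM (@ger0_norm _ (eta ^+ 2 / 24)); last by rewrite divr_ge0// sqr_ge0.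
  apply: (@le_trans _ _ (eta ^+ 2 * (c * eta ^+ 2))).
    have e2 := sqr_ge0 eta; apply: ler_pM => //; first by rewrite divr_ge0.
    lra.
  by rewrite mulrCA -exprD.
set u := A eta g x in h1 *; set v := A eta f x - _ in h2 *; set w := _ / 24 * _ in h4' *.
have := ler_normD (u + v) w; have := ler_normD u v; lra.
Qed.

End taylor.

Section sinc_bounds.
Context {R : realType}.
Implicit Types (t z : R).

(** As an average of the cosine, [sinc] inherits its expansion at 0 from the Taylor bounds for
    [A]. *)
Lemma sincE t : sinc t = A (2 * t) (fun x => cos (1 * x)) 0.
Proof. by rewrite A_cos mulr0 cos0 !mulr1 mulrC mulKf. Qed.

Lemma sinc_le1 t : `|sinc t| <= 1.
Proof.
rewrite sincE; apply: A_bound; first exact: cont_cosZ.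
by move=> s _; exact: cos_max.
Qed.

Lemma der_cos1 t : der (fun x => cos (1 * x)) t (- sin t).
Proof. by apply: der_ext (is_derive_cos t) => y; rewrite mul1r. Qed.

Lemma der_Nsin t : der (fun x => - sin x : R) t (- cos t).
Proof. exact: derN (is_derive_sin t). Qed.

Lemma der_Ncos t : der (fun x => - cos x : R) t (sin t).
Proof. by apply: der_eq (derN (is_derive_cos t)) _; rewrite opprK. Qed.

Lemma sinc_quad t : `|sinc t - 1| <= 4 * t ^+ 2.
Proof.
rewrite sincE; have := @A_taylor2 R _ _ _ 1 0 (2 * t) der_cos1 der_Nsin ler01.
rewrite mulr0 cos0 mul1r exprMn -natrX; apply => y _.
by rewrite normrN cos_max.
Qed.

Lemma sinc_quartic t : `|1 - sinc t ^+ 2 - t ^+ 2 / 3| <= 48 * t ^+ 4.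
Proof.
have := @A_taylor4 R _ _ _ _ _ 1 0 (2 * t) der_cos1 der_Nsin der_Ncos (@is_derive_sin R) ler01.
rewrite -sincE mulr0 cos0 mul1r => /(_ (fun y _ => cos_max y)).
have := sinc_quad t; set s := sinc t => h1 h2.
have -> : 1 - s ^+ 2 - t ^+ 2 / 3 = - (s - 1) ^+ 2 - 2 * (s - (1 + (2 * t) ^+ 2 / 24 * -1)) by field.
have h3 : (s - 1) ^+ 2 <= 16 * t ^+ 4.
  rewrite -real_normK ?num_real//; have -> : 16 * t ^+ 4 = (4 * t ^+ 2) ^+ 2 by ring.
  by rewrite lerXn2r// ?nnegrE// mulr_ge0// sqr_ge0.
have h4 : (2 * t) ^+ 4 = 16 * t ^+ 4 by ring.
rewrite h4 in h2; have h5 := sqr_ge0 (s - 1).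
set w := s - (1 + _) in h2 *; move: h2; rewrite !ler_norml => /andP[h6 h7].
apply/andP; split; lra.
Qed.

Lemma symbS_bounds (kap z : R) :
  [/\ `|symbS kap z| <= 1, `|symbS kap z| <= 2 * (kap * z) ^+ 2 &
      `|symbS kap z - kap ^+ 2 * z ^+ 2 / 12| <= 3 * (kap * z) ^+ 4].
Proof.
have h1 := sinc_le1 (kap * z / 2); have h2 := sinc_quad (kap * z / 2).
have h3 := sinc_quartic (kap * z / 2).
have e2 : (kap * z / 2) ^+ 2 = (kap * z) ^+ 2 / 4 by field.
have e4 : (kap * z / 2) ^+ 4 = (kap * z) ^+ 4 / 16 by field.
rewrite e2 in h2; rewrite e2 e4 in h3; rewrite /symbS.
set s := sinc _ in h1 h2 h3 *; move: h1 h2; rewrite !ler_norml => /andP[a1 a2] /andP[a3 a4].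
have q := sqr_ge0 s; have q1 : s ^+ 2 <= 1 by nra.
split; first by apply/andP; split; lra.
  by apply/andP; split; nra.
move: h3; rewrite ler_norml => /andP[h4 h5].
have -> : kap ^+ 2 * z ^+ 2 / 12 = (kap * z) ^+ 2 / 4 / 3 by field.
by apply/andP; split; lra.
Qed.

Lemma sinc_cont : continuous (@sinc R).
Proof.
apply: (@lip_cont _ _ 1) => x y; rewrite mul1r !sincE /A -intB; [|exact: (@cont_aff R (fun x => cos (1 * x)) _ _ _ (@cont_cosZ R 1))..].
apply: (@le_trans _ _ (`|x - y| * (1 - 0))); last by rewrite subr0 mulr1.
apply: abs_int_le => //.
  by apply: contB; exact: (@cont_aff R (fun x => cos (1 * x)) _ _ _ (@cont_cosZ R 1)).
move=> s /andP[s0 s1]; apply: le_trans (cos_lip _ _) _.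
rewrite !mul1r !add0r (_ : _ - _ = (x - y) * (2 * (s - 2^-1))); last by ring.
rewrite normrM ler_piMr//.
by rewrite ler_norml; apply/andP; split; lra.
Qed.

End sinc_bounds.

(** * Lower bounds for the symbol matrix *)

Section form_bound.
Context {R : realType} {M : nat}.
Variables (k a0 a1 a2 : 'I_M -> R) (sig0 tau delta0 : R).

(** These are the entries of the symmetric matrix symbol of the linear part: [sig0] times the
    identity, minus the sum over m of k_m^2 sinc^2 times the coefficient matrices, in coordinates
    where its value at z = 0 is diag (0, tau). [DD] is the coefficient of z^2 in the degenerate
    direction. *)
Definition L00 z : R := \sum_m k m ^+ 2 * a0 m * symbS (k m) z.
Definition L01 z : R := \sum_m k m ^+ 2 * a1 m * symbS (k m) z.
Definition L11 z : R := tau + \sum_m k m ^+ 2 * a2 m * symbS (k m) z.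
Definition DD : R := \sum_m k m ^+ 4 / 12 * a0 m.

Hypotheses (tau_gt0 : 0 < tau) (delta0_gt0 : 0 < delta0) (DD_gt0 : 0 < DD).
Hypothesis sum0 : \sum_m k m ^+ 2 * a0 m = sig0.
Hypothesis sum1 : \sum_m k m ^+ 2 * a1 m = 0.
Hypothesis sum2 : \sum_m k m ^+ 2 * a2 m = sig0 - tau.
Hypothesis det_ge : forall z,
  delta0 * Num.min `|z| 2 ^+ 2 <= L00 z * L11 z - L01 z ^+ 2.

Lemma sum_abs_le (c F G : 'I_M -> R) (x : R) : 0 <= x -> (forall m, `|F m| <= G m * x) ->
  `|\sum_m c m * F m| <= (\sum_m `|c m| * `|G m|) * x.
Proof.
move=> x0 FG; apply: (le_trans (ler_norm_sum _ _ _)).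
rewrite mulr_suml; apply: ler_sum => m _; rewrite normrM -mulrA ler_wpM2l//.
by apply: le_trans (FG m) _; rewrite ler_wpM2r// ler_norm.
Qed.

Lemma L_bounds : exists C : R, 0 < C /\ forall z,
  [/\ `|L00 z| <= C, `|L11 z| <= C, `|L01 z| <= C * z ^+ 2, `|L11 z - tau| <= C * z ^+ 2 &
      `|L00 z - DD * z ^+ 2| <= C * z ^+ 4].
Proof.
pose s1 (a : 'I_M -> R) := \sum_m `|k m ^+ 2 * a m| * `|1 : R|.
pose s2 (a : 'I_M -> R) := \sum_m `|k m ^+ 2 * a m| * `|2 * k m ^+ 2|.
pose s4 (a : 'I_M -> R) := \sum_m `|k m ^+ 2 * a m| * `|3 * k m ^+ 4|.
have p1 a : 0 <= s1 a by apply: sumr_ge0 => m _; rewrite mulr_ge0.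
have p2 a : 0 <= s2 a by apply: sumr_ge0 => m _; rewrite mulr_ge0.
have p4 a : 0 <= s4 a by apply: sumr_ge0 => m _; rewrite mulr_ge0.
have tp := tau_gt0.
pose C := 1 + tau + s1 a0 + s1 a2 + s2 a1 + s2 a2 + s4 a0.
have [q1 q2 q3 q4 q5] : [/\ s1 a0 <= C, tau + s1 a2 <= C, s2 a1 <= C, s2 a2 <= C & s4 a0 <= C].
  have := p1 a0; have := p1 a2; have := p2 a1; have := p2 a2; have := p4 a0.
  by rewrite /C => *; split => //; lra.
have q6 : 0 < C.
  have := p1 a0; have := p1 a2; have := p2 a1; have := p2 a2; have := p4 a0.
  by rewrite /C => *; lra.
exists C; split => // z.
have z2 := sqr_ge0 z; have z4 : 0 <= z ^+ 4 by rewrite (exprM z 2 2) sqr_ge0.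
have B1 a : `|\sum_m k m ^+ 2 * a m * symbS (k m) z| <= s1 a.
  rewrite -[s1 a]mulr1; apply: sum_abs_le => // m; have [h _ _] := symbS_bounds (k m) z.
  by rewrite mul1r.
have B2 a : `|\sum_m k m ^+ 2 * a m * symbS (k m) z| <= s2 a * z ^+ 2.
  apply: sum_abs_le => // m; have [_ h _] := symbS_bounds (k m) z.
  by rewrite -mulrA -exprMn.
split.
- by apply: le_trans (B1 a0) _.
- rewrite /L11; apply: (le_trans (ler_normD _ _)); rewrite (gtr0_norm tau_gt0).
  by have := B1 a2; lra.
- by apply: le_trans (B2 a1) _; rewrite ler_wpM2r.
- by rewrite /L11 addrAC subrr add0r; apply: le_trans (B2 a2) _; rewrite ler_wpM2r.
- have -> : L00 z - DD * z ^+ 2 =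
      \sum_m k m ^+ 2 * a0 m * (symbS (k m) z - k m ^+ 2 * z ^+ 2 / 12).
    rewrite /L00 /DD mulr_suml -sumrB; apply: eq_bigr => m _; by field.
  apply: (@le_trans _ _ (s4 a0 * z ^+ 4)); last by rewrite ler_wpM2r.
  apply: sum_abs_le => // m; have [_ _ h] := symbS_bounds (k m) z.
  by apply: (le_trans h); rewrite le_eqVlt; apply/orP; left; apply/eqP; ring.
Qed.

Lemma symbS_cont kap : continuous (@symbS R kap).
Proof.
rewrite /symbS; apply: contB; first exact: cont_cst.
apply: contX => z; apply: (@continuous_comp _ _ _ (fun z => kap * z / 2) (@sinc R)); last exact: sinc_cont.
by apply: contM; [apply: contZ; exact: cont_id|exact: cont_cst].
Qed.

Lemma cont_sum (F : 'I_M -> R -> R) : (forall m, continuous (F m)) ->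
  continuous (fun z => \sum_m F m z).
Proof.
move=> cF; have h (r : seq 'I_M) : continuous (fun z => \sum_(m <- r) F m z).
  elim: r => [|m r IH]; first by under eq_fun do rewrite big_nil; exact: cont_cst.
  by under eq_fun do rewrite big_cons; exact: contD.
exact: h.
Qed.

Lemma symbS0 kap : symbS kap (0 : R) = 0.
Proof. by rewrite /symbS mulr0 mul0r /sinc eqxx expr1n subrr. Qed.

(** The trace equals tau > 0 at the origin. If it vanished at some other point of the ray, then L11
    = - L00 there and the determinant could not be positive, against [det_ge]; so it keeps its
    sign. *)
Lemma tr_gt0 z : 0 < L00 z + L11 z.
Proof.
pose g s := L00 (s * z) + L11 (s * z).
have cS m (a : 'I_M -> R) : continuous (fun s : R => k m ^+ 2 * a m * symbS (k m) (s * z)).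
  apply: contZ => s; apply: (@continuous_comp _ _ _ (fun s : R => s * z) (symbS (k m))); last exact: symbS_cont.
  by apply: contM; [exact: cont_id|exact: cont_cst].
have cg : continuous g.
  apply: contD; first by apply: cont_sum => m; exact: cS.
  by apply: contD; [exact: cont_cst|apply: cont_sum => m; exact: cS].
have g0 : g 0 = tau.
  rewrite /g mul0r /L00 /L11 !big1 ?add0r ?addr0// => m _; by rewrite symbS0 mulr0.
have g1 : g 1 = L00 z + L11 z by rewrite /g mul1r.
rewrite ltNge; apply/negP => le0.
have [|s _ gs] := @IVT R g 0 1 0 ler01 (cont_within (A := `[0, 1]%classic) cg).
  by rewrite g0 g1 ge_min le0 orbT le_max ltW.
have w0 : s * z != 0.
  apply/eqP => h; have : g s = tau by rewrite -g0 /g h mul0r.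
  by rewrite gs => h'; have := tau_gt0; rewrite -h' ltxx.
have := det_ge (s * z); have e : L00 (s * z) = - L11 (s * z).
  by apply/eqP; rewrite -addr_eq0; apply/eqP.
rewrite e; have p : 0 < delta0 * Num.min `|s * z| 2 ^+ 2.
  by rewrite mulr_gt0// exprn_gt0// lt_min normr_gt0 w0 ltr0n.
have := sqr_ge0 (L11 (s * z)); have := sqr_ge0 (L01 (s * z)); lra.
Qed.

Definition Lform z (x y : R) : R := L00 z * x ^+ 2 + 2 * L01 z * x * y + L11 z * y ^+ 2.

Lemma Lform_high r : 0 < r -> exists c, 0 < c /\
  forall z x y, r <= `|z| -> c * (x ^+ 2 + y ^+ 2) <= Lform z x y.
Proof.
move=> r0; have [C [C0 hC]] := L_bounds.
have m0 : 0 < Num.min r 2 by rewrite lt_min r0 ltr0n.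
pose c := delta0 * Num.min r 2 ^+ 2 / (2 * C).
exists c; split; first by rewrite divr_gt0 ?mulr_gt0// exprn_gt0.
move=> z x y rz; have t0 := tr_gt0 z; have [b0 b1 _ _ _] := hC z.
have tC : L00 z + L11 z <= 2 * C.
  by have := ler_norm (L00 z); have := ler_norm (L11 z); lra.
have dz : delta0 * Num.min r 2 ^+ 2 <= L00 z * L11 z - L01 z ^+ 2.
  apply: le_trans (det_ge z); rewrite ler_pM2l// lerXn2r// ?nnegrE ?(ltW m0)//.
  by rewrite le_min !ge_min rz lexx orbT.
have xy : 0 <= x ^+ 2 + y ^+ 2 by rewrite addr_ge0// sqr_ge0.
(* Cayley-Hamilton: tr(L) L = L^2 + det(L) *)
have CH : (L00 z + L11 z) * Lform z x y = (L00 z * x + L01 z * y) ^+ 2 +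
  (L01 z * x + L11 z * y) ^+ 2 + (L00 z * L11 z - L01 z ^+ 2) * (x ^+ 2 + y ^+ 2).
  by rewrite /Lform; ring.
have h1 : delta0 * Num.min r 2 ^+ 2 * (x ^+ 2 + y ^+ 2) <= (L00 z + L11 z) * Lform z x y.
  rewrite CH; have := ler_wpM2r xy dz.
  by have := sqr_ge0 (L00 z * x + L01 z * y); have := sqr_ge0 (L01 z * x + L11 z * y); lra.
have f0 : 0 <= Lform z x y.
  rewrite -(pmulr_rge0 _ t0); apply: le_trans h1; rewrite mulr_ge0//.
  by rewrite mulr_ge0 ?sqr_ge0// ltW.
have h2 := le_trans h1 (ler_wpM2r f0 tC).
by rewrite /c mulrAC ler_pdivrMr ?mulr_gt0// [leRHS]mulrC.
Qed.

Lemma Lform_low kp : 0 < kp -> exists r, [/\ 0 < r, r <= 1 &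
  forall z x y, `|z| <= r -> (DD - kp) * z ^+ 2 * x ^+ 2 + tau / 2 * y ^+ 2 <= Lform z x y].
Proof.
move=> kp0; have [C [C0 hC]] := L_bounds; have tp := tau_gt0.
pose A := C + 4 * C ^+ 2 / tau; have A0 : 0 < A.
  have : 0 <= 4 * C ^+ 2 / tau by rewrite divr_ge0 ?mulr_ge0 ?sqr_ge0// ltW.
  by rewrite /A; lra.
pose s := Num.min 1 (Num.min (tau / (4 * C)) (kp / A)).
have s0 : 0 < s.
  by rewrite !lt_min ltr01 !divr_gt0// mulr_gt0.
have s1 : s <= 1 by rewrite ge_min lexx.
have s2 : s <= tau / (4 * C) by rewrite !ge_min lexx !orbT.
have s3 : s <= kp / A by rewrite !ge_min lexx !orbT.
exists s; split=> // z x y zs.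
have [_ _ b1 b2 b3] := hC z.
have zz : z ^+ 2 <= s.
  by rewrite -real_normK ?num_real//; have := normr_ge0 z; nra.
have z0 := sqr_ge0 z.
have C4 : 0 < 4 * C by rewrite mulr_gt0.
rewrite ler_pdivlMr// in s2; rewrite ler_pdivlMr// in s3.
move: b1 b2 b3; rewrite !ler_norml => /andP[b1 b1'] /andP[b2 _] /andP[b3 _].
set l0 := L00 z in b3; set l1 := L01 z in b1 b1'; set l2 := L11 z in b2.
have h0 : 0 <= (l0 - (DD * z ^+ 2 - C * z ^+ 4)) * x ^+ 2 by rewrite mulr_ge0 ?sqr_ge0//; lra.
have Cz : C * z ^+ 2 <= tau / 4.
  have : C * z ^+ 2 <= C * s by rewrite ler_pM2l.
  lra.
have h2 : 0 <= (l2 - 3 / 4 * tau) * y ^+ 2 by rewrite mulr_ge0 ?sqr_ge0//; lra.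
(* Young's inequality for the cross term, with L01 = O(z^2). It costs one tau / 4; the deviation of
   L11 from tau costs another, and tau / 2 is left. *)
have h1 : - (4 * C ^+ 2 / tau * z ^+ 4 * x ^+ 2 + tau / 4 * y ^+ 2) <= 2 * l1 * x * y.
  have e1 : l1 ^+ 2 <= C ^+ 2 * z ^+ 4.
    have : 0 <= (C * z ^+ 2 - l1) * (C * z ^+ 2 + l1) by apply: mulr_ge0; lra.
    rewrite (_ : _ * _ = C ^+ 2 * z ^+ 4 - l1 ^+ 2); first lra.
    by ring.
  have e2 : 0 <= (C ^+ 2 * z ^+ 4 - l1 ^+ 2) * x ^+ 2 by rewrite mulr_ge0 ?sqr_ge0//; lra.
  have e3 := sqr_ge0 (2 * l1 * x + tau / 2 * y).
  have e4 : 0 <= 4 * tau^-1 * ((C ^+ 2 * z ^+ 4 - l1 ^+ 2) * x ^+ 2) + tau^-1 * (2 * l1 * x + tau / 2 * y) ^+ 2.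
    by rewrite addr_ge0// mulr_ge0// ?invr_ge0 ?ltW// mulr_gt0// invr_gt0.
  have : 4 * tau^-1 * ((C ^+ 2 * z ^+ 4 - l1 ^+ 2) * x ^+ 2) + tau^-1 * (2 * l1 * x + tau / 2 * y) ^+ 2 =
    4 * C ^+ 2 / tau * z ^+ 4 * x ^+ 2 + tau / 4 * y ^+ 2 + 2 * l1 * x * y by field; rewrite gt_eqF.
  lra.
have h3 : 0 <= (kp - A * z ^+ 2) * (z ^+ 2 * x ^+ 2).
  apply: mulr_ge0; last by apply: mulr_ge0; exact: sqr_ge0.
  have : A * z ^+ 2 <= A * s by rewrite ler_pM2l.
  lra.
have e5 : (kp - A * z ^+ 2) * (z ^+ 2 * x ^+ 2) =
  kp * z ^+ 2 * x ^+ 2 - C * z ^+ 4 * x ^+ 2 - 4 * C ^+ 2 / tau * z ^+ 4 * x ^+ 2.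
  by rewrite /A; ring.
rewrite e5 in h3; rewrite /Lform -/l0 -/l1 -/l2.
have y2 := sqr_ge0 y; have x2 := sqr_ge0 x.
set u := 4 * C ^+ 2 / tau * z ^+ 4 * x ^+ 2 in h1 h3; set v := C * z ^+ 4 * x ^+ 2 in h3.
have h0' : 0 <= l0 * x ^+ 2 - DD * z ^+ 2 * x ^+ 2 + v.
  by apply: le_trans h0 _; rewrite /v le_eqVlt; apply/orP; left; apply/eqP; ring.
lra.
Qed.

Lemma sin_sqr_le (t : R) : 1 - cos t ^+ 2 <= t ^+ 2.
Proof.
have := sinc_le1 t; rewrite /sinc -sin2cos2 => h.
have [->|t0] := eqVneq t 0; first by rewrite sin0.
move: h; rewrite (negbTE t0) normrM normfV ler_pdivrMr ?normr_gt0// mul1r => h.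
by rewrite -real_normK ?num_real// -[t ^+ 2]real_normK ?num_real// lerXn2r ?nnegrE.
Qed.

Lemma one_sub_sinc (t : R) : (1 - sinc t) ^+ 2 <= 4 /\ (1 - sinc t) ^+ 2 <= 8 * t ^+ 2.
Proof.
have h1 := sinc_le1 t; have h2 := sinc_quad t.
have : `|1 - sinc t| <= 2 by have := ler_normB 1 (sinc t); rewrite normr1; lra.
rewrite distrC in h2; rewrite -real_normK ?num_real//.
set w := `|_| in h2 * => h3; have w0 : 0 <= w by rewrite /w.
by have := sqr_ge0 t; split; nra.
Qed.

(** For |eps z| <= r the difference quotient costs at most (DD - 2 kp) z^2, and the two [K] terms in
    x at most kp z^2 / 2 each, which [Lform_low] covers. For |eps z| > r the left side is at most B
    (x^2 + y^2), while the right side is at least c / eps^2 times the same. *)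
Lemma symbol_lower kp h K : 0 < kp -> 2 * kp <= DD -> 0 < h -> 0 <= K ->
  4 * K * h ^+ 2 <= kp ->
  exists eps0, 0 < eps0 /\ forall eps z x y, 0 < eps -> eps < eps0 ->
  (DD - 2 * kp) * (4 / h ^+ 2) * (1 - cos (h / 2 * z) ^+ 2) * x ^+ 2
  + K * (1 - sinc (h * z / 2)) ^+ 2 * x ^+ 2
  + K * (\sum_m (1 - sinc (k m * eps * z / 2)) ^+ 2) * x ^+ 2 + K * y ^+ 2
  <= (eps ^+ 2)^-1 * Lform (eps * z) x y.
Proof.
move=> kp0 kpD h0 K0 Kh; have tp := tau_gt0.
have [r [r0 r1 hlow]] := Lform_low kp0.
have [c [c0 hhigh]] := Lform_high r0.
pose k2 := \sum_m k m ^+ 2; have k20 : 0 <= k2 by apply: sumr_ge0 => m _; exact: sqr_ge0.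
pose B := (DD - 2 * kp) * (4 / h ^+ 2) + K * 4 + K * (4 * M%:R) + K.
have hh : 0 < h ^+ 2 by rewrite exprn_gt0.
have q0 : 0 <= (DD - 2 * kp) * (4 / h ^+ 2) by rewrite mulr_ge0 ?divr_ge0 ?(ltW hh)//; lra.
have M0 : 0 <= M%:R :> R by exact: ler0n.
have KM : 0 <= K * M%:R by rewrite mulr_ge0.
have B0 : 0 <= B by rewrite /B; lra.
(* For eps < e the four bounds give, in order, eps <= 1, K eps^2 <= tau / 2, B eps^2 <= c and 2 K k2
   eps^2 <= kp / 2. *)
pose e := Num.min 1 (Num.min (tau / (2 * K + 1)) (Num.min (c / (B + 1)) (kp / (8 * K * k2 + 1)))).
have Kk : 0 <= K * k2 by rewrite mulr_ge0.
have e0 : 0 < e by rewrite !lt_min ltr01 !divr_gt0//; lra.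
have e1 : e <= 1 by rewrite ge_min lexx.
have e2 : e <= tau / (2 * K + 1) by rewrite !ge_min lexx !orbT.
have e3 : e <= c / (B + 1) by rewrite !ge_min lexx !orbT.
have e4 : e <= kp / (8 * K * k2 + 1) by rewrite !ge_min lexx !orbT.
rewrite ler_pdivlMr in e2; last lra.
rewrite ler_pdivlMr in e3; last lra.
rewrite ler_pdivlMr in e4; last lra.
exists e; split=> // eps z x y ep epe.
have p2 : 0 < eps ^+ 2 by rewrite exprn_gt0.
have pe : eps ^+ 2 <= e by nra.
have x2 := sqr_ge0 x; have y2 := sqr_ge0 y; have z2 := sqr_ge0 z.
have [i1 i2] := one_sub_sinc (h * z / 2).
have J1 : \sum_m (1 - sinc (k m * eps * z / 2)) ^+ 2 <= 4 * M%:R.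
  rewrite mulr_natr -[X in _ <= _ *+ X]card_ord -sumr_const; apply: ler_sum => m _.
  exact: (one_sub_sinc _).1.
have J2 : \sum_m (1 - sinc (k m * eps * z / 2)) ^+ 2 <= 2 * k2 * eps ^+ 2 * z ^+ 2.
  rewrite /k2 mulr_sumr !mulr_suml; apply: ler_sum => m _.
  by apply: le_trans (one_sub_sinc _).2 _; rewrite le_eqVlt; apply/orP; left; apply/eqP; field.
set s := 1 - cos _ ^+ 2; set i := (1 - sinc (h * z / 2)) ^+ 2 in i1 i2 *; set j := \sum_m _ in J1 J2 *.
have s1 : s <= 1 by rewrite /s; have := sqr_ge0 (cos (h / 2 * z)); lra.
have s2 : 4 / h ^+ 2 * s <= z ^+ 2.
  have := sin_sqr_le (h / 2 * z); rewrite -/s => hs.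
  apply: (@le_trans _ _ (4 / h ^+ 2 * (h / 2 * z) ^+ 2)).
    by rewrite ler_wpM2l// divr_ge0// ltW.
  by rewrite le_eqVlt; apply/orP; left; apply/eqP; field; rewrite gt_eqF.
have ex : 0 <= eps ^+ 2 * x ^+ 2 by apply: mulr_ge0 => //; exact: ltW.
have ey : 0 <= eps ^+ 2 * y ^+ 2 by apply: mulr_ge0 => //; exact: ltW.
have i0 : 0 <= i by exact: sqr_ge0.
have j0 : 0 <= j by apply: sumr_ge0 => m _; exact: sqr_ge0.
rewrite [leRHS]mulrC ler_pdivlMr//.
have [zr|zr] := leP `|eps * z| r.
  apply: le_trans (hlow _ x y zr).
  have u1 : (DD - 2 * kp) * (4 / h ^+ 2) * s <= (DD - 2 * kp) * z ^+ 2.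
    by rewrite -mulrA ler_wpM2l//; lra.
  have u2 : K * i <= kp / 2 * z ^+ 2.
    apply: (@le_trans _ _ (K * (8 * (h * z / 2) ^+ 2))); first by rewrite ler_wpM2l.
    rewrite (_ : K * _ = 4 * K * h ^+ 2 / 2 * z ^+ 2); last by field.
    by rewrite ler_wpM2r//; lra.
  have u3 : K * j <= kp / 2 * z ^+ 2.
    apply: (@le_trans _ _ (K * (2 * k2 * eps ^+ 2 * z ^+ 2))); first by rewrite ler_wpM2l.
    rewrite (_ : K * _ = 2 * (K * k2) * eps ^+ 2 * z ^+ 2); last by ring.
    rewrite ler_wpM2r//.
    have : 2 * (K * k2) * eps ^+ 2 <= 2 * (K * k2) * e by rewrite ler_wpM2l//; lra.
    lra.
  have u4 : K * eps ^+ 2 <= tau / 2.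
    have : K * eps ^+ 2 <= K * e by rewrite ler_wpM2l.
    lra.
  have v1 : ((DD - 2 * kp) * (4 / h ^+ 2) * s + K * i + K * j) * (eps ^+ 2 * x ^+ 2) <=
      ((DD - kp) * z ^+ 2) * (eps ^+ 2 * x ^+ 2).
    by apply: ler_wpM2r => //; lra.
  have v2 : K * eps ^+ 2 * y ^+ 2 <= tau / 2 * y ^+ 2 by rewrite ler_wpM2r.
  rewrite exprMn; lra.
apply: le_trans (hhigh _ x y (ltW zr)).
have v0 : (DD - 2 * kp) * (4 / h ^+ 2) * s <= (DD - 2 * kp) * (4 / h ^+ 2) * 1.
  by rewrite ler_wpM2l.
have v1 : K * i <= K * 4 by rewrite ler_wpM2l.
have v2 : K * j <= K * (4 * M%:R) by rewrite ler_wpM2l.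
have v3 : B * eps ^+ 2 <= c.
  have : B * eps ^+ 2 <= B * e by rewrite ler_wpM2l.
  lra.
have w1 : ((DD - 2 * kp) * (4 / h ^+ 2) * s + K * i + K * j) * (eps ^+ 2 * x ^+ 2) <=
    B * (eps ^+ 2 * x ^+ 2).
  by apply: ler_wpM2r => //; rewrite /B; lra.
have w2 : K * (eps ^+ 2 * y ^+ 2) <= B * (eps ^+ 2 * y ^+ 2).
  by apply: ler_wpM2r => //; rewrite /B; lra.
have w3 : B * eps ^+ 2 * (x ^+ 2 + y ^+ 2) <= c * (x ^+ 2 + y ^+ 2).
  by rewrite ler_wpM2r// addr_ge0.
lra.
Qed.

End form_bound.

Section weighted.
Context {R : realType}.
Implicit Types (f g w p : R -> R) (B h : R).

Lemma L2c_wmul w f B : continuous w -> (forall x, `|w x| <= B) -> L2c f ->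
  L2c (fun x => w x * f x) /\ nrm (fun x => w x * f x) <= B * nrm f.
Proof.
move=> cw wB hf; have [cf _] := hf.
have B0 : 0 <= B by apply: le_trans (wB 0).
apply: nrm_dom => //; first exact: contM.
by move=> x; rewrite normrM ler_wpM2r.
Qed.

Definition wip w f g : R := ip (fun x => w x * f x) g.

Lemma wip_le w f g B : continuous w -> (forall x, `|w x| <= B) -> L2c f -> L2c g ->
  `|wip w f g| <= B * (nrm f * nrm g).
Proof.
move=> cw wB hf hg; have [h1 h2] := L2c_wmul cw wB hf.
apply: (le_trans (ip_le_nrm h1 hg)); rewrite mulrA; apply: ler_wpM2r => //; exact: nrm_ge0.
Qed.

Lemma ipE f g : ip f g = RI (fun x => f x * g x). Proof. by []. Qed.

Lemma wipC w f g : wip w f g = wip w g f.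
Proof. by rewrite /wip /ip; congr RI; apply/funext => x; ring. Qed.

Lemma wipBl w f g p B : continuous w -> (forall x, `|w x| <= B) ->
  L2c f -> L2c g -> L2c p -> wip w (fun x => f x - g x) p = wip w f p - wip w g p.
Proof.
move=> cw wB hf hg hp; rewrite /wip -ipBl//; try exact: (L2c_wmul cw wB _).1.
by congr ip; apply/funext => x; rewrite mulrBr.
Qed.

Lemma wipDl w f g p B : continuous w -> (forall x, `|w x| <= B) ->
  L2c f -> L2c g -> L2c p -> wip w (fun x => f x + g x) p = wip w f p + wip w g p.
Proof.
move=> cw wB hf hg hp; rewrite /wip -ipDl//; try exact: (L2c_wmul cw wB _).1.
by congr ip; apply/funext => x; rewrite mulrDr.
Qed.

Lemma wip_diff w f g B : continuous w -> (forall x, `|w x| <= B) -> L2c f -> L2c g ->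
  `|wip w f f - wip w g g| <= B * (nrm (fun x => f x - g x) * (nrm f + nrm g)).
Proof.
move=> cw wB hf hg; have hd := L2cB hf hg; have hs := L2cD hf hg.
have -> : wip w f f - wip w g g = wip w (fun x => f x - g x) (fun x => f x + g x).
  rewrite (wipBl (B := B))// ![wip w _ (fun x => f x + g x)]wipC !(wipDl (B := B))//.
  by rewrite (wipC w g f); ring.
apply: (le_trans (wip_le cw wB hd hs)).
have B0 : 0 <= B by apply: le_trans (wB 0).
apply: ler_wpM2l => //; apply: ler_wpM2l; [exact: nrm_ge0|exact: nrmD].
Qed.

Definition Dh h f x : R := (f (x + h / 2) - f (x - h / 2)) / h.

(** [Dh] turns cosines into sines and is not a [mult]; the parallelogram law expresses its square
    through the identity and [avg2], which are. *)
Lemma Dh_sqr h p : h != 0 -> L2c p ->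
  L2c (Dh h p) /\
  ip (Dh h p) (Dh h p) = 4 / h ^+ 2 * (ip p p - ip (avg2 (h / 2) p) (avg2 (h / 2) p)).
Proof.
move=> h0 hp; have h1 := L2c_shift (h / 2) hp; have h2 := L2c_shift (- (h / 2)) hp.
have e1 : Dh h p = fun x => h^-1 * (p (x + h / 2) - p (x - h / 2)).
  by apply/funext => x; rewrite /Dh mulrC.
have e2 : avg2 (h / 2) p = fun x => 2^-1 * (p (x + h / 2) + p (x - h / 2)) by [].
rewrite e1 e2; split; first by apply: L2cZ; exact: L2cB.
rewrite !ipZl ?ipZr//; try (by apply: L2cZ; exact: L2cB); try (by apply: L2cZ; exact: L2cD);
  try exact: L2cB; try exact: L2cD.
rewrite (ip_sqrB h1 h2) (ip_sqrD h1 h2) !ip_shift_sqr//.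
by field.
Qed.

Lemma A_shift eta f (c : R) : A eta (fun x => f (x + c)) = fun x => A eta f (x + c).
Proof. by apply/funext => x; apply: eq_int => s _; congr f; ring. Qed.

Lemma Dh_A h eta p : continuous p -> Dh h (A eta p) = A eta (Dh h p).
Proof.
move=> cp; have e1 : Dh h p = fun x => h^-1 * (p (x + h / 2) - p (x - h / 2)).
  by apply/funext => x; rewrite /Dh mulrC.
have c1 := cont_shift (c := h / 2) cp; have c2 := cont_shift (c := - (h / 2)) cp.
rewrite e1 AZ; last exact: contB.
by rewrite AB// !A_shift; apply/funext => x; rewrite /Dh mulrC.
Qed.

End weighted.

Opaque nrm ip A.

(** * Coercivity of the second variation on a subspace of codimension one *)

Section coercivity.
Context {R : realType} {M : nat}.
Variables (k a0 a1 a2 b0 b1 b2 : 'I_M -> R) (sig0 tau delta0 : R).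
Hypotheses (tau_gt0 : 0 < tau) (delta0_gt0 : 0 < delta0) (DD_gt0 : 0 < DD k a0).
Hypothesis sum0 : \sum_m k m ^+ 2 * a0 m = sig0.
Hypothesis sum1 : \sum_m k m ^+ 2 * a1 m = 0.
Hypothesis sum2 : \sum_m k m ^+ 2 * a2 m = sig0 - tau.
Hypothesis det_ge : forall z,
  delta0 * Num.min `|z| 2 ^+ 2 <= L00 k a0 z * L11 k a2 tau z - L01 k a1 z ^+ 2.

Implicit Types (p q f g : R -> R) (eps : R).

Definition Am eps m := A (k m * eps) : (R -> R) -> R -> R.

Definition Bform eps p q : R := sig0 * (ip p p + ip q q) -
  \sum_m k m ^+ 2 * (a0 m * ip (Am eps m p) (Am eps m p)
    + 2 * a1 m * ip (Am eps m p) (Am eps m q) + a2 m * ip (Am eps m q) (Am eps m q)).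

Opaque Dh.

(** The right side minus the left side is the form of the list [l] in the proof; [symbol_lower]
    makes its symbol nonnegative, and [positivity] transfers this to functions. *)
Lemma form_lower kp h K : 0 < kp -> 2 * kp <= DD k a0 -> 0 < h -> 0 <= K ->
  4 * K * h ^+ 2 <= kp ->
  exists eps0, 0 < eps0 /\ forall eps p q, 0 < eps -> eps < eps0 ->
  L2c p -> L2c q -> even p -> even q ->
  (DD k a0 - 2 * kp) * ip (Dh h p) (Dh h p)
  + K * nrm (fun x => p x - A h p x) ^+ 2
  + K * (\sum_m nrm (fun x => p x - Am eps m p x) ^+ 2) + K * nrm q ^+ 2
  <= (eps ^+ 2)^-1 * Bform eps p q.
Proof.
move=> kp0 kpD h0 K0 Kh.
have [eps0 [e0 hs]] := symbol_lower tau_gt0 delta0_gt0 det_ge kp0 kpD h0 K0 Kh.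
exists eps0; split=> // eps p q ep epe hp hq evp evq.
pose c := (DD k a0 - 2 * kp) * (4 / h ^+ 2); pose e := (eps ^+ 2)^-1.
(* By [Dh_sqr] the difference quotient contributes c times the identity minus [avg2] squared: hence
   - c in [t_id] and c in [t_av]. *)
pose t_id := Term (@mult_id R) (e * sig0 - c) 0 (e * sig0 - K).
pose t_av := Term (mult_avg2 (h / 2)) c 0 0.
pose t_h := Term (mult_IA h) (- K) 0 0.
pose tA m := Term (mult_A (k m * eps)) (- (e * (k m ^+ 2 * a0 m))) (- (e * (k m ^+ 2 * a1 m)))
  (- (e * (k m ^+ 2 * a2 m))).
pose tB m := Term (mult_IA (k m * eps)) (- K) 0 0.
pose l := [:: t_id; t_av; t_h] ++ map tA (index_enum 'I_M) ++ map tB (index_enum 'I_M).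
have sumE (F : term -> R) : \sum_(t <- l) F t =
    F t_id + F t_av + F t_h + \sum_m F (tA m) + \sum_m F (tB m).
  by rewrite /l !big_cat/= !big_map !big_cons big_nil; ring.
have pos z x y : 0 <= \sum_(t <- l) tsymb t z x y.
  rewrite sumE /tsymb /=.
  have := hs eps z x y ep epe; rewrite -/c -/e.
  have -> : \sum_m sinc (k m * eps * z / 2) ^+ 2 * (- (e * (k m ^+ 2 * a0 m)) * x ^+ 2 +
      2 * - (e * (k m ^+ 2 * a1 m)) * x * y + - (e * (k m ^+ 2 * a2 m)) * y ^+ 2) =
      e * Lform k a0 a1 a2 tau (eps * z) x y - e * sig0 * (x ^+ 2 + y ^+ 2).
    rewrite /Lform /L00 /L01 /L11.
    have e00 : \sum_m k m ^+ 2 * a0 m * symbS (k m) (eps * z) =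
      sig0 - \sum_m k m ^+ 2 * a0 m * sinc (k m * eps * z / 2) ^+ 2.
      by rewrite -sum0 -sumrB; apply: eq_bigr => m _; rewrite /symbS mulrA; ring.
    have e01 : \sum_m k m ^+ 2 * a1 m * symbS (k m) (eps * z) =
      0 - \sum_m k m ^+ 2 * a1 m * sinc (k m * eps * z / 2) ^+ 2.
      by rewrite -[X in X - _]sum1 -sumrB; apply: eq_bigr => m _; rewrite /symbS mulrA; ring.
    have e11 : \sum_m k m ^+ 2 * a2 m * symbS (k m) (eps * z) =
      sig0 - tau - \sum_m k m ^+ 2 * a2 m * sinc (k m * eps * z / 2) ^+ 2.
      by rewrite -sum2 -sumrB; apply: eq_bigr => m _; rewrite /symbS mulrA; ring.
    rewrite e00 e01 e11.
    transitivity (- e * ((\sum_m k m ^+ 2 * a0 m * sinc (k m * eps * z / 2) ^+ 2) * x ^+ 2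
      + 2 * (\sum_m k m ^+ 2 * a1 m * sinc (k m * eps * z / 2) ^+ 2) * x * y
      + (\sum_m k m ^+ 2 * a2 m * sinc (k m * eps * z / 2) ^+ 2) * y ^+ 2)); last by ring.
    rewrite !(mulr_suml, mulr_sumr) -!big_split/= mulr_sumr.
    by apply: eq_bigr => m _; ring.
  have -> : \sum_m (1 - sinc (k m * eps * z / 2)) ^+ 2 * (- K * x ^+ 2 + 2 * 0 * x * y + 0 * y ^+ 2) =
      - (K * (\sum_m (1 - sinc (k m * eps * z / 2)) ^+ 2) * x ^+ 2).
    rewrite mulr_sumr mulr_suml -sumrN; apply: eq_bigr => m _; ring.
  set S1 := \sum_m _; set S2 := Lform _ _ _ _ _ _ _ _; lra.
have := positivity hp hq evp evq pos; rewrite sumE /tform /=.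
have h1 := (mult_L2 (mult_avg2 (h / 2)) hp).1.
have -> : \sum_m (- (e * (k m ^+ 2 * a0 m)) * ip (A (k m * eps) p) (A (k m * eps) p) +
    2 * - (e * (k m ^+ 2 * a1 m)) * ip (A (k m * eps) p) (A (k m * eps) q) +
    - (e * (k m ^+ 2 * a2 m)) * ip (A (k m * eps) q) (A (k m * eps) q)) =
    e * Bform eps p q - e * sig0 * (ip p p + ip q q).
  rewrite /Bform mulrBr mulrA addrAC subrr add0r mulr_sumr -sumrN.
  apply: eq_bigr => m _; rewrite /Am.
  by move: (ip (A _ p) (A _ p)) (ip (A _ p) (A _ q)) (ip (A _ q) (A _ q)) => u v w; ring.
have -> : \sum_m (- K * ip (fun x => p x - A (k m * eps) p x) (fun x => p x - A (k m * eps) p x)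
     + 2 * 0 * ip (fun x => p x - A (k m * eps) p x) (fun x => q x - A (k m * eps) q x)
     + 0 * ip (fun x => q x - A (k m * eps) q x) (fun x => q x - A (k m * eps) q x)) =
    - (K * (\sum_m nrm (fun x => p x - Am eps m p x) ^+ 2)).
  rewrite mulr_sumr -sumrN; apply: eq_bigr => m _; rewrite nrm_sqr /Am.
  rewrite mulr0 !mul0r !addr0; exact: mulNr.
have hn : h != 0 by rewrite gt_eqF.
have gE := nrm_sqr (fun x => p x - A h p x); have qE := nrm_sqr q.
have [_ dE] := Dh_sqr hn hp.
rewrite [X in _ + K * X + K * (\sum_m _) + _ <= _]gE.
rewrite qE.
rewrite dE.
rewrite [_ * (4 / _ * _)]mulrA.
rewrite -/c.
rewrite -/e.
set S1 := \sum_m _; set S2 := Bform _ _ _; set P := ip p p; set Q := ip q q.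
set V := ip (avg2 _ _) _; set G := ip (fun x => p x - A h p x) _.
lra.
Qed.

Transparent Dh.

(** In the coordinates of the final section 1 / DD and nn / DD are the constants d1 and d2 of the
    theorem ([d1_DD], [d2_nn]). *)
Definition nn : R := \sum_m k m ^+ 3 / 2 * b0 m.
Definition dd1 : R := 1 / DD k a0.
Definition dd2 : R := nn / DD k a0.
Definition Wst : R -> R := Ws dd1 dd2.

Hypothesis nn_neq0 : nn != 0.

Lemma dd1_gt0 : 0 < dd1. Proof. exact: divr_gt0. Qed.

Lemma dd2_neq0 : dd2 != 0.
Proof. by rewrite mulf_neq0// invr_eq0 gt_eqF. Qed.

Definition BW : R := `|3 * dd1 / (2 * dd2)|.

Lemma Wst_bound x : `|Wst x| <= BW.
Proof.
rewrite /Wst /Ws /BW normrM ler_piMr// gtr0_norm; first exact: S_le1.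
exact: S_gt0.
Qed.

Lemma Wst_cont : continuous Wst. Proof. exact: cont_Ws. Qed.

Definition Cub eps p q : R := \sum_m k m ^+ 3 *
  (b0 m * wip Wst (Am eps m p) (Am eps m p) + 2 * b1 m * wip Wst (Am eps m p) (Am eps m q)
   + b2 m * wip Wst (Am eps m q) (Am eps m q)).

Definition hess_quad eps p q : R :=
  (eps ^+ 2)^-1 * Bform eps p q + (ip p p + ip q q) - Cub eps p q.

Lemma Cub_arith (u v w x y z B N t : R) : 0 <= B -> 0 <= x -> 0 <= y -> 0 <= z ->
  0 <= N -> 0 <= t ->
  `|u| <= x * (B * (6 * N)) -> `|v| <= 2 * y * (B * N) -> `|w| <= z * (B * t) ->
  `|u + v + w| <= B * (6 * x + 2 * y + z) * (N + t).
Proof.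
move=> B0 x0 y0 z0 N0 t0 hu hv hw; have := ler_normD (u + v) w; have := ler_normD u v.
have z1 : 0 <= x * (B * t) by rewrite mulr_ge0// mulr_ge0.
have z2 : 0 <= y * (B * t) by rewrite mulr_ge0// mulr_ge0.
have z3 : 0 <= z * (B * N) by rewrite mulr_ge0// mulr_ge0.
lra.
Qed.

(** [Cub] is the contribution of the quadratic force terms to the second variation at (W, 0). Up to
    errors carrying a factor Z only its [b0] part remains, and there all averages of p may be
    replaced by one function phi. *)
Lemma Cub_diff : exists C, 0 <= C /\ forall eps p q phi Z, L2c p -> L2c q -> L2c phi ->
  nrm phi <= nrm p -> nrm q <= Z -> (forall m, nrm (fun x => Am eps m p x - phi x) <= 3 * Z) ->
  `|Cub eps p q - 2 * nn * wip Wst phi phi| <= C * (nrm p * Z + Z ^+ 2).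
Proof.
pose c m := `|k m ^+ 3| * (BW * (6 * `|b0 m| + 2 * `|b1 m| + `|b2 m|)).
have BW0 : 0 <= BW by exact: normr_ge0.
have c0 m : 0 <= c m by rewrite mulr_ge0// mulr_ge0// !addr_ge0// mulr_ge0.
exists (\sum_m c m); split; first by apply: sumr_ge0.
move=> eps p q phi Z hp hq hphi le1 le2 le3.
have X0 := nrm_ge0 p; have Z0 : 0 <= Z by exact: le_trans (nrm_ge0 q) le2.
have -> : Cub eps p q - 2 * nn * wip Wst phi phi = \sum_m k m ^+ 3 *
  (b0 m * (wip Wst (Am eps m p) (Am eps m p) - wip Wst phi phi)
   + 2 * b1 m * wip Wst (Am eps m p) (Am eps m q) + b2 m * wip Wst (Am eps m q) (Am eps m q)).
  rewrite /Cub /nn mulr_sumr mulr_suml -sumrB; apply: eq_bigr => m _.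
  by move: (wip _ _ _) (wip _ _ _) (wip _ _ _) (wip _ _ _) => u v w z; field.
apply: (le_trans (ler_norm_sum _ _ _)); rewrite mulr_suml; apply: ler_sum => m _.
rewrite normrM (_ : c m * _ = `|k m ^+ 3| * (BW * (6 * `|b0 m| + 2 * `|b1 m| + `|b2 m|) * (nrm p * Z + Z ^+ 2))); last exact: esym (mulrA _ _ _).
apply: ler_wpM2l => //.
have hAp := L2c_A (k m * eps) hp; have hAq := L2c_A (k m * eps) hq.
have nAp := nrm_A (k m * eps) hp; have nAq := nrm_A (k m * eps) hq.
rewrite -/(Am eps m p) -/(Am eps m q) in hAp hAq nAp nAq *.
have h1 := wip_diff Wst_cont Wst_bound hAp hphi.
have h2 := wip_le Wst_cont Wst_bound hAp hAq.
have h3 := wip_le Wst_cont Wst_bound hAq hAq.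
have n1 := nrm_ge0 (Am eps m p); have n2 := nrm_ge0 (Am eps m q); have n3 := nrm_ge0 phi.
have {}h1 : `|wip Wst (Am eps m p) (Am eps m p) - wip Wst phi phi| <= BW * (6 * (nrm p * Z)).
  apply: le_trans h1 _; apply: ler_wpM2l => //.
  apply: (@le_trans _ _ (3 * Z * (2 * nrm p))); last by rewrite le_eqVlt; apply/orP; left; apply/eqP; ring.
  have n5 : nrm (Am eps m p) + nrm phi <= 2 * nrm p by rewrite mulr_natl mulr2n; exact: (lerD nAp le1).
  exact: (ler_pM (nrm_ge0 _) (addr_ge0 n1 n3) (le3 m) n5).
have {}h2 : `|wip Wst (Am eps m p) (Am eps m q)| <= BW * (nrm p * Z).
  apply: le_trans h2 _; apply: ler_wpM2l => //.
  exact: (ler_pM n1 n2 nAp (le_trans nAq le2)).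
have {}h3 : `|wip Wst (Am eps m q) (Am eps m q)| <= BW * Z ^+ 2.
  apply: le_trans h3 _; apply: ler_wpM2l => //; rewrite expr2.
  have nAZ := le_trans nAq le2; exact: (ler_pM n2 n2 nAZ nAZ).
move: h1 h2 h3; set u := wip Wst _ _ - _; set v := wip Wst _ _; set w := wip Wst _ _ => h1 h2 h3.
have XZ : 0 <= nrm p * Z by rewrite mulr_ge0.
have ZZ : 0 <= Z ^+ 2 by rewrite sqr_ge0.
have k1 : `|b0 m * u| <= `|b0 m| * (BW * (6 * (nrm p * Z))) by rewrite normrM ler_wpM2l.
have k2 : `|2 * b1 m * v| <= 2 * `|b1 m| * (BW * (nrm p * Z)).
  by rewrite normrM (normrM 2) (ger0_norm (ler0n _ 2)) ler_wpM2l// mulr_ge0.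
have k3 : `|b2 m * w| <= `|b2 m| * (BW * Z ^+ 2) by rewrite normrM ler_wpM2l.
exact: (Cub_arith BW0 (normr_ge0 _) (normr_ge0 _) (normr_ge0 _) XZ ZZ k1 k2 k3).
Qed.

(** The double average phi of p at a fixed scale h is C^1, so [poschl_teller] applies to it whatever
    eps is. The distance from p to phi, the distances from p to its averages [Am] and the size of q
    are paid for by the large multiple K of their squares in [form_lower]. *)
Theorem coercive : exists h, 0 < h /\ exists eps0, 0 < eps0 /\ forall eps p q,
  0 < eps -> eps < eps0 -> L2c p -> L2c q -> even p -> even q ->
  A h (A h p) (y0 dd1) = 0 -> 1 / 1000 * (ip p p + ip q q) <= hess_quad eps p q.
Proof.
have [C [C0 hC]] := Cub_diff.
have Dp := DD_gt0; have [D DE] : exists D : R, D = DD k a0 by eexists.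
rewrite -DE in Dp.
(* K absorbs the error of [Cub_diff]: 250 C^2 comes from Young's inequality with weight 1/1000 on
   the squared norm of p, and C from the term Z^2. *)
pose K := 250 * C ^+ 2 + C + 1.
have K1 : 1 <= K by rewrite /K; have := sqr_ge0 C; lra.
have K0 : 0 <= K by lra.
(* The loss of 2 kp leaves 1999/2000 of D, a small deficit compared with the gap 1/200 that
   [poschl_teller] provides below. *)
pose kp := D / 4000; have kp0 : 0 < kp by rewrite /kp; lra.
pose h := Num.min 1 (kp / (4 * K)).
have q0 : 0 < kp / (4 * K) by rewrite divr_gt0// mulr_gt0//; lra.
have h0 : 0 < h by rewrite lt_min ltr01.
have h1 : h <= 1 by rewrite ge_min lexx.
have h2 : h <= kp / (4 * K) by rewrite ge_min lexx orbT.
have Kh : 4 * K * h ^+ 2 <= kp.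
  have K4 : 0 < 4 * K by lra.
  rewrite ler_pdivlMr// in h2; have : h ^+ 2 <= h by nra.
  move=> hh; apply: le_trans h2; rewrite mulrC; apply: ler_wpM2r => //; exact: ltW.
have kpD : 2 * kp <= DD k a0 by rewrite -DE /kp; lra.
exists h; split => //.
have [eps0 [e0 hF]] := form_lower kp0 kpD h0 K0 Kh.
exists eps0; split => // eps p q ep epe hp hq evp evq phi0.
have {hF} := hF eps p q ep epe hp hq evp evq; rewrite -DE.
set E2 := \sum_m _; set G := nrm (fun x => p x - A h p x).
set Phi1' := ip (Dh h p) _; set eB := _ * Bform _ _ _ => hF.
have [cp _] := hp.
have hg := L2c_A h hp; have hphi := L2c_A h hg; have [cg _] := hg.
pose phi := A h (A h p).
have hn : h != 0 by rewrite gt_eqF.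
have dphi x : der phi x (Dh h (A h p) x) by exact: A_deriv.
have [hD _] := Dh_sqr hn hp.
have [hphi1 _] := Dh_sqr hn hg; have [cphi1 _] := hphi1.
have Phi1le : ip (Dh h (A h p)) (Dh h (A h p)) <= Phi1'.
  by rewrite Dh_A//; exact: (L2c_A_le h hD).2.
have evphi : even phi by apply: A_even => //; exact: A_even.
have := poschl_teller dd1_gt0 dphi cphi1 hphi hphi1 evphi phi0.
set Phi1 := ip (Dh h (A h p)) _ in Phi1le *; set Phi := ip phi phi.
rewrite (wb_sqr dd1_gt0).
pose SS := wip (S dd1) phi phi.
have S0 x := ltW (S_gt0 dd1 x); have S1 := S_le1 dd1.
have Sb x : `|S dd1 x| <= 1 by rewrite ger0_norm.
have iphi2 : integr (fun x => phi x * phi x) by apply: L2c_mul.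
have iS : integr (fun x => S dd1 x * phi x * phi x).
  by apply: L2c_mul => //; exact: (L2c_wmul (@cont_S R dd1) Sb hphi).1.
have SS0 : 0 <= SS by rewrite /SS /wip ipE; apply: RI_ge0 => x; rewrite -mulrA -expr2 mulr_ge0// sqr_ge0.
have SSle : SS <= Phi.
  rewrite /SS /Phi /wip !ipE; apply: le_RI => // x; rewrite -mulrA ler_piMl//; rewrite -expr2; exact: sqr_ge0.
have -> : RI (fun x => dd1 / 4 * (4 - 12 * S dd1 x) * phi x ^+ 2) = dd1 * (Phi - 3 * SS).
  rewrite /Phi /SS /wip !ipE -[3 * _]RIZ// -RIB//; last exact: integrZ.
  rewrite -RIZ; last by apply: integrB => //; exact: integrZ.
  by congr RI; apply/funext => x; field.
have dD : D * dd1 = 1 by rewrite /dd1 -DE; field; rewrite gt_eqF.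
move=> hPT.
have {}hPT : Phi / 200 <= D * Phi1 + (Phi - 3 * SS).
  have := ler_wpM2l (ltW Dp) hPT.
  have -> : D * (Phi1 + dd1 * (Phi - 3 * SS)) = D * Phi1 + (Phi - 3 * SS).
    by rewrite mulrDr [D * (dd1 * _)]mulrA dD mul1r.
  have -> : D * (dd1 / 4 / 50 * Phi) = D * dd1 * Phi / 200 by field.
  by rewrite dD mul1r.
have Phi_le : Phi <= nrm p ^+ 2.
  rewrite nrm_sqr; apply: le_trans (L2c_A_le h hp).2; exact: (L2c_A_le h hg).2.
have E20 : 0 <= E2 by apply: sumr_ge0 => m _; exact: sqr_ge0.
have G20 := sqr_ge0 G; have Y20 := sqr_ge0 (nrm q).
have [Z ZE] : exists Z : R, Z = Num.sqrt (G ^+ 2 + E2 + nrm q ^+ 2) by eexists.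
have Z0 : 0 <= Z by rewrite ZE sqrtr_ge0.
have Z2 : Z ^+ 2 = G ^+ 2 + E2 + nrm q ^+ 2 by rewrite ZE sqr_sqrtr//; lra.
have le_Z u : 0 <= u -> u ^+ 2 <= Z ^+ 2 -> u <= Z.
  by move=> u0; rewrite ler_pXn2r// nnegrE.
have YZ : nrm q <= Z by apply: le_Z; [exact: nrm_ge0|lra].
have GZ : G <= Z by apply: le_Z; [exact: nrm_ge0|lra].
have EZ m : nrm (fun x => p x - Am eps m p x) <= Z.
  apply: le_Z; first exact: nrm_ge0.
  have : nrm (fun x => p x - Am eps m p x) ^+ 2 <= E2.
    rewrite /E2 (bigD1 m)//= lerDl; apply: sumr_ge0 => i _; exact: sqr_ge0.
  lra.
have EphiZ m : nrm (fun x => Am eps m p x - phi x) <= 3 * Z.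
  have hA := L2c_A (k m * eps) hp.
  (* The path from [Am eps m p] to phi leads through p and [A h p], with three steps of size at most
     Z. *)
  have e1 : (fun x => Am eps m p x - phi x) = (fun x =>
    ((p x - A h p x) + (A h p x - phi x)) - (p x - Am eps m p x)).
    by apply/funext => x; ring.
  have l1 := L2cB hp hg; have l2 := L2cB hg hphi; have l3 := L2cB hp hA.
  have e2 : nrm (fun x => A h p x - phi x) <= G.
    have [cg' _] := hg; rewrite /phi -AB//; exact: nrm_A.
  rewrite e1; apply: (le_trans (nrmB (L2cD l1 l2) l3)).
  have eZ := EZ m; have nD := nrmD l1 l2; apply: (le_trans (lerD nD eZ)).
  have e2' := le_trans e2 GZ; apply: (@le_trans _ _ (Z + Z + Z)).
    exact: (lerD (lerD GZ e2') (lexx _)).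
  by rewrite le_eqVlt; apply/orP; left; apply/eqP; ring.
have nphi : nrm phi <= nrm p by apply: le_trans (nrm_A h hg) (nrm_A h hp).
have := hC eps p q phi Z hp hq hphi nphi YZ EphiZ.
have -> : 2 * nn * wip Wst phi phi = 3 * SS.
  rewrite /Wst /Ws /SS; have e1 : (fun x => 3 * dd1 / (2 * dd2) * S dd1 x * phi x) =
      fun x => 3 * dd1 / (2 * dd2) * (S dd1 x * phi x) by apply/funext => x; rewrite mulrA.
  rewrite /wip e1 ipZl//; last exact: (L2c_wmul (@cont_S R dd1) Sb hphi).1.
  rewrite mulrA; congr (_ * _); rewrite /dd2 /dd1 -DE; field.
  by rewrite nn_neq0 gt_eqF.
rewrite ler_norml => /andP[_ hCub].
rewrite /hess_quad -/eB -!nrm_sqr.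
have XZ : C * (nrm p * Z) <= 1 / 1000 * nrm p ^+ 2 + 250 * C ^+ 2 * Z ^+ 2.
  have := sqr_ge0 (nrm p - 500 * C * Z); lra.
have l1 : D * Phi1 <= D * Phi1' by rewrite ler_pM2l.
have P0 : 0 <= Phi1 by exact: ip_ge0.
have KE : K * Z ^+ 2 = 250 * C ^+ 2 * Z ^+ 2 + C * Z ^+ 2 + Z ^+ 2 by rewrite /K; ring.
have hF' : 1999 / 2000 * (D * Phi1') + K * Z ^+ 2 <= eB.
  apply: le_trans hF; rewrite Z2 /kp; lra.
rewrite KE in hF'.
set X2 := nrm p ^+ 2 in Phi_le XZ *; set Y2 := nrm q ^+ 2 in Y20 *.
have Zp := sqr_ge0 Z.
set a := D * Phi1 in l1 hPT; set b := D * Phi1' in l1 hF'; set c := C * (nrm p * Z) in XZ.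
have hCub' : Cub eps p q <= 3 * SS + c + C * Z ^+ 2 by rewrite /c; lra.
lra.
Qed.

End coercivity.

(** * The approximate solution and its residual *)

Section majorant.
Context {R : realType}.
Variable d1 : R.
Hypothesis d1_gt0 : 0 < d1.
Implicit Types (f g : R -> R) (F G : R -> R -> R) (n : nat).

Lemma S_shift_n n x y : `|y| <= n%:R ->
  S d1 (x + y) <= (expR (2 * wb d1) ^+ 3) ^+ n * S d1 x.
Proof.
elim: n x y => [|n IH] x y yn.
  have -> : y = 0 by apply/eqP; rewrite -normr_le0.
  by rewrite addr0 mul1r.
have n0 : n.+1%:R != 0 :> R by rewrite pnatr_eq0.
have n1 : 0 < n.+1%:R :> R by rewrite ltr0n.
pose z := y / n.+1%:R.
have z1 : `|z| <= 1 by rewrite normrM normfV (ger0_norm (ltW n1)) ler_pdivrMr// mul1r.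
have zn : `|n%:R * z| <= n%:R.
  by rewrite normrM ger0_norm// -[X in _ <= X]mulr1 ler_wpM2l.
have yE : y = n%:R * z + z.
  by rewrite -[X in _ + X]mul1r -mulrDl natr1 /z mulrC -mulrA mulVf// mulr1.
rewrite {1}yE addrA exprS -mulrA; apply: (le_trans (S_shift d1_gt0 _ z1)).
apply: ler_wpM2l (IH _ _ zn); apply: exprn_ge0; exact: ltW (expR_gt0 _).
Qed.

Lemma S_shift_le (K : R) : exists B, 0 <= B /\ forall x y, `|y| <= K -> S d1 (x + y) <= B * S d1 x.
Proof.
pose n := (Num.truncn `|K|).+1.
exists ((expR (2 * wb d1) ^+ 3) ^+ n); split.
  by do 2 apply: exprn_ge0; exact: ltW (expR_gt0 _).
move=> x y yK; apply: S_shift_n; apply: (le_trans yK); apply: (le_trans (ler_norm _)).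
by apply: ltW; rewrite /n truncnS_gt.
Qed.

(* [big n F] reads: [F eps = O(eps^n)] as [eps -> 0], uniformly relative to [sech^2]. *)
Definition big n F := (forall eps, continuous (F eps)) /\
  exists C, 0 <= C /\ forall eps x, 0 < eps -> eps <= 1 ->
    `|F eps x| <= C * eps ^+ n * S d1 x.

Let S0 x : 0 <= S d1 x. Proof. exact: ltW (S_gt0 d1 x). Qed.

Lemma big_ext n F G : (forall eps x, 0 < eps -> eps <= 1 -> F eps x = G eps x) ->
  (forall eps, continuous (G eps)) -> big n F -> big n G.
Proof.
move=> e cG [_ [C [C0 h]]]; split => //; exists C; split => // eps x e0 e1.
by rewrite -e// h.
Qed.

Lemma bigD n F G : big n F -> big n G -> big n (fun eps x => F eps x + G eps x).
Proof.
move=> [cF [C [C0 h]]] [cG [D [D0 h']]]; split; first by move=> eps; exact: contD.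
exists (C + D); split; first exact: addr_ge0.
move=> eps x e0 e1; apply: (le_trans (ler_normD _ _)); rewrite !mulrDl.
by apply: lerD; [exact: h|exact: h'].
Qed.

Lemma bigZ (c : R) n F : big n F -> big n (fun eps x => c * F eps x).
Proof.
move=> [cF [C [C0 h]]]; split; first by move=> eps; exact: (contZ (c := c)).
exists (`|c| * C); split; first exact: mulr_ge0.
move=> eps x e0 e1; rewrite normrM -!mulrA; apply: ler_wpM2l => //.
by rewrite mulrA; exact: h.
Qed.

Lemma bigB n F G : big n F -> big n G -> big n (fun eps x => F eps x - G eps x).
Proof.
move=> hF hG; have := bigD hF (bigZ (-1) hG).
by apply: big_ext => [eps x _ _|eps]; [rewrite mulN1r|exact: contB (hF.1 eps) (hG.1 eps)].
Qed.

Lemma bigM n m F G : big n F -> big m G -> big (n + m) (fun eps x => F eps x * G eps x).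
Proof.
move=> [cF [C [C0 h]]] [cG [D [D0 h']]]; split; first by move=> eps; exact: contM.
exists (C * D); split; first exact: mulr_ge0.
move=> eps x e0 e1; rewrite normrM.
have en i : 0 <= eps ^+ i by apply: exprn_ge0; exact: ltW.
apply: (@le_trans _ _ (C * eps ^+ n * S d1 x * (D * eps ^+ m * S d1 x))).
  by apply: ler_pM => //; [exact: h|exact: h'].
rewrite exprD.
have -> : C * eps ^+ n * S d1 x * (D * eps ^+ m * S d1 x) =
  C * D * (eps ^+ n * eps ^+ m) * S d1 x * S d1 x by ring.
by rewrite ler_piMr ?S_le1//; do !apply: mulr_ge0 => //.
Qed.

Lemma big_eps i n F : big n F -> big (i + n) (fun eps x => eps ^+ i * F eps x).
Proof.
move=> [cF [C [C0 h]]]; split; first by move=> eps; exact: (contZ (c := eps ^+ i)).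
exists C; split => // eps x e0 e1.
have en : 0 <= eps ^+ i by apply: exprn_ge0; exact: ltW.
rewrite normrM (ger0_norm en) exprD.
have -> : C * (eps ^+ i * eps ^+ n) * S d1 x = eps ^+ i * (C * eps ^+ n * S d1 x) by ring.
by apply: ler_wpM2l => //; exact: h.
Qed.

Lemma big_div i n F : big (i + n) F -> big n (fun eps x => (eps ^+ i)^-1 * F eps x).
Proof.
move=> [cF [C [C0 h]]]; split; first by move=> eps; exact: (contZ (c := (eps ^+ i)^-1)).
exists C; split => // eps x e0 e1.
have en : 0 < eps ^+ i by exact: exprn_gt0.
rewrite normrM ger0_norm ?invr_ge0 ?(ltW en)// mulrC ler_pdivrMr//.
have -> : C * eps ^+ n * S d1 x * eps ^+ i = C * (eps ^+ i * eps ^+ n) * S d1 x by ring.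
by rewrite -exprD; exact: h.
Qed.

Lemma big_le n m F : (n <= m)%N -> big m F -> big n F.
Proof.
move=> nm [cF [C [C0 h]]]; split => //; exists C; split => // eps x e0 e1.
apply: (le_trans (h _ _ e0 e1)); rewrite ler_wpM2r// ler_wpM2l//.
by rewrite ler_wiXn2l// ltW.
Qed.

(** For eps <= 1 the averaging interval has length at most |kk|, and by [S_shift_le] the values of
    [S] there are comparable with [S] at the centre. *)
Lemma big_A (kk : R) n F : big n F -> big n (fun eps => A (kk * eps) (F eps)).
Proof.
move=> [cF [C [C0 h]]]; split; first by move=> eps; exact: (@A_cont R _ _ (cF eps)).
have [B [B0 hB]] := S_shift_le `|kk|.
exists (C * B); split; first exact: mulr_ge0.
move=> eps x e0 e1; apply: A_bound => // s hs.
apply: (le_trans (h _ _ e0 e1)).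
have -> : C * B * eps ^+ n * S d1 x = C * eps ^+ n * (B * S d1 x) by ring.
apply: ler_wpM2l; first by apply: mulr_ge0 => //; apply: exprn_ge0; exact: ltW.
apply: hB; apply: (le_trans hs); rewrite normrM ler_piMr//.
by rewrite ger0_norm// ltW.
Qed.

Lemma big_sum (I : finType) n (F : I -> R -> R -> R) :
  (forall i, big n (F i)) -> big n (fun eps x => \sum_i F i eps x).
Proof.
move=> h; elim: (index_enum I) => [|i s IH].
  split; first by move=> eps; under eq_fun do rewrite big_nil; exact: cont_cst.
  by exists 0; split => // eps x _ _; rewrite big_nil normr0 !mul0r.
apply: big_ext (bigD (h i) IH) => [eps x _ _|eps]; first by rewrite big_cons.
by under eq_fun do rewrite big_cons; exact: contD ((h i).1 eps) (IH.1 eps).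
Qed.

Lemma big_L2c n F eps : big n F -> 0 < eps -> eps <= 1 -> L2c (F eps).
Proof.
move=> [cF [C [C0 h]]] e0 e1; apply: (proj1 (@L2c_dom _ (S d1) _ (C * eps ^+ n) _ (L2c_S d1_gt0) _)) => // x.
by rewrite (ger0_norm (S0 x)); exact: h.
Qed.

Lemma big_nrm n F : big n F -> exists C, 0 <= C /\ forall eps, 0 < eps -> eps <= 1 ->
  nrm (F eps) <= C * eps ^+ n.
Proof.
move=> [cF [C [C0 h]]]; exists (C * nrm (S d1)); split; first by rewrite mulr_ge0// nrm_ge0.
move=> eps e0 e1.
have en : 0 <= C * eps ^+ n by apply: mulr_ge0 => //; apply: exprn_ge0; exact: ltW.
have [_] : L2c (F eps) /\ nrm (F eps) <= C * eps ^+ n * nrm (S d1); last by rewrite mulrAC.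
apply: nrm_dom => //; first exact: L2c_S.
by move=> x; rewrite (ger0_norm (S0 x)); exact: h.
Qed.

Definition maj f := big 0 (fun=> f).

Lemma majP f : continuous f -> (exists C, 0 <= C /\ forall x, `|f x| <= C * S d1 x) -> maj f.
Proof.
move=> cf [C [C0 h]]; split => //; exists C; split => // eps x _ _.
by rewrite expr0 mulr1.
Qed.

Lemma majM f g : maj f -> maj g -> maj (fun x => f x * g x).
Proof. by move=> hf hg; exact: bigM hf hg. Qed.

Lemma maj_bound f : maj f -> exists C, 0 <= C /\ forall x, `|f x| <= C * S d1 x.
Proof.
move=> [_ [C [C0 h]]]; exists C; split => // x.
by have := h 1 x ltr01 (lexx _); rewrite expr1n mulr1.
Qed.

Lemma big_taylor2 (kk : R) f f1 f2 : (forall y, der f y (f1 y)) -> (forall y, der f1 y (f2 y)) ->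
  maj f2 -> big 2 (fun eps x => A (kk * eps) f x - f x).
Proof.
move=> h0 h1 /maj_bound[C [C0 h]]; have cf := der_cont' h0.
split; first by move=> eps; apply: contB => //; exact: A_cont.
have [B [B0 hB]] := S_shift_le `|kk|.
exists (C * B * kk ^+ 2); split; first by rewrite mulr_ge0 ?sqr_ge0// mulr_ge0.
move=> eps x e0 e1.
have -> : C * B * kk ^+ 2 * eps ^+ 2 * S d1 x = C * (B * S d1 x) * (kk * eps) ^+ 2 by ring.
apply: (A_taylor2 h0 h1); first by rewrite mulr_ge0// mulr_ge0.
move=> y hy; apply: (le_trans (h y)); apply: ler_wpM2l => //.
rewrite -(subrKC x y); apply: hB; apply: (le_trans hy).
by rewrite normrM ler_piMr// ger0_norm// ltW.
Qed.

Lemma big_taylor4 (kk : R) f f1 f2 f3 f4 :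
  (forall y, der f y (f1 y)) -> (forall y, der f1 y (f2 y)) ->
  (forall y, der f2 y (f3 y)) -> (forall y, der f3 y (f4 y)) -> maj f4 ->
  big 4 (fun eps x => A (kk * eps) (A (kk * eps) f) x - (f x + (kk * eps) ^+ 2 / 12 * f2 x)).
Proof.
move=> h0 h1 h2 h3 /maj_bound[C [C0 h]]; have cf := der_cont' h0; have cf2 := der_cont' h2.
split.
  move=> eps; apply: contB; first by do 2 apply: A_cont.
  by apply: contD => //; exact: contZ.
have [B [B0 hB]] := S_shift_le (2 * `|kk|).
exists (3 * (C * B) * kk ^+ 4); split.
  by apply: mulr_ge0; [do !apply: mulr_ge0|rewrite (exprM _ 2 2) sqr_ge0].
move=> eps x e0 e1.
have -> : 3 * (C * B) * kk ^+ 4 * eps ^+ 4 * S d1 x = 3 * (C * (B * S d1 x)) * (kk * eps) ^+ 4 by ring.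
apply: (AA_taylor4 h0 h1 h2 h3); first by rewrite mulr_ge0// mulr_ge0.
move=> y hy; apply: (le_trans (h y)); apply: ler_wpM2l => //.
rewrite -(subrKC x y); apply: hB; apply: (le_trans hy).
by rewrite ler_wpM2l// normrM ler_piMr// ger0_norm// ltW.
Qed.

End majorant.

Section profile_derivatives.
Context {R : realType}.
Variables d1 d2 : R.
Hypotheses (d1_gt0 : 0 < d1) (d2_neq0 : d2 != 0).
Local Notation W := (Ws d1 d2).
Local Notation W1 := (Ws1 d1 d2).

Definition Ws2 (x : R) : R := d1 * W x - d2 * W x ^+ 2.
Definition Ws3 (x : R) : R := d1 * W1 x - d2 * (2 * W x * W1 x).
Definition Ws4 (x : R) : R := d1 * Ws2 x - d2 * (2 * W1 x * W1 x + 2 * W x * Ws2 x).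

Let dW (x : R) : der W x (W1 x). Proof. exact: der_Ws. Qed.
Let dW1 (x : R) : der W1 x (Ws2 x). Proof. exact: der_Ws1. Qed.

Lemma der_Ws2 (x : R) : der Ws2 x (Ws3 x).
Proof.
apply: der_eq (derB (derZ d1 (dW x)) (derZ d2 (derX 1 (dW x)))) _.
by rewrite /Ws3 expr1.
Qed.

Lemma der_Ws3 (x : R) : der Ws3 x (Ws4 x).
Proof.
apply: der_eq (derB (derZ d1 (dW1 x)) (derZ d2 (derM (derZ 2 (dW x)) (dW1 x)))) _.
by [].
Qed.

Lemma der_Ws_sqr (x : R) : der (fun y => W y ^+ 2) x (2 * W x * W1 x).
Proof. by apply: der_eq (derX 1 (dW x)) _; rewrite expr1. Qed.

Lemma der_Ws_sqr1 (x : R) :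
  der (fun y => 2 * W y * W1 y) x (2 * W1 x * W1 x + 2 * W x * Ws2 x).
Proof. exact: derM (derZ 2 (dW x)) (dW1 x). Qed.

Lemma maj_Ws : maj d1 W.
Proof.
apply: majP; first exact: cont_Ws.
exists `|3 * d1 / (2 * d2)|; split => // x.
by rewrite /Ws normrM (ger0_norm (ltW (S_gt0 _ _))).
Qed.

Lemma maj_Ws1 : maj d1 W1.
Proof.
apply: majP; first exact: der_cont' dW1.
exists (2 * wb d1 * `|3 * d1 / (2 * d2)|); split.
  by rewrite mulr_ge0// mulr_ge0// ltW// wb_gt0.
move=> x; have b0 : 0 <= 2 * wb d1 by rewrite mulr_ge0// ltW// wb_gt0.
rewrite /Ws1 /Ws normrN mulrA (normrM _ (S d1 x)) (ger0_norm (ltW (S_gt0 _ _))).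
apply: ler_wpM2r; first exact: ltW (S_gt0 _ _).
rewrite normrM; apply: ler_wpM2r => //.
by rewrite normrM (ger0_norm b0) ler_piMr ?th_le1.
Qed.

Lemma maj_Ws2 : maj d1 Ws2.
Proof.
have h := maj_Ws; have hh : maj d1 (fun x => W x ^+ 2) := majM h h.
exact: (bigB (bigZ d1 h) (bigZ d2 hh)).
Qed.

Lemma maj_Ws_sqr2 : maj d1 (fun x => 2 * W1 x * W1 x + 2 * W x * Ws2 x).
Proof.
by apply: bigD; apply: majM => //; first [exact: maj_Ws1 | exact: maj_Ws2 | apply: bigZ; first [exact: maj_Ws1 | exact: maj_Ws]].
Qed.

Lemma maj_Ws4 : maj d1 Ws4.
Proof. by apply: bigB; apply: bigZ; [exact: maj_Ws2|exact: maj_Ws_sqr2]. Qed.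

End profile_derivatives.

(** * One component of the rescaled system: linearisation and Lipschitz bounds *)

Section component.
Context {R : realType} {M : nat}.
Variables (k u v r s t : 'I_M -> R) (ps : 'I_M -> R -> R -> R) (gam : R).
Hypothesis gam_ge0 : 0 <= gam.
Hypothesis ps0 : forall m, ps m 0 0 = 0.
Hypothesis ps_lip : forall m x y x' y', `|ps m x y - ps m x' y'| <=
  gam * (x ^+ 2 + y ^+ 2 + x' ^+ 2 + y' ^+ 2) * (`|x - x'| + `|y - y'|).

Implicit Types (p q f g : R -> R) (eps X Y : R) (m : 'I_M).

Definition psc eps m X Y : R :=
  k m / eps ^+ 4 * ps m (k m * eps ^+ 2 * X) (k m * eps ^+ 2 * Y).

(* One component of [k eps^-4 F^m (k eps^2 X, k eps^2 Y)], expanded. *)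
Definition gm eps m X Y : R := k m ^+ 2 / eps ^+ 2 * (u m * X + v m * Y)
  + k m ^+ 3 / 2 * (r m * X ^+ 2 + 2 * s m * X * Y + t m * Y ^+ 2) + psc eps m X Y.

Definition Sg eps p q x : R :=
  \sum_m Am k eps m (fun y => gm eps m (Am k eps m p y) (Am k eps m q y)) x.

(** The bound on [ps] is homogeneous of degree three in arguments of size k eps^2, which gives k^3
    eps^6; the prefactor k / eps^4 leaves k^4 eps^2. *)
Lemma psc_lip eps m X Y X' Y' : 0 < eps -> `|psc eps m X Y - psc eps m X' Y'| <=
  gam * k m ^+ 4 * eps ^+ 2 * (X ^+ 2 + Y ^+ 2 + X' ^+ 2 + Y' ^+ 2) * (`|X - X'| + `|Y - Y'|).
Proof.
move=> e0; rewrite /psc -mulrBr [`|k m / _ * _|]normrM.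
have [c cE] : exists c : R, c = k m * eps ^+ 2 by eexists.
rewrite -cE; have := ps_lip m (c * X) (c * Y) (c * X') (c * Y').
rewrite -!mulrBr [`|c * (X - _)|]normrM [`|c * (Y - _)|]normrM.
have eX (z : R) : (c * z) ^+ 2 = c ^+ 2 * z ^+ 2 by exact: exprMn.
rewrite !eX.
move=> /(ler_wpM2l (normr_ge0 (k m / eps ^+ 4))) h; apply: (le_trans h).
have -> : `|k m / eps ^+ 4| = `|k m| / eps ^+ 4.
  by rewrite normrM normfV (ger0_norm (exprn_ge0 _ (ltW e0))).
have -> : `|c| = `|k m| * eps ^+ 2 by rewrite cE normrM (ger0_norm (exprn_ge0 _ (ltW e0))).
rewrite cE le_eqVlt; apply/orP; left; apply/eqP.
have -> : k m ^+ 4 = (`|k m| * `|k m|) * k m ^+ 2.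
  by rewrite -normrM -expr2 ger0_norm ?sqr_ge0//; ring.
by move: (`|k m|) (`|X - X'|) (`|Y - Y'|) => a b c'; field; rewrite gt_eqF.
Qed.

Lemma psc0 eps m : psc eps m 0 0 = 0. Proof. by rewrite /psc !mulr0 ps0 mulr0. Qed.

Lemma psc_le eps m X Y : 0 < eps -> `|psc eps m X Y| <=
  gam * k m ^+ 4 * eps ^+ 2 * (X ^+ 2 + Y ^+ 2) * (`|X| + `|Y|).
Proof. by move=> e0; have := psc_lip m X Y 0 0 e0; rewrite psc0 !subr0 expr0n /= !addr0. Qed.

Lemma cont_ps m f g : continuous f -> continuous g -> continuous (fun x => ps m (f x) (g x)).
Proof.
move=> cf cg x; pose E y := gam * (f y ^+ 2 + g y ^+ 2 + f x ^+ 2 + g x ^+ 2) *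
  (`|f y - f x| + `|g y - g x|).
have cE : continuous E.
  apply: contM.
    apply: (contZ (c := gam)); apply: contD; last exact: cont_cst.
    apply: contD; last exact: cont_cst.
    by apply: contD; exact: (contX (n := 2)).
  by apply: contD; apply: cont_norm; apply: contB => //; exact: cont_cst.
have Ex : E x = 0 by rewrite /E !subrr normr0 addr0 mulr0.
have hE : E y @[y --> x] --> 0 by rewrite -Ex; exact: cE.
apply/cvgrPdist_le => e e0.
move/cvgrPdist_le : hE => /(_ e e0); apply: filterS => y.
rewrite sub0r normrN => h; rewrite distrC; apply: le_trans (ps_lip _ _ _ _ _) _.
exact: le_trans (ler_norm _) h.
Qed.

Lemma cont_psc eps m f g : continuous f -> continuous g ->
  continuous (fun x => psc eps m (f x) (g x)).
Proof.
move=> cf cg; apply: (contZ (c := k m / eps ^+ 4)).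
by apply: cont_ps; exact: (contZ (c := k m * eps ^+ 2)).
Qed.

Lemma cont_gm eps m f g : continuous f -> continuous g ->
  continuous (fun x => gm eps m (f x) (g x)).
Proof.
move=> cf cg; apply: contD; last exact: cont_psc.
apply: contD.
  by apply: (contZ (c := _ / _)); apply: contD; exact: contZ.
apply: (contZ (c := _ / _)); apply: contD; last by apply: contZ; exact: (contX (n := 2)).
apply: contD; first by apply: contZ; exact: (contX (n := 2)).
by apply: contM => //; exact: (contZ (c := 2 * s m)).
Qed.

Lemma cont_Sg eps p q : continuous p -> continuous q -> continuous (Sg eps p q).
Proof.
move=> cp cq; apply: cont_sum => m; apply: A_cont; apply: cont_gm; exact: A_cont.
Qed.

Lemma Sg_even eps p q : continuous p -> continuous q -> even p -> even q -> even (Sg eps p q).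
Proof.
move=> cp cq ep eq x; apply: eq_bigr => m _; apply: A_even.
  by apply: cont_gm; exact: A_cont.
by move=> y; rewrite /Am !(A_even _ _).
Qed.

Lemma gm_k0 eps m X Y : k m = 0 -> gm eps m X Y = 0.
Proof. by move=> k0; rewrite /gm /psc k0 expr0n/= expr0n/= !mul0r !addr0. Qed.

(** The linearisation of [gm] at (w, 0), without the contribution of [psc]. *)
Definition gmlin eps m (w X Y : R) : R :=
  k m ^+ 2 / eps ^+ 2 * (u m * X + v m * Y) + k m ^+ 3 * (w * (r m * X + s m * Y)).

Definition rem_cst eps (B dl : R) m : R := `|k m| ^+ 3 * dl * (`|r m| + 2 * `|s m| + `|t m|)
  + 4 * (gam * k m ^+ 4) * eps ^+ 2 * (B + 1) ^+ 2.

(** Differences of squares factor, and the sums of two arguments are within 2 dl of their values at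
    (w, 0). So the remainder is Lipschitz with a constant of order dl + eps^2, as strong
    monotonicity between two arbitrary points of a ball requires. *)
Lemma gm_lin eps m (w B dl X Y X' Y' : R) : 0 < eps -> 0 <= dl -> dl <= 1 -> `|w| <= B ->
  `|X - w| <= dl -> `|X' - w| <= dl -> `|Y| <= dl -> `|Y'| <= dl ->
  `|gm eps m X Y - gm eps m X' Y' - gmlin eps m w (X - X') (Y - Y')| <=
  rem_cst eps B dl m * (`|X - X'| + `|Y - Y'|).
Proof.
move=> e0 dl0 dl1 hw hX hX' hY hY'.
have -> : gm eps m X Y - gm eps m X' Y' - gmlin eps m w (X - X') (Y - Y') =
  k m ^+ 3 / 2 * (r m * ((X - w) + (X' - w)) * (X - X')
    + s m * (((X - w) + (X' - w)) * (Y - Y') + (Y + Y') * (X - X'))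
    + t m * (Y + Y') * (Y - Y')) + (psc eps m X Y - psc eps m X' Y').
  by rewrite /gm /gmlin; move: (psc _ _ _ _) (psc _ _ _ _) => a b; field; rewrite gt_eqF.
apply: (le_trans (ler_normD _ _)); rewrite /rem_cst [X in _ <= X]mulrDl; apply: lerD.
  have h1 : `|X - w + (X' - w)| <= 2 * dl.
    by apply: le_trans (ler_normD _ _) _; rewrite mulr_natl mulr2n lerD.
  have h2 : `|Y + Y'| <= 2 * dl.
    by apply: le_trans (ler_normD _ _) _; rewrite mulr_natl mulr2n lerD.
  have [K KE] : exists K : R, K = k m ^+ 3 by eexists.
  rewrite -normrX -KE; set a := _ + (X' - w) in h1 *; set b := Y + Y' in h2 *.
  rewrite normrM [`|_ / 2|]normrM normfV (ger0_norm (ler0n _ 2)) -!mulrA.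
  apply: ler_wpM2l; first exact: normr_ge0.
  have n1 : `|r m * (a * (X - X'))| <= `|r m| * (2 * dl * `|X - X'|).
    by rewrite !normrM; apply: ler_wpM2l => //; exact: ler_wpM2r.
  have n2 : `|t m * (b * (Y - Y'))| <= `|t m| * (2 * dl * `|Y - Y'|).
    by rewrite !normrM; apply: ler_wpM2l => //; exact: ler_wpM2r.
  have n3 : `|s m * (a * (Y - Y') + b * (X - X'))| <= `|s m| * (2 * dl * (`|X - X'| + `|Y - Y'|)).
    rewrite normrM; apply: ler_wpM2l => //; apply: le_trans (ler_normD _ _) _.
    by rewrite !normrM [X in _ <= _ * X]addrC mulrDr; apply: lerD; exact: ler_wpM2r.
  rewrite ler_pdivrMl//.
  have p1 : 0 <= `|r m| * (dl * `|Y - Y'|) by do !apply: mulr_ge0 => //.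
  have p2 : 0 <= `|t m| * (dl * `|X - X'|) by do !apply: mulr_ge0 => //.
  have p3 : 0 <= `|s m| * (dl * (`|X - X'| + `|Y - Y'|)).
    by do !apply: mulr_ge0 => //; exact: addr_ge0.
  apply: le_trans (ler_normD _ _) _; apply: le_trans (lerD (ler_normD _ _) (lexx _)) _.
  apply: le_trans (lerD (lerD n1 n3) n2) _; clear -p1 p2 p3; move: p1 p2 p3.
  by move: (`|r m|) (`|s m|) (`|t m|) (`|X - X'|) (`|Y - Y'|) => a1 a2 a3 x y; lra.
apply: (le_trans (psc_lip _ _ _ _ _ e0)); apply: ler_wpM2r; first exact: addr_ge0.
have B0 : 0 <= B by exact: le_trans hw.
have sq (z : R) : `|z| <= B + 1 -> z ^+ 2 <= (B + 1) ^+ 2.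
  by move=> hz; rewrite -(real_normK (num_real z)) ler_pXn2r// ?nnegrE// addr_ge0.
have big1 (z : R) : `|z - w| <= dl -> `|z| <= B + 1.
  move=> hz; rewrite -(subrK w z); apply: le_trans (ler_normD _ _) _.
  by rewrite [B + 1]addrC; apply: lerD => //; exact: le_trans dl1.
have big0 (z : R) : `|z| <= dl -> `|z| <= B + 1.
  by move=> hz; rewrite (le_trans hz)// (le_trans dl1)// lerDr.
have := sq _ (big1 _ hX); have := sq _ (big1 _ hX'); have := sq _ (big0 _ hY); have := sq _ (big0 _ hY').
move: (X ^+ 2) (Y ^+ 2) (X' ^+ 2) (Y' ^+ 2) ((B + 1) ^+ 2) => a b c d z h1 h2 h3 h4.
have -> : 4 * (gam * k m ^+ 4) * eps ^+ 2 * z = gam * k m ^+ 4 * eps ^+ 2 * (4 * z) by ring.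
apply: ler_wpM2l; last by lra.
apply: mulr_ge0; last exact: sqr_ge0.
by apply: mulr_ge0 => //; rewrite (exprM _ 2 2) sqr_ge0.
Qed.

Definition lipc eps (B dl : R) m : R := rem_cst eps B dl m +
  (k m ^+ 2 / eps ^+ 2 * (`|u m| + `|v m|) + `|k m| ^+ 3 * (B * (`|r m| + `|s m|))).

Lemma gmlin_le eps m (w B X Y : R) : 0 < eps -> `|w| <= B ->
  `|gmlin eps m w X Y| <= (k m ^+ 2 / eps ^+ 2 * (`|u m| + `|v m|)
    + `|k m| ^+ 3 * (B * (`|r m| + `|s m|))) * (`|X| + `|Y|).
Proof.
move=> e0 hw; have B0 : 0 <= B by exact: le_trans hw.
have lin (a b : R) : `|a * X + b * Y| <= (`|a| + `|b|) * (`|X| + `|Y|).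
  apply: le_trans (ler_normD _ _) _; rewrite !normrM mulrDl !mulrDr.
  by apply: lerD; [rewrite lerDl mulr_ge0|rewrite lerDr mulr_ge0].
apply: le_trans (ler_normD _ _) _; rewrite mulrDl; apply: lerD.
  have c0 : 0 <= k m ^+ 2 / eps ^+ 2 by rewrite divr_ge0// sqr_ge0.
  by rewrite normrM (ger0_norm c0) -mulrA; apply: ler_wpM2l.
have [K KE] : exists K : R, K = k m ^+ 3 by eexists.
rewrite -normrX -KE [`|K * _|]normrM -!mulrA; apply: ler_wpM2l; first exact: normr_ge0.
by rewrite [`|w * _|]normrM; apply: ler_pM.
Qed.

Lemma gm_lip eps m (w B dl X Y X' Y' : R) : 0 < eps -> 0 <= dl -> dl <= 1 -> `|w| <= B ->
  `|X - w| <= dl -> `|X' - w| <= dl -> `|Y| <= dl -> `|Y'| <= dl ->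
  `|gm eps m X Y - gm eps m X' Y'| <= lipc eps B dl m * (`|X - X'| + `|Y - Y'|).
Proof.
move=> e0 dl0 dl1 hw hX hX' hY hY'; have h1 := gm_lin m e0 dl0 dl1 hw hX hX' hY hY'.
have h2 := gmlin_le m (X - X') (Y - Y') e0 hw.
rewrite -(subrK (gmlin eps m w (X - X') (Y - Y')) (gm eps m X Y - gm eps m X' Y')).
by apply: le_trans (ler_normD _ _) _; rewrite /lipc mulrDl; exact: lerD.
Qed.

End component.

Section component_L2.
Context {R : realType} {M : nat}.
Variables (k u v r s t : 'I_M -> R) (ps : 'I_M -> R -> R -> R) (gam : R).
Hypothesis gam_ge0 : 0 <= gam.
Hypothesis ps0 : forall m, ps m 0 0 = 0.
Hypothesis ps_lip : forall m x y x' y', `|ps m x y - ps m x' y'| <=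
  gam * (x ^+ 2 + y ^+ 2 + x' ^+ 2 + y' ^+ 2) * (`|x - x'| + `|y - y'|).

Implicit Types (p q f g w : R -> R) (eps X Y B dl : R) (m : 'I_M).

Local Notation gm := (gm k u v r s t ps).
Local Notation Sg := (Sg k u v r s t ps).
Local Notation gmlin := (gmlin k u v r s).
Local Notation rem_cst := (rem_cst k r s t gam).
Local Notation lipc := (lipc k u v r s t gam).
Local Notation Am := (Am k).

Lemma nrm_dom2 (e f g : R -> R) (c : R) : 0 <= c -> continuous e -> L2c f -> L2c g ->
  (forall x, `|e x| <= c * (`|f x| + `|g x|)) -> L2c e /\ nrm e <= c * (nrm f + nrm g).
Proof.
move=> c0 ce hf hg h.
have abs (h' : R -> R) : L2c h' -> L2c (fun x => `|h' x|) /\ nrm (fun x => `|h' x|) <= nrm h'.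
  move=> [ch hh]; rewrite -[X in _ /\ _ <= X]mul1r; apply: nrm_dom => //; first exact: cont_norm.
  by move=> x; rewrite normr_id mul1r.
have [af nf] := abs f hf; have [ag ng] := abs g hg.
have [he ne] : L2c e /\ nrm e <= c * nrm (fun x => `|f x| + `|g x|).
  apply: nrm_dom => //; first exact: L2cD.
  by move=> x; rewrite [X in _ <= _ * X]ger0_norm ?addr_ge0.
split => //; apply: (le_trans ne); apply: ler_wpM2l => //.
exact: le_trans (nrmD af ag) (lerD nf ng).
Qed.

Definition Lin eps w p q x : R := \sum_m Am eps m (fun y =>
  gmlin eps m (w y) (Am eps m p y) (Am eps m q y)) x.

Lemma cont_gmlin eps m w f g : continuous w -> continuous f -> continuous g ->
  continuous (fun x => gmlin eps m (w x) (f x) (g x)).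
Proof.
move=> cw cf cg; apply: contD.
  by apply: (contZ (c := _ / _)); apply: contD; exact: contZ.
by apply: (contZ (c := k m ^+ 3)); apply: contM => //; apply: contD; exact: contZ.
Qed.

Lemma rem_cst_ge0 eps B dl m : 0 <= dl -> 0 <= rem_cst eps B dl m.
Proof.
move=> dl0; rewrite /rem_cst; apply: addr_ge0.
  apply: mulr_ge0; last by rewrite !addr_ge0// mulr_ge0.
  by apply: mulr_ge0 => //; exact: exprn_ge0.
apply: mulr_ge0; last exact: sqr_ge0.
apply: mulr_ge0; last exact: sqr_ge0.
by apply: mulr_ge0 => //; apply: mulr_ge0 => //; rewrite (exprM _ 2 2) sqr_ge0.
Qed.

Lemma gmlin_k0 eps m (w X Y : R) : k m = 0 -> gmlin eps m w X Y = 0.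
Proof. by move=> k0; rewrite /gmlin k0 expr0n/= expr0n/= !mul0r addr0. Qed.

Section difference.
Variables (eps B dl : R) (w p q p' q' : R -> R).
Hypotheses (e0 : 0 < eps) (dl0 : 0 <= dl) (dl1 : dl <= 1).
Hypotheses (cw : continuous w) (wB : forall x, `|w x| <= B).
Hypotheses (hp : L2c p) (hq : L2c q) (hp' : L2c p') (hq' : L2c q').
(** For k m = 0 the average is the identity and turns an L^2 bound into no pointwise bound; [gm]
    vanishes in that case. *)
Hypothesis close : forall m x, k m != 0 -> [/\ `|Am eps m p x - w x| <= dl,
  `|Am eps m p' x - w x| <= dl, `|Am eps m q x| <= dl & `|Am eps m q' x| <= dl].

Let dp x := p x - p' x.
Let dq x := q x - q' x.
Let hdp : L2c dp. Proof. exact: L2cB. Qed.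
Let hdq : L2c dq. Proof. exact: L2cB. Qed.

Lemma Am_diff m f g x : L2c f -> L2c g ->
  Am eps m (fun y => f y - g y) x = Am eps m f x - Am eps m g x.
Proof. by move=> [cf _] [cg _]; rewrite /Am AB. Qed.

Lemma Am_diffc m f g x : continuous f -> continuous g ->
  Am eps m (fun y => f y - g y) x = Am eps m f x - Am eps m g x.
Proof. by move=> cf cg; rewrite /Am AB. Qed.

Lemma B_ge0 : 0 <= B. Proof. exact: le_trans (wB 0). Qed.

Lemma L2c_Am m f : L2c f -> L2c (Am eps m f). Proof. exact: L2c_A. Qed.

Lemma lipc_ge0 m : 0 <= lipc eps B dl m.
Proof.
have B0 := B_ge0; rewrite /lipc; apply: addr_ge0; first exact: rem_cst_ge0.
apply: addr_ge0; first by apply: mulr_ge0; [rewrite divr_ge0// sqr_ge0|rewrite addr_ge0].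
by apply: mulr_ge0; [exact: exprn_ge0|rewrite mulr_ge0// addr_ge0].
Qed.

Lemma cont_gmA m f g : L2c f -> L2c g ->
  continuous (fun y => gm eps m (Am eps m f y) (Am eps m g y)).
Proof. by move=> [cf _] [cg _]; apply: (cont_gm ps_lip); exact: A_cont. Qed.

Lemma gm_diff_L2 m : let E y := gm eps m (Am eps m p y) (Am eps m q y)
    - gm eps m (Am eps m p' y) (Am eps m q' y) in
  L2c E /\ nrm E <= lipc eps B dl m * (nrm dp + nrm dq).
Proof.
move=> E; have [h1 h2] : L2c E /\ nrm E <= lipc eps B dl m * (nrm (Am eps m dp) + nrm (Am eps m dq)).
  apply: nrm_dom2; [exact: lipc_ge0| |exact: L2c_Am|exact: L2c_Am|].
    by apply: contB; exact: cont_gmA.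
  move=> x; rewrite !Am_diff//.
  have [k0|k0] := eqVneq (k m) 0.
    rewrite /E !(@gm_k0 _ _ _ _ _ _ _ _ _ _ _ _ _ k0) subrr normr0 mulr_ge0 ?lipc_ge0// addr_ge0//.
  by have [c1 c2 c3 c4] := close x k0; rewrite /E; exact: (gm_lip k u v r s t gam_ge0 ps_lip m e0 dl0 dl1 (wB x) c1 c2 c3 c4).
split => //; apply: (le_trans h2); apply: ler_wpM2l; first exact: lipc_ge0.
by apply: lerD; exact: nrm_A.
Qed.

(** The outer average supplies the pointwise bound. Its constant blows up as eps tends to 0, but it
    serves the passage from L^2 to uniform convergence at fixed eps. *)
Lemma Sg_diff_sup x : `|Sg eps p q x - Sg eps p' q' x| <=
  (\sum_m (Num.sqrt `|k m * eps|)^-1 * lipc eps B dl m) * (nrm dp + nrm dq).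
Proof.
rewrite /Sg -sumrB; apply: le_trans (ler_norm_sum _ _ _) _; rewrite mulr_suml; apply: ler_sum => m _.
have [k0|k0] := eqVneq (k m) 0.
  have z (f g : R -> R) : (fun y => gm eps m (f y) (g y)) = fun=> 0.
    by apply/funext => y; exact: gm_k0.
  rewrite !z /Am A_cst subrr normr0; apply: mulr_ge0; last by rewrite addr_ge0// nrm_ge0.
  by rewrite mulr_ge0 ?invr_ge0 ?sqrtr_ge0// lipc_ge0.
have [h1 h2] := gm_diff_L2 m.
have ke : k m * eps != 0 by rewrite mulf_neq0// gt_eqF.
have -> : Am eps m (fun y => gm eps m (Am eps m p y) (Am eps m q y)) x -
  Am eps m (fun y => gm eps m (Am eps m p' y) (Am eps m q' y)) x =
  Am eps m (fun y => gm eps m (Am eps m p y) (Am eps m q y) - gm eps m (Am eps m p' y) (Am eps m q' y)) x.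
  by rewrite (Am_diffc _ _ (cont_gmA (m := m) hp hq) (cont_gmA (m := m) hp' hq')).
apply: (le_trans (A_sup x ke h1)); rewrite -mulrA; apply: ler_wpM2l => //.
Qed.

Lemma Sg_diff_L2 : L2c (fun x => Sg eps p q x - Sg eps p' q' x) /\
  nrm (fun x => Sg eps p q x - Sg eps p' q' x) <=
  (\sum_m lipc eps B dl m) * (nrm dp + nrm dq).
Proof.
have -> : (fun x => Sg eps p q x - Sg eps p' q' x) = (fun x => \sum_m
  Am eps m (fun y => gm eps m (Am eps m p y) (Am eps m q y) - gm eps m (Am eps m p' y) (Am eps m q' y)) x).
  apply/funext => x; rewrite /Sg -sumrB; apply: eq_bigr => m _.
  by rewrite (Am_diffc _ _ (cont_gmA (m := m) hp hq) (cont_gmA (m := m) hp' hq')).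
have h m := gm_diff_L2 m; split; first by apply: L2c_sum => m; apply: L2c_A; exact: (h m).1.
apply: le_trans (nrm_sum _ _) _; first by move=> m; apply: L2c_A; exact: (h m).1.
rewrite mulr_suml; apply: ler_sum => m _; apply: le_trans (nrm_A _ (h m).1) (h m).2.
Qed.

Lemma Sg_lin_L2 : let E x := Sg eps p q x - Sg eps p' q' x - Lin eps w dp dq x in
  L2c E /\ nrm E <= (\sum_m rem_cst eps B dl m) * (nrm dp + nrm dq).
Proof.
pose F m y := gm eps m (Am eps m p y) (Am eps m q y) - gm eps m (Am eps m p' y) (Am eps m q' y)
  - gmlin eps m (w y) (Am eps m dp y) (Am eps m dq y).
have cl m : continuous (fun y => gmlin eps m (w y) (Am eps m dp y) (Am eps m dq y)).
  by apply: cont_gmlin => //; apply: A_cont; [exact: hdp.1|exact: hdq.1].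
have cF m : continuous (F m).
  by apply: contB => //; apply: contB; exact: cont_gmA.
move=> E; have -> : E = (fun x => \sum_m Am eps m (F m) x).
  apply/funext => x; rewrite /E /Sg /Lin -!sumrB; apply: eq_bigr => m _.
  have cg := cont_gmA (m := m) hp hq; have cg' := cont_gmA (m := m) hp' hq'.
  by rewrite (Am_diffc _ _ (contB cg cg') (cl m)) (Am_diffc _ _ cg cg').
have h m : L2c (F m) /\ nrm (F m) <= rem_cst eps B dl m * (nrm dp + nrm dq).
  have [h1 h2] : L2c (F m) /\ nrm (F m) <= rem_cst eps B dl m * (nrm (Am eps m dp) + nrm (Am eps m dq)).
    apply: nrm_dom2; [exact: rem_cst_ge0|by []|exact: L2c_Am|exact: L2c_Am|].
    move=> x; rewrite /F !Am_diff//.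
    have [k0|k0] := eqVneq (k m) 0.
      rewrite !(@gm_k0 _ _ _ _ _ _ _ _ _ _ _ _ _ k0) gmlin_k0// !subrr normr0.
      by rewrite mulr_ge0 ?rem_cst_ge0// addr_ge0.
    by have [c1 c2 c3 c4] := close x k0; exact: (gm_lin k u v r s t gam_ge0 ps_lip m e0 dl0 dl1 (wB x) c1 c2 c3 c4).
  split => //; apply: (le_trans h2); apply: ler_wpM2l; first exact: rem_cst_ge0.
  by apply: lerD; exact: nrm_A.
split; first by apply: L2c_sum => m; apply: L2c_A; exact: (h m).1.
apply: le_trans (nrm_sum _ _) _; first by move=> m; apply: L2c_A; exact: (h m).1.
rewrite mulr_suml; apply: ler_sum => m _; apply: le_trans (nrm_A _ (h m).1) (h m).2.
Qed.

End difference.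

Lemma Lin_L2 eps B w p q : 0 < eps -> continuous w -> (forall x, `|w x| <= B) -> L2c p -> L2c q ->
  L2c (Lin eps w p q).
Proof.
move=> e0 cw wB hp hq; apply: L2c_sum => m; apply: L2c_A.
have B0 : 0 <= B by exact: le_trans (wB 0).
apply: (proj1 (nrm_dom2 _ _ (L2c_A (k m * eps) hp) (L2c_A (k m * eps) hq) _)); last first.
  by move=> x; exact: (gmlin_le _ _ _ _ _ _ _ _ e0 (wB x)).
- by apply: cont_gmlin => //; apply: A_cont; [exact: hp.1|exact: hq.1].
apply: addr_ge0; first by apply: mulr_ge0; [rewrite divr_ge0// sqr_ge0|rewrite addr_ge0].
by apply: mulr_ge0; [exact: exprn_ge0|rewrite mulr_ge0// addr_ge0].
Qed.

Lemma ip_Lin eps B w p q f : 0 < eps -> continuous w -> (forall x, `|w x| <= B) ->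
  L2c p -> L2c q -> L2c f ->
  ip (Lin eps w p q) f = \sum_m (k m ^+ 2 / eps ^+ 2 *
    (u m * ip (Am eps m p) (Am eps m f) + v m * ip (Am eps m q) (Am eps m f))
   + k m ^+ 3 * (r m * wip w (Am eps m p) (Am eps m f) + s m * wip w (Am eps m q) (Am eps m f))).
Proof.
move=> e0 cw wB hp hq hf.
have hA m g (hg : L2c g) := L2c_A (k m * eps) hg.
have hw g (hg : L2c g) := (L2c_wmul cw wB hg).1.
have e m : (fun y => gmlin eps m (w y) (Am eps m p y) (Am eps m q y)) =
  (fun y => (k m ^+ 2 / eps ^+ 2 * u m) * Am eps m p y + (k m ^+ 2 / eps ^+ 2 * v m) * Am eps m q y
    + ((k m ^+ 3 * r m) * (w y * Am eps m p y) + (k m ^+ 3 * s m) * (w y * Am eps m q y))).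
  by apply/funext => y; rewrite /gmlin; ring.
have h1 m : L2c (fun y => (k m ^+ 2 / eps ^+ 2 * u m) * Am eps m p y) by apply: L2cZ; exact: hA.
have h2 m : L2c (fun y => (k m ^+ 2 / eps ^+ 2 * v m) * Am eps m q y) by apply: L2cZ; exact: hA.
have h3 m : L2c (fun y => (k m ^+ 3 * r m) * (w y * Am eps m p y)) by apply: L2cZ; apply: hw; exact: hA.
have h4 m : L2c (fun y => (k m ^+ 3 * s m) * (w y * Am eps m q y)) by apply: L2cZ; apply: hw; exact: hA.
have h12 m := L2cD (h1 m) (h2 m); have h34 m := L2cD (h3 m) (h4 m).
have hE m := L2cD (h12 m) (h34 m).
rewrite /Lin ip_suml; last 2 first.
- by move=> m; apply: L2c_A; rewrite e; exact: hE.
- by [].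
apply: eq_bigr => m _; have hAf := hA m f hf.
rewrite {1}/Am A_adj//; last by rewrite e; exact: hE.
rewrite e ipDl// ipDl// ipDl// !ipZl//; try exact: hA; try by apply: hw; exact: hA.
rewrite /wip -/(Am eps m f).
by move: (ip _ _) (ip _ _) (ip _ _) (ip _ _) => x1 x2 x3 x4; ring.
Qed.

End component_L2.

(** * Expansion of the averaged forces at the profile *)

Section residual.
Context {R : realType} {M : nat}.
Variables (k u v r s t : 'I_M -> R) (ps : 'I_M -> R -> R -> R) (gam : R).
Hypothesis gam_ge0 : 0 <= gam.
Hypothesis ps0 : forall m, ps m 0 0 = 0.
Hypothesis ps_lip : forall m x y x' y', `|ps m x y - ps m x' y'| <=
  gam * (x ^+ 2 + y ^+ 2 + x' ^+ 2 + y' ^+ 2) * (`|x - x'| + `|y - y'|).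
Variable d1 : R.
Hypothesis d1_gt0 : 0 < d1.
Implicit Types (f g : R -> R) (F G : R -> R -> R) (eps : R) (m : 'I_M).

Local Notation big := (big d1).
Local Notation maj := (maj d1).
Local Notation gm := (gm k u v r s t ps).
Local Notation Sg := (Sg k u v r s t ps).
Local Notation psc := (psc k ps).
Local Notation Am := (Am k).

Lemma big_psc m F G : big 0 F -> big 0 G -> big 2 (fun eps x => psc eps m (F eps x) (G eps x)).
Proof.
move=> [cF [C [C0 h]]] [cG [D [D0 h']]]; split.
  by move=> eps; have := @cont_psc _ _ k ps gam ps_lip eps m _ _ (cF eps) (cG eps).
have S0 x : 0 <= S d1 x := ltW (S_gt0 d1 x).
exists (gam * k m ^+ 4 * (C ^+ 2 + D ^+ 2) * (C + D)); split.
  apply: mulr_ge0; last exact: addr_ge0.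
  apply: mulr_ge0; last by rewrite addr_ge0 ?sqr_ge0.
  by apply: mulr_ge0 => //; rewrite (exprM _ 2 2) sqr_ge0.
move=> eps x e0 e1; apply: le_trans (@psc_le _ _ k _ _ ps0 ps_lip eps m _ _ e0) _.
have {}h := h eps x e0 e1; have {}h' := h' eps x e0 e1; rewrite !expr0 !mulr1 in h h'.
have S1 := S_le1 d1 x.
have sq (z c : R) : 0 <= c -> `|z| <= c * S d1 x -> z ^+ 2 <= c ^+ 2.
  move=> c0 hz; rewrite -(real_normK (num_real z)) ler_pXn2r// ?nnegrE//.
  by apply: (le_trans hz); rewrite ler_piMr.
have -> : gam * k m ^+ 4 * (C ^+ 2 + D ^+ 2) * (C + D) * eps ^+ 2 * S d1 x =
  gam * k m ^+ 4 * eps ^+ 2 * (C ^+ 2 + D ^+ 2) * (C * S d1 x + D * S d1 x) by ring.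
have g0 : 0 <= gam * k m ^+ 4 * eps ^+ 2.
  apply: mulr_ge0; last exact: sqr_ge0.
  by apply: mulr_ge0 => //; rewrite (exprM _ 2 2) sqr_ge0.
apply: ler_pM; [|exact: addr_ge0| |exact: lerD].
  by apply: mulr_ge0 => //; rewrite addr_ge0 ?sqr_ge0.
by apply: ler_wpM2l => //; apply: lerD; apply: sq.
Qed.

Lemma AmDx eps m f g x : continuous f -> continuous g ->
  Am eps m (fun y => f y + g y) x = Am eps m f x + Am eps m g x.
Proof. by move=> cf cg; rewrite /Am AD. Qed.

Lemma AmBx eps m f g x : continuous f -> continuous g ->
  Am eps m (fun y => f y - g y) x = Am eps m f x - Am eps m g x.
Proof. by move=> cf cg; rewrite /Am AB. Qed.

Lemma AmZx eps m (c : R) f x : continuous f -> Am eps m (fun y => c * f y) x = c * Am eps m f x.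
Proof. by move=> cf; rewrite /Am AZ. Qed.

Section averages.
Variables (f f1 f2 : R -> R).
Hypotheses (df : forall y, der f y (f1 y)) (df1 : forall y, der f1 y (f2 y)).
Hypotheses (mf : maj f) (mf2 : maj f2).

Let cf : continuous f. Proof. exact: der_cont' df. Qed.

Lemma big_Am m : big 0 (fun eps => Am eps m f).
Proof. exact: (big_A d1_gt0 (k m) mf). Qed.

Lemma big_Am_sub m : big 2 (fun eps x => Am eps m f x - f x).
Proof. exact: (big_taylor2 d1_gt0 (k m) df df1 mf2). Qed.

Lemma big_AAm_sub m : big 2 (fun eps x => Am eps m (Am eps m f) x - f x).
Proof.
apply: big_ext (bigD (big_A d1_gt0 (k m) (big_Am_sub m)) (big_Am_sub m)) => [eps x _ _|eps].
  by rewrite /Am AB ?subrKA//; exact: A_cont.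
by apply: contB => //; do 2 apply: A_cont.
Qed.

End averages.

Variables (W W1 W2 W3 W4 w w1 w2 Q1 Q2 : R -> R).
Hypotheses (dW : forall y, der W y (W1 y)) (dW1 : forall y, der W1 y (W2 y)).
Hypotheses (dW2 : forall y, der W2 y (W3 y)) (dW3 : forall y, der W3 y (W4 y)).
Hypotheses (dw : forall y, der w y (w1 y)) (dw1 : forall y, der w1 y (w2 y)).
Hypotheses (dQ : forall y, der (fun y => W y ^+ 2) y (Q1 y)) (dQ1 : forall y, der Q1 y (Q2 y)).
Hypotheses (mW : maj W) (mW2 : maj W2) (mW4 : maj W4) (mw : maj w) (mw2 : maj w2) (mQ2 : maj Q2).

Let cW : continuous W. Proof. exact: der_cont' dW. Qed.
Let cW2 : continuous W2. Proof. exact: der_cont' dW2. Qed.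
Let cw : continuous w. Proof. exact: der_cont' dw. Qed.
Let cQ : continuous (fun y => W y ^+ 2). Proof. exact: der_cont' dQ. Qed.
Let cAW eps m : continuous (Am eps m W). Proof. exact: A_cont. Qed.
Let cAw eps m : continuous (Am eps m w). Proof. exact: A_cont. Qed.

Let D1 m eps x := (eps ^+ 2)^-1 *
  (k m ^+ 2 * u m * (Am eps m (Am eps m W) x - (W x + (k m * eps) ^+ 2 / 12 * W2 x))).
Let bD1 m : big 2 (D1 m).
Proof. by apply: (big_div (i := 2)); apply: bigZ; exact: (big_taylor4 d1_gt0 (k m) dW dW1 dW2 dW3 mW4). Qed.

Let bQ m : big 2 (fun eps x => Am eps m (fun y => W y ^+ 2) x - W x ^+ 2).
Proof. exact: (big_Am_sub dQ dQ1 mQ2). Qed.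

(** The error has five parts: [D1], the fourth-order Taylor remainder of the double average of W,
    divided by eps^2; [D2] and [D3], second-order errors in w and in W^2; [f4], the products that
    carry a factor eps^2 w; and [f5], the contribution of [ps]. *)
Lemma comp_residual : big 2 (fun eps x => Sg eps W (fun y => eps ^+ 2 * w y) x -
  ((eps ^+ 2)^-1 * ((\sum_m k m ^+ 2 * u m) * W x) + (\sum_m k m ^+ 4 / 12 * u m) * W2 x
   + (\sum_m k m ^+ 2 * v m) * w x + (\sum_m k m ^+ 3 / 2 * r m) * W x ^+ 2)).
Proof.
pose D2 m eps x := k m ^+ 2 * v m * (Am eps m (Am eps m w) x - w x).
pose D3 m eps x := k m ^+ 3 / 2 * r m * (Am eps m (fun y => Am eps m W y ^+ 2) x - W x ^+ 2).
pose f4 m eps y := eps ^+ 2 * (k m ^+ 3 * s m * (Am eps m W y * Am eps m w y))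
  + eps ^+ 4 * (k m ^+ 3 / 2 * t m * (Am eps m w y * Am eps m w y)).
pose f5 m eps y := psc eps m (Am eps m W y) (eps ^+ 2 * Am eps m w y).
have bW m := big_Am mW m; have bw m := big_Am mw m.
have b4 m : big 2 (f4 m).
  apply: bigD; first exact: (big_eps 2 (bigZ _ (bigM (bW m) (bw m)))).
  exact: (big_le (n := 2) (m := 4) _ (big_eps 4 (bigZ _ (bigM (bw m) (bw m))))).
have b5 m : big 2 (f5 m).
  by apply: big_psc => //; exact: (big_le (n := 0) (m := 2) _ (big_eps 2 (bw m))).
have bD2 m : big 2 (D2 m) by apply: bigZ; exact: (big_AAm_sub dw dw1 mw2).
have bD3 m : big 2 (D3 m).
  apply: bigZ.
  have h : big 2 (fun eps x => Am eps m W x ^+ 2 - W x ^+ 2).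
    apply: big_ext (bigM (big_Am_sub dW dW1 mW2 m) (bigD (bW m) mW)) => [eps x _ _|eps].
      by ring.
    by apply: contB => //; exact: (contX (n := 2)).
  apply: big_ext (bigD (big_A d1_gt0 (k m) h) (bQ m)) => [eps x _ _|eps].
    have cX : continuous (fun y => Am eps m W y ^+ 2) by exact: (contX (n := 2)).
    by rewrite -/(Am eps m _) AmBx ?subrKA.
  apply: contB => //; apply: A_cont.
  have cX : continuous (fun y => Am eps m W y ^+ 2) by exact: (contX (n := 2)).
  exact: cX.
have key m : big 2 (fun eps x => D1 m eps x + (D2 m eps x + (D3 m eps x +
    (Am eps m (f4 m eps) x + Am eps m (f5 m eps) x)))).
  apply: bigD (bD1 m) (bigD (bD2 m) (bigD (bD3 m) (bigD _ _))).
    exact: (big_A d1_gt0 (k m) (b4 m)).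
  exact: (big_A d1_gt0 (k m) (b5 m)).
apply: big_ext (big_sum key) => [eps x e0 e1|eps]; last first.
  apply: contB.
    have cz : continuous (fun y => eps ^+ 2 * w y) by exact: contZ.
    exact: (@cont_Sg _ _ k u v r s t ps gam ps_lip eps _ _ cW cz).
  apply: contD; last exact: (contZ (c := \sum_m k m ^+ 3 / 2 * r m)).
  apply: contD; last exact: contZ.
  apply: contD; last exact: contZ.
  by apply: (contZ (c := (eps ^+ 2)^-1)); exact: contZ.
rewrite !mulr_suml mulr_sumr -!big_split/= /Sg -sumrB; apply: eq_bigr => m _.
have c4 := (b4 m).1 eps; have c5 := (b5 m).1 eps.
have cX : continuous (fun y => Am eps m W y ^+ 2) by exact: (contX (n := 2)).
have -> : (fun y => gm eps m (Am eps m W y) (Am eps m (fun z => eps ^+ 2 * w z) y)) =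
  (fun y => k m ^+ 2 / eps ^+ 2 * u m * Am eps m W y + (k m ^+ 2 * v m * Am eps m w y +
    (k m ^+ 3 / 2 * r m * Am eps m W y ^+ 2 + (f4 m eps y + f5 m eps y)))).
  apply/funext => y; rewrite /Am AZ// -/(Am eps m w) -/(Am eps m W) /gm /f4 /f5.
  move: (psc eps m _ _) => a; move: (Am eps m W y) (Am eps m w y) => b c.
  by field; rewrite gt_eqF.
have z1 : continuous (fun y => k m ^+ 2 / eps ^+ 2 * u m * Am eps m W y) by exact: contZ.
have z2 : continuous (fun y => k m ^+ 2 * v m * Am eps m w y) by exact: contZ.
have z3 : continuous (fun y => k m ^+ 3 / 2 * r m * Am eps m W y ^+ 2) by exact: (contZ (c := _ * _)).
move: c4 c5; move: (f4 m eps) (f5 m eps) => g4 g5 c4 c5.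
have z45 := contD c4 c5; have z345 := contD z3 z45; have z2345 := contD z2 z345.
rewrite AmDx// AmDx// AmDx// AmDx// !AmZx// /D1 /D2 /D3.
move: (Am eps m g4 x) (Am eps m g5 x) (Am eps m (fun y => _ ^+ 2) x) => y1 y2 y3.
move: (Am eps m (Am eps m w) x) (Am eps m (Am eps m W) x) => y4 y5.
by field; rewrite gt_eqF.
Qed.

(** The same expansion for the linearised operator in the direction (W, 0); being a derivative, the
    quadratic term is counted twice. *)
Lemma lin_residual : big 2 (fun eps x => Lin k u v r s eps W W (fun=> 0) x -
  ((eps ^+ 2)^-1 * ((\sum_m k m ^+ 2 * u m) * W x) + (\sum_m k m ^+ 4 / 12 * u m) * W2 x
   + 2 * (\sum_m k m ^+ 3 / 2 * r m) * W x ^+ 2)).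
Proof.
pose D3 m eps x := k m ^+ 3 * r m * (Am eps m (fun y => W y * Am eps m W y) x - W x ^+ 2).
have cWA eps m : continuous (fun y => W y * Am eps m W y) by exact: contM.
have bD3 m : big 2 (D3 m).
  apply: bigZ.
  have h : big 2 (fun eps x => W x * Am eps m W x - W x ^+ 2).
    apply: big_ext (bigM mW (big_Am_sub dW dW1 mW2 m)) => [eps x _ _|eps].
      by ring.
    by apply: contB => //; exact: cWA.
  apply: big_ext (bigD (big_A d1_gt0 (k m) h) (bQ m)) => [eps x _ _|eps].
    by rewrite -/(Am eps m _) AmBx ?subrKA//; exact: cWA.
  by apply: contB => //; apply: A_cont; exact: (cWA eps m).
apply: big_ext (big_sum (fun m => bigD (bD1 m) (bD3 m))) => [eps x e0 e1|eps]; last first.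
  apply: contB.
    apply: cont_sum => m; apply: A_cont; apply: cont_gmlin => //; apply: A_cont => //.
    exact: cont_cst.
  apply: contD; last exact: (contZ (c := 2 * \sum_m k m ^+ 3 / 2 * r m)).
  apply: contD; last exact: contZ.
  by apply: (contZ (c := (eps ^+ 2)^-1)); exact: contZ.
rewrite (mulr_sumr _ _ _ 2) !mulr_suml mulr_sumr -!big_split/= /Lin -sumrB; apply: eq_bigr => m _.
have -> : (fun y => gmlin k u v r s eps m (W y) (Am eps m W y) (Am eps m (fun=> 0) y)) =
  (fun y => k m ^+ 2 / eps ^+ 2 * u m * Am eps m W y + k m ^+ 3 * r m * (W y * Am eps m W y)).
  apply/funext => y; rewrite /gmlin {2 4}/Am A_cst.
  by move: (Am _ _ _ _) => a; ring.
have z1 : continuous (fun y => k m ^+ 2 / eps ^+ 2 * u m * Am eps m W y) by exact: contZ.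
have z2 : continuous (fun y => k m ^+ 3 * r m * (W y * Am eps m W y)) by exact: (contZ (c := _ * _)).
have z3 := cWA eps m; rewrite AmDx// AmZx// AmZx// /D1 /D3.
move: (Am _ _ _ _) (Am _ _ _ _) => x1 x2.
by field; rewrite gt_eqF.
Qed.

End residual.

Opaque wip.

Lemma half_bound {R : realType} (e a nu : R) : 0 < e -> e * (2 * (a + 1)) <= nu -> a * e <= nu / 2.
Proof. by move=> e0 h; lra. Qed.

(** N is the second variation in the direction W, a N its polarised value with (p, q), and u, v are
    the squared norms of p - beta W and q. The right side is the form at (p - beta W, q) plus (- N)
    ((beta - a)^2 + a^2), and this addition is at least c beta^2 / 2, which controls the multiple of
    W that was removed. *)
Lemma oblique_arith {R : realType} (P Q u v H beta a N c w c1 : R) :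
  0 <= c1 -> c1 <= 1 / 2000 -> c1 * (4 * (w + 1)) <= c -> 0 <= w -> 0 <= u -> 0 <= v ->
  N <= - c -> P <= 2 * u + 2 * (- beta) ^+ 2 * w -> Q <= 2 * v ->
  1 / 1000 * (u + v) <= H + 2 * - beta * (a * N) + (- beta) ^+ 2 * N ->
  c1 * (P + Q) <= H + - 2 * a * (a * N).
Proof.
move=> c10 c1a c1b w0 u0 v0 N0 hP hQ hH.
have e1 : c1 * (P + Q) <= c1 * (2 * (u + v) + 2 * beta ^+ 2 * w).
  by apply: ler_wpM2l => //; rewrite sqrrN in hP; lra.
have e2 : 2 * (u + v) * c1 <= 2 * (u + v) * (1 / 2000) by apply: ler_wpM2l => //; lra.
have b0 := sqr_ge0 beta.
have e3 : beta ^+ 2 * (c1 * (4 * (w + 1))) <= beta ^+ 2 * c by exact: ler_wpM2l.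
have e4 : 0 <= beta ^+ 2 * c1 by exact: mulr_ge0.
have c0 : 0 <= c by apply: le_trans c1b; apply: mulr_ge0 => //; lra.
have e5 : 0 <= (- N - c) * ((beta - a) ^+ 2 + a ^+ 2).
  by apply: mulr_ge0; [lra|exact: addr_ge0 (sqr_ge0 _) (sqr_ge0 _)].
have e6 : 0 <= c * (2 * (a - beta / 2) ^+ 2).
  by apply: mulr_ge0 => //; apply: mulr_ge0 => //; exact: sqr_ge0.
rewrite sqrrN in hH; lra.
Qed.

Lemma oblique_const {R : realType} (c w : R) : 0 < c -> 0 <= w ->
  exists c1 : R, [/\ 0 < c1, c1 <= 1 / 2000 & c1 * (4 * (w + 1)) <= c].
Proof.
move=> c0 w0; have w1 : 0 < 4 * (w + 1) by lra.
exists (Num.min (1 / 2000) (c / (4 * (w + 1)))); split.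
- by rewrite lt_min; apply/andP; split; [lra|exact: divr_gt0].
- by rewrite ge_min lexx.
- by rewrite -ler_pdivlMr// ge_min lexx orbT.
Qed.

(** * The linearised operator and its negative direction *)

Section hessian.
Context {R : realType} {M : nat}.
Variables (k a0 a1 a2 b0 b1 b2 : 'I_M -> R) (sig0 tau delta0 : R).
Hypotheses (tau_gt0 : 0 < tau) (delta0_gt0 : 0 < delta0) (DD_gt0 : 0 < DD k a0).
Hypothesis sum0 : \sum_m k m ^+ 2 * a0 m = sig0.
Hypothesis sum1 : \sum_m k m ^+ 2 * a1 m = 0.
Hypothesis sum2 : \sum_m k m ^+ 2 * a2 m = sig0 - tau.
Hypothesis det_ge : forall z,
  delta0 * Num.min `|z| 2 ^+ 2 <= L00 k a0 z * L11 k a2 tau z - L01 k a1 z ^+ 2.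
Hypothesis nn_neq0 : nn k b0 != 0.

Implicit Types (p q f g : R -> R) (eps : R).

Local Notation W := (Wst k a0 b0).
Local Notation d1 := (dd1 k a0).
Local Notation d2 := (dd2 k a0 b0).
Local Notation Hq := (hess_quad k a0 a1 a2 b0 b1 b2 sig0).
Local Notation zero := (fun _ : R => 0 : R).

(** The linearisation is taken at (W, 0) and not at the approximate solution; the difference goes
    into the remainder of [gm_lin]. *)
Definition hess0 eps p q x : R := (eps ^+ 2)^-1 * (sig0 + eps ^+ 2) * p x
  - Lin k a0 a1 b0 b1 eps W p q x.
Definition hess1 eps p q x : R := (eps ^+ 2)^-1 * (sig0 + eps ^+ 2) * q x
  - Lin k a1 a2 b1 b2 eps W p q x.

Definition hess_form eps p q p' q' : R := ip (hess0 eps p q) p' + ip (hess1 eps p q) q'.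

Let cW : continuous W. Proof. exact: Wst_cont. Qed.
Let WB x : `|W x| <= BW k a0 b0. Proof. exact: Wst_bound. Qed.

Lemma L2c_H0 eps p q : 0 < eps -> L2c p -> L2c q -> L2c (hess0 eps p q).
Proof. by move=> e0 hp hq; apply: L2cB; [exact: L2cZ|exact: (Lin_L2 _ _ _ _ _ e0 cW WB)]. Qed.

Lemma L2c_H1 eps p q : 0 < eps -> L2c p -> L2c q -> L2c (hess1 eps p q).
Proof. by move=> e0 hp hq; apply: L2cB; [exact: L2cZ|exact: (Lin_L2 _ _ _ _ _ e0 cW WB)]. Qed.

Lemma Hb_E eps p q p' q' : 0 < eps -> L2c p -> L2c q -> L2c p' -> L2c q' ->
  hess_form eps p q p' q' = (eps ^+ 2)^-1 * (sig0 + eps ^+ 2) * (ip p p' + ip q q') - \sum_m (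
    k m ^+ 2 / eps ^+ 2 * (a0 m * ip (Am k eps m p) (Am k eps m p')
      + a1 m * ip (Am k eps m q) (Am k eps m p') + a1 m * ip (Am k eps m p) (Am k eps m q')
      + a2 m * ip (Am k eps m q) (Am k eps m q'))
    + k m ^+ 3 * (b0 m * wip W (Am k eps m p) (Am k eps m p')
      + b1 m * wip W (Am k eps m q) (Am k eps m p') + b1 m * wip W (Am k eps m p) (Am k eps m q')
      + b2 m * wip W (Am k eps m q) (Am k eps m q'))).
Proof.
move=> e0 hp hq hp' hq'.
have l0 := Lin_L2 k a0 a1 b0 b1 e0 cW WB hp hq; have l1 := Lin_L2 k a1 a2 b1 b2 e0 cW WB hp hq.
rewrite /hess_form /hess0 /hess1 ipBl//; last exact: L2cZ.
rewrite ipBl//; last exact: L2cZ.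
rewrite !ipZl// (ip_Lin k a0 a1 b0 b1 e0 cW WB hp hq hp') (ip_Lin k a1 a2 b1 b2 e0 cW WB hp hq hq').
rewrite addrACA -mulrDr -opprD -big_split/=; congr (_ - _); apply: eq_bigr => m _.
move: (ip _ _) (ip _ _) (ip _ _) (ip _ _) => x1 x2 x3 x4.
by move: (wip _ _ _) (wip _ _ _) (wip _ _ _) (wip _ _ _) => y1 y2 y3 y4; ring.
Qed.

Lemma Hb_sym eps p q p' q' : 0 < eps -> L2c p -> L2c q -> L2c p' -> L2c q' ->
  hess_form eps p q p' q' = hess_form eps p' q' p q.
Proof.
move=> e0 hp hq hp' hq'; rewrite (Hb_E e0 hp hq hp' hq') (Hb_E e0 hp' hq' hp hq).
congr (_ * (_ + _) - _); [exact: ipC|exact: ipC|apply: eq_bigr => m _].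
rewrite (ipC (Am k eps m p) (Am k eps m p')) (ipC (Am k eps m q) (Am k eps m p')).
rewrite (ipC (Am k eps m p) (Am k eps m q')) (ipC (Am k eps m q) (Am k eps m q')).
rewrite (wipC W (Am k eps m p) (Am k eps m p')) (wipC W (Am k eps m q) (Am k eps m p')).
rewrite (wipC W (Am k eps m p) (Am k eps m q')) (wipC W (Am k eps m q) (Am k eps m q')).
move: (ip _ _) (ip _ _) (ip _ _) (ip _ _) => x1 x2 x3 x4.
by move: (wip _ _ _) (wip _ _ _) (wip _ _ _) (wip _ _ _) => y1 y2 y3 y4; ring.
Qed.

Lemma Hb_diag eps p q : 0 < eps -> L2c p -> L2c q -> hess_form eps p q p q = Hq eps p q.
Proof.
move=> e0 hp hq; rewrite Hb_E// /hess_quad /Bform /Cub.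
rewrite mulrBr mulr_sumr; set P := ip p p + ip q q.
have -> : eps ^- 2 * (sig0 + eps ^+ 2) * P = eps ^- 2 * (sig0 * P) + P.
  by field; rewrite gt_eqF.
set S1 := \sum_m _; set S2 := \sum_m _; set S3 := \sum_m _.
suff -> : S1 = S2 + S3 by ring.
rewrite /S1 /S2 /S3 -big_split/=.
apply: eq_bigr => m _.
rewrite (ipC (Am k eps m q) (Am k eps m p)) (wipC W (Am k eps m q) (Am k eps m p)).
move: (ip _ _) (ip _ _) (ip _ _) => x1 x2 x3.
by move: (wip _ _ _) (wip _ _ _) (wip _ _ _) => y1 y2 y3; field; rewrite gt_eqF.
Qed.

Lemma Hb_lin eps p q p1 q1 p2 q2 (c : R) : 0 < eps -> L2c p -> L2c q ->
  L2c p1 -> L2c q1 -> L2c p2 -> L2c q2 ->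
  hess_form eps p q (fun x => p1 x + c * p2 x) (fun x => q1 x + c * q2 x) =
  hess_form eps p q p1 q1 + c * hess_form eps p q p2 q2.
Proof.
move=> e0 hp hq h1 h2 h3 h4; have l0 := L2c_H0 e0 hp hq; have l1 := L2c_H1 e0 hp hq.
have z3 := L2cZ c h3; have z4 := L2cZ c h4.
rewrite /hess_form ipDr// ipDr// !ipZr//.
move: (ip _ _) (ip _ _) (ip _ _) (ip _ _) => x1 x2 x3 x4; ring.
Qed.

Lemma Hq_lin eps p q p2 q2 (c : R) : 0 < eps -> L2c p -> L2c q -> L2c p2 -> L2c q2 ->
  Hq eps (fun x => p x + c * p2 x) (fun x => q x + c * q2 x) =
  Hq eps p q + 2 * c * hess_form eps p q p2 q2 + c ^+ 2 * Hq eps p2 q2.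
Proof.
move=> e0 hp hq h3 h4; have z3 := L2cD hp (L2cZ c h3); have z4 := L2cD hq (L2cZ c h4).
rewrite -(Hb_diag e0 z3 z4) (Hb_lin c e0 z3 z4 hp hq h3 h4).
rewrite (Hb_sym e0 z3 z4 hp hq) (Hb_sym e0 z3 z4 h3 h4).
rewrite (Hb_lin c e0 hp hq hp hq h3 h4) (Hb_lin c e0 h3 h4 hp hq h3 h4).
rewrite (Hb_sym e0 h3 h4 hp hq) (Hb_diag e0 hp hq) (Hb_diag e0 h3 h4).
by move: (hess_form _ _ _ _ _) (hess_quad _ _ _ _ _ _ _ _ _ _ _) (hess_quad _ _ _ _ _ _ _ _ _ _ _) => x1 x2 x3; ring.
Qed.

Lemma d1_gt0 : 0 < d1. Proof. exact: dd1_gt0. Qed.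
Lemma d2_neq0 : d2 != 0. Proof. exact: dd2_neq0. Qed.

Lemma L2c_W : L2c W.
Proof. by have := big_L2c d1_gt0 (maj_Ws d1 d2) ltr01 (lexx _). Qed.

Lemma W_ode x : Ws2 d1 d2 x = (DD k a0)^-1 * (W x - nn k b0 * W x ^+ 2).
Proof.
rewrite /Ws2 /dd1 /dd2 -/(Wst k a0 b0).
by move: (W x) => y; field; rewrite gt_eqF.
Qed.

(** Up to O(eps^2) the value is W - DD W'' - 2 nn W^2, which the profile equation turns into - nn
    W^2. *)
Lemma H0_W : big d1 2 (fun eps x => hess0 eps W zero x + nn k b0 * W x ^+ 2).
Proof.
have h := lin_residual k a0 a1 b0 b1 d1_gt0 (der_Ws d1 d2) (der_Ws1 d1_gt0 d2_neq0)
  (der_Ws2 d1 d2) (der_Ws3 d1_gt0 d2_neq0) (der_Ws_sqr d1 d2) (der_Ws_sqr1 d1_gt0 d2_neq0)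
  (maj_Ws d1 d2) (maj_Ws2 d1 d2) (maj_Ws4 d1_gt0 d2_neq0) (maj_Ws_sqr2 d1_gt0 d2_neq0).
apply: big_ext (bigZ (-1) h) => [eps x e0 e1|eps].
  rewrite /hess0 sum0 -/(DD k a0) -/(Ws2 d1 d2 x) W_ode -/(Wst k a0 b0).
  have -> : \sum_m k m ^+ 3 / 2 * b0 m = nn k b0 by [].
  by move: (Lin _ _ _ _ _ _ _ _ _ _) (W x) => y w; field; rewrite !gt_eqF.
apply: contD; last by apply: contZ; exact: (contX (n := 2)).
apply: contB; first exact: (contZ (c := _ * _)).
apply: cont_sum => m; apply: A_cont; apply: cont_gmlin => //; apply: A_cont => //.
exact: cont_cst.
Qed.

Lemma H1_W : big d1 0 (fun eps => hess1 eps W zero).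
Proof.
have h := lin_residual k a1 a2 b1 b2 d1_gt0 (der_Ws d1 d2) (der_Ws1 d1_gt0 d2_neq0)
  (der_Ws2 d1 d2) (der_Ws3 d1_gt0 d2_neq0) (der_Ws_sqr d1 d2) (der_Ws_sqr1 d1_gt0 d2_neq0)
  (maj_Ws d1 d2) (maj_Ws2 d1 d2) (maj_Ws4 d1_gt0 d2_neq0) (maj_Ws_sqr2 d1_gt0 d2_neq0).
have mW := maj_Ws d1 d2.
have h2 := bigD (bigZ (\sum_m k m ^+ 4 / 12 * a1 m) (maj_Ws2 d1 d2))
  (bigZ (2 * \sum_m k m ^+ 3 / 2 * b1 m) (majM mW mW)).
apply: big_ext (bigZ (-1) (bigD (big_le (n := 0) (m := 2) _ h) h2)) => [eps x e0 e1|eps|//].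
  rewrite /hess1 sum1 mul0r mulr0 /Ws2 -/(Wst k a0 b0).
  by move: (Lin _ _ _ _ _ _ _ _ _ _) (W x) => y w; ring.
apply: contB; first exact: (contZ (c := _ * _) (@cont_cst R 0)).
apply: cont_sum => m; apply: A_cont; apply: cont_gmlin => //; apply: A_cont => //.
exact: cont_cst.
Qed.

Lemma S_lower (K : R) : exists2 c : R, 0 < c & forall x, `|x| <= K -> c <= S d1 x.
Proof.
have [B [B0 hB]] := S_shift_le d1_gt0 K.
have S01 : S d1 0 = 1 by rewrite S_E /wE mulr0 expR0; field.
exists (B + 1)^-1; first by rewrite invr_gt0 ltr_wpDl.
move=> x xK; rewrite -div1r ler_pdivrMr ?ltr_wpDl//.
have := hB x (- x); rewrite normrN subrr S01 => /(_ xK) h.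
by have := S_gt0 d1 x; lra.
Qed.

Lemma W_coef : nn k b0 * (3 * d1 / (2 * d2)) = 3 / 2.
Proof. by rewrite /dd1 /dd2; field; rewrite nn_neq0 gt_eqF. Qed.

Lemma W_coef_neq0 : 3 * d1 / (2 * d2) != 0.
Proof. by have h := W_coef; apply/eqP => z; rewrite z mulr0 in h; lra. Qed.

Lemma S_cube_gt0 : 0 < ip (fun x => S d1 x * S d1 x) (S d1).
Proof.
have [c c0 hc] := S_lower 1.
have hS := L2c_S d1_gt0; have [cS _] := hS.
have hSS : L2c (fun x => S d1 x * S d1 x).
  by apply: (L2c_wmul (B := 1) cS _ hS).1 => x; rewrite ger0_norm ?S_le1// ltW// S_gt0.
have S0 x := ltW (S_gt0 d1 x).
rewrite ipE; apply: (@lt_le_trans _ _ (int 0 1 (fun=> c ^+ 3))).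
  by rewrite int_cst// subr0 mulr1 exprn_gt0.
apply: (@le_trans _ _ (int 0 1 (fun x => S d1 x * S d1 x * S d1 x))).
  apply: le_int => //; first exact: cont_cst.
    by apply: contM => //; exact: contM.
  move=> x /andP[x0 x1]; have h : c <= S d1 x by apply: hc; rewrite ger0_norm.
  rewrite -[X in _ <= X]/(S d1 x ^+ 2 * S d1 x) -exprSr.
  by apply: lerXn2r => //; rewrite ?nnegrE//; exact: ltW.
apply: int_le_RI => //; first by apply: contM => //; exact: contM.
  by move=> x; do !apply: mulr_ge0.
exact: L2c_mul hSS hS.
Qed.

(** By [W_coef], nn W is 3/2 times sech^2: nn and W have the same sign, whatever that sign is. *)
Lemma nn_W_cube : 0 < nn k b0 * ip (fun x => W x * W x) W.
Proof.
set kp := 3 * d1 / (2 * d2).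
have hS := L2c_S d1_gt0; have [cS _] := hS.
have hSS : L2c (fun x => S d1 x * S d1 x).
  by apply: (L2c_wmul (B := 1) cS _ hS).1 => x; rewrite ger0_norm ?S_le1// ltW// S_gt0.
have -> : ip (fun x => W x * W x) W = kp * (kp ^+ 2 * ip (fun x => S d1 x * S d1 x) (S d1)).
  have -> : (fun x => W x * W x) = (fun x => kp ^+ 2 * (S d1 x * S d1 x)).
    by apply/funext => x; rewrite /Wst /Ws -/kp; ring.
  have -> : W = (fun x => kp * S d1 x) by [].
  have hS' := L2cZ kp hS; rewrite ipZl// ipZr//.
  by move: (ip _ _) => y; ring.
rewrite mulrA W_coef; apply: mulr_gt0; first lra.
apply: mulr_gt0 S_cube_gt0; rewrite exprn_even_gt0//=; exact: W_coef_neq0.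
Qed.

(* By the profile equation the second variation there is [-nn * int W^3] up to [O(eps^2)]. *)
Lemma negative_direction : exists c eps0 B, [/\ 0 < c, 0 < eps0, 0 <= B &
  forall eps, 0 < eps -> eps < eps0 -> [/\ Hq eps W zero <= - c,
    nrm (hess0 eps W zero) <= B & nrm (hess1 eps W zero) <= B]].
Proof.
have [C1 [C10 h1]] := big_nrm d1_gt0 H0_W; have [C2 [C20 h2]] := big_nrm d1_gt0 H1_W.
have [nu nuE] : exists nu : R, nu = nn k b0 * ip (fun x => W x * W x) W by eexists.
have nu0 : 0 < nu by rewrite nuE nn_W_cube.
have hW := L2c_W; have WW : L2c (fun x => W x * W x) by exact: (L2c_wmul cW WB hW).1.
have hz : L2c zero := L2c0.
pose N1 := nrm W; have N10 : 0 <= N1 by exact: nrm_ge0.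
(* Keeps the error C1 eps N1 in the second variation below nu / 2. *)
pose e1 := Num.min 1 (nu / (2 * (C1 * N1 + 1))).
have p1 : 0 < C1 * N1 + 1 by rewrite ltr_wpDl// mulr_ge0.
have e10 : 0 < e1 by rewrite lt_min ltr01 divr_gt0// mulr_gt0.
pose n2 := nrm (fun x => nn k b0 * (W x * W x)).
exists (nu / 2), e1, (Num.max C2 (C1 + n2)); split => //; first by rewrite divr_gt0.
  by rewrite le_max C20.
move=> eps e0 ee1; have e1' : eps <= 1 by rewrite ltW// (lt_le_trans ee1)// ge_min lexx.
have := h1 eps e0 e1'; have := h2 eps e0 e1'; rewrite expr0 mulr1 => k2 k1.
have hH0 := L2c_H0 e0 hW hz; have hH1 := L2c_H1 e0 hW hz.
have hnW := L2cZ (nn k b0) WW.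
have eS : eps ^+ 2 <= eps by rewrite expr2 ler_piMl// ltW.
have k1' : nrm (fun x => hess0 eps W zero x + nn k b0 * (W x * W x)) <= C1 * eps.
  by apply: le_trans k1 _; apply: ler_wpM2l.
have hR := L2cD hH0 hnW.
have n0E : nrm (hess0 eps W zero) <= C1 + n2.
  have -> : hess0 eps W zero = (fun x => (hess0 eps W zero x + nn k b0 * (W x * W x)) - nn k b0 * (W x * W x)).
    by apply/funext => x; rewrite addrK.
  apply: le_trans (nrmB hR hnW) _; rewrite -/n2 lerD2r; apply: le_trans k1' _.
  by rewrite ler_piMr.
split; last 2 first.
- by rewrite le_max n0E orbT.
- by rewrite le_max k2.
rewrite -Hb_diag// /hess_form.
have -> : ip (hess1 eps W zero) zero = 0.
  have -> : zero = (fun x => 0 * zero x) by apply/funext => x; rewrite mul0r.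
  by rewrite ipZr ?mul0r//; have <- : zero = (fun x => 0 * zero x) by apply/funext => x; rewrite mul0r.
have -> : ip (hess0 eps W zero) W = ip (fun x => hess0 eps W zero x + nn k b0 * (W x * W x)) W - nu.
  by rewrite ipDl// [ip (fun x => nn k b0 * _) W]ipZl// -nuE addrK.
have := ip_le_nrm hR hW; rewrite -/N1 ler_norml => /andP[_ h].
have h' : C1 * eps * N1 <= nu / 2.
  have : eps <= nu / (2 * (C1 * N1 + 1)) by rewrite ltW// (lt_le_trans ee1)// ge_min lexx orbT.
  rewrite ler_pdivlMr ?mulr_gt0// => h3; rewrite mulrAC.
  exact: (half_bound e0 h3).
have h3 : nrm (fun x => hess0 eps W zero x + nn k b0 * (W x * W x)) * N1 <= C1 * eps * N1.
  exact: ler_wpM2r.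
have h4 := le_trans (le_trans h h3) h'.
rewrite addr0 lerBlDr; apply: le_trans h4 _.
by rewrite addrC {2}(splitr nu) addrK.
Qed.

(** W is a nonzero multiple of [S], which is bounded below on bounded sets by a positive constant;
    averages inherit this bound. *)
Lemma point_functional (h y : R) : exists l, 0 < `|A h (A h W) y| /\ l = A h (A h W) y.
Proof.
exists (A h (A h W) y); split => //.
set kp := 3 * d1 / (2 * d2).
have kp0 : kp != 0 by exact: W_coef_neq0.
have cS := @cont_S R d1.
have -> : W = (fun x => kp * S d1 x) by [].
rewrite AZ// AZ//; last exact: A_cont.
rewrite normr_gt0 mulf_neq0//.
have [c c0 hc] := S_lower (`|y| + 2 * `|h|).
(* A lower bound on f <= 1 is an upper bound on |1 - f|, to which [A_bound] applies. *)
have low (f : R -> R) (x : R) : continuous f -> (forall z, `|z| <= `|h| -> c <= f (x + z) <= 1) -> c <= A h f x.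
  move=> cf hf; have := @A_bound R h (fun z => 1 - f z) x (1 - c) (contB (@cont_cst R 1) cf).
  have -> : A h (fun z => 1 - f z) x = 1 - A h f x.
    by rewrite (AB _ (@cont_cst R 1) cf) A_cst.
  move=> H; have {}H : `|1 - A h f x| <= 1 - c.
    apply: H => z hz; have /andP[z1 z2] := hf z hz.
    by rewrite ger0_norm ?subr_ge0// lerB.
  by move: H; rewrite ler_norml => /andP[_]; lra.
have upper x : A h (S d1) x <= 1.
  have <- : A h (fun=> 1) x = 1 by rewrite A_cst.
  by apply: le_A => // [|z]; [exact: cont_cst|exact: S_le1].
suff : c <= A h (A h (S d1)) y by move=> h1; rewrite gt_eqF// (lt_le_trans c0).
apply: (low _ y) => [|z hz]; first exact: A_cont.
rewrite upper andbT; apply: low => // z' hz'; rewrite S_le1 andbT; apply: hc.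
apply: le_trans (ler_normD _ _) _; have := ler_normD y z; lra.
Qed.

Lemma ip_sum_le f g (c : R) : L2c f -> L2c g ->
  ip f f <= 2 * ip (fun x => f x + c * g x) (fun x => f x + c * g x) + 2 * c ^+ 2 * ip g g.
Proof.
move=> hf hg; have hz := L2cZ c hg; have h2 := L2cZ 2 hz.
have := ip_ge0 (fun x => f x + 2 * (c * g x)); rewrite !ip_sqrD//.
rewrite !ipZr// !ipZl// ?ipZr//.
by move: (ip f f) (ip f g) (ip g g) => x y z; nra.
Qed.

(** Testing with (p - 2 a W, q) in place of (p, q) reverses the negative direction. The multiple
    beta of W is chosen so that the double average of p - beta W vanishes at [y0 d1], where
    [coercive] applies. *)
Theorem oblique_coercive : exists c eps0, [/\ 0 < c, 0 < eps0 & forall eps p q a,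
  0 < eps -> eps < eps0 -> L2c p -> L2c q -> even p -> even q ->
  a * Hq eps W zero = hess_form eps p q W zero ->
  c * (ip p p + ip q q) <=
  hess_form eps p q (fun x => p x + - 2 * a * W x) (fun x => q x + - 2 * a * 0)].
Proof.
have [h [h0 [e1 [e10 hc]]]] := coercive b1 b2 tau_gt0 delta0_gt0 DD_gt0 sum0 sum1 sum2 det_ge nn_neq0.
have [c [e2 [B [c0 e20 B0 hn]]]] := negative_direction.
have [lW [lW0 lWE]] := point_functional h (y0 d1).
have hW := L2c_W; have hz : L2c zero := L2c0.
have eW : even W by exact: Ws_even.
have [w wE] : exists w : R, w = ip W W by eexists.
have w0 : 0 <= w by rewrite wE ip_ge0.
have [c1 [c1p c1a c1b]] := oblique_const c0 w0.
have mp : 0 < Num.min e1 e2 by rewrite lt_min e10.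
exists c1, (Num.min e1 e2); split; [exact: c1p|exact: mp|].
move=> eps p q a ep; rewrite lt_min => /andP[ee1 ee2] hp hq evp evq aNE.
have [N0 _ _] := hn eps ep ee2.
have [N NE] : exists N : R, N = Hq eps W zero by eexists.
rewrite -NE in N0; have aN : hess_form eps p q W zero = a * N by rewrite -aNE NE.
rewrite (Hb_lin _ ep hp hq hp hq hW hz) aN (Hb_diag ep hp hq).
pose beta := A h (A h p) (y0 d1) / lW.
have lWn : lW != 0 by rewrite -normr_gt0 lWE.
have cp : continuous p := hp.1.
pose U x := p x + - beta * W x; pose V x := q x + - beta * zero x.
have hU : L2c U by exact: L2cD hp (L2cZ _ hW).
have hV : L2c V by exact: L2cD hq (L2cZ _ hz).
have := hc eps U V ep ee1 hU hV.
have evU : even U by move=> x; rewrite /U evp eW.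
have evV : even V by move=> x; rewrite /V evq.
have cW' := contZ (c := - beta) cW.
have lU : A h (A h U) (y0 d1) = 0.
  rewrite /U (AD _ cp cW') AZ// AD//; last 2 first.
  - exact: A_cont.
  - by apply: (contZ (c := - beta)); exact: A_cont.
  rewrite AZ//; last exact: A_cont.
  by rewrite -lWE /beta mulNr divfK// subrr.
move=> /(_ evU evV lU); rewrite (Hq_lin _ ep hp hq hW hz) aN -NE.
have hp2 := ip_sum_le (- beta) hp hW; have hq2 := ip_sum_le (- beta) hq hz.
have zz : ip zero zero = 0 by rewrite -nrm_sqr nrm0 expr0n.
rewrite zz (mulr0 (2 * (- beta) ^+ 2)) addr0 in hq2; rewrite -wE in hp2.
move=> h3; exact: (oblique_arith (ltW c1p) c1a c1b w0 (ip_ge0 U) (ip_ge0 V) N0 hp2 hq2 h3).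
Qed.

End hessian.

Section equation.
Context {R : realType} {M : nat}.
Variables (k a0 a1 a2 b0 b1 b2 b3 : 'I_M -> R) (sig0 tau delta0 gam : R).
Variables (psi0 psi1 : 'I_M -> R -> R -> R).
Hypotheses (tau_gt0 : 0 < tau) (delta0_gt0 : 0 < delta0) (DD_gt0 : 0 < DD k a0).
Hypothesis sum0 : \sum_m k m ^+ 2 * a0 m = sig0.
Hypothesis sum1 : \sum_m k m ^+ 2 * a1 m = 0.
Hypothesis sum2 : \sum_m k m ^+ 2 * a2 m = sig0 - tau.
Hypothesis det_ge : forall z,
  delta0 * Num.min `|z| 2 ^+ 2 <= L00 k a0 z * L11 k a2 tau z - L01 k a1 z ^+ 2.
Hypothesis nn_neq0 : nn k b0 != 0.
Hypothesis gam_ge0 : 0 <= gam.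
Hypotheses (psi00 : forall m, psi0 m 0 0 = 0) (psi10 : forall m, psi1 m 0 0 = 0).
Hypothesis psi0_lip : forall m x y x' y', `|psi0 m x y - psi0 m x' y'| <=
  gam * (x ^+ 2 + y ^+ 2 + x' ^+ 2 + y' ^+ 2) * (`|x - x'| + `|y - y'|).
Hypothesis psi1_lip : forall m x y x' y', `|psi1 m x y - psi1 m x' y'| <=
  gam * (x ^+ 2 + y ^+ 2 + x' ^+ 2 + y' ^+ 2) * (`|x - x'| + `|y - y'|).

Implicit Types (p q f g : R -> R) (eps : R).

Local Notation W := (Wst k a0 b0).
Local Notation d1 := (dd1 k a0).
Local Notation d2 := (dd2 k a0 b0).
Local Notation Sg0 := (Sg k a0 a1 b0 b1 b2 psi0).
Local Notation Sg1 := (Sg k a1 a2 b1 b2 b3 psi1).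

(* The equation, integrated once and divided by [eps^5]. *)
Definition eqn0 eps p q x : R := (eps ^+ 2)^-1 * (sig0 + eps ^+ 2) * p x - Sg0 eps p q x.
Definition eqn1 eps p q x : R := (eps ^+ 2)^-1 * (sig0 + eps ^+ 2) * q x - Sg1 eps p q x.

Let e1 : R := (\sum_m k m ^+ 4 / 12 * a1 m) / tau.
Let e2 : R := (\sum_m k m ^+ 3 / 2 * b1 m) / tau.

(* The second component of the approximate solution is [eps^2 * correction]; it cancels the terms
   of order one of the second equation. *)
Definition correction (x : R) : R := e1 * Ws2 d1 d2 x + e2 * W x ^+ 2.
Definition corr1 (x : R) : R := e1 * Ws3 d1 d2 x + e2 * (2 * W x * Ws1 d1 d2 x).
Definition corr2 (x : R) : R := e1 * Ws4 d1 d2 x +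
  e2 * (2 * Ws1 d1 d2 x * Ws1 d1 d2 x + 2 * W x * Ws2 d1 d2 x).

Let hd1 : 0 < d1. Proof. exact: d1_gt0. Qed.
Let hd2 : d2 != 0. Proof. exact: d2_neq0. Qed.

Lemma der_corr x : der correction x (corr1 x).
Proof. exact: derD (derZ e1 (der_Ws2 d1 d2 x)) (derZ e2 (der_Ws_sqr d1 d2 x)). Qed.

Lemma der_corr1 x : der corr1 x (corr2 x).
Proof. exact: derD (derZ e1 (der_Ws3 hd1 hd2 x)) (derZ e2 (der_Ws_sqr1 hd1 hd2 x)). Qed.

Lemma maj_corr : maj d1 correction.
Proof.
have mW := maj_Ws d1 d2.
exact: (bigD (bigZ e1 (maj_Ws2 d1 d2)) (bigZ e2 (majM mW mW))).
Qed.

Lemma maj_corr2 : maj d1 corr2.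
Proof. exact: (bigD (bigZ e1 (maj_Ws4 hd1 hd2)) (bigZ e2 (maj_Ws_sqr2 hd1 hd2))). Qed.

Let cW : continuous W. Proof. exact: Wst_cont. Qed.
Let cw eps : continuous (fun x => eps ^+ 2 * correction x).
Proof. by apply: (contZ (c := eps ^+ 2)); exact: der_cont' der_corr. Qed.

(** [sum0] cancels the terms of order eps^-2, [sum1] the contribution of the correction, and the
    profile equation the remaining terms of order one. *)
Lemma residual0 : big d1 2 (fun eps => eqn0 eps W (fun x => eps ^+ 2 * correction x)).
Proof.
have h := comp_residual k a0 a1 b0 b1 b2 gam_ge0 psi00 psi0_lip hd1 (der_Ws d1 d2) (der_Ws1 hd1 hd2)
  (der_Ws2 d1 d2) (der_Ws3 hd1 hd2) der_corr der_corr1 (der_Ws_sqr d1 d2) (der_Ws_sqr1 hd1 hd2)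
  (maj_Ws d1 d2) (maj_Ws2 d1 d2) (maj_Ws4 hd1 hd2) maj_corr maj_corr2 (maj_Ws_sqr2 hd1 hd2).
apply: big_ext (bigZ (-1) h) => [eps x ep e1'|eps].
  rewrite /eqn0 sum0.
  rewrite sum1.
  rewrite -/(DD k a0) -/(Ws2 d1 d2 x).
  rewrite (W_ode b0 DD_gt0) -/(Wst k a0 b0).
  have -> : \sum_m k m ^+ 3 / 2 * b0 m = nn k b0 by [].
  move: (Sg _ _ _ _ _ _ _ _ _ _ _) (W x) => y v; field.
  by rewrite !gt_eqF.
apply: contB; first exact: (contZ (c := _ * _)).
exact: (@cont_Sg _ _ k a0 a1 b0 b1 b2 psi0 gam psi0_lip eps W _ cW (@cw eps)).
Qed.

Lemma residual1 : big d1 2 (fun eps => eqn1 eps W (fun x => eps ^+ 2 * correction x)).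
Proof.
have h := comp_residual k a1 a2 b1 b2 b3 gam_ge0 psi10 psi1_lip hd1 (der_Ws d1 d2) (der_Ws1 hd1 hd2)
  (der_Ws2 d1 d2) (der_Ws3 hd1 hd2) der_corr der_corr1 (der_Ws_sqr d1 d2) (der_Ws_sqr1 hd1 hd2)
  (maj_Ws d1 d2) (maj_Ws2 d1 d2) (maj_Ws4 hd1 hd2) maj_corr maj_corr2 (maj_Ws_sqr2 hd1 hd2).
apply: big_ext (bigB (big_eps 2 maj_corr) h) => [eps x ep e1'|eps].
  rewrite /eqn1 sum1 sum2 -/(Ws2 d1 d2 x) /correction -/(Wst k a0 b0) /e1 /e2.
  move: (Sg _ _ _ _ _ _ _ _ _ _ _) (W x) (Ws2 d1 d2 x) => y v z.
  move: (\sum_m _) (\sum_m _) => s t; field.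
  by rewrite !gt_eqF.
apply: contB; first exact: (contZ (c := _ * _)).
exact: (@cont_Sg _ _ k a1 a2 b1 b2 b3 psi1 gam psi1_lip eps W _ cW (@cw eps)).
Qed.

End equation.

(** * Reflected Zarantonello iteration *)

Section zarantonello.
Context {R : realType} (V : lmodType R) (E : V -> Prop) (B : V -> V -> R).
Hypothesis ED : forall u v, E u -> E v -> E (u + v).
Hypothesis EZ : forall (c : R) u, E u -> E (c *: u).
Hypothesis BC : forall u v, E u -> E v -> B u v = B v u.
Hypothesis BD : forall u v w, E u -> E v -> E w -> B (u + v) w = B u w + B v w.
Hypothesis BZ : forall (c : R) u v, E u -> E v -> B (c *: u) v = c * B u v.
Hypothesis B_ge0 : forall u, E u -> 0 <= B u u.

(** The form is bilinear on [E] alone, because in the application it is an integral that is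
    meaningful for square-integrable functions; hence the membership conditions throughout. *)
Definition bnorm u : R := Num.sqrt (B u u).

Let EN u : E u -> E (- u). Proof. by move=> h; rewrite -scaleN1r; exact: EZ. Qed.
Let EB u v : E u -> E v -> E (u - v). Proof. by move=> h1 h2; exact: ED h1 (EN h2). Qed.

Lemma bnorm_ge0 u : 0 <= bnorm u. Proof. exact: sqrtr_ge0. Qed.

Lemma bnorm_sqr u : E u -> bnorm u ^+ 2 = B u u.
Proof. by move=> hu; rewrite sqr_sqrtr// B_ge0. Qed.

Lemma form_line u v (c : R) : E u -> E v ->
  B (u + c *: v) (u + c *: v) = B u u + 2 * c * B u v + c ^+ 2 * B v v.
Proof.
move=> hu hv; have hz := EZ c hv; have hs := ED hu hz.
rewrite BD// (BC hu hs) (BC hz hs) BD// BD// (BC hu hz) !BZ// (BC hv hz) BZ// (BC hv hu).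
by move: (B u u) (B u v) (B v v) => x y z; ring.
Qed.

Lemma bnormZ (c : R) u : E u -> bnorm (c *: u) = `|c| * bnorm u.
Proof.
move=> hu; have hz := EZ c hu.
by rewrite /bnorm BZ// (BC hu hz) BZ// mulrA -expr2 sqrtrM ?sqr_ge0// sqrtr_sqr.
Qed.

Lemma bnormN u : E u -> bnorm (- u) = bnorm u.
Proof. by move=> hu; rewrite -scaleN1r bnormZ// normrN1 mul1r. Qed.

(** The form is only semidefinite, so the cases in which one of the norms is 0 are treated apart. *)
Lemma form_le_bnorm u v : E u -> E v -> B u v <= bnorm u * bnorm v.
Proof.
move=> hu hv; have n1 := bnorm_ge0 u; have n2 := bnorm_ge0 v.
have h (c : R) := B_ge0 (ED hu (EZ c hv)).
have hc c : 0 <= bnorm u ^+ 2 + 2 * c * B u v + c ^+ 2 * bnorm v ^+ 2.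
  by rewrite !bnorm_sqr// -form_line.
have [v0|v0] := eqVneq (bnorm v) 0.
  rewrite v0 mulr0 leNgt; apply/negP => b0.
  have := hc (- ((bnorm u ^+ 2 + 1) / B u v)).
  rewrite v0 expr0n/= mulr0 addr0 mulrN mulNr -mulrA divfK ?gt_eqF//.
  by have := sqr_ge0 (bnorm u); lra.
have vp : 0 < bnorm v by rewrite lt_neqAle eq_sym v0.
have := hc (- (bnorm u / bnorm v)).
have -> : bnorm u ^+ 2 + 2 * - (bnorm u / bnorm v) * B u v + (- (bnorm u / bnorm v)) ^+ 2 * bnorm v ^+ 2
   = 2 * bnorm u / bnorm v * (bnorm u * bnorm v - B u v) by field.
have [u0|u0] := eqVneq (bnorm u) 0; last first.
  have up : 0 < bnorm u by rewrite lt_neqAle eq_sym u0.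
  by rewrite pmulr_rge0 ?subr_ge0// divr_gt0// mulr_gt0.
move=> _; rewrite u0 mul0r leNgt; apply/negP => b0.
have := hc (- (B u v / bnorm v ^+ 2)); rewrite u0 expr0n/= add0r.
have -> : 2 * - (B u v / bnorm v ^+ 2) * B u v + (- (B u v / bnorm v ^+ 2)) ^+ 2 * bnorm v ^+ 2
  = - (B u v / bnorm v) ^+ 2 by field.
by rewrite oppr_ge0 le_eqVlt ltNge sqr_ge0 orbF sqrf_eq0 mulf_eq0 invr_eq0 (negbTE v0) orbF gt_eqF.
Qed.

Lemma bnormD u v : E u -> E v -> bnorm (u + v) <= bnorm u + bnorm v.
Proof.
move=> hu hv; have n1 := bnorm_ge0 u; have n2 := bnorm_ge0 v.
have s0 : 0 <= bnorm u + bnorm v by exact: addr_ge0.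
rewrite -(@ler_pXn2r _ 2) ?nnegrE ?bnorm_ge0//.
rewrite bnorm_sqr; last exact: ED.
have := form_line 1 hu hv; rewrite scale1r => ->; rewrite sqrrD -!bnorm_sqr//.
have := form_le_bnorm hu hv.
by move: (B u v) (bnorm u) (bnorm v) => x y z; lra.
Qed.

Variables (F : V -> V) (u0 : V) (rho c L : R).
Hypotheses (c_gt0 : 0 < c) (cL : c <= L) (rho_gt0 : 0 < rho) (Eu0 : E u0).

Definition in_ball u := E u /\ bnorm (u - u0) <= rho.

Hypothesis FE : forall u, in_ball u -> E (F u).
Hypothesis F_mono : forall u v, in_ball u -> in_ball v ->
  c * bnorm (u - v) ^+ 2 <= B (F u - F v) (u - v).
Hypothesis F_lip : forall u v, in_ball u -> in_ball v -> bnorm (F u - F v) <= L * bnorm (u - v).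
Hypothesis F_res : bnorm (F u0) <= c * rho / 2.

(** This step s minimises 1 - 2 s c + s^2 L^2, and the minimum 1 - s c is at most [theta]
    squared. *)
Let step : R := c / L ^+ 2.
Let theta : R := 1 - step * c / 2.
Let G u := u - step *: F u.

Let L_gt0 : 0 < L. Proof. exact: lt_le_trans cL. Qed.
Let step_gt0 : 0 < step. Proof. by rewrite divr_gt0// exprn_gt0. Qed.
Let step_c : step * c <= 1.
Proof.
have l2 : 0 < L ^+ 2 by rewrite exprn_gt0.
rewrite /step mulrAC ler_pdivrMr// mul1r -expr2.
by rewrite ler_pXn2r// nnegrE ltW.
Qed.
Let theta_ge0 : 0 <= theta. Proof. by have := step_c; rewrite /theta; move: (step * c) => x hx; lra. Qed.
Let theta_lt1 : theta < 1.
Proof. by rewrite /theta ltrBlDr ltrDl divr_gt0// mulr_gt0. Qed.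

Let G_contr u v : in_ball u -> in_ball v -> bnorm (G u - G v) <= theta * bnorm (u - v).
Proof.
move=> bu bv; have [hu _] := bu; have [hv _] := bv.
have hd := EB hu hv; have hF := EB (FE bu) (FE bv).
have -> : G u - G v = (u - v) + (- step) *: (F u - F v).
  by rewrite /G opprB scaleNr scalerBr opprB addrACA [RHS]addrACA; congr (_ + _); exact: addrC.
rewrite -(@ler_pXn2r _ 2) ?nnegrE ?bnorm_ge0// ?mulr_ge0 ?bnorm_ge0//.
rewrite bnorm_sqr; last exact: ED hd (EZ _ hF).
rewrite form_line// (BC hd hF) -!bnorm_sqr// exprMn.
have h1 := F_mono bu bv.
have h2 : bnorm (F u - F v) ^+ 2 <= L ^+ 2 * bnorm (u - v) ^+ 2.
  by rewrite -exprMn ler_pXn2r ?nnegrE ?bnorm_ge0 ?mulr_ge0 ?bnorm_ge0 ?F_lip// ltW.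
have h3 : step ^+ 2 * bnorm (F u - F v) ^+ 2 <= step * c * bnorm (u - v) ^+ 2.
  apply: le_trans (ler_wpM2l (sqr_ge0 _) h2) _; rewrite mulrA.
  have -> : step ^+ 2 * L ^+ 2 = step * c; last by [].
  by rewrite /step; field; rewrite gt_eqF.
have h4 : step * (c * bnorm (u - v) ^+ 2) <= step * B (F u - F v) (u - v).
  by rewrite ler_pM2l.
have h5 : (1 - step * c) * bnorm (u - v) ^+ 2 <= theta ^+ 2 * bnorm (u - v) ^+ 2.
  apply: ler_wpM2r; first exact: sqr_ge0.
  by rewrite /theta; have := sqr_ge0 (step * c); nra.
rewrite sqrrN; apply: le_trans h5.
move: h3 h4; move: (B _ _) (bnorm (u - v) ^+ 2) (bnorm (F u - F v) ^+ 2) => x y z h3 h4.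
by move: h3 h4; move: step => s; lra.
Qed.

Let in_ball0 : in_ball u0.
Proof.
split => //; have z0 : u0 - u0 = 0 *: u0 by rewrite subrr scale0r.
by rewrite z0 bnormZ// normr0 mul0r ltW.
Qed.

Let EG u : in_ball u -> E (G u).
Proof. by move=> bu; apply: EB; [exact: bu.1|exact: EZ (FE bu)]. Qed.

Let G_ball u : in_ball u -> in_ball (G u).
Proof.
move=> bu; split; first exact: EG.
have hG := EG bu; have hG0 := EG in_ball0.
rewrite -(subrK (G u0) (G u)) -addrA.
apply: le_trans (bnormD (EB hG hG0) (EB hG0 Eu0)) _.
have -> : bnorm (G u0 - u0) = step * bnorm (F u0).
  rewrite /G addrAC subrr add0r bnormN; last exact: EZ (FE in_ball0).
  by rewrite bnormZ ?(ger0_norm (ltW step_gt0))//; exact: FE.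
have h1 := G_contr bu in_ball0.
have h2 : theta * bnorm (u - u0) <= theta * rho by apply: ler_wpM2l => //; exact: bu.2.
have h3 : step * bnorm (F u0) <= step * (c * rho / 2) by rewrite ler_pM2l.
(* The bound in [F_res] is calibrated so that the contracted radius and the first step add up to rho
   exactly. *)
have h4 : theta * rho + step * (c * rho / 2) = rho by rewrite /theta; field.
by rewrite -[X in _ <= X]h4; apply: lerD => //; exact: le_trans h2.
Qed.

(** No limit is taken, since [E] need not be complete for the form; geometric bounds on the iterates
    are returned instead. *)
Theorem zarantonello : exists (u : nat -> V) (K th : R),
  [/\ 0 <= K, 0 <= th, th < 1, forall n, in_ball (u n) &
  (forall n m, (n <= m)%N -> bnorm (u n - u m) <= K * th ^+ n) /\
  (forall n, bnorm (F (u n)) <= K * th ^+ n)].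
Proof.
pose u n := iter n G u0.
have bu n : in_ball (u n) by elim: n => [|n IH]; [exact: in_ball0|exact: G_ball].
have uE n : u n - u n.+1 = step *: F (u n).
  by rewrite /u iterS -/(u n) /G opprB addrCA subrr addr0.
have EF n := FE (bu n).
have du n : bnorm (u n - u n.+1) = step * bnorm (F (u n)).
  by rewrite uE bnormZ// (ger0_norm (ltW step_gt0)).
have hd n : bnorm (u n - u n.+1) <= theta ^+ n * (step * bnorm (F u0)).
  elim: n => [|n IH]; first by rewrite expr0 mul1r du.
  rewrite exprS -mulrA; apply: le_trans (ler_wpM2l theta_ge0 IH).
  exact: (G_contr (bu n) (bu n.+1)).
have hF n : bnorm (F (u n)) <= theta ^+ n * bnorm (F u0).
  by have := hd n; rewrite du mulrCA ler_pM2l.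
pose s := step * bnorm (F u0) / (1 - theta).
have t1 : 0 < 1 - theta by rewrite subr_gt0.
have s0 : 0 <= s by apply: divr_ge0; [exact: mulr_ge0 (ltW step_gt0) (bnorm_ge0 _)|exact: ltW].
have tele n j : bnorm (u n - u (n + j)%N) <= s * (theta ^+ n - theta ^+ (n + j)).
  elim: j => [|j IH].
    have z0 : u n - u n = 0 *: u n by rewrite subrr scale0r.
    by rewrite addn0 z0 (subrr (theta ^+ n)) mulr0 bnormZ ?normr0 ?mul0r//; exact: (bu n).1.
  rewrite addnS -(subrK (u (n + j)%N) (u n)) -addrA.
  have [e1 _] := bu n; have [e2 _] := bu (n + j)%N; have [e3 _] := bu (n + j).+1.
  apply: le_trans (bnormD (EB e1 e2) (EB e2 e3)) _.
  apply: le_trans (lerD IH (hd _)) _; rewrite exprS.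
  have -> : step * bnorm (F u0) = s * (1 - theta) by rewrite /s divfK// gt_eqF.
  by rewrite le_eqVlt; apply/orP; left; apply/eqP; ring.
have n0 := bnorm_ge0 (F u0).
exists u, (s + bnorm (F u0)), theta; split => //; first exact: addr_ge0.
have tn n : 0 <= theta ^+ n by exact: exprn_ge0.
split=> [n m nm|n].
  rewrite -(subnKC nm); apply: le_trans (tele _ _) _; rewrite mulrDl.
  rewrite mulrBr; have := mulr_ge0 s0 (tn (n + (m - n))%N); have := mulr_ge0 n0 (tn n); lra.
apply: le_trans (hF n) _; rewrite mulrC ler_wpM2r// lerDr//.
Qed.

End zarantonello.

(** * Limits of geometrically Cauchy sequences *)

Section uniform_limit.
Context {R : realType}.
Variables (K th : R).
Hypotheses (K0 : 0 <= K) (th0 : 0 <= th) (th1 : th < 1).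

Lemma geometric_small (e : R) n : 0 < e -> exists m, (n <= m)%N /\ K * th ^+ m <= e.
Proof.
move=> e0; have : K * th ^+ m @[m --> \oo] --> K * 0.
  by apply: cvgZr; apply: cvg_expr; rewrite ger0_norm.
rewrite mulr0 => /cvgrPdist_le /(_ e e0) [N _ hN].
exists (maxn n N); split; first exact: leq_maxl.
have := hN (maxn n N) (leq_maxr _ _); rewrite sub0r normrN; exact: le_trans (ler_norm _).
Qed.

(** The limit is the supremum of the lower bounds P n x - K th^n, each of which lies below every
    upper bound P m x + K th^m. *)
Lemma uniform_limit (P : nat -> R -> R) :
  (forall n m x, (n <= m)%N -> `|P n x - P m x| <= K * th ^+ n) ->
  exists Q : R -> R, forall n x, `|P n x - Q x| <= K * th ^+ n.
Proof.
move=> h; have tn n : 0 <= K * th ^+ n by rewrite mulr_ge0// exprn_ge0.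
have ub n m x : P m x - K * th ^+ m <= P n x + K * th ^+ n.
  have [nm|/ltnW nm] := leqP n m.
    by have := h n m x nm; rewrite ler_norml => /andP[+ _]; have := tn m; lra.
  by have := h m n x nm; rewrite ler_norml => /andP[_]; have := tn n; lra.
pose X x := [set y | exists n, y = P n x - K * th ^+ n].
have hX x : has_sup (X x).
  split; first by exists (P 0%N x - K * th ^+ 0); exists 0%N.
  by exists (P 0%N x + K * th ^+ 0) => _ [m ->].
exists (fun x => sup (X x)) => n x; rewrite ler_norml; apply/andP; split.
  have : sup (X x) <= P n x + K * th ^+ n.
    by apply: ge_sup; [exact: (hX x).1|move=> _ [m ->]].
  lra.
have : P n x - K * th ^+ n <= sup (X x) by apply: ub_le_sup; [exact: (hX x).2|exists n].
lra.
Qed.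

Lemma uniform_limit_cont (P : nat -> R -> R) (Q : R -> R) :
  (forall n, continuous (P n)) -> (forall n x, `|P n x - Q x| <= K * th ^+ n) -> continuous Q.
Proof.
move=> cP h x; apply/cvgrPdist_le => e e0.
have e3 : 0 < e / 3 by rewrite divr_gt0.
have [n [_ hn]] := geometric_small 0 e3.
have : P n y @[y --> x] --> P n x by exact: cP.
move=> /cvgrPdist_le /(_ _ e3); apply: filterS => y hy.
have h1 := le_trans (h n x) hn; have h2 := le_trans (h n y) hn.
have -> : Q x - Q y = - (P n x - Q x) + (P n x - P n y) + (P n y - Q y) by ring.
apply: le_trans (ler_normD _ _) _.
have : `|- (P n x - Q x) + (P n x - P n y)| <= e / 3 + e / 3.
  by apply: le_trans (ler_normD _ _) _; rewrite normrN lerD.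
lra.
Qed.

(** On a bounded interval uniform convergence lets f m replace g at small cost, so the L^2 bound on
    f n - f m passes to f n - g; the interval is arbitrary. *)
Lemma L2_limit (f : nat -> R -> R) (g : R -> R) : (forall n, L2c (f n)) -> continuous g ->
  (forall n m, (n <= m)%N -> nrm (fun x => f n x - f m x) <= K * th ^+ n) ->
  (forall n x, `|f n x - g x| <= K * th ^+ n) ->
  L2c g /\ forall n, nrm (fun x => f n x - g x) <= K * th ^+ n.
Proof.
move=> hf cg h1 h2.
have key n : L2c (fun x => f n x - g x) /\ ip (fun x => f n x - g x) (fun x => f n x - g x) <= (K * th ^+ n) ^+ 2.
  have cfg m : continuous (fun x => f m x - g x) by apply: contB => //; exact: (hf m).1.
  apply: L2c_bounded => // T Tge0.
  set e := K * th ^+ n; apply/ler_addgt0Pr => eta eta0.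
  have dp : 0 < e ^+ 2 + 4 * T + 1 by have := sqr_ge0 e; lra.
  (* If |b| <= d then (a + b)^2 <= (1 + d) a^2 + d^2 + d. After integration over [-T, T] the excess
     is at most d (e^2 + 4 T), and this choice keeps it below eta. *)
  pose d := Num.min 1 (eta / (e ^+ 2 + 4 * T + 1)).
  have d0 : 0 < d by rewrite lt_min ltr01 divr_gt0.
  have d1 : d <= 1 by rewrite ge_min lexx.
  have d2 : d * (e ^+ 2 + 4 * T + 1) <= eta by rewrite -ler_pdivlMr// ge_min lexx orbT.
  have [m [nm hm]] := geometric_small n d0.
  have hB := L2cB (hf n) (hf m).
  have cB := hB.1; have cB2 := contX (n := 2) cB.
  have i1 : int (- T) T (fun x => (f n x - f m x) ^+ 2) <= e ^+ 2.
    apply: le_trans (int_sqr_le_ip _ _ hB) _; rewrite -nrm_sqr.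
    by rewrite ler_pXn2r ?nnegrE ?nrm_ge0 ?h1// /e mulr_ge0// exprn_ge0.
  have i2 : int (- T) T (fun x => (f n x - g x) ^+ 2) <=
     int (- T) T (fun x => (1 + d) * (f n x - f m x) ^+ 2 + (d ^+ 2 + d)).
    apply: le_int; first exact: (contX (n := 2)).
      by apply: contD; [exact: contZ|exact: cont_cst].
    move=> x _; have hb := le_trans (h2 m x) hm.
    have -> : f n x - g x = (f n x - f m x) + (f m x - g x) by ring.
    move: hb; move: (f n x - f m x) (f m x - g x) => a b; rewrite ler_norml => /andP[b1 b2].
    have b3 : b ^+ 2 <= d ^+ 2 by nra.
    have : 0 <= (d * a - b) ^+ 2 by exact: sqr_ge0.
    have -> : (d * a - b) ^+ 2 = d * (d * a ^+ 2 - 2 * (a * b)) + b ^+ 2 by ring.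
    move=> h3; have h4 : 0 <= d * (d * a ^+ 2 - 2 * (a * b) + d) by nra.
    by rewrite pmulr_rge0// in h4; nra.
  apply: le_trans i2 _; rewrite intD; [|exact: contZ|exact: cont_cst].
  rewrite intZ// int_cst; last by lra.
  have : (1 + d) * int (- T) T (fun x => (f n x - f m x) ^+ 2) <= (1 + d) * e ^+ 2.
    by apply: ler_wpM2l => //; lra.
  have dT : d ^+ 2 * T <= d * T by apply: ler_wpM2r => //; rewrite expr2 ler_piMr// ltW.
  lra.
have hg : L2c g.
  have [h3 _] := key 0%N; have := L2cB (hf 0%N) h3.
  by congr L2c; apply/funext => x; ring.
split => // n; apply: nrm_le; last exact: (key n).2.
by rewrite mulr_ge0// exprn_ge0.
Qed.

End uniform_limit.

Section pairs.
Context {R : realType}.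
(** [R^o] equips functions with the pointwise module structure that the abstract iteration
    expects. *)
Definition pairT := ((R -> R^o) * (R -> R^o))%type.
Implicit Types (u v w : pairT) (c : R).

Definition Ep u : Prop := [/\ L2c (u.1 : R -> R), L2c (u.2 : R -> R), even u.1 & even u.2].
Definition pair_form u v : R := ip u.1 v.1 + ip u.2 v.2.
Local Notation bn := (bnorm pair_form).

Lemma pair1B u v x : (u - v).1 x = u.1 x - v.1 x. Proof. by []. Qed.
Lemma pair2B u v x : (u - v).2 x = u.2 x - v.2 x. Proof. by []. Qed.

Lemma Ep_D u v : Ep u -> Ep v -> Ep (u + v).
Proof.
move=> [h1 h2 e1 e2] [h3 h4 e3 e4]; split; first exact: (L2cD h1 h3).
- exact: (L2cD h2 h4).
- by move=> x; rewrite /= /GRing.add /= e1 e3.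
- by move=> x; rewrite /= /GRing.add /= e2 e4.
Qed.

Lemma Ep_Z c u : Ep u -> Ep (c *: u).
Proof.
move=> [h1 h2 e1 e2]; split; [exact: (L2cZ c h1)|exact: (L2cZ c h2)| |].
- by move=> x; rewrite /= /GRing.scale /= e1.
- by move=> x; rewrite /= /GRing.scale /= e2.
Qed.

Lemma Bp_C u v : Ep u -> Ep v -> pair_form u v = pair_form v u.
Proof. by rewrite /pair_form (ipC u.1) (ipC u.2). Qed.

Lemma Bp_D u v w : Ep u -> Ep v -> Ep w -> pair_form (u + v) w = pair_form u w + pair_form v w.
Proof.
move=> [h1 h2 _ _] [h3 h4 _ _] [h5 h6 _ _].
rewrite /pair_form addrACA; congr (_ + _); [exact: ipDl|exact: ipDl].
Qed.

Lemma Bp_Z c u v : Ep u -> Ep v -> pair_form (c *: u) v = c * pair_form u v.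
Proof.
move=> [h1 h2 _ _] [h3 h4 _ _].
by rewrite /pair_form mulrDr; congr (_ + _); [exact: ipZl|exact: ipZl].
Qed.

Lemma Bp_ge0 u : Ep u -> 0 <= pair_form u u.
Proof. by move=> _; rewrite addr_ge0// ip_ge0. Qed.

Lemma Ep_B u v : Ep u -> Ep v -> Ep (u - v).
Proof. by move=> hu hv; rewrite -scaleN1r; apply: Ep_D => //; exact: Ep_Z. Qed.

Lemma bn_sqr u : Ep u -> bn u ^+ 2 = nrm u.1 ^+ 2 + nrm u.2 ^+ 2.
Proof. by move=> hu; rewrite (bnorm_sqr Bp_ge0 hu) !nrm_sqr. Qed.

Lemma nrm1_le_bn u : Ep u -> nrm u.1 <= bn u.
Proof.
move=> hu; rewrite -(@ler_pXn2r _ 2) ?nnegrE ?bnorm_ge0 ?nrm_ge0//.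
by rewrite bn_sqr// lerDl sqr_ge0.
Qed.

Lemma nrm2_le_bn u : Ep u -> nrm u.2 <= bn u.
Proof.
move=> hu; rewrite -(@ler_pXn2r _ 2) ?nnegrE ?bnorm_ge0 ?nrm_ge0//.
by rewrite bn_sqr// lerDr sqr_ge0.
Qed.

Lemma bn_le_nrm u : Ep u -> bn u <= nrm u.1 + nrm u.2.
Proof.
move=> hu; have n1 := nrm_ge0 u.1; have n2 := nrm_ge0 u.2.
rewrite -(@ler_pXn2r _ 2) ?nnegrE ?bnorm_ge0// ?addr_ge0//.
by rewrite bn_sqr// sqrrD; have := mulr_ge0 n1 n2; move: (nrm _) (nrm _) => x y; lra.
Qed.

Lemma Bp_le u v : Ep u -> Ep v -> `|pair_form u v| <= bn u * bn v.
Proof.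
move=> hu hv; have Bl := form_le_bnorm Ep_D Ep_Z Bp_C Bp_D Bp_Z Bp_ge0.
rewrite ler_norml; apply/andP; split; last exact: Bl.
have hN : Ep (- u) by rewrite -scaleN1r; exact: Ep_Z.
have := Bl _ _ hN hv; rewrite (bnormN Ep_Z Bp_C Bp_Z)// -scaleN1r Bp_Z// mulN1r; lra.
Qed.

End pairs.

(** * Reflection of the negative direction *)

Section reflection.
Context {R : realType} (V : lmodType R) (E : V -> Prop) (B : V -> V -> R).
Hypothesis ED : forall u v, E u -> E v -> E (u + v).
Hypothesis EZ : forall (c : R) u, E u -> E (c *: u).
Hypothesis BC : forall u v, E u -> E v -> B u v = B v u.
Hypothesis BD : forall u v w, E u -> E v -> E w -> B (u + v) w = B u w + B v w.
Hypothesis BZ : forall (c : R) u v, E u -> E v -> B (c *: u) v = c * B u v.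
Hypothesis B_ge0 : forall u, E u -> 0 <= B u u.
Local Notation bn := (bnorm B).

Lemma E_B u v : E u -> E v -> E (u - v).
Proof. by move=> hu hv; rewrite -scaleN1r; apply: ED => //; exact: EZ. Qed.

Lemma form_B u v w : E u -> E v -> E w -> B (u - v) w = B u w - B v w.
Proof. by move=> hu hv hw; rewrite -scaleN1r BD ?BZ ?mulN1r//; exact: EZ. Qed.

Lemma bnormB u v : E u -> E v -> bn (u - v) <= bn u + bn v.
Proof.
move=> hu hv; have hN : E (- v) by rewrite -scaleN1r; exact: EZ.
rewrite -(bnormN EZ BC BZ hv); exact: (bnormD ED EZ BC BD BZ B_ge0).
Qed.

Lemma form_norm_le u v : E u -> E v -> `|B u v| <= bn u * bn v.
Proof.
move=> hu hv; have hN : E (- u) by rewrite -scaleN1r; exact: EZ.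
have h := form_le_bnorm ED EZ BC BD BZ B_ge0.
have := h _ _ hN hv; rewrite (bnormN EZ BC BZ hu) -scaleN1r BZ// mulN1r => h1.
by rewrite ler_norml lerNl h1 h.
Qed.

Variables (g w : V).
Hypotheses (Eg : E g) (Ew : E w) (N_neq0 : B g w != 0).

(* [refl] reverses [w] and fixes the kernel of [<g, .>]; [reflT] is its adjoint. *)
Definition refl u := u - (2 * B g u / B g w) *: w.
Definition reflT u := u - (2 * B u w / B g w) *: g.
Definition refl_cst : R := 1 + 2 * bn g * bn w / `|B g w|.

Lemma E_refl u : E u -> E (refl u). Proof. by move=> h; apply: E_B => //; exact: EZ. Qed.
Lemma E_reflT u : E u -> E (reflT u). Proof. by move=> h; apply: E_B => //; exact: EZ. Qed.

Lemma reflT_adj u v : E u -> E v -> B (reflT u) v = B u (refl v).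
Proof.
move=> hu hv; have hz := EZ (2 * B u w / B g w) Eg; have hz' := EZ (2 * B g v / B g w) Ew.
rewrite form_B// BZ// (BC hu (E_refl hv)) form_B// BZ// (BC Ew hu) (BC hv hu).
by move: (B u v) (B u w) (B g v) => x y z; field.
Qed.

Lemma reflT_B u v : E u -> E v -> reflT (u - v) = reflT u - reflT v.
Proof.
move=> hu hv; rewrite /reflT form_B// mulrBr mulrBl scalerBl !opprB.
by rewrite addrACA [RHS]addrACA; congr (_ + _); exact: addrC.
Qed.

(** [reflT] changes the sign of the pairing with w, so it is an involution, and bounds on
    [reflT (T u)] give back bounds on [T u]. *)
Lemma reflT_inv u : E u -> reflT (reflT u) = u.
Proof.
move=> hu; have hz := EZ (2 * B u w / B g w) Eg.
have e : B (reflT u) w = - B u w by rewrite form_B// BZ//; move: (B u w) => x; field.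
by rewrite {1}/reflT e /reflT mulrN mulNr scaleNr opprK subrK.
Qed.

Lemma bn_reflT u : E u -> bn (reflT u) <= refl_cst * bn u.
Proof.
move=> hu; apply: le_trans (bnormB hu (EZ _ Eg)) _; rewrite (bnormZ EZ BC BZ)//.
rewrite /refl_cst [X in _ <= X]mulrDl mul1r (lerD2l (bn u)) normrM normfV normrM (ger0_norm (ler0n _ 2)).
have -> : 2 * bn g * bn w / `|B g w| * bn u = 2 * (bn u * bn w) / `|B g w| * bn g by ring.
apply: ler_wpM2r; first exact: bnorm_ge0.
by apply: ler_wpM2r; [rewrite invr_ge0|rewrite ler_pM2l// form_norm_le].
Qed.

Lemma bn_refl u : E u -> bn (refl u) <= refl_cst * bn u.
Proof.
move=> hu; apply: le_trans (bnormB hu (EZ _ Ew)) _; rewrite (bnormZ EZ BC BZ)//.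
rewrite /refl_cst [X in _ <= X]mulrDl mul1r (lerD2l (bn u)) normrM normfV normrM (ger0_norm (ler0n _ 2)).
have -> : 2 * bn g * bn w / `|B g w| * bn u = 2 * (bn g * bn u) / `|B g w| * bn w by ring.
apply: ler_wpM2r; first exact: bnorm_ge0.
by apply: ler_wpM2r; [rewrite invr_ge0|rewrite ler_pM2l// form_norm_le].
Qed.

Lemma refl_cst_ge1 : 1 <= refl_cst.
Proof. by rewrite lerDl divr_ge0// !mulr_ge0// bnorm_ge0. Qed.

Variables (T : V -> V) (u0 : V) (rho c L : R).
Hypotheses (c_gt0 : 0 < c) (L_ge0 : 0 <= L) (rho_gt0 : 0 < rho) (Eu0 : E u0).
Local Notation ball := (in_ball E B u0 rho).
Hypothesis TE : forall u, ball u -> E (T u).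
Hypothesis T_mono : forall u v, ball u -> ball v ->
  c * bn (u - v) ^+ 2 <= B (T u - T v) (refl (u - v)).
Hypothesis T_lip : forall u v, ball u -> ball v -> bn (T u - T v) <= L * bn (u - v).
Hypothesis T_res : refl_cst * bn (T u0) <= c * rho / 2.

(** Composed with [reflT], the map [T] is strongly monotone in the ordinary sense, because <reflT d,
    v> = <d, refl v>. *)
Theorem reflected_zarantonello : exists (u : nat -> V) (K th : R),
  [/\ 0 <= K, 0 <= th, th < 1, forall n, ball (u n) &
  (forall n m, (n <= m)%N -> bn (u n - u m) <= K * th ^+ n) /\
  (forall n, bn (T (u n)) <= K * th ^+ n)].
Proof.
pose F u := reflT (T u); have C1 := refl_cst_ge1.
have C0 : 0 <= refl_cst by apply: le_trans C1.
have b0 : ball u0.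
  split => //; have z0 : u0 - u0 = 0 *: u0 by rewrite subrr scale0r.
  by rewrite z0 (bnormZ EZ BC BZ)// normr0 mul0r ltW.
have FE u : ball u -> E (F u) by move=> bu; apply: E_reflT; exact: TE.
have F_mono u v : ball u -> ball v -> c * bn (u - v) ^+ 2 <= B (F u - F v) (u - v).
  move=> bu bv; rewrite -reflT_B; [|exact: TE|exact: TE].
  rewrite reflT_adj; [exact: T_mono|exact: E_B (TE bu) (TE bv)|exact: E_B bu.1 bv.1].
(* The summand c makes the Lipschitz constant at least as large as the monotonicity constant. *)
have F_lip u v : ball u -> ball v -> bn (F u - F v) <= (refl_cst * L + c) * bn (u - v).
  move=> bu bv; rewrite -reflT_B; [|exact: TE|exact: TE].
  apply: le_trans (bn_reflT (E_B (TE bu) (TE bv))) _.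
  have h := ler_wpM2l C0 (T_lip bu bv); apply: le_trans h _.
  rewrite mulrA; apply: ler_wpM2r; first exact: bnorm_ge0.
  by rewrite lerDl ltW.
have F_res : bn (F u0) <= c * rho / 2 by apply: le_trans (bn_reflT (TE b0)) T_res.
have cL : c <= refl_cst * L + c by rewrite lerDr mulr_ge0.
have [u [K [th [K0 th0 th1 bu [h1 h2]]]]] :=
  zarantonello ED EZ BC BD BZ B_ge0 c_gt0 cL rho_gt0 Eu0 FE F_mono F_lip F_res.
have tn n : 0 <= th ^+ n by exact: exprn_ge0.
exists u, (refl_cst * K), th; split => //; first exact: mulr_ge0.
split=> [n m nm|n].
  apply: le_trans (h1 n m nm) _; apply: ler_wpM2r => //.
  by rewrite -[X in X <= _]mul1r; exact: ler_wpM2r.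
rewrite -(reflT_inv (TE (bu n))); apply: le_trans (bn_reflT (FE _ (bu n))) _.
by rewrite -mulrA; apply: ler_wpM2l.
Qed.

End reflection.

(** * Existence in normalised coordinates *)

Section component_limit.
Context {R : realType}.
Variables (K th : R).
Hypotheses (K0 : 0 <= K) (th0 : 0 <= th) (th1 : th < 1).

Lemma geometric_zero (a : R) (C : R) : 0 <= C -> (forall n, `|a| <= C * th ^+ n) -> a = 0.
Proof.
move=> C0 h; apply/eqP; rewrite -normr_le0; apply/ler_addgt0Pr => e e0; rewrite add0r.
by have [n [_ hn]] := geometric_small C th0 th1 0 e0; exact: le_trans (h n) hn.
Qed.

(** In ka p - P = t the right side tends to 0 in L^2 while P converges uniformly. So P / ka, which
    differs from p by a null sequence in L^2, has a continuous limit, and p tends to it in L^2. *)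
Lemma component_limit (p P t : nat -> R -> R) (ka C : R) : 0 < ka -> 0 <= C ->
  (forall n, L2c (p n)) -> (forall n, even (p n)) -> (forall n, continuous (P n)) ->
  (forall n, L2c (t n)) -> (forall n x, ka * p n x - P n x = t n x) ->
  (forall n, nrm (t n) <= K * th ^+ n) ->
  (forall n m, (n <= m)%N -> nrm (fun x => p n x - p m x) <= K * th ^+ n) ->
  (forall n m x, (n <= m)%N -> `|P n x - P m x| <= C * K * th ^+ n) ->
  exists g K', [/\ 0 <= K', L2c g, (forall n, even (P n)) -> even g,
    forall n, nrm (fun x => p n x - g x) <= K' * th ^+ n &
    forall n x, `|P n x - ka * g x| <= K' * th ^+ n].
Proof.
move=> ka0 C0 hp ep cP ht pt nt np nP.
have CK : 0 <= C * K by exact: mulr_ge0.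
have tn n : 0 <= th ^+ n by exact: exprn_ge0.
have i0 : 0 <= ka^-1 by rewrite invr_ge0 ltW.
have kan : ka != 0 by rewrite gt_eqF.
have [Q hQ] := uniform_limit CK th0 nP.
have cQ := uniform_limit_cont th0 th1 cP hQ.
pose f n x := ka^-1 * P n x; pose g x := ka^-1 * Q x.
pose K1 := ka^-1 * (C * K) + K + 2 * ka^-1 * K.
have K10 : 0 <= K1 by rewrite /K1 !addr_ge0 ?mulr_ge0.
have fE n : f n = (fun x => p n x - ka^-1 * t n x).
  by apply/funext => x; rewrite -pt /f; field.
have hf n : L2c (f n) by rewrite fE; exact: L2cB (hp n) (L2cZ _ (ht n)).
have nf n m : (n <= m)%N -> nrm (fun x => f n x - f m x) <= K1 * th ^+ n.
  move=> nm.
  have -> : (fun x => f n x - f m x) = (fun x => (p n x - p m x) - ka^-1 * (t n x - t m x)).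
    by apply/funext => x; rewrite !fE; ring.
  apply: le_trans (nrmB (L2cB (hp n) (hp m)) (L2cZ _ (L2cB (ht n) (ht m)))) _.
  rewrite (nrmZ _ (L2cB (ht n) (ht m))) (ger0_norm i0).
  have h1 := np n m nm; have h2 := nrmB (ht n) (ht m).
  have h3 : nrm (t m) <= K * th ^+ n.
    by apply: le_trans (nt m) _; apply: ler_wpM2l => //; apply: ler_wiXn2l => //; exact: ltW.
  have h4 : nrm (fun x => t n x - t m x) <= 2 * (K * th ^+ n).
    by apply: le_trans h2 _; rewrite mulr_natl mulr2n; exact: (lerD (nt n) h3).
  have h5 := ler_wpM2l i0 h4.
  have h6 : 0 <= ka^-1 * (C * K) * th ^+ n by rewrite !mulr_ge0.
  apply: le_trans (lerD h1 h5) _; rewrite /K1; lra.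
have fg n x : `|f n x - g x| <= K1 * th ^+ n.
  rewrite /f /g -mulrBr normrM (ger0_norm i0); have h := ler_wpM2l i0 (hQ n x).
  apply: le_trans h _; rewrite mulrA; apply: ler_wpM2r => //.
  by rewrite /K1 -addrA lerDl addr_ge0// !mulr_ge0.
have cg : continuous g by exact: contZ.
have [hg ng] := L2_limit K10 th0 th1 hf cg nf fg.
exists g, (K1 + ka^-1 * K + C * K); split => //.
- by rewrite !addr_ge0 ?mulr_ge0.
- move=> eP x; apply/eqP; rewrite -subr_eq0; apply/eqP.
  apply: (@geometric_zero _ (2 * K1)) => [|n]; first exact: mulr_ge0.
  have -> : g (- x) - g x = (f n x - g x) - (f n (- x) - g (- x)).
    by rewrite {2}/f eP -/(f n x); ring.
  apply: le_trans (ler_normB _ _) _; rewrite -mulrA mulr_natl mulr2n.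
  exact: (lerD (fg n x) (fg n (- x))).
- move=> n; have -> : (fun x => p n x - g x) = (fun x => ka^-1 * t n x + (f n x - g x)).
    by apply/funext => x; rewrite fE; ring.
  apply: le_trans (nrmD (L2cZ _ (ht n)) (L2cB (hf n) hg)) _.
  rewrite (nrmZ _ (ht n)) (ger0_norm i0); have h1 := ler_wpM2l i0 (nt n); have h2 := ng n.
  have h3 : 0 <= C * K * th ^+ n by rewrite mulr_ge0.
  apply: le_trans (lerD h1 h2) _; lra.
- move=> n x; have -> : ka * g x = Q x by rewrite /g mulrA mulfV// mul1r.
  apply: le_trans (hQ n x) _; apply: ler_wpM2r => //.
  by rewrite lerDr addr_ge0// mulr_ge0.
Qed.

End component_limit.

Section fixed_eps.
Context {R : realType} {M : nat}.
Variables (k a0 a1 a2 b0 b1 b2 b3 : 'I_M -> R) (sig0 tau delta0 gam : R).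
Variables (psi0 psi1 : 'I_M -> R -> R -> R).
Hypotheses (tau_gt0 : 0 < tau) (delta0_gt0 : 0 < delta0) (DD_gt0 : 0 < DD k a0).
Hypothesis sum0 : \sum_m k m ^+ 2 * a0 m = sig0.
Hypothesis sum1 : \sum_m k m ^+ 2 * a1 m = 0.
Hypothesis sum2 : \sum_m k m ^+ 2 * a2 m = sig0 - tau.
Hypothesis det_ge : forall z,
  delta0 * Num.min `|z| 2 ^+ 2 <= L00 k a0 z * L11 k a2 tau z - L01 k a1 z ^+ 2.
Hypothesis nn_neq0 : nn k b0 != 0.
Hypothesis gam_ge0 : 0 <= gam.
Hypotheses (psi00 : forall m, psi0 m 0 0 = 0) (psi10 : forall m, psi1 m 0 0 = 0).
Hypothesis psi0_lip : forall m x y x' y', `|psi0 m x y - psi0 m x' y'| <=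
  gam * (x ^+ 2 + y ^+ 2 + x' ^+ 2 + y' ^+ 2) * (`|x - x'| + `|y - y'|).
Hypothesis psi1_lip : forall m x y x' y', `|psi1 m x y - psi1 m x' y'| <=
  gam * (x ^+ 2 + y ^+ 2 + x' ^+ 2 + y' ^+ 2) * (`|x - x'| + `|y - y'|).

Implicit Types (p q f g : R -> R) (eps : R).

Local Notation W := (Wst k a0 b0).
Local Notation d1 := (dd1 k a0).
Local Notation d2 := (dd2 k a0 b0).
Local Notation Sg0 := (Sg k a0 a1 b0 b1 b2 psi0).
Local Notation Sg1 := (Sg k a1 a2 b1 b2 b3 psi1).

Local Notation T0 := (eqn0 k a0 a1 b0 b1 b2 sig0 psi0).
Local Notation T1 := (eqn1 k a1 a2 b1 b2 b3 sig0 psi1).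
Local Notation H0 := (hess0 k a0 a1 b0 b1 sig0).
Local Notation H1 := (hess1 k a0 a1 a2 b0 b1 b2 sig0).
Local Notation Hb := (hess_form k a0 a1 a2 b0 b1 b2 sig0).
Local Notation Hq := (hess_quad k a0 a1 a2 b0 b1 b2 sig0).
Local Notation corr := (correction k a0 a1 b0 b1 tau).
Local Notation zero := (fun _ : R => 0 : R).
Local Notation pairT := (@pairT R).
Local Notation bn := (bnorm (@pair_form R)).
Local Notation Bp := (@pair_form R).

Definition TT eps (u : pairT) : pairT := (T0 eps u.1 u.2, T1 eps u.1 u.2).
Definition W0 : pairT := (W, zero).
Definition approx eps : pairT := (W, fun x => eps ^+ 2 * corr x).
Definition HH eps (u : pairT) : pairT := (H0 eps u.1 u.2, H1 eps u.1 u.2).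

Let cW : continuous W. Proof. exact: Wst_cont. Qed.
Let WB x : `|W x| <= BW k a0 b0. Proof. exact: Wst_bound. Qed.
Let hW : L2c W. Proof. exact: L2c_W. Qed.
Let eW : even W. Proof. exact: Ws_even. Qed.

Lemma Ep_W0 : Ep W0.
Proof. by split => //=; exact: L2c0. Qed.

Lemma corr_even : even corr.
Proof. by move=> x; rewrite /correction /Ws2 /Wst !Ws_even. Qed.

Lemma Ep_approx eps : 0 < eps -> eps <= 1 -> Ep (approx eps).
Proof.
move=> e0 e1; split => //=; last by move=> x; rewrite corr_even.
by apply: L2cZ; exact: (big_L2c (d1_gt0 DD_gt0) (maj_corr k a0 a1 b0 b1 tau) ltr01 (lexx _)).
Qed.

Lemma Lin_even eps (u v r s : 'I_M -> R) p q : continuous p -> continuous q -> even p -> even q ->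
  even (Lin k u v r s eps W p q).
Proof.
move=> cp cq ep eq x; apply: eq_bigr => m _; apply: A_even.
  by apply: cont_gmlin => //; exact: A_cont.
by move=> y; rewrite /Am !(A_even _ _)// eW.
Qed.

Lemma Ep_HH eps u : 0 < eps -> Ep u -> Ep (HH eps u).
Proof.
move=> e0 [h1 h2 e1 e2]; split; [exact: L2c_H0|exact: L2c_H1| |].
- by move=> x; rewrite /= /hess0 e1 (Lin_even _ _ _ _ _ h1.1 h2.1 e1 e2).
- by move=> x; rewrite /= /hess1 e2 (Lin_even _ _ _ _ _ h1.1 h2.1 e1 e2).
Qed.

Lemma Bp_HH eps u v : Bp (HH eps u) v = Hb eps u.1 u.2 v.1 v.2. Proof. by []. Qed.

Variables (eps c dl rho CJ : R).
Hypotheses (e0 : 0 < eps) (e1 : eps <= 1) (c0 : 0 < c).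
Hypotheses (dl0 : 0 <= dl) (dl1 : dl <= 1) (rho0 : 0 < rho).
Hypothesis Hco : forall p q a, L2c p -> L2c q -> even p -> even q ->
  a * Hq eps W zero = Hb eps p q W zero -> c * (ip p p + ip q q) <=
  Hb eps p q (fun x => p x + - 2 * a * W x) (fun x => q x + - 2 * a * 0).
Hypothesis N_lt0 : Hq eps W zero < 0.
Local Notation g := (HH eps W0).
Local Notation ua := (approx eps).
Local Notation ball := (in_ball (@Ep R) Bp ua rho).
Hypothesis close : forall u, ball u -> forall m x, k m != 0 ->
  `|Am k eps m u.1 x - W x| <= dl /\ `|Am k eps m u.2 x| <= dl.

Let kap0 : R := \sum_m rem_cst k b0 b1 b2 gam eps (BW k a0 b0) dl m.
Let kap1 : R := \sum_m rem_cst k b1 b2 b3 gam eps (BW k a0 b0) dl m.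
Hypothesis CJ_ge : refl_cst Bp g W0 <= CJ.
Hypothesis kap_small : 4 * (kap0 + kap1) * CJ <= c.
Hypothesis res_small : CJ * bn (TT eps ua) <= c / 2 * rho / 2.

Lemma Bp_g_W0 : Bp g W0 = Hq eps W zero.
Proof. by rewrite Bp_HH -Hb_diag//; exact: L2c0. Qed.

Let Eg : Ep g. Proof. exact: Ep_HH Ep_W0. Qed.
Let N_neq0 : Bp g W0 != 0. Proof. by rewrite Bp_g_W0 lt_eqF. Qed.
Let Ea : Ep ua. Proof. exact: Ep_approx. Qed.
Let ball_a : ball ua.
Proof.
split => //; have -> : ua - ua = 0 *: ua by rewrite subrr scale0r.
by rewrite (bnormZ (@Ep_Z R) (@Bp_C R) (@Bp_Z R))// normr0 mul0r ltW.
Qed.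

Let close2 u v : ball u -> ball v -> forall m x, k m != 0 ->
  [/\ `|Am k eps m u.1 x - W x| <= dl, `|Am k eps m v.1 x - W x| <= dl,
      `|Am k eps m u.2 x| <= dl & `|Am k eps m v.2 x| <= dl].
Proof.
move=> bu bv m x k0; have [h1 h2] := close bu x k0; have [h3 h4] := close bv x k0.
by split.
Qed.

Let Lip0 : R := \sum_m lipc k a0 a1 b0 b1 b2 gam eps (BW k a0 b0) dl m.
Let Lip1 : R := \sum_m lipc k a1 a2 b1 b2 b3 gam eps (BW k a0 b0) dl m.
Let Lip : R := `|(eps ^+ 2)^-1 * (sig0 + eps ^+ 2)| + Lip0 + Lip1.

Let Lip0_ge0 : 0 <= Lip0.
Proof. by apply: sumr_ge0 => m _; exact: (lipc_ge0 _ _ _ _ _ _ gam_ge0 _ dl0 WB). Qed.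
Let Lip1_ge0 : 0 <= Lip1.
Proof. by apply: sumr_ge0 => m _; exact: (lipc_ge0 _ _ _ _ _ _ gam_ge0 _ dl0 WB). Qed.
Let Lip_ge0 : 0 <= Lip. Proof. by rewrite /Lip !addr_ge0. Qed.
Let kap0_ge0 : 0 <= kap0. Proof. by apply: sumr_ge0 => m _; exact: rem_cst_ge0. Qed.
Let kap1_ge0 : 0 <= kap1. Proof. by apply: sumr_ge0 => m _; exact: rem_cst_ge0. Qed.

Lemma Sg_diff0 u v : ball u -> ball v ->
  L2c (fun x => Sg0 eps u.1 u.2 x - Sg0 eps v.1 v.2 x) /\
  nrm (fun x => Sg0 eps u.1 u.2 x - Sg0 eps v.1 v.2 x) <=
  Lip0 * (nrm (u - v).1 + nrm (u - v).2).
Proof.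
move=> bu bv; have [[h1 h2 _ _] _] := bu; have [[h3 h4 _ _] _] := bv.
exact: (Sg_diff_L2 a0 a1 b0 b1 b2 gam_ge0 psi0_lip e0 dl0 dl1 WB h1 h2 h3 h4 (close2 bu bv)).
Qed.

Lemma Sg_diff1 u v : ball u -> ball v ->
  L2c (fun x => Sg1 eps u.1 u.2 x - Sg1 eps v.1 v.2 x) /\
  nrm (fun x => Sg1 eps u.1 u.2 x - Sg1 eps v.1 v.2 x) <=
  Lip1 * (nrm (u - v).1 + nrm (u - v).2).
Proof.
move=> bu bv; have [[h1 h2 _ _] _] := bu; have [[h3 h4 _ _] _] := bv.
exact: (Sg_diff_L2 a1 a2 b1 b2 b3 gam_ge0 psi1_lip e0 dl0 dl1 WB h1 h2 h3 h4 (close2 bu bv)).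
Qed.

(** At a point of the ball, [TT] is its value at the approximate solution, square-integrable by the
    residual bounds, plus a difference that the Lipschitz bounds cover. *)
Lemma Ep_TT u : ball u -> Ep (TT eps u).
Proof.
move=> bu; have [[h1 h2 ev1 ev2] _] := bu; have [h3 h4 _ _] := Ea.
have r0 : L2c (T0 eps ua.1 ua.2).
  exact: (big_L2c (d1_gt0 DD_gt0) (residual0 b1 b2 tau DD_gt0 sum0 sum1 nn_neq0 gam_ge0 psi00 psi0_lip) e0 e1).
have r1 : L2c (T1 eps ua.1 ua.2).
  exact: (big_L2c (d1_gt0 DD_gt0) (residual1 b1 b2 b3 tau_gt0 DD_gt0 sum1 sum2 nn_neq0 gam_ge0 psi10 psi1_lip) e0 e1).
have [s0 _] := Sg_diff0 bu ball_a; have [s1 _] := Sg_diff1 bu ball_a.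
split => /=.
- have := L2cB (L2cD r0 (L2cZ ((eps ^+ 2)^-1 * (sig0 + eps ^+ 2)) (L2cB h1 h3))) s0.
  by congr L2c; apply/funext => x; rewrite /eqn0; ring.
- have := L2cB (L2cD r1 (L2cZ ((eps ^+ 2)^-1 * (sig0 + eps ^+ 2)) (L2cB h2 h4))) s1.
  by congr L2c; apply/funext => x; rewrite /eqn1; ring.
- by move=> x; rewrite /eqn0 ev1 (Sg_even k a0 a1 b0 b1 b2 psi0_lip eps h1.1 h2.1 ev1 ev2).
- by move=> x; rewrite /eqn1 ev2 (Sg_even k a1 a2 b1 b2 b3 psi1_lip eps h1.1 h2.1 ev1 ev2).
Qed.

Lemma TT_lip u v : ball u -> ball v -> bn (TT eps u - TT eps v) <= 2 * Lip * bn (u - v).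
Proof.
move=> bu bv; have Ed : Ep (u - v) by apply: Ep_B; [exact: bu.1|exact: bv.1].
have ET : Ep (TT eps u - TT eps v) by apply: Ep_B; exact: Ep_TT.
apply: le_trans (bn_le_nrm ET) _.
have [s0 n0] := Sg_diff0 bu bv; have [s1 n1] := Sg_diff1 bu bv.
have [hd1 hd2 _ _] := Ed.
set ka := (eps ^+ 2)^-1 * (sig0 + eps ^+ 2).
have t0 : nrm (TT eps u - TT eps v).1 <= `|ka| * nrm (u - v).1 + Lip0 * (nrm (u - v).1 + nrm (u - v).2).
  have -> : (TT eps u - TT eps v).1 =
    (fun x => ka * (u - v).1 x - (Sg0 eps u.1 u.2 x - Sg0 eps v.1 v.2 x)).
    by apply/funext => x; rewrite !pair1B /TT /= /eqn0 -/ka; ring.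
  by apply: le_trans (nrmB (L2cZ ka hd1) s0) _; apply: lerD n0; rewrite (nrmZ ka hd1).
have t1 : nrm (TT eps u - TT eps v).2 <= `|ka| * nrm (u - v).2 + Lip1 * (nrm (u - v).1 + nrm (u - v).2).
  have -> : (TT eps u - TT eps v).2 =
    (fun x => ka * (u - v).2 x - (Sg1 eps u.1 u.2 x - Sg1 eps v.1 v.2 x)).
    by apply/funext => x; rewrite !pair2B /TT /= /eqn1 -/ka; ring.
  by apply: le_trans (nrmB (L2cZ ka hd2) s1) _; apply: lerD n1; rewrite (nrmZ ka hd2).
have m1 := nrm1_le_bn Ed; have m2 := nrm2_le_bn Ed.
apply: le_trans (lerD t0 t1) _.
have -> : `|ka| * nrm (u - v).1 + Lip0 * (nrm (u - v).1 + nrm (u - v).2) +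
  (`|ka| * nrm (u - v).2 + Lip1 * (nrm (u - v).1 + nrm (u - v).2)) =
  Lip * (nrm (u - v).1 + nrm (u - v).2).
  by rewrite /Lip -/ka; move: (nrm _) (nrm _) => x y; ring.
rewrite [2 * _]mulrC -mulrA; apply: ler_wpM2l => //.
by rewrite mulr_natl mulr2n; exact: (lerD m1 m2).
Qed.

(** Oblique coercivity of the linearisation gives the constant c. The remainder has Lipschitz
    constant 2 (kap0 + kap1), the reflection costs a factor [CJ], and [kap_small] makes the product
    at most c / 2. *)
Lemma TT_mono u v : ball u -> ball v ->
  c / 2 * bn (u - v) ^+ 2 <= Bp (TT eps u - TT eps v) (refl Bp g W0 (u - v)).
Proof.
move=> bu bv; have Ed : Ep (u - v) by apply: Ep_B; [exact: bu.1|exact: bv.1].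
have ET : Ep (TT eps u - TT eps v) by apply: Ep_B; exact: Ep_TT.
have EH := Ep_HH e0 Ed.
pose Er := HH eps (u - v) - (TT eps u - TT eps v).
have EE : Ep Er by exact: Ep_B.
have EJ := E_refl Bp (@Ep_D R) (@Ep_Z R) g Ep_W0 Ed.
have -> : TT eps u - TT eps v = HH eps (u - v) - Er by rewrite /Er subKr.
rewrite (form_B (@Ep_Z R) (@Bp_D R) (@Bp_Z R))//.
have [[h1 h2 _ _] _] := bu; have [[h3 h4 _ _] _] := bv.
have [s0 n0] := Sg_lin_L2 a0 a1 b0 b1 b2 gam_ge0 psi0_lip e0 dl0 dl1 cW WB h1 h2 h3 h4 (close2 bu bv).
have [s1 n1] := Sg_lin_L2 a1 a2 b1 b2 b3 gam_ge0 psi1_lip e0 dl0 dl1 cW WB h1 h2 h3 h4 (close2 bu bv).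
have r0 : nrm Er.1 <= kap0 * (nrm (u - v).1 + nrm (u - v).2).
  apply: le_trans n0; rewrite le_eqVlt; apply/orP; left; apply/eqP; congr nrm; apply/funext => x.
  rewrite /Er pair1B /TT /HH pair1B /= /hess0 /eqn0.
  rewrite -[(u.1 - v.1) x]/(u.1 x - v.1 x).
  rewrite -[Lin _ _ _ _ _ _ _ _ _ x]/(Lin k a0 a1 b0 b1 eps W (fun y => u.1 y - v.1 y) (fun y => u.2 y - v.2 y) x).
  by move: (Lin _ _ _ _ _ _ _ _ _ _) (Sg0 _ _ _ _) (Sg0 _ _ _ _) => y1 y2 y3; ring.
have r1 : nrm Er.2 <= kap1 * (nrm (u - v).1 + nrm (u - v).2).
  apply: le_trans n1; rewrite le_eqVlt; apply/orP; left; apply/eqP; congr nrm; apply/funext => x.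
  rewrite /Er pair2B /TT /HH pair2B /= /hess1 /eqn1.
  rewrite -[(u.2 - v.2) x]/(u.2 x - v.2 x).
  rewrite -[Lin _ _ _ _ _ _ _ _ _ x]/(Lin k a1 a2 b1 b2 eps W (fun y => u.1 y - v.1 y) (fun y => u.2 y - v.2 y) x).
  by move: (Lin _ _ _ _ _ _ _ _ _ _) (Sg1 _ _ _ _) (Sg1 _ _ _ _) => y1 y2 y3; ring.
have m1 := nrm1_le_bn Ed; have m2 := nrm2_le_bn Ed.
have d0 := bnorm_ge0 Bp (u - v).
have Erle : bn Er <= 2 * (kap0 + kap1) * bn (u - v).
  apply: le_trans (bn_le_nrm EE) _; apply: le_trans (lerD r0 r1) _; rewrite -mulrDl.
  rewrite [2 * _]mulrC -mulrA; apply: ler_wpM2l; first exact: addr_ge0.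
  by rewrite mulr_natl mulr2n; exact: (lerD m1 m2).
have hH : c * bn (u - v) ^+ 2 <= Bp (HH eps (u - v)) (refl Bp g W0 (u - v)).
  have [hd1 hd2 ev1 ev2] := Ed; have hz : L2c zero := L2c0.
  rewrite (bnorm_sqr (@Bp_ge0 R) Ed) Bp_HH.
  have aN : (Bp g (u - v) / Bp g W0) * Hq eps W zero = Hb eps (u - v).1 (u - v).2 W zero.
    by rewrite -Bp_g_W0 divfK// Bp_HH; exact: Hb_sym.
  have := Hco hd1 hd2 ev1 ev2 aN; set a := _ / _ => h; apply: le_trans h _.
  rewrite le_eqVlt; apply/orP; left; apply/eqP; congr Hb; apply/funext => x.
    rewrite /refl pair1B; congr (_ + _).
    rewrite -[RHS]/(- (2 * Bp g (u - v) / Bp g W0 * W x)) /a.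
    by move: (Bp _ _) (Bp _ _) (W x) => y1 y2 y3; rewrite !mulNr !mulrA.
  rewrite /refl pair2B; congr (_ + _).
  by rewrite -[RHS]/(- (2 * Bp g (u - v) / Bp g W0 * 0)) !mulr0 oppr0.
have hE : `|Bp Er (refl Bp g W0 (u - v))| <= c / 2 * bn (u - v) ^+ 2.
  apply: le_trans (Bp_le EE EJ) _.
  have hJ := bn_refl (@Ep_D R) (@Ep_Z R) (@Bp_C R) (@Bp_D R) (@Bp_Z R) (@Bp_ge0 R) Eg Ep_W0 Ed.
  have {}hJ : bn (refl Bp g W0 (u - v)) <= CJ * bn (u - v).
    by apply: le_trans hJ _; apply: ler_wpM2r.
  apply: (@le_trans _ _ (2 * (kap0 + kap1) * bn (u - v) * (CJ * bn (u - v)))).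
    by apply: ler_pM => //; exact: bnorm_ge0.
  move: kap_small => ks; have {}ks := ler_wpM2r (sqr_ge0 (bn (u - v))) ks.
  have -> : 2 * (kap0 + kap1) * bn (u - v) * (CJ * bn (u - v)) =
    4 * (kap0 + kap1) * CJ * bn (u - v) ^+ 2 / 2 by field.
  by rewrite ler_pdivrMr//; apply: le_trans ks _; rewrite le_eqVlt; apply/orP; left; apply/eqP; field.
move: hE hH; rewrite ler_norml => /andP[_].
move=> k1 k2; have e : c / 2 * bn (u - v) ^+ 2 = c * bn (u - v) ^+ 2 - c / 2 * bn (u - v) ^+ 2.
  by move: (bn (u - v) ^+ 2) => z; field.
by rewrite {1}e; exact: (lerB k2 k1).
Qed.

Hypothesis sig0_gt0 : 0 < sig0.

(** Both components converge by [component_limit] and the limit stays in the closed ball, so the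
    supremum bounds on [Sg0] and [Sg1] apply to it and carry the equation over pointwise. *)
Theorem fixed_eps_solution : exists u : pairT, [/\ Ep u, bn (u - ua) <= rho,
  forall x, T0 eps u.1 u.2 x = 0 & forall x, T1 eps u.1 u.2 x = 0].
Proof.
have ch : 0 < c / 2 by rewrite divr_gt0.
have L0 : 0 <= 2 * Lip by rewrite mulr_ge0.
have hres : refl_cst Bp g W0 * bn (TT eps ua) <= c / 2 * rho / 2.
  by apply: le_trans res_small; apply: ler_wpM2r => //; exact: bnorm_ge0.
have [u [K [th [K0 th0 th1 bu [un uT]]]]] := reflected_zarantonello (@Ep_D R) (@Ep_Z R) (@Bp_C R)
  (@Bp_D R) (@Bp_Z R) (@Bp_ge0 R) Eg Ep_W0 N_neq0 ch L0 rho0 Ea Ep_TT TT_mono TT_lip hres.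
have [ka kaE] : exists ka : R, ka = (eps ^+ 2)^-1 * (sig0 + eps ^+ 2) by eexists.
have ka0 : 0 < ka by rewrite kaE mulr_gt0 ?invr_gt0 ?addr_gt0 ?exprn_gt0.
have Eu n : Ep (u n) := (bu n).1.
have hu1 n : L2c (u n).1 by case: (Eu n).
have hu2 n : L2c (u n).2 by case: (Eu n).
have eu1 n : even (u n).1 by case: (Eu n).
have eu2 n : even (u n).2 by case: (Eu n).
have ET n := Ep_TT (bu n).
have hT1 n : L2c (TT eps (u n)).1 by case: (ET n).
have hT2 n : L2c (TT eps (u n)).2 by case: (ET n).
have Ed n m : Ep (u n - u m) by exact: Ep_B.
have nT1 n : nrm (TT eps (u n)).1 <= K * th ^+ n by exact: le_trans (nrm1_le_bn (ET n)) (uT n).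
have nT2 n : nrm (TT eps (u n)).2 <= K * th ^+ n by exact: le_trans (nrm2_le_bn (ET n)) (uT n).
have nd1 n m : (n <= m)%N -> nrm (u n - u m).1 <= K * th ^+ n.
  by move=> nm; exact: le_trans (nrm1_le_bn (Ed n m)) (un n m nm).
have nd2 n m : (n <= m)%N -> nrm (u n - u m).2 <= K * th ^+ n.
  by move=> nm; exact: le_trans (nrm2_le_bn (Ed n m)) (un n m nm).
pose C0 := \sum_m (Num.sqrt `|k m * eps|)^-1 * lipc k a0 a1 b0 b1 b2 gam eps (BW k a0 b0) dl m.
pose C1 := \sum_m (Num.sqrt `|k m * eps|)^-1 * lipc k a1 a2 b1 b2 b3 gam eps (BW k a0 b0) dl m.
have C00 : 0 <= C0.
  apply: sumr_ge0 => m _; apply: mulr_ge0; first by rewrite invr_ge0 sqrtr_ge0.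
  exact: (lipc_ge0 _ _ _ _ _ _ gam_ge0 _ dl0 WB).
have C10 : 0 <= C1.
  apply: sumr_ge0 => m _; apply: mulr_ge0; first by rewrite invr_ge0 sqrtr_ge0.
  exact: (lipc_ge0 _ _ _ _ _ _ gam_ge0 _ dl0 WB).
have sup0 v w x : ball v -> ball w -> `|Sg0 eps v.1 v.2 x - Sg0 eps w.1 w.2 x| <=
    C0 * (nrm (v - w).1 + nrm (v - w).2).
  move=> bv bw; have [[h1 h2 _ _] _] := bv; have [[h3 h4 _ _] _] := bw.
  exact: (Sg_diff_sup a0 a1 b0 b1 b2 gam_ge0 psi0_lip e0 dl0 dl1 WB h1 h2 h3 h4 (close2 bv bw)).
have sup1 v w x : ball v -> ball w -> `|Sg1 eps v.1 v.2 x - Sg1 eps w.1 w.2 x| <=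
    C1 * (nrm (v - w).1 + nrm (v - w).2).
  move=> bv bw; have [[h1 h2 _ _] _] := bv; have [[h3 h4 _ _] _] := bw.
  exact: (Sg_diff_sup a1 a2 b1 b2 b3 gam_ge0 psi1_lip e0 dl0 dl1 WB h1 h2 h3 h4 (close2 bv bw)).
have twice n m (C : R) : 0 <= C -> (n <= m)%N ->
  C * (nrm (u n - u m).1 + nrm (u n - u m).2) <= 2 * C * K * th ^+ n.
  move=> Cge nm; have -> : 2 * C * K * th ^+ n = C * (K * th ^+ n + K * th ^+ n) by ring.
  by apply: ler_wpM2l => //; exact: (lerD (nd1 n m nm) (nd2 n m nm)).
have [g0 [K1 [K10 hg0 eg0 ng0 sg0]]] := @component_limit R K th K0 th0 th1 (fun n => (u n).1)
  (fun n => Sg0 eps (u n).1 (u n).2) (fun n => (TT eps (u n)).1) ka (2 * C0) ka0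
  (mulr_ge0 (ler0n _ 2) C00) hu1 eu1
  (fun n => cont_Sg psi0_lip (hu1 n).1 (hu2 n).1) hT1 (fun n x => congr1 (fun z => z * (u n).1 x - Sg0 eps (u n).1 (u n).2 x) kaE) nT1 nd1
  (fun n m x nm => le_trans (sup0 (u n) (u m) x (bu n) (bu m)) (twice n m C0 C00 nm)).
have [g1 [K2 [K20 hg1 eg1 ng1 sg1]]] := @component_limit R K th K0 th0 th1 (fun n => (u n).2)
  (fun n => Sg1 eps (u n).1 (u n).2) (fun n => (TT eps (u n)).2) ka (2 * C1) ka0
  (mulr_ge0 (ler0n _ 2) C10) hu2 eu2
  (fun n => cont_Sg psi1_lip (hu1 n).1 (hu2 n).1) hT2 (fun n x => congr1 (fun z => z * (u n).2 x - Sg1 eps (u n).1 (u n).2 x) kaE) nT2 nd2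
  (fun n m x nm => le_trans (sup1 (u n) (u m) x (bu n) (bu m)) (twice n m C1 C10 nm)).
pose v : pairT := (g0, g1).
have Ev : Ep v.
  split => //=.
    by apply: eg0 => n; exact: (Sg_even k a0 a1 b0 b1 b2 psi0_lip eps (hu1 n).1 (hu2 n).1 (eu1 n) (eu2 n)).
  by apply: eg1 => n; exact: (Sg_even k a1 a2 b1 b2 b3 psi1_lip eps (hu1 n).1 (hu2 n).1 (eu1 n) (eu2 n)).
have nv n : nrm (u n - v).1 + nrm (u n - v).2 <= (K1 + K2) * th ^+ n.
  by rewrite mulrDl; exact: (lerD (ng0 n) (ng1 n)).
have bv : bn (v - ua) <= rho.
  apply/ler_addgt0Pr => e ep; have [n [_ hn]] := geometric_small (K1 + K2) th0 th1 0 ep.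
  have Euv : Ep (u n - v) by exact: Ep_B.
  have Eua : Ep (u n - ua) by exact: Ep_B.
  have -> : v - ua = (u n - ua) - (u n - v) by rewrite opprB [RHS]addrC subrKA.
  apply: le_trans (bnormB (@Ep_D R) (@Ep_Z R) (@Bp_C R) (@Bp_D R) (@Bp_Z R) (@Bp_ge0 R) Eua Euv) _.
  apply: lerD; first exact: (bu n).2.
  exact: le_trans (bn_le_nrm Euv) (le_trans (nv n) hn).
have ballv : ball v := conj Ev bv.
exists v; split => // x.
  apply: (geometric_zero (C := K1 + C0 * (K1 + K2)) th0 th1) => [|n]; first by rewrite addr_ge0 ?mulr_ge0 ?addr_ge0.
  have -> : T0 eps v.1 v.2 x = (Sg0 eps (u n).1 (u n).2 x - Sg0 eps v.1 v.2 x) -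
     (Sg0 eps (u n).1 (u n).2 x - ka * g0 x) by rewrite /eqn0 -kaE /=; ring.
  apply: le_trans (ler_normB _ _) _; rewrite addrC [X in _ <= X]mulrDl; apply: lerD; first exact: sg0.
  apply: le_trans (sup0 (u n) v x (bu n) ballv) _; rewrite -mulrA; apply: ler_wpM2l => //.
apply: (geometric_zero (C := K2 + C1 * (K1 + K2)) th0 th1) => [|n]; first by rewrite addr_ge0 ?mulr_ge0 ?addr_ge0.
have -> : T1 eps v.1 v.2 x = (Sg1 eps (u n).1 (u n).2 x - Sg1 eps v.1 v.2 x) -
   (Sg1 eps (u n).1 (u n).2 x - ka * g1 x) by rewrite /eqn1 -kaE /=; ring.
apply: le_trans (ler_normB _ _) _; rewrite addrC [X in _ <= X]mulrDl; apply: lerD; first exact: sg1.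
apply: le_trans (sup1 (u n) v x (bu n) ballv) _; rewrite -mulrA; apply: ler_wpM2l => //.
Qed.

End fixed_eps.

Section small_eps.
Context {R : realType} {M : nat}.
Variables (k a0 a1 a2 b0 b1 b2 b3 : 'I_M -> R) (sig0 tau delta0 gam : R).
Variables (psi0 psi1 : 'I_M -> R -> R -> R).
Hypotheses (tau_gt0 : 0 < tau) (delta0_gt0 : 0 < delta0) (DD_gt0 : 0 < DD k a0).
Hypothesis sum0 : \sum_m k m ^+ 2 * a0 m = sig0.
Hypothesis sum1 : \sum_m k m ^+ 2 * a1 m = 0.
Hypothesis sum2 : \sum_m k m ^+ 2 * a2 m = sig0 - tau.
Hypothesis det_ge : forall z,
  delta0 * Num.min `|z| 2 ^+ 2 <= L00 k a0 z * L11 k a2 tau z - L01 k a1 z ^+ 2.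
Hypothesis nn_neq0 : nn k b0 != 0.
Hypothesis gam_ge0 : 0 <= gam.
Hypotheses (psi00 : forall m, psi0 m 0 0 = 0) (psi10 : forall m, psi1 m 0 0 = 0).
Hypothesis psi0_lip : forall m x y x' y', `|psi0 m x y - psi0 m x' y'| <=
  gam * (x ^+ 2 + y ^+ 2 + x' ^+ 2 + y' ^+ 2) * (`|x - x'| + `|y - y'|).
Hypothesis psi1_lip : forall m x y x' y', `|psi1 m x y - psi1 m x' y'| <=
  gam * (x ^+ 2 + y ^+ 2 + x' ^+ 2 + y' ^+ 2) * (`|x - x'| + `|y - y'|).

Implicit Types (p q f g : R -> R) (eps : R).

Local Notation W := (Wst k a0 b0).
Local Notation d1 := (dd1 k a0).
Local Notation d2 := (dd2 k a0 b0).
Local Notation Sg0 := (Sg k a0 a1 b0 b1 b2 psi0).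
Local Notation Sg1 := (Sg k a1 a2 b1 b2 b3 psi1).

Local Notation T0 := (eqn0 k a0 a1 b0 b1 b2 sig0 psi0).
Local Notation T1 := (eqn1 k a1 a2 b1 b2 b3 sig0 psi1).
Local Notation H0 := (hess0 k a0 a1 b0 b1 sig0).
Local Notation H1 := (hess1 k a0 a1 a2 b0 b1 b2 sig0).
Local Notation Hb := (hess_form k a0 a1 a2 b0 b1 b2 sig0).
Local Notation Hq := (hess_quad k a0 a1 a2 b0 b1 b2 sig0).
Local Notation corr := (correction k a0 a1 b0 b1 tau).
Local Notation zero := (fun _ : R => 0 : R).
Local Notation pairT := (@pairT R).
Local Notation bn := (bnorm (@pair_form R)).
Local Notation Bp := (@pair_form R).

Local Notation TT := (TT k a0 a1 a2 b0 b1 b2 b3 sig0 psi0 psi1).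
Local Notation W0 := (W0 k a0 b0).
Local Notation approx := (approx k a0 a1 b0 b1 tau).
Local Notation HH := (HH k a0 a1 a2 b0 b1 b2 sig0).
Hypothesis sig0_gt0 : 0 < sig0.

Let cW : continuous W. Proof. exact: Wst_cont. Qed.
Let WB x : `|W x| <= BW k a0 b0. Proof. exact: Wst_bound. Qed.
Let hW : L2c W. Proof. exact: L2c_W. Qed.
Let eW : even W. Proof. exact: Ws_even. Qed.
Let hd1 : 0 < d1. Proof. exact: d1_gt0. Qed.
Let hd2 : d2 != 0. Proof. exact: d2_neq0. Qed.
Let ccorr : continuous corr. Proof. by move=> x; exact: (der_cont' (der_corr k a0 a1 b0 b1 tau)). Qed.

Lemma maj_bounded f : maj d1 f -> exists C, 0 <= C /\ forall x, `|f x| <= C.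
Proof.
move=> /maj_bound[C [C0 h]]; exists C; split => // x; apply: le_trans (h x) _.
by rewrite ler_piMr// S_le1.
Qed.

(** The product of eps^(-1/2) and eps^2 is eps^(3/2), rounded up to eps. *)
Lemma sup_scale (x eps : R) : 0 < eps -> eps <= 1 -> x != 0 ->
  (Num.sqrt `|x * eps|)^-1 * eps ^+ 2 <= (Num.sqrt `|x|)^-1 * eps.
Proof.
move=> e0 e1 x0; have xp : 0 < Num.sqrt `|x| by rewrite sqrtr_gt0 normr_gt0.
have ep : 0 < Num.sqrt eps by rewrite sqrtr_gt0.
rewrite normrM (ger0_norm (ltW e0)) sqrtrM// invfM -mulrA; apply: ler_wpM2l; first by rewrite invr_ge0 ltW.
rewrite mulrC ler_pdivrMr// expr2; apply: ler_wpM2l; first exact: ltW.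
rewrite -{1}(sqr_sqrtr (ltW e0)) expr2 ler_piMr ?(ltW ep)//.
by rewrite -(@ler_pXn2r _ 2) ?nnegrE ?(ltW ep)// sqr_sqrtr ?(ltW e0)// expr1n.
Qed.

(* Averaging over an interval of length [|k| eps] maps [L^2] to [L^infty] with norm
   [(|k| eps)^(-1/2)]. *)
Lemma ball_close r : 0 <= r -> exists Kd, 0 <= Kd /\ forall eps u, 0 < eps -> eps <= 1 ->
  in_ball (@Ep R) Bp (approx eps) (r * eps ^+ 2) u -> forall m x, k m != 0 ->
  `|Am k eps m u.1 x - W x| <= Kd * eps /\ `|Am k eps m u.2 x| <= Kd * eps.
Proof.
move=> r0; have [C2 [C20 hC2]] := maj_bounded (maj_Ws2 d1 d2).
have [Cc [Cc0 hCc]] := maj_bounded (maj_corr k a0 a1 b0 b1 tau).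
pose Ks := \sum_m (Num.sqrt `|k m|)^-1; pose Kq := \sum_m k m ^+ 2.
have Ks0 m : (Num.sqrt `|k m|)^-1 <= Ks.
  by rewrite /Ks (bigD1 m)//= lerDl sumr_ge0// => i _; rewrite invr_ge0 sqrtr_ge0.
have Kq0 m : k m ^+ 2 <= Kq by rewrite /Kq (bigD1 m)//= lerDl sumr_ge0// => i _; rewrite sqr_ge0.
have Ks1 : 0 <= Ks by apply: sumr_ge0 => i _; rewrite invr_ge0 sqrtr_ge0.
have Kq1 : 0 <= Kq by apply: sumr_ge0 => i _; rewrite sqr_ge0.
exists (r * Ks + C2 * Kq + Cc); split; first by rewrite !addr_ge0 ?mulr_ge0.
move=> eps u e0 e1 [Eu hu] m x k0.
have Ea := Ep_approx a1 b0 b1 tau DD_gt0 e0 e1.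
have Ed : Ep (u - approx eps) by exact: Ep_B.
have [hd1' hd2' _ _] := Ed; have [hu1 hu2 _ _] := Eu.
have ke : k m * eps != 0 by rewrite mulf_neq0// gt_eqF.
have i0 : 0 <= (Num.sqrt `|k m * eps|)^-1 by rewrite invr_ge0 sqrtr_ge0.
have eps2 : eps ^+ 2 <= eps by rewrite expr2 ler_piMl// ltW.
have sup (f : R -> R) : L2c f -> nrm f <= r * eps ^+ 2 -> `|A (k m * eps) f x| <= r * Ks * eps.
  move=> hf nf; apply: le_trans (A_sup x ke hf) _; apply: le_trans (ler_wpM2l i0 nf) _.
  have -> : (Num.sqrt `|k m * eps|)^-1 * (r * eps ^+ 2) =
    r * ((Num.sqrt `|k m * eps|)^-1 * eps ^+ 2) by ring.
  rewrite -mulrA; apply: ler_wpM2l => //; apply: le_trans (sup_scale e0 e1 k0) _.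
  by apply: ler_wpM2r => //; exact: ltW.
have s1 := sup _ hd1' (le_trans (nrm1_le_bn Ed) hu).
have s2 := sup _ hd2' (le_trans (nrm2_le_bn Ed) hu).
have ez : continuous (fun x => eps ^+ 2 * corr x) by exact: contZ.
have eps_le (a b : R) : 0 <= a -> a <= b -> a * eps ^+ 2 <= b * eps.
  by move=> age ab; apply: ler_pM => //; exact: sqr_ge0.
split.
- have -> : Am k eps m u.1 x - W x = A (k m * eps) (u - approx eps).1 x + (A (k m * eps) W x - W x).
    have -> : A (k m * eps) (u - approx eps).1 x = A (k m * eps) u.1 x - A (k m * eps) W x.
      by rewrite -[(u - approx eps).1]/(fun y => u.1 y - W y) AB//; exact: hu1.1.
    by rewrite /Am; ring.
  apply: le_trans (ler_normD _ _) _.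
  have h := A_taylor2 (eta := k m * eps) (x := x) (der_Ws d1 d2) (der_Ws1 hd1 hd2) C20 (fun y _ => hC2 y).
  have {}h : `|A (k m * eps) W x - W x| <= C2 * Kq * eps.
    apply: le_trans h _; rewrite exprMn mulrA; apply: eps_le; first by rewrite mulr_ge0// sqr_ge0.
    exact: ler_wpM2l.
  have h3 : 0 <= Cc * eps by rewrite mulr_ge0// ltW.
  by apply: le_trans (lerD s1 h) _; rewrite !mulrDl lerDl.
- have -> : Am k eps m u.2 x = A (k m * eps) (u - approx eps).2 x + A (k m * eps) (fun x => eps ^+ 2 * corr x) x.
    have -> : A (k m * eps) (u - approx eps).2 x =
      A (k m * eps) u.2 x - A (k m * eps) (fun x => eps ^+ 2 * corr x) x.
      by rewrite -[(u - approx eps).2]/(fun y => u.2 y - eps ^+ 2 * corr y) AB//; exact: hu2.1.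
    by rewrite subrK.
  apply: le_trans (ler_normD _ _) _.
  have h : `|A (k m * eps) (fun x => eps ^+ 2 * corr x) x| <= Cc * eps.
    apply: A_bound => // s _; rewrite normrM ger0_norm ?sqr_ge0// mulrC.
    by apply: eps_le.
  have h3 : 0 <= C2 * Kq * eps by rewrite mulr_ge0 ?mulr_ge0// ltW.
  by apply: le_trans (lerD s2 h) _; rewrite !mulrDl addrAC lerDl.
Qed.

(** [rem_cst] is of order dl + eps^2, with dl = Kd eps on the ball. *)
Lemma kap_sum_small (r s t : 'I_M -> R) Kd : 0 <= Kd -> exists Q, 0 <= Q /\ forall eps, 0 < eps ->
  eps <= 1 -> \sum_m rem_cst k r s t gam eps (BW k a0 b0) (Kd * eps) m <= Q * eps.
Proof.
move=> Kd0; pose Q m := `|k m| ^+ 3 * Kd * (`|r m| + 2 * `|s m| + `|t m|)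
  + 4 * (gam * k m ^+ 4) * (BW k a0 b0 + 1) ^+ 2.
have k4 m : 0 <= k m ^+ 4 by rewrite (exprM _ 2 2) sqr_ge0.
have g4 m : 0 <= 4 * (gam * k m ^+ 4) * (BW k a0 b0 + 1) ^+ 2.
  by apply: mulr_ge0; [rewrite mulr_ge0// mulr_ge0|exact: sqr_ge0].
exists (\sum_m Q m); split.
  apply: sumr_ge0 => m _; apply: addr_ge0 => //; apply: mulr_ge0; last by rewrite !addr_ge0// mulr_ge0.
  by apply: mulr_ge0 => //; exact: exprn_ge0.
move=> eps e0 e1; rewrite mulr_suml; apply: ler_sum => m _; rewrite /rem_cst /Q.
have eps2 : eps ^+ 2 <= eps by rewrite expr2 ler_piMl// ltW.
have := ler_wpM2l (g4 m) eps2.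
move: (`|k m| ^+ 3) (`|r m|) (`|s m|) (`|t m|) (BW k a0 b0) (k m ^+ 4) => x1 x2 x3 x4 x5 x6; lra.
Qed.

Theorem normalized_solution : exists eps0 C, [/\ 0 < eps0, 0 < C & forall eps, 0 < eps -> eps < eps0 ->
  exists p q, [/\ [/\ L2c p, L2c q, even p & even q],
    (forall x, T0 eps p q x = 0), (forall x, T1 eps p q x = 0),
    nrm (fun x => p x - W x) <= C * eps ^+ 2 & nrm q <= C * eps ^+ 2]].
Proof.
have [c [ea [c0 ea0 hco]]] := oblique_coercive b1 b2 tau_gt0 delta0_gt0 DD_gt0 sum0 sum1 sum2 det_ge nn_neq0.
have [cN [eb [Bn [cN0 eb0 Bn0 hneg]]]] := negative_direction a2 b1 b2 DD_gt0 sum0 sum1 nn_neq0.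
(* An upper bound for [refl_cst] that is uniform in eps: [Bn] bounds both components of the
   linearisation at (W, 0), and [cN] bounds the modulus of the second variation there from below. *)
have [CJ CJE] : exists CJ : R, CJ = 1 + 2 * (2 * Bn) * nrm W / cN by eexists.
have CJ1 : 1 <= CJ.
  by rewrite CJE lerDl divr_ge0 ?(ltW cN0)// !mulr_ge0// nrm_ge0.
have [R0 [R00 hR0]] := big_nrm hd1 (residual0 b1 b2 tau DD_gt0 sum0 sum1 nn_neq0 gam_ge0 psi00 psi0_lip).
have [R1 [R10 hR1]] := big_nrm hd1 (residual1 b1 b2 b3 tau_gt0 DD_gt0 sum1 sum2 nn_neq0 gam_ge0 psi10 psi1_lip).
(* Gives CJ (R0 + R1) <= c r / 4, which is the condition [res_small] on a ball of radius r eps^2;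
   the summand 1 keeps r positive. *)
have [r rE] : exists r : R, r = 4 * CJ * (R0 + R1) / c + 1 by eexists.
have CJ0 : 0 <= CJ by exact: le_trans CJ1.
have r1 : 1 <= r by rewrite rE lerDr divr_ge0 ?(ltW c0)// !mulr_ge0// addr_ge0.
have r0 : 0 <= r by exact: le_trans r1.
have [Kd [Kd0 hKd]] := ball_close r0.
have [Q0 [Q00 hQ0]] := kap_sum_small b0 b1 b2 Kd0.
have [Q1 [Q10 hQ1]] := kap_sum_small b1 b2 b3 Kd0.
have D1 : 0 < Kd + 1 by rewrite ltr_wpDl.
have D2 : 0 < 4 * (Q0 + Q1) * CJ + 1 by rewrite ltr_wpDl// !mulr_ge0// addr_ge0.
(* The second bound keeps the pointwise distance Kd eps below 1; the third yields [kap_small]. *)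
pose ec := Num.min 1 (Num.min (Kd + 1)^-1 (c / (4 * (Q0 + Q1) * CJ + 1))).
have ec0 : 0 < ec by rewrite !lt_min ltr01 invr_gt0 D1 divr_gt0.
have nc := nrm_ge0 corr.
exists (Num.min ec (Num.min ea eb)), (r + nrm corr); split.
- by rewrite lt_min ec0 lt_min ea0.
- by rewrite ltr_wpDr// (lt_le_trans ltr01).
move=> eps e0; rewrite lt_min [_ < ec]lt_min [_ < Num.min (Kd + 1)^-1 _]lt_min [_ < Num.min ea eb]lt_min.
move=> /andP[/and3P[e1' e2 e3] /andP[e4 e5]].
have e1 := ltW e1'; have [hN hB0 hB1] := hneg eps e0 e5.
have e2' : 0 < eps ^+ 2 by exact: exprn_gt0.
have dl0 : 0 <= Kd * eps by rewrite mulr_ge0// ltW.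
have dl1 : Kd * eps <= 1.
  have : eps * (Kd + 1) <= 1 by rewrite -ler_pdivlMr// div1r ltW.
  by rewrite mulrDr mulr1 mulrC => h; apply: le_trans h; rewrite lerDl ltW.
have rho0 : 0 < r * eps ^+ 2 by rewrite mulr_gt0// (lt_le_trans ltr01).
have Nlt : Hq eps W zero < 0 by apply: le_lt_trans hN _; rewrite oppr_lt0.
have ck : 4 * (\sum_m rem_cst k b0 b1 b2 gam eps (BW k a0 b0) (Kd * eps) m +
   \sum_m rem_cst k b1 b2 b3 gam eps (BW k a0 b0) (Kd * eps) m) * CJ <= c.
  have h1 := hQ0 eps e0 e1; have h2 := hQ1 eps e0 e1; have h12 := lerD h1 h2.
  have h3 : eps * (4 * (Q0 + Q1) * CJ + 1) <= c by rewrite -ler_pdivlMr// ltW.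
  apply: (@le_trans _ _ (4 * (Q0 * eps + Q1 * eps) * CJ)).
    by apply: ler_wpM2r => //; apply: ler_wpM2l.
  apply: le_trans h3.
  have -> : eps * (4 * (Q0 + Q1) * CJ + 1) = 4 * (Q0 * eps + Q1 * eps) * CJ + eps by ring.
  by rewrite lerDl ltW.
have Eg := Ep_HH k a0 a1 a2 b0 b1 b2 sig0 e0 (Ep_W0 b0 DD_gt0).
have hrefl : refl_cst Bp (HH eps W0) W0 <= CJ.
  rewrite /refl_cst CJE lerD2l (Bp_g_W0 a1 a2 b0 b1 b2 sig0 DD_gt0 e0).
  have iN : `|Hq eps W zero|^-1 <= cN^-1.
    by rewrite lef_pV2 ?posrE// ?normr_gt0 ?lt_eqF// ltr0_norm// lerNr.
  have bg : bn (HH eps W0) <= 2 * Bn.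
    by apply: le_trans (bn_le_nrm Eg) _; rewrite mulr_natl mulr2n; exact: (lerD hB0 hB1).
  have bw : bn W0 <= nrm W.
    by apply: le_trans (bn_le_nrm (Ep_W0 b0 DD_gt0)) _; rewrite /= nrm0 addr0.
  have b1' := bnorm_ge0 Bp (HH eps W0); have b2' := bnorm_ge0 Bp W0.
  have p1 : 0 <= 2 * bn (HH eps W0) by rewrite mulr_ge0.
  have p2 : 2 * bn (HH eps W0) <= 2 * (2 * Bn) by rewrite ler_pM2l.
  have p3 := ler_pM p1 b2' p2 bw.
  have p4 : 0 <= `|Hq eps W zero|^-1 by rewrite invr_ge0.
  exact: (ler_pM (mulr_ge0 p1 b2') p4 p3 iN).
have Ea := Ep_approx a1 b0 b1 tau DD_gt0 e0 e1.
have cl u := hKd eps u e0 e1.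
have ba : in_ball (@Ep R) Bp (approx eps) (r * eps ^+ 2) (approx eps).
  split => //; have -> : approx eps - approx eps = 0 *: approx eps by rewrite subrr scale0r.
  by rewrite (bnormZ (@Ep_Z R) (@Bp_C R) (@Bp_Z R))// normr0 mul0r ltW.
have hTa := Ep_TT b2 b3 tau_gt0 DD_gt0 sum0 sum1 sum2 nn_neq0 gam_ge0 psi00 psi10 psi0_lip psi1_lip
  e0 e1 dl0 dl1 rho0 cl ba.
have hres : CJ * bn (TT eps (approx eps)) <= c / 2 * (r * eps ^+ 2) / 2.
  have h1 : bn (TT eps (approx eps)) <= (R0 + R1) * eps ^+ 2.
    by apply: le_trans (bn_le_nrm hTa) _; rewrite mulrDl; exact: (lerD (hR0 eps e0 e1) (hR1 eps e0 e1)).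
  apply: le_trans (ler_wpM2l CJ0 h1) _.
  have -> : c / 2 * (r * eps ^+ 2) / 2 = CJ * ((R0 + R1) * eps ^+ 2) + c / 4 * eps ^+ 2.
    by rewrite rE; field; rewrite gt_eqF.
  by rewrite lerDl mulr_ge0 ?(ltW e2')// divr_ge0// ltW.
have [[p q] [Ev hv t0 t1]] := fixed_eps_solution tau_gt0 DD_gt0 sum0 sum1 sum2 nn_neq0 gam_ge0
  psi00 psi10 psi0_lip psi1_lip e0 e1 c0 dl0 dl1 rho0 (fun p q a => hco eps p q a e0 e4) Nlt cl hrefl ck hres sig0_gt0.
have Ed : Ep (((p, q) : pairT) - approx eps) by exact: Ep_B.
have [h1 h2 h3 h4] := Ev; exists p, q; split => //.
- apply: le_trans (le_trans (nrm1_le_bn Ed) hv) _; apply: ler_wpM2r; first exact: ltW.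
  by rewrite lerDl.
have hc : L2c corr by have [_ hc _ _] := Ep_approx a1 b0 b1 tau DD_gt0 ltr01 (lexx _);
  move: hc; congr L2c; apply/funext => x; rewrite /= expr1n mul1r.
have -> : q = (fun x => (((p, q) : pairT) - approx eps).2 x + eps ^+ 2 * corr x).
  by apply/funext => x; rewrite pair2B /= subrK.
have hd : L2c (((p, q) : pairT) - approx eps).2 by case: Ed.
apply: le_trans (nrmD hd (L2cZ _ hc)) _; rewrite (nrmZ _ hc) (ger0_norm (ltW e2')) mulrDl.
apply: lerD; last by rewrite mulrC.
exact: le_trans (nrm2_le_bn Ed) hv.
Qed.

End small_eps.

(** * Back to the lattice equation *)

Section L2_library.
Context {R : realType}.
Local Notation mu := (@lebesgue_measure R).

Lemma Lnorm2_EFin (f : R -> R) : integr (fun x => f x ^+ 2) ->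
  'N[mu]_2%:E[EFin \o f]%E = (Num.sqrt (RI (fun x => f x ^+ 2)))%:E.
Proof.
move=> hf; rewrite unlock /Lnorm.
rewrite (_ : (\int[mu]_x _)%E = (RI (fun x => f x ^+ 2))%:E).
  by rewrite poweR_EFin powR12_sqrt// RI_ge0// => x; exact: sqr_ge0.
rewrite EFin_RI//; apply: eq_integral => x _ /=.
by rewrite (powR_mulrn 2)// real_normK// num_real.
Qed.

Lemma L2c_Lfun (f : R -> R) : L2c f -> f \in Lfun mu 2%:E.
Proof.
move=> [cf hf]; rewrite inE; apply/andP; split; rewrite inE/=; first exact: cont_meas.
by rewrite /finite_norm Lnorm2_EFin// ltry.
Qed.

End L2_library.

Section columns.
Context {R : realType}.
Implicit Types (f g : R -> R).

Definition col2 f g (x : R) : 'cV[R]_2 := \col_i (if i == 0 then f x else g x).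

Lemma col2_0 f g x : col2 f g x 0 0 = f x. Proof. by rewrite mxE. Qed.
Lemma col2_1 f g x : col2 f g x 1 0 = g x. Proof. by rewrite mxE. Qed.

Lemma ord2P (P : 'I_2 -> Prop) : P 0 -> P 1 -> forall i, P i.
Proof.
move=> h0 h1 [[|[|//]] hi].
  by rewrite (_ : Ordinal hi = 0)//; exact/val_inj.
by rewrite (_ : Ordinal hi = 1)//; exact/val_inj.
Qed.

Lemma colP2 (u v : 'cV[R]_2) : u 0 0 = v 0 0 -> u 1 0 = v 1 0 -> u = v.
Proof.
move=> h0 h1; apply/matrixP => i j; rewrite (ord1 j).
by move: i; apply: ord2P.
Qed.

Lemma derive_col2 f g f' g' : (forall x, der f x (f' x)) -> (forall x, der g x (g' x)) ->
  (forall x, derivable (col2 f g) x 1) /\ derive1 (col2 f g) = col2 f' g'.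
Proof.
move=> df dg.
have e0 : (fun x => col2 f g x 0 0) = f by apply/funext => x; exact: col2_0.
have e1 : (fun x => col2 f g x 1 0) = g by apply/funext => x; exact: col2_1.
have hd x : derivable (col2 f g) x 1.
  apply/derivable_mxP => i j; rewrite (ord1 j); move: i; apply: ord2P.
    by rewrite e0; exact: der_derivable (df x).
  by rewrite e1; exact: der_derivable (dg x).
split => //; apply/funext => x; rewrite derive1E derive_mx//; apply: colP2.
  by rewrite mxE e0 col2_0; have [_ ->] := df x.
by rewrite mxE e1 col2_1; have [_ ->] := dg x.
Qed.

End columns.

(** * Rotation to coordinates that diagonalise the matrix of c1, c2, c3 *)

Section rotation.
Context {R : realType} {M : nat}.
Variables (k : 'I_M -> R) (alpha : 'I_M -> 'M[R]_2) (beta : 'I_M -> 'I_2 -> 'M[R]_2).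
Variable Psi : 'I_M -> 'I_2 -> 'cV[R]_2 -> R.
Hypothesis h_alpha : forall m, alpha m 0 1 = alpha m 1 0.
Hypothesis h_beta22 : forall m, beta m 0 1 1 = beta m 1 0 1.
Hypothesis h_beta12 : forall m, beta m 0 0 1 = beta m 1 0 0.
Hypothesis h_c2 : c2 k alpha != 0.

Local Notation c1 := (Defs.c1 k alpha).
Local Notation c2 := (Defs.c2 k alpha).
Local Notation c3 := (Defs.c3 k alpha).
Local Notation s0 := (sigma0 k alpha).
Local Notation L := (lambda k alpha).

Definition rmu : R := 1 + L ^+ 2.
(** The gap between the two eigenvalues of that matrix, whose trace is c1 + c3. *)
Definition rtau : R := 2 * s0 - (c1 + c3).
Let e := s0 - c3.

Lemma rmu_gt0 : 0 < rmu. Proof. by rewrite ltr_wpDr// sqr_ge0. Qed.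

Let disc_gt0 : 0 < (c1 - c3) ^+ 2 + 4 * c2 ^+ 2.
Proof. by rewrite ltr_wpDl ?sqr_ge0// mulr_gt0// exprn_even_gt0. Qed.

Lemma rtau_gt0 : 0 < rtau.
Proof.
have -> : rtau = Num.sqrt ((c1 - c3) ^+ 2 + 4 * c2 ^+ 2) by rewrite /rtau /sigma0; field.
by rewrite sqrtr_gt0.
Qed.

Let char_eq : (s0 - c1) * e = c2 ^+ 2.
Proof.
have := sqr_sqrtr (ltW disc_gt0); rewrite /e /sigma0; move: (Num.sqrt _) => s hs.
have -> : (2^-1 * (c1 + c3 + s) - c1) * (2^-1 * (c1 + c3 + s) - c3) = (s ^+ 2 - (c1 - c3) ^+ 2) / 4 by field.
by rewrite hs; field.
Qed.

Let e_neq0 : e != 0.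
Proof.
apply/eqP => e0; have := char_eq; rewrite e0 mulr0 => /esym/eqP.
by rewrite sqrf_eq0 (negbTE h_c2).
Qed.

Let c2E : c2 = L * e. Proof. by rewrite /lambda divfK. Qed.
Let s1E : s0 - c1 = L ^+ 2 * e.
Proof. by apply: (mulIf e_neq0); rewrite char_eq c2E; ring. Qed.
Let tauE : rtau = rmu * e.
Proof. by rewrite /rmu mulrDl mul1r -s1E /rtau /e; ring. Qed.
Let c3E : c3 = s0 - e. Proof. by rewrite /e; ring. Qed.
Let c1E : c1 = s0 - L ^+ 2 * e. Proof. by rewrite -s1E; ring. Qed.
Let mu_neq0 : rmu != 0. Proof. by rewrite gt_eqF// rmu_gt0. Qed.

(* Coefficients of the system in the coordinates [(p, q)] with [W = (p - lambda q, lambda p + q)],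
   in which the matrix [sum_m k_m^2 alpha^m] is diagonal. *)
Definition ra0 m : R := rmu^-1 * alpha m 0 0 + 2 * L / rmu * alpha m 0 1 + L ^+ 2 / rmu * alpha m 1 1.
Definition ra1 m : R := - L / rmu * alpha m 0 0 + (1 - L ^+ 2) / rmu * alpha m 0 1 + L / rmu * alpha m 1 1.
Definition ra2 m : R := L ^+ 2 / rmu * alpha m 0 0 + - (2 * L) / rmu * alpha m 0 1 + rmu^-1 * alpha m 1 1.

(** By the symmetry hypotheses beta^m is a symmetric trilinear form with four independent entries.
    With l = (1, L) and n = (-L, 1), the numbers [rb0] to [rb3] are its values at (l, l, l), (l, l,
    n), (l, n, n) and (n, n, n), divided by [rmu]. *)
Definition rb0 m : R := (beta m 0 0 0 + 3 * L * beta m 0 0 1 + 3 * L ^+ 2 * beta m 0 1 1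
  + L ^+ 3 * beta m 1 1 1) / rmu.
Definition rb1 m : R := (- L * beta m 0 0 0 + (1 - 2 * L ^+ 2) * beta m 0 0 1
  + (2 * L - L ^+ 3) * beta m 0 1 1 + L ^+ 2 * beta m 1 1 1) / rmu.
Definition rb2 m : R := (L ^+ 2 * beta m 0 0 0 + (L ^+ 3 - 2 * L) * beta m 0 0 1
  + (1 - 2 * L ^+ 2) * beta m 0 1 1 + L * beta m 1 1 1) / rmu.
Definition rb3 m : R := (- L ^+ 3 * beta m 0 0 0 + 3 * L ^+ 2 * beta m 0 0 1
  - 3 * L * beta m 0 1 1 + beta m 1 1 1) / rmu.

(** This map is sqrt (rmu) times a rotation, so its inverse is its transpose divided by [rmu]; hence
    the divisions by [rmu] in all coefficients. *)
Definition rvec (x y : R) : 'cV[R]_2 := \col_i (if i == 0 then x - L * y else L * x + y).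
Definition rpsi0 m x y : R := (Psi m 0 (rvec x y) + L * Psi m 1 (rvec x y)) / rmu.
Definition rpsi1 m x y : R := (Psi m 1 (rvec x y) - L * Psi m 0 (rvec x y)) / rmu.

Lemma sum_lin3 (w f g h : 'I_M -> R) (x y z : R) :
  \sum_m w m * (x * f m + y * g m + z * h m) =
  x * (\sum_m w m * f m) + y * (\sum_m w m * g m) + z * (\sum_m w m * h m).
Proof. by rewrite !mulr_sumr -!big_split/=; apply: eq_bigr => m _; ring. Qed.

Lemma sum_lin3S (w f g h S : 'I_M -> R) (x y z : R) :
  \sum_m w m * (x * f m + y * g m + z * h m) * S m =
  x * (\sum_m w m * f m * S m) + y * (\sum_m w m * g m * S m) + z * (\sum_m w m * h m * S m).
Proof. by rewrite !mulr_sumr -!big_split/=; apply: eq_bigr => m _; ring. Qed.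

Lemma rsum0 : \sum_m k m ^+ 2 * ra0 m = s0.
Proof.
by rewrite sum_lin3 -/c1 -/c2 -/c3 c1E c2E c3E; move: mu_neq0; rewrite /rmu => mu0; field.
Qed.

Lemma rsum1 : \sum_m k m ^+ 2 * ra1 m = 0.
Proof.
by rewrite sum_lin3 -/c1 -/c2 -/c3 c1E c2E c3E; move: mu_neq0; rewrite /rmu => mu0; field.
Qed.

Lemma rsum2 : \sum_m k m ^+ 2 * ra2 m = s0 - rtau.
Proof.
by rewrite sum_lin3 -/c1 -/c2 -/c3 tauE c1E c2E c3E; move: mu_neq0; rewrite /rmu => mu0; field.
Qed.

(** Rotation preserves determinants, so T is the gap times the determinant of the symbol matrix;
    hypothesis (iv) thereby becomes [det_ge]. *)
Lemma symbT_det z : symbT k alpha z =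
  rtau * (L00 k ra0 z * L11 k ra2 rtau z - L01 k ra1 z ^+ 2).
Proof.
rewrite /symbT /L00 /L01 /L11 -/rtau; congr (_ * _).
have -> : \sum_m k m ^+ 2 * ((s0 - c3) * alpha m 0 0 + (s0 - c1) * alpha m 1 1 + 2 * c2 * alpha m 0 1)
  * symbS (k m) z = (s0 - c3) * (\sum_m k m ^+ 2 * alpha m 0 0 * symbS (k m) z)
  + (s0 - c1) * (\sum_m k m ^+ 2 * alpha m 1 1 * symbS (k m) z)
  + 2 * c2 * (\sum_m k m ^+ 2 * alpha m 0 1 * symbS (k m) z) by rewrite sum_lin3S.
rewrite !sum_lin3S tauE s1E c2E -/e.
move: (\sum_m _) (\sum_m _) (\sum_m _) => x y z'.
by move: mu_neq0; rewrite /rmu => mu0; field.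
Qed.

Lemma rdet_ge (delta0 : R) : (forall z, delta0 * Num.min `|z| 2 ^+ 2 <= symbT k alpha z) ->
  forall z, delta0 / rtau * Num.min `|z| 2 ^+ 2 <= L00 k ra0 z * L11 k ra2 rtau z - L01 k ra1 z ^+ 2.
Proof.
move=> h z; have := h z; rewrite symbT_det => hz.
by rewrite mulrAC ler_pdivrMr ?rtau_gt0// [X in _ <= X]mulrC.
Qed.

Lemma d1_DD : d1 k alpha = 1 / DD k ra0.
Proof.
rewrite /d1 /DD sum_lin3 -/rmu.
have -> : Defs.b2 k alpha = a2 k alpha by apply: eq_bigr => m _; rewrite h_alpha.
rewrite -/(a1 k alpha) -/(a2 k alpha) -/(b1 k alpha).
have -> : rmu^-1 * a1 k alpha + 2 * L / rmu * a2 k alpha + L ^+ 2 / rmu * b1 k alpha =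
  (a1 k alpha + L * a2 k alpha + L * (a2 k alpha + L * b1 k alpha)) / rmu by field.
by rewrite invf_div mul1r.
Qed.

Lemma d2_nn : d2 k alpha beta = nn k rb0 / DD k ra0.
Proof.
have -> : nn k rb0 / DD k ra0 = d1 k alpha * nn k rb0 by rewrite d1_DD; ring.
rewrite /Defs.d1 /Defs.d2 -/rmu.
suff -> : a3 k beta + L ^+ 2 * a4 k beta + L * a5 k beta +
  L * (L * b5 k beta + L ^+ 2 * b3 k beta + b4 k beta) = rmu * nn k rb0 by rewrite mulrAC.
rewrite /nn /a3 /a4 /a5 /b3 /b4 /b5 !mulr_sumr -!big_split/= !mulr_sumr -!big_split/=.
apply: eq_bigr => m _; rewrite /rb0 -h_beta12 -h_beta22.
by field.
Qed.

Lemma force_rot m (x y : R) (f0 f1 : R) :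
  f0 = ra0 m * x + ra1 m * y + 2^-1 * (rb0 m * x ^+ 2 + 2 * rb1 m * x * y + rb2 m * y ^+ 2) + rpsi0 m x y ->
  f1 = ra1 m * x + ra2 m * y + 2^-1 * (rb1 m * x ^+ 2 + 2 * rb2 m * x * y + rb3 m * y ^+ 2) + rpsi1 m x y ->
  force alpha beta Psi m (rvec x y) 0 0 = f0 - L * f1 /\
  force alpha beta Psi m (rvec x y) 1 0 = L * f0 + f1.
Proof.
move=> -> ->; rewrite /rpsi0 /rpsi1 !mxE /= -h_alpha -h_beta12 -h_beta22.
move: (Psi m 0 _) (Psi m 1 _) => P0 P1.
rewrite /ra0 /ra1 /ra2 /rb0 /rb1 /rb2 /rb3.
move: mu_neq0; rewrite /rmu; move: L => l mu0.
move: (alpha m 0 0) (alpha m 0 1) (alpha m 1 1) => A0 A1 A2.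
move: (beta m 0 0 0) (beta m 0 0 1) (beta m 0 1 1) (beta m 1 1 1) => B0 B1 B2 B3.
by split; field.
Qed.

(** The sum of squares is multiplied by exactly [rmu] and the sum of moduli by at most 1 + |L|. A
    single constant, summed over m, serves both components. *)
Lemma rpsi_lip (gamma : 'I_M -> 'I_2 -> R) :
  (forall m i (x y : 'cV[R]_2), `|Psi m i x - Psi m i y| <=
    gamma m i * (x 0 0 ^+ 2 + x 1 0 ^+ 2 + y 0 0 ^+ 2 + y 1 0 ^+ 2)
    * (`|x 0 0 - y 0 0| + `|x 1 0 - y 1 0|)) ->
  exists gam, [/\ 0 <= gam, forall m x y x' y', `|rpsi0 m x y - rpsi0 m x' y'| <=
    gam * (x ^+ 2 + y ^+ 2 + x' ^+ 2 + y' ^+ 2) * (`|x - x'| + `|y - y'|) &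
    forall m x y x' y', `|rpsi1 m x y - rpsi1 m x' y'| <=
    gam * (x ^+ 2 + y ^+ 2 + x' ^+ 2 + y' ^+ 2) * (`|x - x'| + `|y - y'|)].
Proof.
move=> hPsi; pose G m := (`|gamma m 0| + `|gamma m 1|) * (1 + `|L|) ^+ 2.
have G0 m : 0 <= G m by rewrite mulr_ge0 ?sqr_ge0// addr_ge0.
exists (\sum_m G m).
have key (m : 'I_M) (i : 'I_2) (x y x' y' : R) : `|Psi m i (rvec x y) - Psi m i (rvec x' y')| <=
  `|gamma m i| * (rmu * (x ^+ 2 + y ^+ 2 + x' ^+ 2 + y' ^+ 2)) * ((1 + `|L|) * (`|x - x'| + `|y - y'|)).
  apply: le_trans (hPsi m i _ _) _; rewrite !mxE /=.
  have -> : (x - L * y) ^+ 2 + (L * x + y) ^+ 2 + (x' - L * y') ^+ 2 + (L * x' + y') ^+ 2 =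
    rmu * (x ^+ 2 + y ^+ 2 + x' ^+ 2 + y' ^+ 2) by rewrite /rmu; ring.
  have n0 : 0 <= rmu * (x ^+ 2 + y ^+ 2 + x' ^+ 2 + y' ^+ 2).
    by rewrite mulr_ge0 ?(ltW rmu_gt0)// !addr_ge0 ?sqr_ge0.
  have d0 : `|x - L * y - (x' - L * y')| + `|L * x + y - (L * x' + y')| <=
    (1 + `|L|) * (`|x - x'| + `|y - y'|).
    have -> : x - L * y - (x' - L * y') = (x - x') - L * (y - y') by ring.
    have -> : L * x + y - (L * x' + y') = L * (x - x') + (y - y') by ring.
    apply: le_trans (lerD (ler_normB _ _) (ler_normD _ _)) _; rewrite !normrM.
    by rewrite le_eqVlt; apply/orP; left; apply/eqP; ring.
  set n := rmu * _ in n0 *; set d := `|x - L * y - _| + _ in d0 *.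
  have dge : 0 <= d by rewrite addr_ge0.
  apply: (@le_trans _ _ (`|gamma m i| * n * d)).
    by apply: ler_wpM2r => //; apply: ler_wpM2r => //; exact: ler_norm.
  by apply: ler_wpM2l => //; rewrite mulr_ge0.
have GS m : G m <= \sum_m G m by rewrite (bigD1 m)//= lerDl sumr_ge0.
have fin (m : 'I_M) (N D g0 g1 P0 P1 : R) : 0 <= N -> 0 <= D -> g0 + g1 = `|gamma m 0| + `|gamma m 1| ->
  0 <= g0 -> 0 <= g1 -> `|P0| <= g0 * (rmu * N) * ((1 + `|L|) * D) ->
  `|P1| <= g1 * (rmu * N) * ((1 + `|L|) * D) -> forall l, `|l| = `|L| ->
  `|(P0 + l * P1) / rmu| <= (\sum_m G m) * N * D.
  move=> N0 D0 gE g00 g10 h0 h1 l lE.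
  rewrite normrM normfV (ger0_norm (ltW rmu_gt0)) ler_pdivrMr ?rmu_gt0//.
  apply: le_trans (ler_normD _ _) _; rewrite normrM lE.
  have h1' := ler_wpM2l (normr_ge0 L) h1; apply: le_trans (lerD h0 h1') _.
  apply: (@le_trans _ _ (G m * N * D * rmu)); last first.
    apply: ler_wpM2r; first exact: ltW rmu_gt0.
    by apply: ler_wpM2r => //; apply: ler_wpM2r.
  have nL := normr_ge0 L.
  have -> : G m * N * D * rmu = g0 * (rmu * N) * ((1 + `|L|) * D) + `|L| * (g1 * (rmu * N) * ((1 + `|L|) * D))
    + (g0 * `|L| + g1) * (rmu * N) * ((1 + `|L|) * D) by rewrite /G -gE; ring.
  rewrite lerDl; apply: mulr_ge0; last by rewrite mulr_ge0// addr_ge0.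
  by apply: mulr_ge0; [rewrite addr_ge0// mulr_ge0|rewrite mulr_ge0// ltW// rmu_gt0].
split; first exact: sumr_ge0.
- move=> m x y x' y'.
  have -> : rpsi0 m x y - rpsi0 m x' y' = ((Psi m 0 (rvec x y) - Psi m 0 (rvec x' y'))
    + L * (Psi m 1 (rvec x y) - Psi m 1 (rvec x' y'))) / rmu by rewrite /rpsi0; ring.
  apply: (fin m _ _ `|gamma m 0| `|gamma m 1|) => //; try exact: key.
  by rewrite !addr_ge0 ?sqr_ge0.
- move=> m x y x' y'.
  have -> : rpsi1 m x y - rpsi1 m x' y' = ((Psi m 1 (rvec x y) - Psi m 1 (rvec x' y'))
    + - L * (Psi m 0 (rvec x y) - Psi m 0 (rvec x' y'))) / rmu by rewrite /rpsi1; ring.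
  apply: (fin m _ _ `|gamma m 1| `|gamma m 0|) => //; try exact: key.
  - by rewrite !addr_ge0 ?sqr_ge0.
  - exact: addrC.
  - by rewrite normrN.
Qed.

End rotation.

(** * From the integrated system to the travelling wave *)

Section wave.
Context {R : realType} {M : nat}.
Variables (k : 'I_M -> R) (alpha : 'I_M -> 'M[R]_2) (beta : 'I_M -> 'I_2 -> 'M[R]_2).
Variable Psi : 'I_M -> 'I_2 -> 'cV[R]_2 -> R.
Hypothesis h_alpha : forall m, alpha m 0 1 = alpha m 1 0.
Hypothesis h_beta22 : forall m, beta m 0 1 1 = beta m 1 0 1.
Hypothesis h_beta12 : forall m, beta m 0 0 1 = beta m 1 0 0.
Local Notation L := (lambda k alpha).

Lemma der_sum (I : finType) (f : I -> R -> R) (f' : I -> R) x :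
  (forall i, der (f i) x (f' i)) -> der (fun y => \sum_i f i y) x (\sum_i f' i).
Proof.
move=> h; elim: (index_enum I) => [|i r IH].
  rewrite big_nil; apply: der_ext (der_cst 0 x) => y; by rewrite big_nil.
rewrite big_cons; apply: der_ext (derD (h i) IH) => y; by rewrite big_cons.
Qed.

Section scalar_component.
Variables (u v r s t : 'I_M -> R) (ps : 'I_M -> R -> R -> R) (gam : R).
Hypothesis ps_lip : forall m x y x' y', `|ps m x y - ps m x' y'| <=
  gam * (x ^+ 2 + y ^+ 2 + x' ^+ 2 + y' ^+ 2) * (`|x - x'| + `|y - y'|).
Variables (eps : R) (p q : R -> R).
Hypotheses (e0 : 0 < eps) (cp : continuous p) (cq : continuous q).

Definition scalar_force m x y : R := u m * x + v m * y +
  2^-1 * (r m * x ^+ 2 + 2 * s m * x * y + t m * y ^+ 2) + ps m x y.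

Definition force_at m (x : R) : R := scalar_force m (k m * eps ^+ 2 * Am k eps m p x)
  (k m * eps ^+ 2 * Am k eps m q x).

Definition force_diff m (x : R) : R := if k m == 0 then 0
  else force_at m (x + k m * eps / 2) - force_at m (x - k m * eps / 2).

Lemma gm_force m x : gm k u v r s t ps eps m (Am k eps m p x) (Am k eps m q x) =
  k m / eps ^+ 4 * force_at m x.
Proof.
rewrite /force_at /scalar_force /gm /psc.
move: (ps m _ _) => a; move: (Am k eps m p x) (Am k eps m q x) => b c.
by field; rewrite gt_eqF.
Qed.

(** The outer average of a continuous function is differentiable, with a difference quotient as its
    derivative; this recovers the force differences of the wave equation. *)
Lemma der_Sg x : der (Sg k u v r s t ps eps p q) x (eps ^- 5 * \sum_m force_diff m x).
Proof.
rewrite mulr_sumr; apply: der_sum => m; rewrite /force_diff.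
have [k0|k0] := eqVneq (k m) 0.
  rewrite mulr0; apply: der_ext (der_cst 0 x) => y.
  have -> : (fun z => gm k u v r s t ps eps m (Am k eps m p z) (Am k eps m q z)) = fun=> 0.
    by apply/funext => z; exact: gm_k0.
  by rewrite /Am A_cst.
have ke : k m * eps != 0 by rewrite mulf_neq0// gt_eqF.
have cg : continuous (fun z => gm k u v r s t ps eps m (Am k eps m p z) (Am k eps m q z)).
  have h1 : continuous (Am k eps m p) by exact: A_cont.
  have h2 : continuous (Am k eps m q) by exact: A_cont.
  exact: (cont_gm ps_lip h1 h2).
apply: der_eq (A_deriv x ke cg) _; rewrite !gm_force.
by move: (force_at m _) (force_at m _) => a b; field; rewrite k0 gt_eqF.
Qed.

End scalar_component.

Local Notation s0 := (sigma0 k alpha).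
Local Notation a0 := (ra0 k alpha).
Local Notation a1 := (ra1 k alpha).
Local Notation a2 := (ra2 k alpha).
Local Notation b0 := (rb0 k alpha beta).
Local Notation b1 := (rb1 k alpha beta).
Local Notation b2 := (rb2 k alpha beta).
Local Notation b3 := (rb3 k alpha beta).
Local Notation p0 := (rpsi0 k alpha Psi).
Local Notation p1 := (rpsi1 k alpha Psi).

Variables (gam eps : R) (p q : R -> R).
Hypothesis p0_lip : forall m x y x' y', `|p0 m x y - p0 m x' y'| <=
  gam * (x ^+ 2 + y ^+ 2 + x' ^+ 2 + y' ^+ 2) * (`|x - x'| + `|y - y'|).
Hypothesis p1_lip : forall m x y x' y', `|p1 m x y - p1 m x' y'| <=
  gam * (x ^+ 2 + y ^+ 2 + x' ^+ 2 + y' ^+ 2) * (`|x - x'| + `|y - y'|).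
Hypotheses (s0_gt0 : 0 < s0) (e0 : 0 < eps) (cp : continuous p) (cq : continuous q).
Hypothesis T0_eq : forall x, eqn0 k a0 a1 b0 b1 b2 s0 p0 eps p q x = 0.
Hypothesis T1_eq : forall x, eqn1 k a1 a2 b1 b2 b3 s0 p1 eps p q x = 0.

Let f0 m x := force_diff a0 a1 b0 b1 b2 p0 eps p q m x.
Let f1 m x := force_diff a1 a2 b1 b2 b3 p1 eps p q m x.
Let w : R := eps ^+ 3 * (s0 + eps ^+ 2).

Let w_gt0 : 0 < w. Proof. by rewrite mulr_gt0 ?exprn_gt0 ?addr_gt0 ?exprn_gt0. Qed.

(** The equation expresses p as a multiple of [Sg], which gains a derivative: continuous solutions
    are differentiable. *)
Let dp x : der p x (w^-1 * \sum_m f0 m x).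
Proof.
have pE y : w^-1 * eps ^+ 5 * Sg k a0 a1 b0 b1 b2 p0 eps p q y = p y.
  have := T0_eq y; rewrite /eqn0; move/eqP; rewrite subr_eq0 => /eqP <-.
  by rewrite /w; field; rewrite !gt_eqF ?addr_gt0 ?exprn_gt0.
have h := derZ (w^-1 * eps ^+ 5) (der_Sg a0 a1 b0 b1 b2 p0_lip e0 cp cq x).
apply: (der_ext pE); apply: (der_eq h).
by rewrite /f0; move: (\sum_m _) => z; field; rewrite !gt_eqF.
Qed.

Let dq x : der q x (w^-1 * \sum_m f1 m x).
Proof.
have qE y : w^-1 * eps ^+ 5 * Sg k a1 a2 b1 b2 b3 p1 eps p q y = q y.
  have := T1_eq y; rewrite /eqn1; move/eqP; rewrite subr_eq0 => /eqP <-.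
  by rewrite /w; field; rewrite !gt_eqF ?addr_gt0 ?exprn_gt0.
have h := derZ (w^-1 * eps ^+ 5) (der_Sg a1 a2 b1 b2 b3 p1_lip e0 cp cq x).
apply: (der_ext qE); apply: (der_eq h).
by rewrite /f1; move: (\sum_m _) => z; field; rewrite !gt_eqF.
Qed.

Theorem wave_of_solution : exists Q : R -> 'cV[R]_2,
  travelling_wave k (force alpha beta Psi) eps (Num.sqrt (s0 + eps ^+ 2)) Q /\
  derive1 Q = col2 (fun x => p x - L * q x) (fun x => L * p x + q x).
Proof.
pose V1 x := p x - L * q x; pose V2 x := L * p x + q x.
have cV1 : continuous V1 by apply: contB => //; exact: contZ.
have cV2 : continuous V2 by apply: contD => //; exact: contZ.
have [F1 dF1] := primitive_exists cV1; have [F2 dF2] := primitive_exists cV2.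
have [dQ Q1] := derive_col2 dF1 dF2.
have dV1 x := derB (dp x) (derZ L (dq x)); have dV2 x := derD (derZ L (dp x)) (dq x).
have [dV VE] := derive_col2 dV1 dV2.
exists (col2 F1 F2); split; last exact: Q1.
split; first by split; [exact: dQ|rewrite Q1; exact: dV].
move=> x; rewrite /derive1n /= Q1 VE.
have fE m : (k m * eps) *: diff_bwd (k m * eps) (fun y => force alpha beta Psi m
    ((k m * eps ^+ 2) *: diff_fwd (k m * eps) (col2 F1 F2) y)) x =
  col2 (fun x => f0 m x - L * f1 m x) (fun x => L * f0 m x + f1 m x) x.
  have [k0|k0] := eqVneq (k m) 0.
    rewrite k0 mul0r scale0r; apply: colP2; rewrite ?col2_0 ?col2_1 mxE /f0 /f1 /force_diff k0 eqxx.
      by rewrite mulr0 subr0.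
    by rewrite mulr0 addr0.
  have ke : k m * eps != 0 by rewrite mulf_neq0// gt_eqF.
  have argE y : (k m * eps ^+ 2) *: diff_fwd (k m * eps) (col2 F1 F2) y =
    rvec k alpha (k m * eps ^+ 2 * Am k eps m p (y + k m * eps / 2))
      (k m * eps ^+ 2 * Am k eps m q (y + k m * eps / 2)).
    (* A forward difference quotient is an average centred half a step ahead; the backward
       difference then takes the forces at x plus and minus half a step, as in [force_diff]. *)
    have h (F V : R -> R) : continuous V -> (forall x, der F x (V x)) ->
      (k m * eps)^-1 * (F (y + k m * eps) - F y) = Am k eps m V (y + k m * eps / 2).
      move=> cV dF; rewrite /Am (A_prim _ ke cV dF) mulrC.
      by congr ((F _ - F _) / _); field.
    have cLq : continuous (fun x => L * q x) by exact: contZ.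
    have cLp : continuous (fun x => L * p x) by exact: contZ.
    apply: colP2.
      rewrite /diff_fwd !mxE /= (h _ _ cV1 dF1) /V1 /Am AB// AZ//.
      by move: (A _ _ _) (A _ _ _) => a b; ring.
    rewrite /diff_fwd !mxE /= (h _ _ cV2 dF2) /V2 /Am AD// AZ//.
    by move: (A _ _ _) (A _ _ _) => a b; ring.
  rewrite /diff_bwd scalerA mulfV// scale1r !argE.
  have eP z := @force_rot _ _ k alpha beta Psi h_alpha h_beta22 h_beta12 m _ _ _ _
    (erefl (force_at a0 a1 b0 b1 b2 p0 eps p q m z)) (erefl (force_at a1 a2 b1 b2 b3 p1 eps p q m z)).
  have xE : x - k m * eps + k m * eps / 2 = x - k m * eps / 2 by field.
  rewrite xE; have [h1 h2] := eP (x + k m * eps / 2); have [h3 h4] := eP (x - k m * eps / 2).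
  have sE (a b : 'cV[R]_2) i : (a - b) i 0 = a i 0 - b i 0 by rewrite !mxE.
  apply: colP2.
    rewrite sE col2_0 /f0 /f1 /force_diff (negbTE k0).
    by rewrite h1 h3; ring.
  rewrite sE col2_1 /f0 /f1 /force_diff (negbTE k0).
  by rewrite h2 h4; ring.
rewrite (eq_bigr _ (fun m _ => fE m)) sqr_sqrtr; last by rewrite addr_ge0 ?sqr_ge0// ltW.
rewrite -/w; apply: colP2; rewrite !(mxE, summxE) ?col2_0 ?col2_1 /=.
  rewrite [RHS](eq_bigr (fun m => f0 m x - L * f1 m x)) => [|m _]; last exact: col2_0.
  rewrite sumrB -mulr_sumr; move: (\sum_m _) (\sum_m _) => y z.
  by field; rewrite gt_eqF.
rewrite [RHS](eq_bigr (fun m => L * f0 m x + f1 m x)) => [|m _]; last exact: col2_1.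
rewrite big_split/= -mulr_sumr; move: (\sum_m _) (\sum_m _) => y z.
by field; rewrite gt_eqF.
Qed.

End wave.

Theorem theorem1 (R : realType) (M : nat) (k : 'I_M -> R)
    (alpha : 'I_M -> 'M[R]_2) (beta : 'I_M -> 'I_2 -> 'M[R]_2)
    (Psi : 'I_M -> 'I_2 -> 'cV[R]_2 -> R)
    (h_alpha : forall m, alpha m 0 1 = alpha m 1 0)
    (h_beta22 : forall m, beta m 0 1 1 = beta m 1 0 1)
    (h_beta12 : forall m, beta m 0 0 1 = beta m 1 0 0)
    (h_sigma0 : 0 < sigma0 k alpha)
    (h_c2 : c2 k alpha != 0)
    (h_d1 : 0 < d1 k alpha)
    (h_d2 : d2 k alpha beta != 0)
    (h_Psi0 : forall m i, Psi m i 0 = 0)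
    (h_Psi : exists gamma : 'I_M -> 'I_2 -> R,
      forall m i (x y : 'cV[R]_2),
        `|Psi m i x - Psi m i y| <=
          gamma m i * (x 0 0 ^+ 2 + x 1 0 ^+ 2 + y 0 0 ^+ 2 + y 1 0 ^+ 2)
          * (`|x 0 0 - y 0 0| + `|x 1 0 - y 1 0|))
    (h_T : exists delta0 : R, 0 < delta0 /\
      forall z : R, delta0 * Num.min `|z| 2 ^+ 2 <= symbT k alpha z) :
  exists Wstar : R -> R,
    unique (even_homoclinic (d1 k alpha) (d2 k alpha beta)) Wstar /\
    let W0 := fun x : R =>
      \col_(i < 2) (if i == 0 then Wstar x else lambda k alpha * Wstar x) in
    exists eps0 C : R, [/\ 0 < eps0, 0 < C &
      forall eps : R, 0 < eps -> eps < eps0 ->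
        exists Q : R -> 'cV[R]_2,
          [/\ travelling_wave k (force alpha beta Psi) eps
                (Num.sqrt (sigma0 k alpha + eps ^+ 2)) Q,
              forall i, L2_even (fun x => derive1 Q x i 0)
            & (L2_norm (fun x => (derive1 Q x - W0 x)%R) <= (C * eps ^+ 2)%:E)%E]].
Proof.
have hDD : 0 < DD k (ra0 k alpha) by move: h_d1; rewrite (d1_DD k h_alpha) div1r invr_gt0.
have hnn : nn k (rb0 k alpha beta) != 0.
  by move: h_d2; rewrite (d2_nn k h_alpha h_beta22 h_beta12); apply: contra_neq => ->; rewrite mul0r.
have [gamma hgamma] := h_Psi; have [gam [gam0 lip0 lip1]] := rpsi_lip k alpha hgamma.
have [delta0 [delta00 hT]] := h_T.
have tau0 := rtau_gt0 h_c2.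
have hdet := rdet_ge h_c2 hT.
have vec0 : rvec k alpha 0 0 = 0 by apply: colP2; rewrite !mxE /= mulr0 ?subr0 ?addr0.
have z0 m : rpsi0 k alpha Psi m 0 0 = 0 by rewrite /rpsi0 vec0 !h_Psi0 mulr0 addr0 mul0r.
have z1 m : rpsi1 k alpha Psi m 0 0 = 0 by rewrite /rpsi1 vec0 !h_Psi0 mulr0 subr0 mul0r.
have [eps0 [C [eps00 C0 hsol]]] 
  := normalized_solution (rb1 k alpha beta) (rb2 k alpha beta) (rb3 k alpha beta) tau0 (divr_gt0 delta00 tau0) hDD
  (rsum0 h_c2) (rsum1 h_c2) (rsum2 h_c2) hdet hnn gam0 z0 z1 lip0 lip1 h_sigma0.
have WE : Wst k (ra0 k alpha) (rb0 k alpha beta) = Ws (d1 k alpha) (d2 k alpha beta).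
  by rewrite /Wst (d1_DD k h_alpha) (d2_nn k h_alpha h_beta22 h_beta12).
set W := Ws (d1 k alpha) (d2 k alpha beta) in WE *.
exists W; split.
  split; first exact: even_homoclinic_Ws.
  by move=> W' hW'; exact: even_homoclinic_unique.
move=> W0; set L := lambda k alpha.
have mu0 := rmu_gt0 k alpha.
(* The change of coordinates multiplies Euclidean norms by sqrt (rmu); p - W and q contribute C
   eps^2 each. *)
exists eps0, (Num.sqrt (rmu k alpha) * (2 * C)); split => //.
  by rewrite mulr_gt0 ?sqrtr_gt0// mulr_gt0.
move=> eps e0 ee0; have [p [q [[hp hq ep eq] t0 t1 np nq]]] := hsol eps e0 ee0.
have [cp _] := hp; have [cq _] := hq.
have [Q [hQ QE]] := wave_of_solution h_alpha h_beta22 h_beta12 lip0 lip1 h_sigma0 e0 cp cq t0 t1.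
have h1 : L2c (fun x => p x - L * q x) by exact: L2cB hp (L2cZ _ hq).
have h2 : L2c (fun x => L * p x + q x) by exact: L2cD (L2cZ _ hp) hq.
exists Q; split => //.
  apply: ord2P; split.
  - have -> : (fun x => derive1 Q x 0 0) = (fun x => p x - L * q x).
      by apply/funext => x; rewrite QE col2_0.
    exact: L2c_Lfun.
  - by move=> x; rewrite QE !col2_0 ep eq.
  - have -> : (fun x => derive1 Q x 1 0) = (fun x => L * p x + q x).
      by apply/funext => x; rewrite QE col2_1.
    exact: L2c_Lfun.
  - by move=> x; rewrite QE !col2_1 ep eq.
rewrite WE in np.
have hW : L2c W by rewrite -WE; exact: L2c_W.
have hd := L2cB hp hW.
pose d x := p x - W x.
have sqE x : euclidean_norm (derive1 Q x - W0 x) ^+ 2 = rmu k alpha * (d x * d x + q x * q x).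
  rewrite /euclidean_norm sqr_sqrtr ?addr_ge0 ?sqr_ge0// QE !mxE /= /d /rmu -/L.
  by move: (p x) (q x) (W x) => a b c; ring.
have i1 : integr (fun x => d x * d x) by exact: L2c_mul.
have i2 : integr (fun x => q x * q x) by exact: L2c_mul.
have fE : (fun x => euclidean_norm (derive1 Q x - W0 x) ^+ 2) =
  (fun x => rmu k alpha * (d x * d x + q x * q x)) by apply/funext.
have iE : integr (fun x => euclidean_norm (derive1 Q x - W0 x) ^+ 2).
  by rewrite fE; apply: integrZ; exact: integrD.
have := Lnorm2_EFin iE; rewrite /L2_norm => ->.
rewrite lee_fin fE RIZ; last exact: integrD.
rewrite RID// -!ipE -!nrm_sqr sqrtrM ?(ltW mu0)// -mulrA; apply: ler_wpM2l; first exact: sqrtr_ge0.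
have n1 := nrm_ge0 d; have n2 := nrm_ge0 q.
apply: (@le_trans _ _ (nrm d + nrm q)).
  rewrite -[X in _ <= X]ger0_norm ?addr_ge0// -sqrtr_sqr; apply: ler_wsqrtr.
  by rewrite sqrrD addrAC lerDl mulrn_wge0// mulr_ge0.
have -> : 2 * C * eps ^+ 2 = C * eps ^+ 2 + C * eps ^+ 2 by ring.
exact: (lerD np nq).
Qed.
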